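(* Consider a nondegenerate branch of boundary data as described in the context, with two-parameter Type-II generating function $\mathcal{S}_{t,s}(q,p)$. For fixed $s$ and $q$, set $S^{s,q}_t(p):=\mathcal{S}_{t,s}(q,p)$. Then $S^{s,q}$ satisfies the rough Hamilton–Jacobi equation $$dS^{s,q}_t(p)=H\Big(\frac{\partial S^{s,q}_t}{\partial p}(p),p\Big)dt+\mathcal{H}\Big(\frac{\partial S^{s,q}_t}{\partial p}(p),p\Big)d\mathbf{Z}_t,\qquad S^{s,q}_s(p)=\langle p,q\rangle,$$ meaning that for every compact interval $[u,v]$ contained in the branch, $$S^{s,q}_v(p)-S^{s,q}_u(p)=\int_u^vH\Big(\frac{\partial S^{s,q}_r}{\partial p}(p),p\Big)dr+\int_u^v\mathcal{H}\Big(\frac{\partial S^{s,q}_r}{\partial p}(p),p\Big)d\mathbf{Z}_r,$$ the second integral being the rough integral against $\mathbf{Z}$ of the controlled path $r\mapsto\mathcal{H}\big(\frac{\partial S^{s,q}_r}{\partial p}(p),p\big)$. Similarly, for fixed $t$ and $p$, set $\tilde S^{t,p}_s(q):=\mathcal{S}_{t,s}(q,p)$. Then $$d\tilde S^{t,p}_s(q)=-H\Big(q,\frac{\partial\tilde S^{t,p}_s}{\partial q}(q)\Big)ds-\mathcal{H}\Big(q,\frac{\partial\tilde S^{t,p}_s}{\partial q}(q)\Big)d\mathbf{Z}_s,\qquad\tilde S^{t,p}_t(q)=\langle p,q\rangle,$$ that is, for every compact interval $[u,v]$ contained in the branch, $$\tilde S^{t,p}_v(q)-\tilde S^{t,p}_u(q)=-\int_u^vH\Big(q,\frac{\partial\tilde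 S^{t,p}_r}{\partial q}(q)\Big)dr-\int_u^v\mathcal{H}\Big(q,\frac{\partial\tilde S^{t,p}_r}{\partial q}(q)\Big)d\mathbf{Z}_r .$$
   Context: Let $\alpha\in(\frac13,\frac12]$ and let $\mathbf{Z}=(Z,\mathbb{Z})$ be a fixed geometric $\alpha$-Hölder rough path on $[t_0,t_1]$ with values in $\mathbb{R}^K$ (Chen's relation and $\mathbb{Z}_{s,t}+\mathbb{Z}_{s,t}^*=Z_{s,t}\otimes Z_{s,t}$). $T^*Q\cong\mathbb{R}^N\times\mathbb{R}^N$ with Euclidean pairing $\langle\cdot,\cdot\rangle$; $H\in C^\infty(T^*Q,\mathbb{R})$, $\mathcal{H}=(H_1,\dots,H_K)^T\in C^\infty(T^*Q,\mathbb{R}^K)$, $\mathcal{H}\,d\mathbf{Z}=\sum_jH_j\,d\mathbf{Z}^j$. All integrals against $\mathbf{Z}$ and integrals $\int\langle p,dq\rangle$ are rough integrals of paths controlled by $Z$. For $t_0\le s<t\le t_1$ and data $q,p\in\mathbb{R}^N$, $(\bar q,\bar p)$ denotes the solution on $[s,t]$ of the rough Hamilton's equations $$d\bar q_r=\tfrac{\partial H}{\partial p}(\bar q_r,\bar p_r)\,dr+\tfrac{\partial\mathcal{H}}{\partial p}(\bar q_r,\bar p_r)\,d\mathbf{Z}_r,\qquad d\bar p_r=-\tfrac{\partial H}{\partial q}(\bar q_r,\bar p_r)\,dr-\tfrac{\partial\mathcal{H}}{\partial q}(\bar q_r,\bar p_r)\,d\mathbf{Z}_r,$$ with $\bar q_s=q$,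 $\bar p_t=p$ (solutions are controlled paths with Gubinelli derivatives given by the coefficients of $d\mathbf{Z}$). The associated generating function is $$\mathcal{S}_{t,s}(q,p):=\langle p,\bar q_t\rangle-\int_s^t\langle\bar p_r,d\bar q_r\rangle+\int_s^tH(\bar q_r,\bar p_r)\,dr+\int_s^t\mathcal{H}(\bar q_r,\bar p_r)\,d\mathbf{Z}_r,\qquad\mathcal{S}_{s,s}(q,p)=\langle p,q\rangle .$$ Nondegenerate branch (standing assumption): with $\Phi_{t,s}$ the two-parameter (local) solution flow $(q_s,p_s)\mapsto(q_t,p_t)$ of these equations and $\pi_p(q,p)=p$, there is an open set of boundary data $(q,p)$ on which a branch of solutions $(\bar q,\bar p)$ exists and for which the map $p_s\mapsto\pi_p\Phi_{t,s}(q,p_s)$ is a local $C^\infty$-diffeomorphism near $\bar p_s$; the solutions of the branch extend to $[t_0,t_1]$, $\Phi_{t,s}$ is a flow of local diffeomorphisms there, and $(\bar q,\bar p)$ and $\mathcal{S}_{t,s}$ depend smoothly on $(q,p)$. ''Contained in the branch'' means that for all times in $[u,v]$ (in the role of the varying endpoint $t$, resp. $s$) the boundary data lie on this nondegenerate branch. *)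

(* Defs.v *)
From HB Require Import structures.
From mathcomp Require Import all_boot all_order all_algebra.
From mathcomp Require Import all_classical all_reals all_analysis.

Set Implicit Arguments.
Unset Strict Implicit.
Unset Printing Implicit Defensive.

Import Order.TTheory GRing.Theory Num.Theory numFieldNormedType.Exports.

Local Open Scope classical_set_scope.
Local Open Scope ring_scope.

Section Smoothness.
Context {R : realType}.

(* [f] has all iterated directional derivatives up to order [n] on [U], and
   these are continuous on [U]; used for open [U] only. *)
Fixpoint is_Cn {V W : normedModType R} (n : nat) (U : set V) (f : V -> W) :
    Prop :=
  {within U, continuous f} /\
  if n is m.+1 then
    forall v, (forall x, U x -> derivable f x v) /\ is_Cn m U ('D_v f)
  else True.

Definition is_Cinf {V W : normedModType R} (U : set V) (f : V -> W) : Prop :=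
  forall n, is_Cn n U f.

(* Families [f a] with a (time) parameter [a]: the derivatives are taken in the
   second variable only, but they are jointly continuous in both.  [D] is a set
   of pairs (a, x) all of whose slices at fixed [a] are open. *)
Fixpoint is_Cn_family {P : topologicalType} {V W : normedModType R} (n : nat)
    (D : set (P * V)) (f : P -> V -> W) : Prop :=
  {within D, continuous (fun z : P * V => f z.1 z.2)} /\
  if n is m.+1 then
    forall v, (forall z, D z -> derivable (f z.1) z.2 v) /\
              is_Cn_family m D (fun a x => 'D_v (f a) x)
  else True.

Definition is_Cinf_family {P : topologicalType} {V W : normedModType R}
    (D : set (P * V)) (f : P -> V -> W) : Prop :=
  forall n, is_Cn_family n D f.

Definition local_diffeo_at {V W : normedModType R} (f : V -> W) (x : V) : Prop :=
  exists (A : set V) (B : set W) (g : W -> V),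
    [/\ open A /\ A x, open B /\ f @` A = B, is_Cinf A f, is_Cinf B g &
        forall y, A y -> g (f y) = y].

Definition dotr {n} (x y : 'rV[R]_n) : R := \sum_(k < n) x 0 k * y 0 k.

Definition grad {n} (f : 'rV[R]_n -> R) (x : 'rV[R]_n) : 'rV[R]_n :=
  \row_k 'D_(delta_mx 0 k) f x.

End Smoothness.

Section RoughPaths.
Context {R : realType} {K : nat}.
Variables (alpha : R) (Z : R -> 'rV[R]_K) (ZZ : R -> R -> 'M[R]_K).

(* [ZZ s t i j] stands for the iterated integral of (Z^i_r - Z^i_s) dZ^j_r over
   [s, t]. *)
Definition geometric_rough_path (t0 t1 : R) : Prop :=
  [/\ exists C : R, forall s t, t0 <= s -> s <= t -> t <= t1 ->
        `|Z t - Z s| <= C * (t - s) `^ alpha /\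
        `|ZZ s t| <= C * (t - s) `^ (2 * alpha),
      forall s u t, t0 <= s -> s <= u -> u <= t -> t <= t1 ->
        ZZ s t = ZZ s u + ZZ u t + (Z u - Z s)^T *m (Z t - Z u) &
      forall s t, t0 <= s -> s <= t -> t <= t1 ->
        ZZ s t + (ZZ s t)^T = (Z t - Z s)^T *m (Z t - Z s)].

(* [F' r i] is the Gubinelli derivative of [F] at time [r] in the direction of
   the component Z^i. *)
Definition controlled {W : normedModType R} (a b : R)
    (F : R -> W) (F' : R -> 'I_K -> W) : Prop :=
  exists C : R, forall u v, a <= u -> u <= v -> v <= b ->
    `|F v - F u - \sum_(i < K) (Z v - Z u) 0 i *: F' u i|
      <= C * (v - u) `^ (2 * alpha) /\
    forall i, `|F' v i - F' u i| <= C * (v - u) `^ alpha.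

(* Integrals of a controlled path [F] against a controlled path [G], both with
   values in R^n and paired by the Euclidean inner product. *)
Section Integral.
Context {n : nat}.
Variables (F : R -> 'rV[R]_n) (F' : R -> 'I_K -> 'rV[R]_n).
Variables (G : R -> 'rV[R]_n) (G' : R -> 'I_K -> 'rV[R]_n).

Definition rough_germ (u v : R) : R :=
  dotr (F u) (G v - G u) +
  \sum_(i < K) \sum_(j < K) dotr (F' u i) (G' u j) * ZZ u v i j.

(* The partition a = x_0 < ... < x_m = b is encoded by [:: x_1; ...; x_m]. *)
Definition rough_sum (a : R) (s : seq R) : R :=
  \sum_(w <- zip (a :: s) s) rough_germ w.1 w.2.

Definition is_rough_int (a b I : R) : Prop :=
  forall e : R, 0 < e -> exists2 d : R, 0 < d &
    forall s, itv_partition a b s -> path (fun x y => y - x < d) a s ->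
      `|rough_sum a s - I| < e.

Definition rough_int (a b : R) : R := xget 0 [set I | is_rough_int a b I].

End Integral.

(* The integral of sum_j F_j dZ^j: the integrator is [Z] itself, whose
   Gubinelli derivative is the identity. *)
Definition rough_intZ (F : R -> 'rV[R]_K) (F' : R -> 'I_K -> 'rV[R]_K)
    (a b : R) : R :=
  rough_int F F' Z (fun _ j => delta_mx 0 j) a b.

(* Gubinelli derivative of [f \o X] when [X] has Gubinelli derivative [X']. *)
Definition chain_gub {V W : normedModType R} (f : V -> W)
    (X : R -> V) (X' : R -> 'I_K -> V) : R -> 'I_K -> W :=
  fun r i => 'D_(X' r i) f (X r).

Definition rough_int_comp {V : normedModType R} (f : V -> 'rV[R]_K)
    (X : R -> V) (X' : R -> 'I_K -> V) (a b : R) : R :=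
  rough_intZ (f \o X) (chain_gub f X X') a b.

End RoughPaths.

Section Hamilton.
Context {R : realType} {N K : nat}.

Local Notation TQ := ('rV[R]_N * 'rV[R]_N)%type.

Variables (alpha t0 t1 : R) (Z : R -> 'rV[R]_K) (ZZ : R -> R -> 'M[R]_K).
Variables (H : TQ -> R) (cH : TQ -> 'rV[R]_K).

Definition dHdq (h : TQ -> R) (x : TQ) : 'rV[R]_N := grad (fun q => h (q, x.2)) x.1.
Definition dHdp (h : TQ -> R) (x : TQ) : 'rV[R]_N := grad (fun p => h (x.1, p)) x.2.

Definition cHj (j : 'I_K) (x : TQ) : R := cH x 0 j.

Definition ham_gub (X : R -> TQ) (r : R) (j : 'I_K) : TQ :=
  (dHdp (cHj j) (X r), - dHdq (cHj j) (X r)).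

Definition rough_hamilton_solution (X : R -> TQ) : Prop :=
  controlled alpha Z t0 t1 X (ham_gub X) /\
  forall u v, t0 <= u -> u <= v -> v <= t1 -> forall k : 'I_N,
    ((X v).1 - (X u).1) 0 k =
      (\int[lebesgue_measure]_(r in `[u, v]) dHdp H (X r) 0 k) +
      rough_int_comp Z ZZ (fun x => \row_j dHdp (cHj j) x 0 k) X (ham_gub X) u v
    /\
    ((X v).2 - (X u).2) 0 k =
      - (\int[lebesgue_measure]_(r in `[u, v]) dHdq H (X r) 0 k) -
      rough_int_comp Z ZZ (fun x => \row_j dHdq (cHj j) x 0 k) X (ham_gub X) u v.

(* A branch is given by its domain [D], where [D t s (q, p)] says that the data
   qbar_s = q, pbar_t = p belong to it, and its solutions [sol t s (q, p)]. *)
Definition gen_fun (sol : R -> R -> TQ -> R -> TQ) (t s : R) (x : TQ) : R :=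
  let X := sol t s x in
  dotr x.2 (X t).1
  - rough_int ZZ (fun r => (X r).2) (fun r i => (ham_gub X r i).2)
                 (fun r => (X r).1) (fun r i => (ham_gub X r i).1) s t
  + (\int[lebesgue_measure]_(r in `[s, t]) H (X r))
  + rough_int_comp Z ZZ cH X (ham_gub X) s t.

(* [Phi t s] is the local solution flow from time [s] to time [t], with domain
   [Om s].  It maps [Om s] into [Om t] with inverse [Phi s t], so it is a
   diffeomorphism as soon as all [Phi t s] are smooth. *)
Record local_flow (Om : R -> set TQ) (Phi : R -> R -> TQ -> TQ) : Prop := {
  flow_time : forall s x, Om s x -> t0 <= s <= t1;
  flow_open : forall s x, Om s x ->
    \forall z \near (s, x), t0 <= z.1 <= t1 -> Om z.1 z.2;
  flow_sol : forall s x, Om s x ->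
    rough_hamilton_solution (fun r => Phi r s x);
  flow_id : forall s x, Om s x -> Phi s s x = x;
  flow_dom : forall r s x, t0 <= r <= t1 -> Om s x -> Om r (Phi r s x);
  flow_comp : forall r u s x, t0 <= r <= t1 -> t0 <= u <= t1 -> Om s x ->
    Phi r u (Phi u s x) = Phi r s x;
  flow_smooth :
    is_Cinf_family [set z : (R * R) * TQ | t0 <= z.1.1 <= t1 /\ Om z.1.2 z.2]
      (fun a => Phi a.1 a.2)
}.

Record nondegenerate_branch (Om : R -> set TQ) (Phi : R -> R -> TQ -> TQ)
    (D : R -> R -> set TQ) (sol : R -> R -> TQ -> R -> TQ) : Prop := {
  branch_flow : local_flow Om Phi;
  branch_time : forall t s x, D t s x -> [/\ t0 <= s, s <= t & t <= t1];
  (* openness is relative to the pairs (t, s) over which the branch exists; these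
     may be any set of pairs, e.g. {s} x [u, v] *)
  branch_open : forall t s x, D t s x ->
    \forall z \near ((t, s), x), D z.1.1 z.1.2 !=set0 -> D z.1.1 z.1.2 z.2;
  branch_sol : forall t s x, D t s x -> rough_hamilton_solution (sol t s x);
  branch_bdry : forall t s x, D t s x ->
    (sol t s x s).1 = x.1 /\ (sol t s x t).2 = x.2;
  branch_follows_flow : forall t s x, D t s x ->
    Om s (sol t s x s) /\
    forall r, t0 <= r <= t1 -> sol t s x r = Phi r s (sol t s x s);
  branch_nondeg : forall t s x, D t s x ->
    local_diffeo_at (fun ps => (Phi t s (x.1, ps)).2) (sol t s x s).2;
  branch_smooth :
    is_Cinf_family
      [set z : (R * R * R) * TQ | D z.1.1.1 z.1.1.2 z.2 /\ t0 <= z.1.2 <= t1]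
      (fun a x => sol a.1.1 a.1.2 x a.2);
  branch_gen_smooth :
    is_Cinf_family [set z : (R * R) * TQ | D z.1.1 z.1.2 z.2]
      (fun a x => gen_fun sol a.1 a.2 x)
}.

End Hamilton.

(* Main.v *)
Require Import Defs.
From mathcomp Require Import all_boot all_order all_algebra.
From mathcomp Require Import all_classical all_reals all_analysis.
From mathcomp Require Import ring lra.

Set Implicit Arguments.
Unset Strict Implicit.
Unset Printing Implicit Defensive.

Import Order.TTheory GRing.Theory Num.Theory numFieldNormedType.Exports.

Local Open Scope classical_set_scope.
Local Open Scope ring_scope.

(** Let A be the action of a solution: the integral of [p dq] minus the integrals of [H dr] and of
    [cH dZ] ([rough_action]). The generating function S is the pairing of the final momentum with
    the final position, minus A ([gen_funE]). Orders are counted in powers of |v - u|^alpha: an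
    increment of [Z] has order 1, [ZZ] and time have order 2. A quantity that is additive in time
    and of order 3 is zero, because 3 alpha > 1; the sewing lemma turns expansions up to order 3
    into identities between rough integrals. Three facts carry the proof.

    Gradient. Along solutions of Hamilton's equations the interior terms in the variation of A
    cancel, and the boundary pairing of [p] with the variation of [q] remains. Hence the p-gradient
    of S is the final position and its q-gradient is the initial momentum ([branch_gradient]). The
    derivative of a solution in its data exists at each time and is locally bounded, but no rough
    regularity in time is known for it, so the rough integrals are never differentiated. Instead, on
    [u, v] the action is replaced, up to order 3, by an explicit expression in the two endpoint
    states plus a corrector of higher order. After subtraction of the boundary pairing, its
    derivative in the parameter is again of order 3 ([kk_derive], [bO_dkk]), by symmetry of second
    derivatives and geometricity of the rough path. Integration in the parameter gives [variation],
    whose left-hand side is additive in time and therefore zero ([dir_global]). All this needs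
    constants that are uniform over families of solutions, while each solution is controlled only
    with a constant of its own; [davie] supplies the uniformity.

    Characteristics. Nondegeneracy makes the momentum that solves the boundary value problem locally
    unique, uniformly in both times ([flow_locally_injective]). So a branch solution, read at a
    neighbouring end time, is the branch solution for the data found there ([continuation]). Along
    one such path both S and its gradient are explicit ([forward_char], [backward_char]).

    Fixed argument. A Taylor expansion in space leads from the characteristic back to a fixed point.
    Its quadratic term contains the Hessian of S at the later time, so Hölder continuity of the
    Hessian in time is needed; [hess_incr] obtains it by comparing gradient increments at two points
    whose distance is |v - u|^alpha. It follows that the gradient is a controlled path whose
    Gubinelli derivative is the gradient of the rate of S ([gradpt_step], [rate_chain]), and that S
    has the same local expansion as the two integrals in the equation ([value_step],
    [value_increment]). [integral_equation] concludes.

    For the second equation the same argument applies to the negative of S as a function of the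
    initial position, with all Hamiltonians composed with the symplectic rotation [swap]. *)

(** * Sewing lemma for scalar germs *)

Section Sewing.
Context {R : realType}.
Implicit Types (g : R -> R -> R) (a b c d th C K I : R) (s r : seq R).

Definition psum g a s : R := \sum_(w <- zip (a :: s) s) g w.1 w.2.

Lemma psum_nil g a : psum g a [::] = 0.
Proof. by rewrite /psum /= big_nil. Qed.

Lemma psum_cons g a x s : psum g a (x :: s) = g a x + psum g x s.
Proof. by rewrite /psum /= big_cons. Qed.

Lemma psum_cat g a s r :
  psum g a (s ++ r) = psum g a s + psum g (last a s) r.
Proof.
elim: s a => [|x s IH] a /=; first by rewrite psum_nil add0r.
by rewrite !psum_cons IH addrA.
Qed.

Lemma powR_double_lt1 th : 1 < th -> 2 * 2^-1 `^ th < 1 :> R.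
Proof.
move=> th1; have -> : th = 1 + (th - 1) by ring.
rewrite powRD; last by apply/implyP => _; rewrite invr_eq0.
rewrite powRr1 // mulrA divff // mul1r.
have : (2^-1 : R) `^ (th - 1) < 1 `^ (th - 1).
  by apply: gt0_ltr_powR; rewrite ?nnegrE ?subr_gt0 // ?invf_lt1 ?ltr1n.
by rewrite powR1.
Qed.

(** The solution K of K = 2 K 2^(-th) + 2 C: two pieces of half length plus two additivity
    defects. *)
Definition sewing_cst C th : R := 2 * C / (1 - 2 * 2^-1 `^ th).

Lemma sewing_cst_ge0 C th : 0 <= C -> 1 < th -> 0 <= sewing_cst C th.
Proof.
move=> C0 /powR_double_lt1 h.
by rewrite /sewing_cst divr_ge0 ?mulr_ge0 ?subr_ge0 // ltW.
Qed.

Lemma sewing_cstE C th : 1 < th ->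
  2 * (sewing_cst C th * 2^-1 `^ th) + 2 * C = sewing_cst C th.
Proof.
move=> /powR_double_lt1 h; rewrite /sewing_cst; field.
by rewrite subr_eq0 gt_eqF.
Qed.

Definition almost_additive g a b C th := forall u m v,
  a <= u -> u <= m -> m <= v -> v <= b ->
  `|g u v - g u m - g m v| <= C * (v - u) `^ th.

Lemma almost_additive_sub g a b C th a' b' : a <= a' -> b' <= b ->
  almost_additive g a b C th -> almost_additive g a' b' C th.
Proof.
move=> aa bb h u m v au um mv vb; apply: h => //.
  exact: le_trans au.
exact: le_trans bb.
Qed.

(** Singling out the subinterval that contains the midpoint leaves at most half of the length on
    either side, however uneven the partition is. *)
Lemma itv_partition_split a b s : a < b -> itv_partition a b s ->
  exists s1 x s2, [/\ s = s1 ++ x :: s2, itv_partition a (last a s1) s1,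
    itv_partition x b s2, last a s1 < x &
    last a s1 <= (a + b) / 2 /\ (a + b) / 2 < x].
Proof.
move=> ab [ps /eqP lb].
have ac : a <= (a + b) / 2 by lra.
have cb : (a + b) / 2 < b by lra.
move: ac cb; set c := (a + b) / 2 => ac cb; clearbody c; clear ab.
elim: s a ps lb ac => [|x s IH] a /=.
  by move=> _ -> ?; lra.
move=> /andP[ax ps] lb ac.
have [xc|cx] := leP x c; last first.
  by exists [::], x, s; split => //=; split => //; apply/eqP.
have [s1 [y [s2 [-> [p1 l1] p2 l12 lcy]]]] := IH x ps lb xc.
exists (x :: s1), y, s2; split => //=.
by split => //=; rewrite ax.
Qed.

(** Induction on the number of points: the subinterval around the midpoint is cut out, the two
    remaining pieces are at most half as long, and joining the three costs two defects. The constant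
    reproduces itself by [sewing_cstE]. *)
Lemma sewing_partition g a b C th s : 0 <= C -> 1 < th ->
  almost_additive g a b C th -> itv_partition a b s ->
  `|psum g a s - g a b| <= sewing_cst C th * (b - a) `^ th.
Proof.
move=> C0 th1.
have [n] := ubnP (size s); elim: n => // n IH in a b s *.
move=> sn hg ps.
have th0 : th != 0 by apply/eqP => h; move: th1; rewrite h ltr10.
have := itv_partition_le ps; rewrite le_eqVlt => /predU1P[eab|ab].
  (* On a degenerate interval the defect at three equal points forces [g a a = 0]; here [th != 0]
     matters, since 0 to the power 0 is 1. *)
  have := hg a a a (lexx a) (lexx a) (lexx a); rewrite -eab lexx => /(_ isT).
  rewrite -eab in ps.
  have -> : s = [::] := itv_partitionxx ps.
  rewrite (subrr a) powR0 // !mulr0 psum_nil sub0r normrN => h.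
  rewrite -normrN; apply: le_trans h; rewrite le_eqVlt; apply/orP; left.
  by apply/eqP; congr (`| _ |); ring.
have [s1 [x [s2 [es p1 p2 yx [yc cx]]]]] := itv_partition_split ab ps.
have ay := itv_partition_le p1; have xb := itv_partition_le p2.
have hs : (size s1 < n)%N /\ (size s2 < n)%N.
  move: sn; rewrite es size_cat /= addnS ltnS => h; split.
    by apply: leq_ltn_trans h; exact: leq_addr.
  by apply: leq_ltn_trans h; exact: leq_addl.
have yb : last a s1 <= b by apply: le_trans xb; exact: ltW.
have ax : a <= x by apply: le_trans (ltW yx).
have h1 := IH _ _ _ hs.1 (almost_additive_sub (lexx _) yb hg) p1.
have h2 := IH _ _ _ hs.2 (almost_additive_sub ax (lexx _) hg) p2.
have h3 := hg a _ b (lexx _) ay yb (lexx _).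
have h4 := hg _ x b ay (ltW yx) xb (lexx _).
rewrite es psum_cat psum_cons.
set y := last a s1 in h1 h2 h3 h4 yc yx ay yb *.
have hp u v : a <= u -> u <= v -> v <= b -> v - u <= (b - a) * 2^-1 ->
    (v - u) `^ th <= (b - a) `^ th * 2^-1 `^ th.
  move=> au uv vb huv; rewrite -powRM ?subr_ge0 ?invr_ge0 ?(ltW ab) //.
  by apply: ge0_ler_powR => //; rewrite ?nnegrE; lra.
have K0 := sewing_cst_ge0 C0 th1.
have e1 : sewing_cst C th * (y - a) `^ th <=
   sewing_cst C th * ((b - a) `^ th * 2^-1 `^ th).
  by apply: ler_wpM2l => //; apply: hp => //; lra.
have e2 : sewing_cst C th * (b - x) `^ th <=
   sewing_cst C th * ((b - a) `^ th * 2^-1 `^ th).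
  by apply: ler_wpM2l => //; apply: hp => //; lra.
have e4 : C * (b - y) `^ th <= C * (b - a) `^ th.
  apply: ler_wpM2l => //; apply: ge0_ler_powR; rewrite ?nnegrE; lra.
have := sewing_cstE C th1.
move=> /(congr1 (fun z => z * (b - a) `^ th)).
move: h1 h2 h3 h4 e1 e2 e4; rewrite !ler_norml.
move: (sewing_cst C th) => K.
move: (2^-1 `^ th) ((b - a) `^ th) ((y - a) `^ th) ((b - x) `^ th) ((b - y) `^ th).
move=> X1 X2 X3 X4 X5.
have -> : (2 * (K * X1) + 2 * C) * X2 = 2 * (K * (X2 * X1)) + 2 * (C * X2) by ring.
lra.
Qed.

Lemma itv_partition_uncons a b x s :
  itv_partition a b (x :: s) -> a < x /\ itv_partition x b s.
Proof. by case=> /= /andP[ax ps] l; split. Qed.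

(** The points of [r] in each interval of the coarse partition form a partition of it, so
    [sewing_partition] applies interval by interval and the errors add up. *)
Lemma refine_psum g a b C th s r : 0 <= C -> 1 < th ->
  almost_additive g a b C th -> itv_partition a b s -> itv_partition a b r ->
  {subset s <= r} ->
  `|psum g a r - psum g a s| <=
    sewing_cst C th * psum (fun u v => (v - u) `^ th) a s.
Proof.
move=> C0 th1.
elim: s a r => [|x s IH] a r hg ps pr sr.
  move/itv_partition_nil: ps pr => -> /itv_partitionxx ->.
  by rewrite !psum_nil mulr0 subrr normr0.
have [ax ps'] := itv_partition_uncons ps.
have xr : x \in r by apply: sr; rewrite mem_head.
case/splitPr: xr pr sr => r1 r2 pr sr.
have p1 : itv_partition a x (rcons r1 x).
  case: pr => pr _; split; last by rewrite last_rcons.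
  by move: pr; rewrite -cat_rcons cat_path => /andP[].
have p2 : itv_partition x b r2.
  case: pr => pr hl; split; last by move: hl; rewrite -cat_rcons last_cat last_rcons.
  by move: pr; rewrite -cat_rcons cat_path last_rcons => /andP[].
have xb := itv_partition_le p2.
have s2 : {subset s <= r2}.
  move=> z zs.
  have xz : x < z.
    by case: ps' => h _; move/allP: (order_path_min lt_trans h) => /(_ z zs).
  have : z \in rcons r1 x ++ r2 by rewrite cat_rcons; apply: sr; rewrite inE zs orbT.
  rewrite mem_cat => /orP[|//].
  rewrite mem_rcons inE => /predU1P[zx|zr1]; first by move: xz; rewrite zx ltxx.
  case: p1 => + _; rewrite (path_pairwise lt_trans) /= pairwise_rcons.
  by move=> /andP[_ /andP[/allP/(_ z zr1)]] /(lt_trans xz); rewrite ltxx.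
have ax' : a <= x by exact: ltW.
have h1 := sewing_partition C0 th1 (almost_additive_sub (lexx a) xb hg) p1.
have h2 := IH _ _ (almost_additive_sub ax' (lexx b) hg) ps' p2 s2.
rewrite -cat_rcons psum_cat last_rcons !psum_cons mulrDr.
apply: le_trans (lerD h1 h2); apply: le_trans (ler_normD _ _).
by rewrite le_eqVlt; apply/orP; left; apply/eqP; congr (`| _ |); ring.
Qed.

Lemma psum_powR_mesh a b th d s : 1 < th -> itv_partition a b s ->
  path (fun x y => y - x < d) a s ->
  psum (fun u v => (v - u) `^ th) a s <= d `^ (th - 1) * (b - a).
Proof.
move=> th1; elim: s a => [|x s IH] a.
  by move=> /itv_partition_nil -> _; rewrite psum_nil subrr mulr0.
move=> /itv_partition_uncons[ax ps] /= /andP[dx pd].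
rewrite psum_cons.
have -> : d `^ (th - 1) * (b - a) =
    d `^ (th - 1) * (x - a) + d `^ (th - 1) * (b - x) by ring.
apply: lerD; last exact: IH.
have xa : 0 <= x - a by rewrite subr_ge0 ltW.
rewrite -(mulr_powRB1 xa (lt_trans ltr01 th1)) [leRHS]mulrC.
apply: ler_wpM2l; first by rewrite subr_ge0 ltW.
by apply: ge0_ler_powR; rewrite ?nnegrE ?subr_ge0; lra.
Qed.

Lemma exists_itv_partition a b d : a <= b -> 0 < d ->
  exists2 s, itv_partition a b s & path (fun x y => y - x < d) a s.
Proof.
move=> ab d0.
have [n hn] : exists n : nat, b - a <= n%:R * (d / 2).
  exists (Num.truncn ((b - a) / (d / 2))).+1.
  by rewrite -ler_pdivrMr ?divr_gt0 // ltW // truncnS_gt.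
elim: n a ab hn => [|n IH] a ab hn.
  have -> : a = b by apply/eqP; rewrite eq_le ab /=; move: hn; lra.
  by exists [::] => //; split => //=.
move: ab; rewrite le_eqVlt => /predU1P[->|ab].
  by exists [::] => //; split => //=.
have [h|h] := leP (b - a) (d / 2).
  exists [:: b]; first exact: itv_partition1.
  by rewrite /= andbT; lra.
have [||s [p1 p2] p3] := IH (a + d / 2).
- lra.
- by move: hn; rewrite -natr1; lra.
exists (a + d / 2 :: s); first by split => //=; rewrite p1 andbT; lra.
by rewrite /= p3 andbT; lra.
Qed.

(** The mesh convergence of [is_rough_int] for an arbitrary germ; for [rough_germ] the two are
    convertible. *)
Definition sum_lim g a b I := forall e, 0 < e -> exists2 d, 0 < d &
  forall s, itv_partition a b s -> path (fun x y => y - x < d) a s ->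
    `|psum g a s - I| < e.

Lemma sum_lim_unique g a b I J : a <= b ->
  sum_lim g a b I -> sum_lim g a b J -> I = J.
Proof.
move=> ab hI hJ; apply/eqP; rewrite -subr_eq0 -normr_le0.
apply/ler_addgt0Pl => e e0; rewrite addr0.
have [d1 d10 h1] := hI (e / 2) (divr_gt0 e0 (ltr0Sn _ 1)).
have [d2 d20 h2] := hJ (e / 2) (divr_gt0 e0 (ltr0Sn _ 1)).
have d0 : 0 < Num.min d1 d2 by rewrite lt_min d10 d20.
have [s ps ms] := exists_itv_partition ab d0.
have {}h1 : `|psum g a s - I| < e / 2.
  apply: h1 => //; apply: sub_path ms => x y.
  by rewrite lt_min => /andP[].
have {}h2 : `|psum g a s - J| < e / 2.
  apply: h2 => //; apply: sub_path ms => x y.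
  by rewrite lt_min => /andP[].
by move: h1 h2; rewrite !ltr_norml !ler_norml; lra.
Qed.

Lemma sum_lim_cat g a b c I J L : a <= b -> b <= c ->
  sum_lim g a b I -> sum_lim g b c J -> sum_lim g a c L -> L = I + J.
Proof.
move=> ab bc hI hJ hL; apply/eqP; rewrite -subr_eq0 -normr_le0.
apply/ler_addgt0Pl => e e0; rewrite addr0.
have e30 : 0 < e / 3 by exact: divr_gt0.
have [d1 d10 h1] := hI _ e30.
have [d2 d20 h2] := hJ _ e30.
have [d3 d30 h3] := hL _ e30.
have d0 : 0 < Num.min d1 (Num.min d2 d3) by rewrite !lt_min d10 d20.
have [s ps ms] := exists_itv_partition ab d0.
have [r pr mr] := exists_itv_partition bc d0.
have {}h1 : `|psum g a s - I| < e / 3.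
  by apply: h1 => //; apply: sub_path ms => x y; rewrite !lt_min => /and3P[].
have {}h2 : `|psum g b r - J| < e / 3.
  by apply: h2 => //; apply: sub_path mr => x y; rewrite !lt_min => /and3P[].
have lsb : last a s = b by case: ps => _ /eqP.
have {}h3 : `|psum g a (s ++ r) - L| < e / 3.
  apply: h3; first exact: itv_partition_cat ps pr.
  rewrite cat_path lsb; apply/andP; split.
    by apply: sub_path ms => x y; rewrite !lt_min => /and3P[].
  by apply: sub_path mr => x y; rewrite !lt_min => /and3P[].
move: h1 h2 h3; rewrite psum_cat lsb.
by rewrite !ltr_norml !ler_norml; lra.
Qed.

Lemma mesh_powR_small (th K e : R) : 1 < th -> 0 < e ->
  exists2 d, 0 < d & K * d `^ (th - 1) < e.
Proof.
move=> th1 e0.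
have th0 : 0 < th - 1 by rewrite subr_gt0.
pose M := `|K| + 1; have M0 : 0 < M by rewrite ltr_wpDl.
exists ((e / M) `^ (th - 1)^-1); first by rewrite powR_gt0 // divr_gt0.
rewrite -powRrM mulVf ?gt_eqF // powRr1; last by rewrite ltW // divr_gt0.
rewrite mulrA ltr_pdivrMr // (mulrC K) ltr_pM2l //.
by apply: le_lt_trans (ler_norm _) _; rewrite ltrDl.
Qed.

Lemma sewing g a b C th : 0 <= C -> 1 < th -> a <= b ->
  almost_additive g a b C th ->
  exists2 I, sum_lim g a b I &
    `|I - g a b| <= sewing_cst C th * (b - a) `^ th.
Proof.
move=> C0 th1 ab hg.
pose K := sewing_cst C th.
have K0 : 0 <= K by exact: sewing_cst_ge0.
have key d s r : itv_partition a b s -> itv_partition a b r ->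
    path (fun x y => y - x < d) a s -> path (fun x y => y - x < d) a r ->
    psum g a s <= psum g a r + 2 * (K * (b - a) * d `^ (th - 1)).
  move=> ps pr ms mr.
  (* Two partitions of small mesh are compared through their common refinement. *)
  pose t := sort <=%O (undup (s ++ r)).
  have st : sorted <%O t by rewrite lt_sorted_uniq_le sort_uniq undup_uniq sort_le_sorted.
  have mt z : (z \in t) = (z \in s) || (z \in r).
    by rewrite mem_sort mem_undup mem_cat.
  have pt : itv_partition a b t.
    have az z : z \in t -> a < z.
      rewrite mt => /orP[zs|zr].
        by case: ps => h _; move/allP: (order_path_min lt_trans h) => /(_ z zs).
      by case: pr => h _; move/allP: (order_path_min lt_trans h) => /(_ z zr).
    have zb z : z \in t -> z <= b.
      have h q : itv_partition a b q -> z \in q -> z <= b.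
        move=> pq /(nthP b)[i iq <-].
        have := @itv_partition_nth_le _ _ a b q i.+1.
        by rewrite ltnS /=; apply.
      by rewrite mt => /orP[]; exact: h.
    have pat : path <%O a t.
      by rewrite (path_sortedE lt_trans) st andbT; apply/allP.
    split=> //; apply/eqP/le_anti/andP; split.
      have := mem_last a t; rewrite inE => /predU1P[->//|]; exact: zb.
    have bs : b \in a :: t.
      case: ps => _ /eqP <-; have := mem_last a s.
      by rewrite !inE mt => /predU1P[->|->]; rewrite ?eqxx ?orbT.
    move: pat; rewrite (path_pairwise lt_trans) lastI pairwise_rcons => /andP[/allP h _].
    move: bs; rewrite lastI mem_rcons inE => /predU1P[-> //|/h].
    exact: ltW.
  have h1 : `|psum g a t - psum g a s| <= K * (d `^ (th - 1) * (b - a)).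
    apply: le_trans (ler_wpM2l K0 (psum_powR_mesh th1 ps ms)).
    by apply: (refine_psum C0 th1 hg) => // z zs; rewrite mt zs.
  have h2 : `|psum g a t - psum g a r| <= K * (d `^ (th - 1) * (b - a)).
    apply: le_trans (ler_wpM2l K0 (psum_powR_mesh th1 pr mr)).
    by apply: (refine_psum C0 th1 hg) => // z zs; rewrite mt zs orbT.
  move: h1 h2; rewrite !ler_norml.
  have -> : K * (d `^ (th - 1) * (b - a)) = K * (b - a) * d `^ (th - 1) by ring.
  lra.
(* Lower bounds of all sums of sufficiently small mesh. Their supremum is the limit: each fine sum
   is, up to the mesh error, both a member and an upper bound of [E]. *)
pose E := [set x | exists2 d, 0 < d & forall s, itv_partition a b s ->
  path (fun x y => y - x < d) a s -> x <= psum g a s].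
have Eub d s : 0 < d -> itv_partition a b s ->
    path (fun x y => y - x < d) a s ->
    ubound E (psum g a s + 2 * (K * (b - a) * d `^ (th - 1))).
  move=> d0 ps ms x [d' d'0 h].
  have m0 : 0 < Num.min d d' by rewrite lt_min d0.
  have [r pr mr] := exists_itv_partition ab m0.
  apply: le_trans (h r pr _) _.
    by apply: sub_path mr => ? ?; rewrite lt_min => /andP[].
  apply: key => //; apply: sub_path mr => ? ?.
  by rewrite lt_min => /andP[].
have Ein d s : 0 < d -> itv_partition a b s ->
    path (fun x y => y - x < d) a s ->
    E (psum g a s - 2 * (K * (b - a) * d `^ (th - 1))).
  move=> d0 ps ms; exists d => // r pr mr.
  by rewrite lerBlDr; exact: key.
have supE : has_sup E.
  have [s ps ms] := exists_itv_partition ab ltr01.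
  split; first by eexists; exact: (Ein 1 s ltr01 ps ms).
  by eexists; exact: (Eub 1 s ltr01 ps ms).
have lim : sum_lim g a b (sup E).
  move=> e e0.
  have [d d0 hd] := mesh_powR_small (2 * K * (b - a)) th1 e0.
  exists d => // s ps ms.
  have h1 := ub_le_sup supE.2 (Ein d s d0 ps ms).
  have h2 := ge_sup supE.1 (Eub d s d0 ps ms).
  apply: le_lt_trans hd.
  have -> : 2 * K * (b - a) * d `^ (th - 1) = 2 * (K * (b - a) * d `^ (th - 1)) by ring.
  by rewrite ler_norml; lra.
exists (sup E) => //.
apply/ler_addgt0Pl => e e0.
have [d d0 hd] := lim e e0.
have [s ps ms] := exists_itv_partition ab d0.
have := hd _ ps ms; have := sewing_partition C0 th1 hg ps.
rewrite -/K ltr_norml !ler_norml; lra.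
Qed.

(** The increments of [phi] telescope and the errors are at most C mesh^(th - 1) (b - a). With
    [g = 0] this shows that an additive quantity of order above one vanishes. *)
Lemma sum_lim_increment g (phi : R -> R) a b C th d : 1 < th -> 0 < d ->
  (forall u v, a <= u -> u <= v -> v <= b -> v - u < d ->
    `|g u v - (phi v - phi u)| <= C * (v - u) `^ th) ->
  sum_lim g a b (phi b - phi a).
Proof.
move=> th1 d0 h e e0.
have [d1 d10 hd] := mesh_powR_small (`|C| * `|b - a|) th1 e0.
exists (Num.min d1 d); first by rewrite lt_min d10.
move=> s ps ms.
have {}h u v : a <= u -> u <= v -> v <= b -> v - u < d ->
    `|g u v - (phi v - phi u)| <= `|C| * (v - u) `^ th.
  move=> au uv vb /(h _ _ au uv vb) h'; apply: le_trans h' _.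
  by apply: ler_wpM2r (ler_norm _); exact: powR_ge0.
have : `|psum g a s - (phi b - phi a)| <=
    `|C| * psum (fun u v => (v - u) `^ th) a s.
  have {}ms : path (fun x y => y - x < d) a s.
    by apply: sub_path ms => ? ?; rewrite lt_min => /andP[].
  elim: s a ps ms {e0 hd} h => [|x s IH] a ps ms h.
    by rewrite (itv_partition_nil ps) !psum_nil subrr subrr normr0 mulr0.
  have [ax ps'] := itv_partition_uncons ps; move: ms => /= /andP[dx ms].
  have xb := itv_partition_le ps'.
  have h1 := h a x (lexx _) (ltW ax) xb dx.
  have h2 := IH x ps' ms (fun u v xu => h u v (le_trans (ltW ax) xu)).
  rewrite !psum_cons mulrDr; apply: le_trans (lerD h1 h2).
  apply: le_trans (ler_normD _ _).
  by rewrite le_eqVlt; apply/orP; left; apply/eqP; congr (`| _ |); ring.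
move=> /le_lt_trans; apply; apply: le_lt_trans hd.
have ms1 : path (fun x y => y - x < d1) a s.
  by apply: sub_path ms => ? ?; rewrite lt_min => /andP[].
apply: le_trans (ler_wpM2l (normr_ge0 C) (psum_powR_mesh th1 ps ms1)) _.
rewrite (ger0_norm (x := b - a)); last by rewrite subr_ge0 (itv_partition_le ps).
by rewrite le_eqVlt; apply/orP; left; apply/eqP; ring.
Qed.

Lemma sum_lim_ext g g' a b I :
  (forall u v, a <= u -> u <= v -> v <= b -> g u v = g' u v) ->
  sum_lim g a b I -> sum_lim g' a b I.
Proof.
move=> h hI e /hI[d d0 hd]; exists d => // s ps ms.
suff <- : psum g a s = psum g' a s by exact: hd.
elim: s a ps h {hI hd ms} => [|x s IH] a ps h; first by rewrite !psum_nil.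
have [ax ps'] := itv_partition_uncons ps.
rewrite !psum_cons h ?(ltW ax) ?(itv_partition_le ps') //.
by rewrite (IH x) // => u v xu; apply: h; exact: le_trans (ltW ax) xu.
Qed.

End Sewing.

(** * Calculus of orders in a scale *)

Section BigO.
Context {R : realType}.

(** One constant serves for all points of [P]; in applications a point contains a parameter and the
    times, so every such bound is uniform in the parameter. *)
Definition bO {T : Type} (P : set T) (eta : T -> R) (k : nat) (A : T -> R) :=
  exists C, forall t, P t -> `|A t| <= C * eta t ^+ k.

(** Boundedness of [eta] is what allows an order to be lowered ([bOW]). *)
Definition scale {T : Type} (P : set T) (eta : T -> R) :=
  (forall t, P t -> 0 <= eta t) /\ exists M, forall t, P t -> eta t <= M.

Lemma bO_pull {T T' : Type} (phi : T' -> T) (P : set T) (P' : set T') eta eta' k A :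
  (forall t, P t -> 0 <= eta t) ->
  (forall t, P' t -> P (phi t) /\ eta (phi t) <= eta' t) ->
  bO P eta k A -> bO P' eta' k (A \o phi).
Proof.
move=> e0 h [C hC]; exists `|C| => t /h[Pt le]; apply: le_trans (hC _ Pt) _.
apply: le_trans (ler_wpM2r _ (ler_norm C)) _; first by rewrite exprn_ge0 ?e0.
by apply: ler_wpM2l => //; apply: lerXn2r => //; rewrite nnegrE ?e0 // (le_trans _ le) ?e0.
Qed.

Context {T : Type} (P : set T) (eta : T -> R) (sc : scale P eta).
Implicit Types (A B : T -> R) (k l : nat).
Local Notation O := (bO P eta).

Lemma bO_ge0 k A : O k A -> exists2 C, 0 <= C & forall t, P t -> `|A t| <= C * eta t ^+ k.
Proof.
move=> [C h]; exists `|C| => // t Pt; apply: le_trans (h t Pt) _.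
by apply: ler_wpM2r (ler_norm C); rewrite exprn_ge0 ?sc.1.
Qed.

Lemma bO_le k A B : (forall t, P t -> `|A t| <= `|B t|) -> O k B -> O k A.
Proof. by move=> h [C hC]; exists C => t Pt; apply: le_trans (h t Pt) (hC t Pt). Qed.

Lemma bO_eq k A B : (forall t, P t -> A t = B t) -> O k B -> O k A.
Proof. by move=> h; apply: bO_le => t /h ->. Qed.

Lemma bOW k l A : (k <= l)%N -> O l A -> O k A.
Proof.
move=> kl /bO_ge0[C C0 h]; have [e0 [M hM]] := sc.
have M0 : 0 <= Num.max M 0 by rewrite le_max lexx orbT.
exists (C * Num.max M 0 ^+ (l - k)) => t Pt; apply: le_trans (h t Pt) _.
rewrite -mulrA; apply: ler_wpM2l => //.
rewrite -{1}(subnK kl) exprD; apply: ler_wpM2r; first by rewrite exprn_ge0 ?e0.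
by apply: lerXn2r; rewrite ?nnegrE ?e0 // le_max hM.
Qed.

Lemma bO0 k : O k (fun=> 0).
Proof. by exists 0 => t _; rewrite normr0 mul0r. Qed.

Lemma bOD k A B : O k A -> O k B -> O k (fun t => A t + B t).
Proof.
move=> [C hC] [D hD]; exists (C + D) => t Pt; rewrite mulrDl.
by apply: le_trans (ler_normD _ _) (lerD (hC t Pt) (hD t Pt)).
Qed.

Lemma bON k A : O k A -> O k (fun t => - A t).
Proof. by apply: bO_le => t _; rewrite normrN. Qed.

Lemma bOB k A B : O k A -> O k B -> O k (fun t => A t - B t).
Proof. by move=> hA hB; apply: bOD => //; exact: bON. Qed.

Lemma bOM k l m A B : (m <= k + l)%N -> O k A -> O l B -> O m (fun t => A t * B t).
Proof.
move=> mkl /bO_ge0[C C0 hC] /bO_ge0[D D0 hD]; apply: bOW mkl _.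
exists (C * D) => t Pt; rewrite normrM exprD mulrACA.
by apply: ler_pM => //; [exact: hC|exact: hD].
Qed.

Lemma bO_sum k (I : finType) (A : I -> T -> R) :
  (forall i, O k (A i)) -> O k (fun t => \sum_i A i t).
Proof.
move=> h; have /choice[C hC] := fun i => h i.
exists (\sum_i C i) => t Pt; rewrite mulr_suml.
by apply: le_trans (ler_norm_sum _ _ _) _; apply: ler_sum => i _; exact: hC.
Qed.

Lemma bO_cst (c : R) : O 0 (fun=> c).
Proof. by exists `|c| => t _; rewrite expr0 mulr1. Qed.

Lemma bOMc k (c : R) A : O k A -> O k (fun t => c * A t).
Proof. by move=> h; apply: (@bOM 0 k) => //; exact: bO_cst. Qed.

Lemma bO_mulr k A B : O 0 A -> O k B -> O k (fun t => A t * B t).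
Proof. exact: bOM. Qed.

End BigO.

(** * Families of controlled paths and sewing of their germs *)

Section RoughSewing.
Context {R : realType} {K : nat}.
Variables (alpha t0 t1 : R) (Z : R -> 'rV[R]_K) (ZZ : R -> R -> 'M[R]_K).
Hypotheses (al3 : 3^-1 < alpha) (al2 : alpha <= 2^-1).
Hypothesis rp : geometric_rough_path alpha Z ZZ t0 t1.

Lemma alpha_gt0 : 0 < alpha.
Proof. by apply: lt_trans al3; rewrite invr_gt0. Qed.

Lemma alpha3_gt1 : 1 < 3 * alpha.
Proof. by move: al3; lra. Qed.

Lemma powR_alpha (h : R) k : 0 <= h -> h `^ (k%:R * alpha) = (h `^ alpha) ^+ k.
Proof. by move=> h0; rewrite mulrC powRrM powR_mulrn ?powR_ge0. Qed.

Section Family.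
Context {E : Type}.
Variables (A : set E) (lo hi : E -> R).
Hypothesis lohi : forall e, A e -> t0 <= lo e /\ hi e <= t1.

(** A point is a parameter with two ordered times in its window; [dom3] adds an intermediate time,
    for additivity defects. *)
Definition dom2 : set (E * R * R) :=
  [set t | [/\ A t.1.1, lo t.1.1 <= t.1.2, t.1.2 <= t.2 & t.2 <= hi t.1.1]].
Definition eta2 (t : E * R * R) : R := (t.2 - t.1.2) `^ alpha.
Definition dom3 : set (E * R * R * R) :=
  [set t | [/\ A t.1.1.1, lo t.1.1.1 <= t.1.1.2, t.1.1.2 <= t.1.2,
     t.1.2 <= t.2 & t.2 <= hi t.1.1.1]].
Definition eta3 (t : E * R * R * R) : R := (t.2 - t.1.1.2) `^ alpha.

Lemma le_powR_alpha (x y : R) : 0 <= x -> x <= y -> x `^ alpha <= y `^ alpha.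
Proof.
move=> x0 xy; apply: ge0_ler_powR; rewrite ?nnegrE ?(ltW alpha_gt0) //.
exact: le_trans xy.
Qed.

Lemma scale2 : scale dom2 eta2.
Proof.
split=> [t _|]; first exact: powR_ge0.
exists ((t1 - t0) `^ alpha) => -[[e u] v] [] /= /lohi[h1 h2] h3 h4 h5.
by apply: le_powR_alpha => /=; lra.
Qed.

Lemma scale3 : scale dom3 eta3.
Proof.
split=> [t _|]; first exact: powR_ge0.
exists ((t1 - t0) `^ alpha) => -[[[e u] m] v] [] /= /lohi[h1 h2] h3 h4 h5 h6.
by apply: le_powR_alpha => /=; lra.
Qed.

(** This is where [alpha <= 2^-1] enters: a time increment is as small as a second-order rough
    increment. *)
Lemma bO_h2 : bO dom2 eta2 2 (fun t => t.2 - t.1.2).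
Proof.
exists ((t1 - t0) `^ (1 - 2 * alpha)) => -[[e u] v] [] /= /lohi[h1 h2] h3 h4 h5.
rewrite ger0_norm ?subr_ge0 // -powR_alpha ?subr_ge0 //.
have [->|uv] := eqVneq u v; first by rewrite subrr mulr_ge0 ?powR_ge0.
have h0 : 0 < v - u by rewrite subr_gt0 lt_neqAle uv.
rewrite -{1}(@powRr1 _ (v - u)) ?(ltW h0) //.
have -> : (v - u) `^ 1 = (v - u) `^ (1 - 2 * alpha) * (v - u) `^ (2 * alpha).
  by rewrite -powRD ?(gt_eqF h0) ?implybT //; congr (_ `^ _); ring.
apply: ler_wpM2r; rewrite ?powR_ge0 //.
by apply: ge0_ler_powR => /=; rewrite ?nnegrE; move: al2; lra.
Qed.

Definition dZ (u v : R) (i : 'I_K) : R := (Z v - Z u) 0 i.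

Lemma bO_dZ i : bO dom2 eta2 1 (fun t => dZ t.1.2 t.2 i).
Proof.
have [[C hC] _ _] := rp; exists C => -[[e u] v] [] /= /lohi[h1 h2] h3 h4 h5.
rewrite expr1; have [+ _] := hC u v (le_trans h1 h3) h4 (le_trans h5 h2).
apply: le_trans; rewrite [leRHS]/Num.Def.normr /= mx_normrE.
by apply: (le_trans _ (le_bigmax _ _ (0, i))) => /=.
Qed.

Lemma bO_ZZ i j : bO dom2 eta2 2 (fun t => ZZ t.1.2 t.2 i j).
Proof.
have [[C hC] _ _] := rp; exists C => -[[e u] v] [] /= /lohi[h1 h2] h3 h4 h5.
rewrite -powR_alpha ?subr_ge0 //.
have [_ +] := hC u v (le_trans h1 h3) h4 (le_trans h5 h2).
apply: le_trans; rewrite [leRHS]/Num.Def.normr /= mx_normrE.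
by apply: (le_trans _ (le_bigmax _ _ (i, j))) => /=.
Qed.

Definition pum (t : E * R * R * R) : E * R * R := (t.1.1.1, t.1.1.2, t.1.2).
Definition pmv (t : E * R * R * R) : E * R * R := (t.1.1.1, t.1.2, t.2).
Definition puv (t : E * R * R * R) : E * R * R := (t.1.1.1, t.1.1.2, t.2).

Lemma bO_um k F : bO dom2 eta2 k F -> bO dom3 eta3 k (F \o pum).
Proof.
apply: bO_pull => [t _|]; first exact: powR_ge0.
move=> -[[[e u] m] v] [] /= h1 h2 h3 h4 h5; split.
  by split => //=; exact: le_trans h5.
by apply: le_powR_alpha => /=; lra.
Qed.

Lemma bO_mv k F : bO dom2 eta2 k F -> bO dom3 eta3 k (F \o pmv).
Proof.
apply: bO_pull => [t _|]; first exact: powR_ge0.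
move=> -[[[e u] m] v] [] /= h1 h2 h3 h4 h5; split.
  by split => //=; exact: le_trans h3.
by apply: le_powR_alpha => /=; lra.
Qed.

Lemma bO_uv k F : bO dom2 eta2 k F -> bO dom3 eta3 k (F \o puv).
Proof.
apply: bO_pull => [t _|]; first exact: powR_ge0.
move=> -[[[e u] m] v] [] /= h1 h2 h3 h4 h5; split => //=.
by split => //=; exact: le_trans h4.
Qed.

(* A family of scalar controlled paths with uniform constants. *)
Record fctrl (f : E -> R -> R) (f' : E -> R -> 'I_K -> R) : Prop := {
  fctrl_rem : bO dom2 eta2 2 (fun t => f t.1.1 t.2 - f t.1.1 t.1.2
     - \sum_i dZ t.1.2 t.2 i * f' t.1.1 t.1.2 i);
  fctrl_der : forall i, bO dom2 eta2 1 (fun t => f' t.1.1 t.2 i - f' t.1.1 t.1.2 i);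
  fctrl_bdd : forall i, bO dom2 eta2 0 (fun t => f' t.1.1 t.1.2 i) }.

Lemma fctrl_inc f f' : fctrl f f' ->
  bO dom2 eta2 1 (fun t => f t.1.1 t.2 - f t.1.1 t.1.2).
Proof.
move=> [h1 h2 h3].
apply: (bO_eq (B := fun t => (f t.1.1 t.2 - f t.1.1 t.1.2
     - \sum_i dZ t.1.2 t.2 i * f' t.1.1 t.1.2 i)
   + \sum_i dZ t.1.2 t.2 i * f' t.1.1 t.1.2 i)) => [t _|]; first by rewrite subrK.
apply: bOD; first exact: (bOW scale2 (l := 2)).
by apply: bO_sum => i; apply: (bOM scale2 (k := 1) (l := 0)) => //; exact: bO_dZ.
Qed.

Lemma fctrl_bdd_r f f' i : fctrl f f' -> bO dom2 eta2 0 (fun t => f' t.1.1 t.2 i).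
Proof.
move=> [h1 h2 h3].
apply: (bO_eq (B := fun t => (f' t.1.1 t.2 i - f' t.1.1 t.1.2 i) + f' t.1.1 t.1.2 i)).
  by move=> t _; rewrite subrK.
by apply: bOD => //; exact: (bOW scale2 (l := 1)).
Qed.

Definition germ1 (f g : R -> R) (f' g' : R -> 'I_K -> R) (u v : R) : R :=
  f u * (g v - g u) + \sum_i \sum_j f' u i * g' u j * ZZ u v i j.

Lemma ZZ_chen u m v i j : t0 <= u -> u <= m -> m <= v -> v <= t1 ->
  ZZ u v i j = ZZ u m i j + ZZ m v i j + dZ u m i * dZ m v j.
Proof.
move=> h1 h2 h3 h4; have [_ ch _] := rp; rewrite (ch u m v) //.
by rewrite !mxE big_ord1 /dZ !mxE.
Qed.

Lemma ZZ_sym u v i j : t0 <= u -> u <= v -> v <= t1 ->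
  ZZ u v i j + ZZ u v j i = dZ u v i * dZ u v j.
Proof.
move=> h1 h2 h4; have [_ _ /(_ u v h1 h2 h4)/matrixP/(_ i j)] := rp.
by rewrite !mxE big_ord1 /dZ !mxE.
Qed.

(** Chen's relation cancels the second-order terms over [u, v]. Each term left is a product of a
    factor of order 1 and a factor of order 2. *)
Lemma germ1_defect f f' g g' : fctrl f f' -> fctrl g g' ->
  bO dom3 eta3 3 (fun t =>
    germ1 (f t.1.1.1) (g t.1.1.1) (f' t.1.1.1) (g' t.1.1.1) t.1.1.2 t.2
  - germ1 (f t.1.1.1) (g t.1.1.1) (f' t.1.1.1) (g' t.1.1.1) t.1.1.2 t.1.2
  - germ1 (f t.1.1.1) (g t.1.1.1) (f' t.1.1.1) (g' t.1.1.1) t.1.2 t.2).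
Proof.
move=> hf hg; have [f1 f2 f3] := hf; have [g1 g2 g3] := hg.
have sc := scale3.
pose rf (t : E * R * R * R) := f t.1.1.1 t.1.2 - f t.1.1.1 t.1.1.2
     - \sum_i dZ t.1.1.2 t.1.2 i * f' t.1.1.1 t.1.1.2 i.
pose rg (t : E * R * R * R) := g t.1.1.1 t.2 - g t.1.1.1 t.1.2
     - \sum_j dZ t.1.2 t.2 j * g' t.1.1.1 t.1.2 j.
pose sf (t : E * R * R * R) := \sum_i dZ t.1.1.2 t.1.2 i * f' t.1.1.1 t.1.1.2 i.
pose dg (t : E * R * R * R) := \sum_j dZ t.1.2 t.2 j *
   (g' t.1.1.1 t.1.2 j - g' t.1.1.1 t.1.1.2 j).
apply: (bO_eq (B := fun t => - (rf t * (g t.1.1.1 t.2 - g t.1.1.1 t.1.2))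
  - sf t * rg t - sf t * dg t
  - \sum_i \sum_j ((f' t.1.1.1 t.1.2 i - f' t.1.1.1 t.1.1.2 i) * g' t.1.1.1 t.1.2 j
      + f' t.1.1.1 t.1.1.2 i * (g' t.1.1.1 t.1.2 j - g' t.1.1.1 t.1.1.2 j))
      * ZZ t.1.2 t.2 i j)).
  move=> [[[e u] m] v] [] /= Ae lu um mv vh.
  have [l0 h1] := lohi Ae.
  rewrite /germ1 /rf /rg /sf /dg /=.
  have -> : \sum_i \sum_j f' e u i * g' e u j * ZZ u v i j =
     \sum_i \sum_j f' e u i * g' e u j * ZZ u m i j
   + \sum_i \sum_j f' e u i * g' e u j * ZZ m v i j
   + (\sum_i dZ u m i * f' e u i) * (\sum_j dZ m v j * g' e u j).
    rewrite big_distrl /= -!big_split /=; apply: eq_bigr => i _.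
    rewrite big_distrr /= -!big_split /=; apply: eq_bigr => j _.
    rewrite (ZZ_chen _ _ _ um mv) ?(le_trans l0) ?(le_trans vh) //; ring.
  have -> : \sum_i \sum_j ((f' e m i - f' e u i) * g' e m j +
       f' e u i * (g' e m j - g' e u j)) * ZZ m v i j =
     \sum_i \sum_j f' e m i * g' e m j * ZZ m v i j
   - \sum_i \sum_j f' e u i * g' e u j * ZZ m v i j.
    rewrite -sumrB; apply: eq_bigr => i _; rewrite -sumrB.
    by apply: eq_bigr => j _; ring.
  have -> : \sum_j dZ m v j * (g' e m j - g' e u j) =
     \sum_j dZ m v j * g' e m j - \sum_j dZ m v j * g' e u j.
    by rewrite -sumrB; apply: eq_bigr => j _; ring.
  ring.
have brf : bO dom3 eta3 2 rf by exact: (bO_um f1).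
have brg : bO dom3 eta3 2 rg by exact: (bO_mv g1).
have bsf : bO dom3 eta3 1 sf.
  apply: bO_sum => i; apply: (bOM sc (k := 1) (l := 0)) => //.
    exact: (bO_um (bO_dZ i)).
  exact: (bO_um (f3 i)).
have bdg : bO dom3 eta3 2 dg.
  apply: bO_sum => i; apply: (bOM sc (k := 1) (l := 1)) => //.
    exact: (bO_mv (bO_dZ i)).
  exact: (bO_um (g2 i)).
apply: bOB; [apply: bOB; [apply: bOB|]|].
- apply/bON/(bOM sc (k := 2) (l := 1)) => //.
  exact: (bO_mv (fctrl_inc hg)).
- exact: (bOM sc (k := 1) (l := 2)).
- exact: (bOM sc (k := 1) (l := 2)).
apply: bO_sum => i; apply: bO_sum => j.
apply: (bOM sc (k := 1) (l := 2)) => //; last exact: (bO_mv (bO_ZZ i j)).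
apply: bOD.
  apply: (bOM sc (k := 1) (l := 0)) => //; first exact: (bO_um (f2 i)).
  exact: (bO_mv (g3 j)).
apply: (bOM sc (k := 0) (l := 1)) => //; first exact: (bO_um (f3 i)).
exact: (bO_um (g2 j)).
Qed.

Lemma germ_sewing (G : E -> R -> R -> R) :
  bO dom3 eta3 3 (fun t => G t.1.1.1 t.1.1.2 t.2 - G t.1.1.1 t.1.1.2 t.1.2
    - G t.1.1.1 t.1.2 t.2) ->
  exists I : E -> R -> R -> R,
    (forall e u v, A e -> lo e <= u -> u <= v -> v <= hi e ->
      sum_lim (G e) u v (I e u v)) /\
    bO dom2 eta2 3 (fun t => I t.1.1 t.1.2 t.2 - G t.1.1 t.1.2 t.2).
Proof.
move=> /(bO_ge0 scale3)[C C0 hC].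
have aa e : A e -> almost_additive (G e) (lo e) (hi e) C (3 * alpha).
  move=> Ae u m v lu um mv vh.
  have uv : 0 <= v - u by rewrite subr_ge0 (le_trans um).
  by rewrite powR_alpha //; exact: (hC (e, u, m, v)).
have hI (t : E * R * R) : exists I, dom2 t -> sum_lim (G t.1.1) t.1.2 t.2 I /\
    `|I - G t.1.1 t.1.2 t.2| <= sewing_cst C (3 * alpha) * eta2 t ^+ 3.
  have [dt|ndt] := pselect (dom2 t); last by exists 0.
  case: t dt => [[e u] v] [] /= Ae lu uv vh.
  have := sewing C0 alpha3_gt1 uv (almost_additive_sub lu vh (aa e Ae)).
  by move=> [I h1 h2]; exists I; rewrite /eta2 -powR_alpha ?subr_ge0.
have [I hI'] := choice hI.
exists (fun e u v => I (e, u, v)); split=> [e u v Ae lu uv vh|].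
  by have [] := hI' (e, u, v).
by exists (sewing_cst C (3 * alpha)) => -[[e u] v] /hI' [].
Qed.

End Family.
End RoughSewing.

(** * Directional derivatives of real functions on a normed space *)

Section DirectionalDerivatives.
Context {R : realType}.

(** A form without quotient and without punctured neighbourhood, in which changes of variable are
    mere substitutions. *)
Lemma is_derive_epsP {V : normedModType R} (f : V -> R) (x v : V) (df : R) :
  is_derive x v f df <->
  forall e, 0 < e -> exists2 d, 0 < d & forall h, `|h| < d ->
    `|f (h *: v + x) - f x - h * df| <= e * `|h|.
Proof.
split=> [[dv <-] e e0|h].
  move: dv => /cvgrPdist_le /(_ e e0); rewrite near_withinE => -[d d0 hd].
  exists d => // h hh; have [->|hn0] := eqVneq h 0.
    by rewrite scale0r add0r subrr mul0r subr0 normr0 mulr0.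
  have := hd h; rewrite /= sub0r normrN => /(_ hh hn0).
  rewrite -/('D_v f x).
  have -> : f (h *: v + x) - f x - h * 'D_v f x =
      - (h * ('D_v f x - h^-1 *: (f (h *: v + x) - f x))).
    by rewrite /GRing.scale /=; field.
  by rewrite normrN normrM mulrC; exact: ler_wpM2r.
have cv : (fun h => h^-1 *: ((f \o shift x) (h *: v) - f x)) @ 0^' --> df.
  apply/cvgrPdist_le => e e0; have [d d0 hd] := h e e0.
  rewrite near_withinE; exists d => //= k /=; rewrite sub0r normrN => kd kn0.
  have := hd k kd.
  have -> : f (k *: v + x) - f x - k * df =
      - (k * (df - k^-1 *: (f (k *: v + x) - f x))).
    by rewrite /GRing.scale /=; field.
  by rewrite normrN normrM mulrC ler_pM2r ?normr_gt0.
split; first by apply/cvg_ex; exists df.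
exact: cvg_lim cv.
Qed.

Lemma is_derive_line {V : normedModType R} (f : V -> R) (x w : V) (t df : R) :
  is_derive (x + t *: w) w f df -> is_derive t 1 (fun t : R => f (x + t *: w)) df.
Proof.
move=> /is_derive_epsP h; apply/is_derive_epsP => e /h[d d0 hd].
exists d => // k /hd; rewrite -[k *: 1]/(k * 1) mulr1.
by rewrite scalerDl addrCA.
Qed.

Lemma is_derive_of_line {V : normedModType R} (f : V -> R) (x w : V) (df : R) :
  is_derive (0 : R) 1 (fun t : R => f (x + t *: w)) df -> is_derive x w f df.
Proof.
move=> /is_derive_epsP h; apply/is_derive_epsP => e /h[d d0 hd].
exists d => // k /hd; rewrite -[k *: 1]/(k * 1) mulr1 addr0.
by rewrite scale0r addr0 [k *: w + x]addrC.
Qed.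

Lemma mvt_line {V : normedModType R} (f : V -> R) (df : V -> R) (x w : V) :
  (forall t, 0 <= t <= 1 -> is_derive (x + t *: w) w f (df (x + t *: w))) ->
  exists2 t, 0 <= t <= 1 & f (x + w) - f x = df (x + t *: w).
Proof.
move=> h.
have hd t : 0 <= t <= 1 -> is_derive (t : R) 1 (fun t : R => f (x + t *: w)) (df (x + t *: w)).
  by move=> /h; exact: is_derive_line.
have [|||c cI] := @MVT_segment R (fun t => f (x + t *: w)) (fun t => df (x + t *: w)) 0 1.
- exact: ler01.
- by move=> t; rewrite in_itv /= => /andP[t0 t1]; apply: hd; rewrite !ltW.
- by apply: derivable_within_continuous => t; rewrite in_itv /= => /hd[].
rewrite scale1r scale0r addr0 subr0 mulr1 => e.
by exists c.
Qed.

Lemma is_derive_scale {V : normedModType R} (f : V -> R) (x v : V) (c df : R) :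
  is_derive x v f df -> is_derive x (c *: v) f (c * df).
Proof.
move=> /is_derive_epsP h; apply/is_derive_epsP => e e0.
have c0 : 0 < `|c| + 1 by rewrite ltr_wpDl.
have [d d0 hd] := h (e / (`|c| + 1)) (divr_gt0 e0 c0).
exists (d / (`|c| + 1)); first exact: divr_gt0.
move=> k; rewrite ltr_pdivlMr // => kd.
have hk : `|k| * `|c| <= `|k| * (`|c| + 1) by apply: ler_wpM2l => //; rewrite lerDl.
have := hd (k * c); rewrite normrM => /(_ (le_lt_trans hk kd)).
rewrite scalerA [k * (c * df)]mulrA => /le_trans; apply.
rewrite -mulrA; apply: ler_wpM2l; first exact: ltW.
by rewrite mulrC ler_pdivrMr.
Qed.

(* Only [v] needs derivability at the single point [x]. *)
Lemma is_derive_add_dir {V : normedModType R} (f df : V -> R) (x v w : V) (dv r : R) :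
  0 < r -> is_derive x v f dv ->
  (forall y, `|y - x| < r -> is_derive y w f (df y)) ->
  {for x, continuous df} ->
  is_derive x (v + w) f (dv + df x).
Proof.
move=> r0 /is_derive_epsP hv hw hc; apply/is_derive_epsP => e e0.
have e20 : 0 < e / 2 by exact: divr_gt0.
have [d1 d10 h1] := hv _ e20.
move: hc => /cvgrPdist_le /(_ _ e20) /nbhs_normP[d2 d20 h2].
pose M := `|v| + `|w| + 1.
have M0 : 0 < M by rewrite ltr_wpDl // addr_ge0.
pose d3 := Num.min r d2 / M.
have d30 : 0 < d3 by rewrite divr_gt0 // lt_min r0.
exists (Num.min d1 d3); first by rewrite lt_min d10.
move=> k; rewrite lt_min => /andP[k1 k3].
have near_pt t : 0 <= t <= 1 ->
    `|(k *: v + x + t *: (k *: w)) - x| < Num.min r d2.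
  move=> /andP[t0 t1].
  have -> : k *: v + x + t *: (k *: w) - x = k *: (v + t *: w).
    by rewrite addrAC addrK scalerDr !scalerA [t * k]mulrC.
  rewrite normrZ; apply: le_lt_trans (_ : `|k| * M < _); last first.
    by rewrite -ltr_pdivlMr.
  apply: ler_wpM2l => //; apply: le_trans (ler_normD _ _) _.
  rewrite normrZ ger0_norm // /M -addrA lerD2l.
  apply: le_trans (_ : `|w| <= _); last by rewrite lerDl.
  by rewrite ler_piMl.
have near_r t : 0 <= t <= 1 -> `|(k *: v + x + t *: (k *: w)) - x| < r.
  by move=> /near_pt/lt_le_trans; apply; rewrite ge_min lexx.
have [t t01 ht] := @mvt_line V f (fun y => k * df y) (k *: v + x) (k *: w)
  (fun t t01 => is_derive_scale k (hw _ (near_r t t01))).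
have {}h1 := h1 k k1.
have {}h2 := h2 _ (_ : ball_ Num.norm x d2 (k *: v + x + t *: (k *: w))).
have : `|df x - df (k *: v + x + t *: (k *: w))| <= e / 2.
  apply: h2 => /=; rewrite -normrN opprB.
  by apply: lt_le_trans (near_pt t t01) _; rewrite ge_min lexx orbT.
set D := df (k *: v + x + _) in ht *.
move=> {}h2.
have -> : f (k *: (v + w) + x) - f x - k * (dv + df x) =
    (f (k *: v + x) - f x - k * dv) + (f (k *: v + x + k *: w) - f (k *: v + x))
    - k * df x.
  rewrite scalerDr [k *: v + k *: w + x]addrAC; ring.
rewrite ht.
have -> : f (k *: v + x) - f x - k * dv + k * D - k * df x =
    (f (k *: v + x) - f x - k * dv) + - (k * (df x - D)) by ring.
apply: le_trans (ler_normD _ _) _; rewrite normrN normrM.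
have -> : e * `|k| = e / 2 * `|k| + `|k| * (e / 2) by field.
by apply: lerD => //; exact: ler_wpM2l.
Qed.

End DirectionalDerivatives.

(** * Coordinates on row vectors and on phase space *)

Section Coordinates.
Context {R : realType}.

(** A common interface for ['rV[R]_n] and for pairs, so that the Taylor estimates are proved once.
    In it every coordinate is nonexpansive. *)
Record coords (V : normedModType R) (I : finType) := Coords {
  crd : V -> I -> R;
  bas : I -> V;
  crdD : forall u v i, crd (u + v) i = crd u i + crd v i;
  crdZ : forall c v i, crd (c *: v) i = c * crd v i;
  crdE : forall v, v = \sum_i crd v i *: bas i;
  crd_bas : forall i k, crd (bas i) k = (i == k)%:R;
  crd_le : forall v i, `|crd v i| <= `|v| }.

Lemma crdN (V : normedModType R) (I : finType) (B : coords V I) v i :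
  crd B (- v) i = - crd B v i.
Proof. by rewrite -scaleN1r crdZ mulN1r. Qed.

Lemma crdB (V : normedModType R) (I : finType) (B : coords V I) u v i :
  crd B (u - v) i = crd B u i - crd B v i.
Proof. by rewrite crdD crdN. Qed.

Lemma rV_norm_ge n (x : 'rV[R]_n) i : `|x 0 i| <= `|x|.
Proof.
rewrite [leRHS]/Num.Def.normr /= mx_normrE.
by apply: (le_trans _ (le_bigmax _ _ (0, i))) => /=.
Qed.

Definition rV_coords n : coords 'rV[R]_n 'I_n.
Proof.
refine (@Coords 'rV[R]_n 'I_n (fun v i => v 0 i) (fun i => delta_mx 0 i) _ _ _ _ _).
- by move=> u v i; rewrite mxE.
- by move=> c v i; rewrite mxE.
- by move=> v; exact: row_sum_delta.
- by move=> i k; rewrite mxE eqxx eq_sym.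
- by move=> v i; exact: rV_norm_ge.
Defined.

Definition pair_coords n m : coords ('rV[R]_n * 'rV[R]_m)%type ('I_n + 'I_m)%type.
Proof.
refine (@Coords ('rV[R]_n * 'rV[R]_m)%type ('I_n + 'I_m)%type
  (fun v i => match i with inl k => v.1 0 k | inr k => v.2 0 k end)
  (fun i => match i with inl k => (delta_mx 0 k, 0) | inr k => (0, delta_mx 0 k) end)
  _ _ _ _ _).
- by move=> u v [] i /=; rewrite mxE.
- by move=> c v [] i /=; rewrite mxE.
- case=> v1 v2; rewrite big_sumType /=.
  have E1 : \sum_i v1 0 i *: (delta_mx 0 i, 0 : 'rV[R]_m) = (v1, 0).
    rewrite [in RHS](row_sum_delta v1); elim/big_rec2 : _ => // i y1 y2 _ ->.
    by rewrite -[LHS]/((_, _)) /= scaler0 add0r.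
  have E2 : \sum_i v2 0 i *: (0 : 'rV[R]_n, delta_mx 0 i) = (0, v2).
    rewrite [in RHS](row_sum_delta v2); elim/big_rec2 : _ => // i y1 y2 _ ->.
    by rewrite -[LHS]/((_, _)) /= scaler0 add0r.
  by rewrite E1 E2 -[RHS]/((_, _)) /= addr0 add0r.
- by case=> i [] k /=; rewrite mxE ?eqxx ?andbT //= eq_sym.
- by move=> v [] i; apply: le_trans (rV_norm_ge _ _) _;
    rewrite [leRHS]/Num.Def.normr /= le_max lexx ?orbT.
Defined.

Context {V : normedModType R} {I : finType} (B : coords V I).

Lemma crd0 i : crd B 0 i = 0.
Proof. by rewrite -(scale0r (0 : V)) crdZ mul0r. Qed.

Lemma norm_crd_le v : `|v| <= \sum_i `|crd B v i| * `|bas B i|.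
Proof.
rewrite {1}(crdE B v); apply: le_trans (ler_norm_sum _ _ _) _.
by apply: ler_sum => i _; rewrite normrZ.
Qed.

(** Directional derivatives need not be linear in the direction; continuity of the partial
    derivatives makes them so, one basis vector at a time. *)
Lemma is_derive_coords (f : V -> R) (x w : V) (df : I -> V -> R) (r : R) : 0 < r ->
  (forall i y, `|y - x| < r -> is_derive y (bas B i) f (df i y)) ->
  (forall i, {for x, continuous (df i)}) ->
  is_derive x w f (\sum_i crd B w i * df i x).
Proof.
move=> r0 h1 h2; rewrite [w in is_derive _ w](crdE B w).
elim/big_rec2 : _ => [|i y1 y2 _ IH]; first exact: is_derive0.
rewrite addrC [in X in is_derive _ _ _ X]addrC.
apply: (@is_derive_add_dir R V f (fun y => crd B w i * df i y) x _ _ _ r) => //.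
  by move=> y hy; apply: is_derive_scale; exact: h1.
by apply: cvgM; [exact: cvg_cst|exact: h2].
Qed.

End Coordinates.

Section Polynomials.
Context {R : realType}.

Lemma is_derive_mulrC (c t : R) : is_derive t 1 (fun t : R => t * c) c.
Proof.
apply/is_derive_epsP => e e0; exists 1 => // h _.
rewrite -[h *: 1]/(h * 1) mulr1 (_ : _ - _ = 0) ?normr0; last by ring.
by rewrite mulr_ge0 // ltW.
Qed.

Lemma is_derive_sqr (c t : R) : is_derive t 1 (fun t : R => 2^-1 * c * t ^+ 2) (c * t).
Proof.
apply/is_derive_epsP => e e0.
have c0 : 0 < `|c| + 1 by rewrite ltr_wpDl.
exists (e / (`|c| + 1)); first exact: divr_gt0.
move=> h; rewrite ltr_pdivlMr // => hh.
rewrite -[h *: 1]/(h * 1) mulr1.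
have -> : 2^-1 * c * (h + t) ^+ 2 - 2^-1 * c * t ^+ 2 - h * (c * t) =
    (2^-1 * c * h) * h by field.
rewrite !normrM; apply: ler_wpM2r => //.
rewrite ger0_norm ?invr_ge0 //; have := normr_ge0 (c : R); have := normr_ge0 (h : R).
move: hh; nra.
Qed.

Lemma is_derive_shiftl {V : normedModType R} (f : V -> R) (x w c : V) (df : R) :
  is_derive (x + c) w f df -> is_derive x w (fun y => f (y + c)) df.
Proof.
move=> /is_derive_epsP h; apply/is_derive_epsP => e /h[d d0 hd].
by exists d => // k /hd; rewrite addrA.
Qed.

End Polynomials.

(** * Locally uniform C^n families: Taylor expansions and symmetry of second derivatives *)

Section LocalFamilies.
Context {R : realType} {P : Type} {V : normedModType R}.

(** The radius is chosen before the parameter, so it is common to all parameters along [F]. *)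
Definition nearF (F : set_system P) (x0 : V) (Q : P -> V -> Prop) :=
  exists2 r : R, 0 < r & F [set a | forall x, `|x - x0| < r -> Q a x].

Definition nearF2 (F : set_system P) (x0 : V) (Q : P -> V -> V -> Prop) :=
  exists2 r : R, 0 < r &
    F [set a | forall x y, `|x - x0| < r -> `|y - x0| < r -> Q a x y].

(* Families [f a] that are C^n near [x0], uniformly for [a] along [F]. *)
Fixpoint Cloc {W : normedModType R} n (F : set_system P) (x0 : V) (f : P -> V -> W) : Prop :=
  [/\ nearF F x0 (fun a x => {for x, continuous (f a)}),
      exists C, nearF F x0 (fun a x => `|f a x| <= C) &
      if n is m.+1 then forall v,
        nearF F x0 (fun a x => derivable (f a) x v) /\
        Cloc m F x0 (fun a => 'D_v (f a))
      else True].

Context {F : set_system P} (FF : Filter F) {x0 : V}.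

Lemma nearF_imp (Q Q' : P -> V -> Prop) :
  (forall a x, Q a x -> Q' a x) -> nearF F x0 Q -> nearF F x0 Q'.
Proof.
move=> h [r r0 hr]; exists r => //; apply: filterS hr => a ha x xr.
exact/h/ha.
Qed.

Lemma nearF_and (Q Q' : P -> V -> Prop) : nearF F x0 Q -> nearF F x0 Q' ->
  nearF F x0 (fun a x => Q a x /\ Q' a x).
Proof.
move=> [r r0 hr] [s s0 hs]; exists (Num.min r s); first by rewrite lt_min r0.
apply: filterS2 hr hs => a ha hb x; rewrite lt_min => /andP[h1 h2].
by split; [exact: ha|exact: hb].
Qed.

Lemma nearF_fin (I : finType) (Q : I -> P -> V -> Prop) :
  (forall i, nearF F x0 (Q i)) -> nearF F x0 (fun a x => forall i, Q i a x).
Proof.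
move=> h; have : nearF F x0 (fun a x => forall i, i \in enum I -> Q i a x).
  elim: (enum I) => [|i s IH].
    by exists 1 => //; apply: filterE.
  apply: nearF_imp (nearF_and (h i) IH) => a x [h1 h2] k.
  by rewrite inE => /predU1P[->|/h2].
by apply: nearF_imp => a x h' i; apply: h'; rewrite mem_enum.
Qed.

Lemma nearF_nbhd (Q : P -> V -> Prop) : nearF F x0 Q ->
  nearF F x0 (fun a x => exists2 r : R, 0 < r & forall y, `|y - x| < r -> Q a y).
Proof.
move=> [r r0 hr]; exists (r / 2); first exact: divr_gt0.
apply: filterS hr => a ha x xr; exists (r / 2); first exact: divr_gt0.
move=> y yx; apply: ha; rewrite -(subrKA x); apply: le_lt_trans (ler_normD _ _) _.
by rewrite (splitr r) ltrD.
Qed.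

Lemma nearF2_imp (Q Q' : P -> V -> V -> Prop) :
  (forall a x y, Q a x y -> Q' a x y) -> nearF2 F x0 Q -> nearF2 F x0 Q'.
Proof.
move=> h [r r0 hr]; exists r => //; apply: filterS hr => a ha x y xr yr.
exact/h/ha.
Qed.

Lemma nearF2_and (Q Q' : P -> V -> V -> Prop) : nearF2 F x0 Q -> nearF2 F x0 Q' ->
  nearF2 F x0 (fun a x y => Q a x y /\ Q' a x y).
Proof.
move=> [r r0 hr] [s s0 hs]; exists (Num.min r s); first by rewrite lt_min r0.
apply: filterS2 hr hs => a ha hb x y.
rewrite !lt_min => /andP[h1 h2] /andP[h3 h4].
by split; [exact: ha|exact: hb].
Qed.

Lemma nearF2_fin (I : finType) (Q : I -> P -> V -> V -> Prop) :
  (forall i, nearF2 F x0 (Q i)) -> nearF2 F x0 (fun a x y => forall i, Q i a x y).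
Proof.
move=> h; have : nearF2 F x0 (fun a x y => forall i, i \in enum I -> Q i a x y).
  elim: (enum I) => [|i s IH].
    by exists 1 => //; apply: filterE.
  apply: nearF2_imp (nearF2_and (h i) IH) => a x y [h1 h2] k.
  by rewrite inE => /predU1P[->|/h2].
by apply: nearF2_imp => a x y h' i; apply: h'; rewrite mem_enum.
Qed.

Lemma ball_segment (x y : V) r (t : R) : `|x - x0| < r -> `|y - x0| < r ->
  0 <= t <= 1 -> `|x + t *: (y - x) - x0| < r.
Proof.
move=> xr yr /andP[t0 t1].
have -> : x + t *: (y - x) - x0 = (x - x0) + t *: ((y - x0) - (x - x0)).
  by rewrite opprB addrA subrK addrAC.
have -> : (x - x0) + t *: ((y - x0) - (x - x0)) = (1 - t) *: (x - x0) + t *: (y - x0).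
  by rewrite scalerBr scalerBl scale1r addrA addrAC.
apply: le_lt_trans (ler_normD _ _) _; rewrite !normrZ.
rewrite (ger0_norm t0) ger0_norm ?subr_ge0 //.
have [t00|tn0] := eqVneq t 0; first by rewrite t00 subr0 mul1r mul0r addr0.
have tp : 0 < t by rewrite lt_neqAle eq_sym tn0.
have -> : r = (1 - t) * r + t * r by ring.
by rewrite ler_ltD ?ltr_pM2l // ler_wpM2l ?subr_ge0 // ltW.
Qed.

Lemma nearF2_segment (Q : P -> V -> Prop) : nearF F x0 Q ->
  nearF2 F x0 (fun a x y => forall t : R, 0 <= t <= 1 -> Q a (x + t *: (y - x))).
Proof.
move=> [r r0 hr]; exists r => //; apply: filterS hr => a ha x y xr yr t t01.
by apply: ha; exact: ball_segment.
Qed.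

Lemma Cloc_pred {W : normedModType R} n (f : P -> V -> W) : Cloc n.+1 F x0 f -> Cloc n F x0 f.
Proof.
elim: n f => [|n IH] f [h1 h2 h3]; first by split.
split=> // v; have [h4 h5] := h3 v; split => //; exact: IH.
Qed.

Lemma ClocW {W : normedModType R} n m (f : P -> V -> W) : (m <= n)%N -> Cloc n F x0 f -> Cloc m F x0 f.
Proof.
move=> /subnKC <-; elim: (n - m)%N => [|k IH]; first by rewrite addn0.
by rewrite addnS => /Cloc_pred.
Qed.

Context {I : finType} (B : coords V I).
Fact pd_key : unit. Proof. exact: tt. Qed.

(* Locked: unfolding it makes unification explore the limit behind 'D_v. *)
Definition pd (i : I) (f : V -> R) : V -> R := locked_with pd_key ('D_(bas B i) f).

Lemma pdE i f : pd i f = 'D_(bas B i) f.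
Proof. by rewrite /pd unlock. Qed.

Lemma Cloc_pd n (f : P -> V -> R) i : Cloc n.+1 F x0 f -> Cloc n F x0 (fun a => pd i (f a)).
Proof.
case=> _ _ /(_ (bas B i))[_]; congr (Cloc _ _ _ _).
by apply/funext => a; rewrite pdE.
Qed.

Lemma Cloc_is_derive (f : P -> V -> R) : Cloc 1 F x0 f ->
  nearF F x0 (fun a x => forall w,
    is_derive x w (f a) (\sum_i crd B w i * pd i (f a) x)).
Proof.
case=> _ _ h.
have h1 : nearF F x0 (fun a x => forall i, derivable (f a) x (bas B i)).
  by apply: nearF_fin => i; have [] := h (bas B i).
have h2 : nearF F x0 (fun a x => forall i, {for x, continuous (pd i (f a))}).
  apply: nearF_fin => i; have [_ [+ _ _]] := h (bas B i).
  by apply: nearF_imp => a x; rewrite pdE.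
apply: nearF_imp (nearF_and (nearF_nbhd h1) h2) => a x [[r r0 h3] h4] w.
apply: (is_derive_coords w r0 _ h4) => i y /h3/(_ i) hd.
by rewrite pdE; exact: derivableP.
Qed.

Lemma Cloc_lipschitz (f : P -> V -> R) : Cloc 1 F x0 f -> exists2 C, 0 <= C &
  nearF2 F x0 (fun a x y => `|f a y - f a x| <= C * `|y - x|).
Proof.
move=> hf; have h1 := Cloc_is_derive hf.
have h2 i : exists C, nearF F x0 (fun a x => `|pd i (f a) x| <= C).
  by case: (Cloc_pd i hf).
have {h2} [C hC] := choice h2.
exists (\sum_i `|C i|); first by apply: sumr_ge0.
apply: nearF2_imp (nearF2_segment (nearF_and h1 (nearF_fin hC))) => a x y h.
have [t t01] := @mvt_line R V (f a) (fun z => \sum_i crd B (y - x) i * pd i (f a) z)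
  x (y - x) (fun t t01 => (h t t01).1 _).
rewrite subrKC => ->; rewrite mulr_suml.
apply: le_trans (ler_norm_sum _ _ _) _; apply: ler_sum => i _.
rewrite normrM mulrC; apply: ler_pM => //; last exact: crd_le.
by apply: le_trans ((h t t01).2 i) (ler_norm _).
Qed.

(** Mean value theorem on the segment, then the Lipschitz bound for the partial derivatives. *)
Lemma Cloc_taylor2 (f : P -> V -> R) : Cloc 2 F x0 f -> exists2 C, 0 <= C &
  nearF2 F x0 (fun a x y =>
    `|f a y - f a x - \sum_i crd B (y - x) i * pd i (f a) x| <= C * `|y - x| ^+ 2).
Proof.
move=> hf; have h1 := Cloc_is_derive (Cloc_pred hf).
have h2 i : exists C, 0 <= C /\
    nearF2 F x0 (fun a x y => `|pd i (f a) y - pd i (f a) x| <= C * `|y - x|).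
  by have [C C0 hC] := Cloc_lipschitz (Cloc_pd i hf); exists C.
have {h2} [C hC] := choice h2.
exists (\sum_i C i); first by apply: sumr_ge0 => i _; have [] := hC i.
have := nearF2_fin (fun i => (hC i).2) => -[r r0 hr].
have [s s0 hs] := nearF2_segment h1.
exists (Num.min r s); first by rewrite lt_min r0.
apply: filterS2 hr hs => a hr hs x y.
rewrite !lt_min => /andP[xr xs] /andP[yr ys].
have [t t01] := @mvt_line R V (f a) (fun z => \sum_i crd B (y - x) i * pd i (f a) z)
  x (y - x) (fun t t01 => hs _ _ xs ys t t01 _).
rewrite subrKC => ->; rewrite -sumrB mulr_suml.
apply: le_trans (ler_norm_sum _ _ _) _; apply: ler_sum => i _.
rewrite -mulrBr normrM expr2 mulrA [leRHS]mulrC; apply: ler_pM => //.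
  exact: crd_le.
apply: le_trans (hr x _ xr (ball_segment xr yr t01) i) _.
have [C0 _] := hC i; apply: ler_wpM2l => //.
rewrite addrC addKr normrZ; case/andP: t01 => t0 t1.
by rewrite ger0_norm // ler_piMl.
Qed.

Lemma Cloc_taylor3 (f : P -> V -> R) : Cloc 3 F x0 f -> exists2 C, 0 <= C &
  nearF2 F x0 (fun a x y =>
    `|f a y - f a x - \sum_i crd B (y - x) i * pd i (f a) x
      - 2^-1 * \sum_i \sum_k crd B (y - x) i * crd B (y - x) k * pd k (pd i (f a)) x|
     <= C * `|y - x| ^+ 3).
Proof.
move=> hf; have h1 := Cloc_is_derive (ClocW (isT : 1 <= 3)%N hf).
have h2 i : exists C, 0 <= C /\ nearF2 F x0 (fun a x y =>
    `|pd i (f a) y - pd i (f a) x - \sum_k crd B (y - x) k * pd k (pd i (f a)) x|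
      <= C * `|y - x| ^+ 2).
  by have [C C0 hC] := Cloc_taylor2 (Cloc_pd i hf); exists C.
have {h2} [C hC] := choice h2.
exists (\sum_i C i); first by apply: sumr_ge0 => i _; have [] := hC i.
have := nearF2_fin (fun i => (hC i).2) => -[r r0 hr].
have [s s0 hs] := nearF2_segment h1.
exists (Num.min r s); first by rewrite lt_min r0.
apply: filterS2 hr hs => a hr hs x y.
rewrite !lt_min => /andP[xr xs] /andP[yr ys].
set w := y - x.
pose A1 := \sum_i crd B w i * pd i (f a) x.
pose A2 := \sum_i \sum_k crd B w i * crd B w k * pd k (pd i (f a)) x.
(* With the quadratic Taylor polynomial removed, the mean value theorem leaves exactly the
   first-order Taylor remainders of the partial derivatives. *)
pose g (t : R) := f a (x + t *: w) - t * A1 - (2^-1 * A2) * t ^+ 2.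
pose dg (t : R) := \sum_i crd B w i * pd i (f a) (x + t *: w) - A1 - A2 * t.
have hg (t : R) : 0 <= t <= 1 -> is_derive t 1 g (dg t).
  move=> t01; have := is_derive_line (hs x y xs ys t t01 w) => hd.
  apply: is_deriveB (is_derive_sqr _ _).
  exact: is_deriveB (is_derive_mulrC _ _).
have [|||t] := @MVT_segment R g dg 0 1 => //.
- by move=> t; rewrite in_itv /= => /andP[t0 t1]; apply: hg; rewrite !ltW.
- by apply: derivable_within_continuous => t; rewrite in_itv /= => /hg[].
rewrite in_itv /= => t01; rewrite subr0 mulr1 /g.
rewrite scale1r scale0r addr0 !mul1r mul0r expr1n expr0n /= mulr0 mulr1 !subr0.
rewrite subrKC => e.
have -> : f a y - f a x - A1 - 2^-1 * A2 = f a y - A1 - 2^-1 * A2 - f a x by ring.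
rewrite e /dg /A1 /A2 mulr_suml -!sumrB mulr_suml.
apply: le_trans (ler_norm_sum _ _ _) _; apply: ler_sum => i _.
have -> : crd B w i * pd i (f a) (x + t *: w) - crd B w i * pd i (f a) x -
    (\sum_k crd B w i * crd B w k * pd k (pd i (f a)) x) * t =
  crd B w i * (pd i (f a) (x + t *: w) - pd i (f a) x
    - \sum_k crd B ((x + t *: w) - x) k * pd k (pd i (f a)) x).
  rewrite !mulrBr; congr (_ - _); rewrite mulr_suml mulr_sumr.
  by apply: eq_bigr => k _; rewrite addrC addKr crdZ; ring.
have -> : C i * `|w| ^+ 3 = `|w| * (C i * `|w| ^+ 2) by ring.
rewrite normrM; apply: ler_pM => //; first exact: crd_le.
apply: le_trans (hr x _ xr (ball_segment xr yr t01) i) _.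
have [C0 _] := hC i; apply: ler_wpM2l => //.
rewrite addrC addKr normrZ; case/andP: t01 => t0 t1.
by apply: lerXn2r; rewrite ?nnegrE ?mulr_ge0 // ger0_norm // ler_piMl.
Qed.

(** The second difference over a small parallelogram is symmetric in the two directions, and each
    mixed partial derivative equals it divided by h^2, up to an error of size h. *)
Lemma Cloc_schwarz (f : P -> V -> R) : Cloc 3 F x0 f -> nearF F x0 (fun a x => forall i k,
  pd i (pd k (f a)) x = pd k (pd i (f a)) x).
Proof.
move=> hf; have h1 := Cloc_is_derive (ClocW (isT : 1 <= 3)%N hf).
have h2 i : exists C, 0 <= C /\ nearF2 F x0 (fun a x y =>
    `|pd i (f a) y - pd i (f a) x - \sum_k crd B (y - x) k * pd k (pd i (f a)) x|
      <= C * `|y - x| ^+ 2).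
  by have [C C0 hC] := Cloc_taylor2 (Cloc_pd i hf); exists C.
have {h2} [C hC] := choice h2.
have := nearF2_fin (fun i => (hC i).2) => -[r r0 hr].
have := nearF_nbhd h1 => -[s s0 hs].
exists (Num.min r s); first by rewrite lt_min r0.
apply: filterS2 hr hs => a hr hs x; rewrite lt_min => /andP[xr xs].
have [d d0 hd] := hs x xs.
pose q := Num.min (r - `|x - x0|) d.
have q0 : 0 < q by rewrite lt_min subr_gt0 xr.
have q1 y : `|y - x| < q -> `|y - x0| < r /\ `|y - x| < d.
  rewrite lt_min => /andP[h ->]; split => //.
  rewrite -(subrKA x); apply: le_lt_trans (ler_normD _ _) _.
  by move: h; rewrite ltrBrDr.
pose M (i k : I) := `|bas B i| + `|bas B k| + 1.
pose S (i k : I) h := f a (x + h *: bas B i + h *: bas B k) - f a (x + h *: bas B i)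
   - (f a (x + h *: bas B k) - f a x).
have key i k : exists2 D, 0 <= D & forall h, 0 < h -> h * M i k < q ->
    `|S i k h - h ^+ 2 * pd k (pd i (f a)) x| <= D * h ^+ 3.
  exists (2 * (C i * M i k ^+ 2)).
    by have [? _] := hC i; rewrite mulr_ge0 // mulr_ge0 // sqr_ge0.
  move=> h h0 hM.
  have M0 : 0 <= M i k by rewrite /M !addr_ge0.
  have inb (t u : R) : 0 <= t <= 1 -> 0 <= u <= 1 ->
      `|(x + t *: (h *: bas B i) + u *: (h *: bas B k)) - x| <= h * M i k.
    move=> /andP[t0 t1] /andP[u0 u1].
    rewrite -[x + _ + _]addrA [x + _]addrC addrK; apply: le_trans (ler_normD _ _) _.
    rewrite !normrZ (ger0_norm t0) (ger0_norm u0) (gtr0_norm h0) /M !mulrDr mulr1.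
    apply: ler_wpDr; first exact: ltW.
    by apply: lerD; rewrite ler_piMl // mulr_ge0 // ltW.
  have E : (fun y => f a (y + h *: bas B k) - f a y) =
      (fun y => f a (y + h *: bas B k)) - f a by [].
  have hMd : h * M i k < d by apply: lt_le_trans hM _; rewrite ge_min lexx orbT.
  have hyp t : 0 <= t <= 1 -> is_derive (x + t *: (h *: bas B i)) (h *: bas B i)
     (fun y => f a (y + h *: bas B k) - f a y)
     (h * (pd i (f a) (x + t *: (h *: bas B i) + h *: bas B k)
         - pd i (f a) (x + t *: (h *: bas B i)))).
    move=> t01.
    have hin (u : R) : 0 <= u <= 1 -> is_derive ((x + t *: (h *: bas B i)) + u *: (h *: bas B k))
        (h *: bas B i) (f a)
        (h * pd i (f a) ((x + t *: (h *: bas B i)) + u *: (h *: bas B k))).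
      move=> u01; apply: is_derive_scale.
      have [hdd _] := hd _ (le_lt_trans (inb t u t01 u01) hMd) (bas B i).
      by rewrite pdE; exact: derivableP.
    rewrite mulrBr E; apply: is_deriveB.
      apply: is_derive_shiftl; have := hin 1; rewrite scale1r; apply.
      by rewrite ler01 lexx.
    by have := hin 0; rewrite scale0r addr0; apply; rewrite lexx ler01.
  have [t t01] := @mvt_line R V (fun y => f a (y + h *: bas B k) - f a y)
    (fun y => h * (pd i (f a) (y + h *: bas B k) - pd i (f a) y)) x (h *: bas B i)
    hyp.
  rewrite /S => ->.
  have := inb t 1 t01; rewrite scale1r ler01 lexx => /(_ isT) in1.
  have := inb t 0 t01; rewrite scale0r addr0 ler01 lexx => /(_ isT) in0.
  have [in1r _] := q1 _ (le_lt_trans in1 hM).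
  have [in0r _] := q1 _ (le_lt_trans in0 hM).
  have := hr x _ xr in1r i; have := hr x _ xr in0r i.
  have -> : \sum_l crd B (x + t *: (h *: bas B i) + h *: bas B k - x) l * pd l (pd i (f a)) x
     = \sum_l crd B (x + t *: (h *: bas B i) - x) l * pd l (pd i (f a)) x
      + h * pd k (pd i (f a)) x.
    rewrite addrAC.
    under eq_bigr do rewrite crdD mulrDl.
    rewrite big_split /=; congr (_ + _).
    rewrite (bigD1 k) //= crdZ crd_bas eqxx mulr1 big1 ?addr0 // => l lk.
    by rewrite crdZ crd_bas eq_sym (negbTE lk) mulr0 mul0r.
  have [C0 _] := hC i.
  have le2 (z : V) : `|z| <= h * M i k -> C i * `|z| ^+ 2 <= C i * M i k ^+ 2 * h ^+ 2.
    move=> hz; rewrite -mulrA -exprMn [M i k * h]mulrC; apply: ler_wpM2l => //.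
    by apply: lerXn2r; rewrite ?nnegrE ?mulr_ge0 // ltW.
  move=> /le_trans/(_ (le2 _ in0)) e0 /le_trans/(_ (le2 _ in1)) e1.
  move: e0 e1; set D0 := pd i (f a) x; set L := \sum_l _.
  set D1 := pd i (f a) _; set D2 := pd i (f a) _; set D3 := pd k _ _.
  move: (C i * M i k ^+ 2) => W e0 e1.
  have -> : h * (D2 - D1) - h ^+ 2 * D3 =
     h * ((D2 - D0 - (L + h * D3)) - (D1 - D0 - L)) by ring.
  rewrite normrM (gtr0_norm h0).
  have -> : 2 * W * h ^+ 3 = h * (W * h ^+ 2 + W * h ^+ 2) by ring.
  apply: ler_wpM2l; first exact: ltW.
  by apply: le_trans (ler_normB _ _) (lerD e1 e0).
move=> i k; have [D1 D10 k1] := key i k; have [D2 D20 k2] := key k i.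
apply/eqP; rewrite -subr_eq0 -normr_le0; apply/ler_addgt0Pl => e e0; rewrite addr0.
pose h := Num.min (q / 2 / M i k) (e / (D1 + D2 + 1)).
have M0 : 0 < M i k by rewrite /M ltr_wpDl // addr_ge0.
have D0 : 0 < D1 + D2 + 1 by rewrite ltr_wpDl // addr_ge0.
have h0 : 0 < h by rewrite lt_min !divr_gt0.
have hM : h * M i k < q.
  apply: (@le_lt_trans _ _ (q / 2)); last by rewrite ltr_pdivrMr // ltr_pMr // ltr1n.
  by rewrite -ler_pdivlMr // ge_min lexx.
have Msym : M k i = M i k by rewrite /M [`|bas B k| + _]addrC.
have := k2 h h0; rewrite Msym => /(_ hM).
have -> : S k i h = S i k h.
  by rewrite /S [x + _ + h *: bas B i]addrAC; ring.
have {}k1 := k1 h h0 hM; move: k1 => k1 k2'.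
rewrite -(ler_pM2l (exprn_gt0 2 h0)) -{1}(ger0_norm (ltW (exprn_gt0 2 h0))) -normrM.
set X := pd i _ _ in k2' *; set Y := pd k _ _ in k1 *.
have -> : h ^+ 2 * (X - Y) = (S i k h - h ^+ 2 * Y) - (S i k h - h ^+ 2 * X) by ring.
apply: le_trans (ler_normB _ _) _; apply: le_trans (lerD k1 k2') _.
have -> : D1 * h ^+ 3 + D2 * h ^+ 3 = h ^+ 2 * ((D1 + D2) * h) by ring.
apply: ler_wpM2l; first exact: sqr_ge0.
have : h <= e / (D1 + D2 + 1) by rewrite ge_min lexx orbT.
rewrite ler_pdivlMr // => he; apply: le_trans he.
by rewrite mulrC; apply: ler_wpM2l; rewrite ?ltW // ltrDl.
Qed.

End LocalFamilies.

(** * Chain rule and construction of locally uniform families *)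

Section ClocConversions.
Context {R : realType}.

Lemma is_derive_nearP {V : normedModType R} (f : V -> R) (x v : V) (df : R) :
  is_derive x v f df <->
  forall e, 0 < e -> \forall h \near (0 : R),
    `|f (h *: v + x) - f x - h * df| <= e * `|h|.
Proof.
rewrite is_derive_epsP; split=> h e /h.
  move=> [d d0 hd]; apply/nbhs_normP; exists d => //= k /=.
  by rewrite sub0r normrN => /hd.
move=> /nbhs_normP[d d0 hd]; exists d => // k kd; apply: hd => /=.
by rewrite sub0r normrN.
Qed.

(** The curve is only known to have coordinates differentiable at [t]; a first-order expansion of
    [f] with quadratic error is enough to compose. *)
Lemma chain_curve {V : normedModType R} {I : finType} (B : coords V I)
    (f : V -> R) (x : R -> V) (t : R) (dx d : I -> R) (C r : R) :
  0 < r -> 0 <= C ->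
  (forall i, is_derive t 1 (fun t => crd B (x t) i) (dx i)) ->
  (forall y, `|y - x t| < r ->
    `|f y - f (x t) - \sum_i crd B (y - x t) i * d i| <= C * `|y - x t| ^+ 2) ->
  is_derive t 1 (f \o x) (\sum_i dx i * d i).
Proof.
move=> r0 C0 hx hf; apply/is_derive_nearP => e e0.
(* [M] bounds the difference quotients of the curve near [t]. *)
pose M := \sum_i (`|dx i| + 1) * `|bas B i| + 1.
have M0 : 0 < M by rewrite ltr_wpDl // sumr_ge0 // => i _; rewrite mulr_ge0 // addr_ge0.
pose N := \sum_i `|d i| + 1.
have N0 : 0 < N by rewrite ltr_wpDl // sumr_ge0.
have h1 : \forall h \near (0 : R), forall i,
    `|crd B (x (h *: 1 + t)) i - crd B (x t) i - h * dx i| <= Num.min 1 (e / 2 / N) * `|h|.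
  have e1 : 0 < Num.min 1 (e / 2 / N) by rewrite lt_min ltr01 !divr_gt0.
  have h0 i : nbhs (0 : R) (fun h : R => `|crd B (x (h *: 1 + t)) i - crd B (x t) i
      - h * dx i| <= Num.min 1 (e / 2 / N) * `|h|).
    exact: ((is_derive_nearP _ _ _ _).1 (hx i) _ e1).
  exact: filter_forall h0.
have d1 : 0 < Num.min (r / M) (e / 2 / (C * M ^+ 2 + 1)).
  by rewrite lt_min !divr_gt0 // ltr_wpDl // mulr_ge0 // sqr_ge0.
have h2 : \forall h \near (0 : R), `|h| < Num.min (r / M) (e / 2 / (C * M ^+ 2 + 1)).
  by apply/nbhs_normP; exists (Num.min (r / M) (e / 2 / (C * M ^+ 2 + 1))) => //= k /=;
    rewrite sub0r normrN.
apply: filterS2 h1 h2 => h h1 h2.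
have lex : `|x (h *: 1 + t) - x t| <= M * `|h|.
  apply: le_trans (norm_crd_le B _) _; rewrite /M mulrDl mul1r.
  apply: ler_wpDr => //; rewrite mulr_suml; apply: ler_sum => i _.
  rewrite mulrAC; apply: ler_wpM2r => //; rewrite crdB.
  have := h1 i; set D := crd B (x _) i - crd B (x t) i => hD.
  have -> : D = (D - h * dx i) + h * dx i by rewrite subrK.
  apply: le_trans (ler_normD _ _) _; rewrite normrM mulrDl mul1r addrC [`|h| * _]mulrC.
  rewrite lerD2l; apply: le_trans hD _.
  by rewrite ler_piMl // ge_min lexx.
move: h2; rewrite lt_min => /andP[h2 h3].
have := hf (x (h *: 1 + t)).
have hr : `|x (h *: 1 + t) - x t| < r.
  by apply: le_lt_trans lex _; rewrite mulrC -ltr_pdivlMr.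
move=> /(_ hr) h4.
have -> : (f \o x) (h *: 1 + t) - (f \o x) t - h * \sum_i dx i * d i =
   (f (x (h *: 1 + t)) - f (x t) - \sum_i crd B (x (h *: 1 + t) - x t) i * d i)
   + \sum_i (crd B (x (h *: 1 + t)) i - crd B (x t) i - h * dx i) * d i.
  have -> : \sum_i (crd B (x (h *: 1 + t)) i - crd B (x t) i - h * dx i) * d i =
     \sum_i crd B (x (h *: 1 + t) - x t) i * d i - h * \sum_i dx i * d i.
    by rewrite mulr_sumr -sumrB; apply: eq_bigr => i _; rewrite crdB; ring.
  rewrite /=; ring.
apply: le_trans (ler_normD _ _) _.
have -> : e * `|h| = e / 2 * `|h| + e / 2 * `|h| by field.
apply: lerD.
  apply: le_trans h4 _; apply: le_trans (_ : C * (M * `|h|) ^+ 2 <= _).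
    by apply: ler_wpM2l => //; apply: lerXn2r; rewrite ?nnegrE ?mulr_ge0 ?(ltW M0).
  have -> : C * (M * `|h|) ^+ 2 = C * M ^+ 2 * `|h| * `|h| by ring.
  apply: ler_wpM2r => //; move: h3.
  have CM : 0 < C * M ^+ 2 + 1 by rewrite ltr_wpDl // mulr_ge0 // sqr_ge0.
  rewrite ltr_pdivlMr // => /ltW; apply: le_trans.
  by rewrite mulrC; apply: ler_wpM2l => //; rewrite lerDl.
apply: le_trans (ler_norm_sum _ _ _) _.
apply: le_trans (_ : \sum_i (e / 2 / N * `|h|) * `|d i| <= _).
  apply: ler_sum => i _; rewrite normrM; apply: ler_wpM2r => //.
  apply: le_trans (h1 i) _; apply: ler_wpM2r => //.
  by rewrite ge_min lexx orbT.
rewrite -mulr_sumr mulrAC; apply: ler_wpM2r => //.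
have e2 : 0 <= e / 2 / N by rewrite !divr_ge0 // ltW.
apply: le_trans (_ : e / 2 / N * N <= _); last by rewrite divfK // gt_eqF.
by apply: ler_wpM2l => //; rewrite lerDl.
Qed.

Section Loc.
Context {P : Type} {V : normedModType R}.
Context (F : set_system P) (FF : Filter F).

Lemma near_norm (x : V) (Q : V -> Prop) :
  (exists2 r : R, 0 < r & forall y, `|y - x| < r -> Q y) -> \forall y \near x, Q y.
Proof.
move=> [r r0 h]; apply/nbhs_normP; exists r => //= y /=.
by rewrite -normrN opprB; exact: h.
Qed.

Lemma Cloc_ext {W : normedModType R} n x0 (f g : P -> V -> W) :
  nearF F x0 (fun a x => f a x = g a x) -> Cloc n F x0 f -> Cloc n F x0 g.
Proof.
elim: n f g => [|n IH] f g e.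
all: have e' := nearF_and FF (nearF_nbhd FF e) e.
all: move=> [h1 [C h2] h3].
all: have k1 : nearF F x0 (fun a x => {for x, continuous (g a)}).
1,3: apply: (nearF_imp FF) (nearF_and FF e' h1) => a x [[/near_norm he hx] hc];
  rewrite /prop_for /continuous_at -hx; apply: cvg_trans hc; exact: near_eq_cvg.
all: have k2 : nearF F x0 (fun a x => `|g a x| <= C).
1,3: by apply: (nearF_imp FF) (nearF_and FF e h2) => a x [->].
  by split => //; exists C.
split => //; first by exists C.
move=> v; have [h4 h5] := h3 v; split.
  by apply: (nearF_imp FF) (nearF_and FF e' h4) => a x [[/near_norm he _]];
    exact: near_eq_derivable.
apply: IH h5; apply: (nearF_imp FF) e' => a x [/near_norm he _].
exact: near_eq_derive.
Qed.

Lemma is_derive_crd {W : normedModType R} {I : finType} (B : coords W I) (f : V -> W) x v i :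
  derivable f x v -> is_derive x v (fun y => crd B (f y) i) (crd B ('D_v f x) i).
Proof.
move=> hf; apply/is_derive_nearP => e e0.
move: hf => /cvgrPdist_le /(_ e e0); rewrite near_withinE.
rewrite -/('D_v f x); apply: filterS => h hh.
have [->|h0] := eqVneq h 0.
  by rewrite scale0r add0r subrr mul0r subr0 normr0 mulr0.
have {}hh := hh h0.
have -> : crd B (f (h *: v + x)) i - crd B (f x) i - h * crd B ('D_v f x) i =
    - (h * crd B ('D_v f x - h^-1 *: (f (h *: v + x) - f x)) i).
  by rewrite crdB crdZ crdB; field.
rewrite normrN normrM mulrC; apply: ler_wpM2r => //.
by apply: le_trans hh; exact: crd_le.
Qed.

Lemma Cloc_crd {W : normedModType R} {I : finType} (B : coords W I) n x0
    (f : P -> V -> W) i :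
  Cloc n F x0 f -> Cloc n F x0 (fun a x => crd B (f a x) i).
Proof.
elim: n f => [|n IH] f [h1 [C h2] h3].
all: have k1 : nearF F x0 (fun a x => {for x, continuous (fun x => crd B (f a x) i)}).
1,3: apply: (nearF_imp FF) h1 => a x /cvgrPdist_le hc; apply/cvgrPdist_le => e /hc;
  apply: filterS => y; rewrite -crdB; apply: le_trans; exact: crd_le.
all: have k2 : nearF F x0 (fun a x => `|crd B (f a x) i| <= C).
1,3: by apply: (nearF_imp FF) h2 => a x; apply: le_trans; exact: crd_le.
  by split => //; exists C.
split => //; first by exists C.
move=> v; have [h4 h5] := h3 v; split.
  by apply: (nearF_imp FF) h4 => a x hd; have [] := is_derive_crd B i hd.
apply: Cloc_ext (IH _ h5); apply: (nearF_imp FF) h4 => a x hd.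
by have [_ ->] := is_derive_crd B i hd.
Qed.

Lemma Cloc_affine {V' W : normedModType R} (io io0 : V' -> V) n (y0 : V')
    (f : P -> V -> W) :
  (forall (h : R) v y, io (h *: v + y) = h *: io0 v + io y) ->
  (forall y z, `|io y - io z| <= `|y - z|) ->
  Cloc n F (io y0) f -> Cloc n F y0 (fun a y => f a (io y)).
Proof.
move=> hio lio.
have nio (Q : P -> V -> Prop) : nearF F (io y0) Q -> nearF F y0 (fun a y => Q a (io y)).
  move=> [r r0 hr]; exists r => //; apply: filterS hr => a ha y yr.
  by apply: ha; apply: le_lt_trans (lio _ _) yr.
have ctn : continuous io.
  move=> y; apply/cvgrPdist_lt => e e0; apply/nbhs_normP; exists e => //= z /=.
  exact: le_lt_trans.
have dio (g : V -> W) v y : (fun h : R => h^-1 *: (((fun y => g (io y)) \o shift y) (h *: v) - g (io y)))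
   = (fun h : R => h^-1 *: ((g \o shift (io y)) (h *: io0 v) - g (io y))).
  by apply/funext => h /=; rewrite hio.
elim: n f => [|n IH] f [h1 [C h2] h3].
all: have k1 : nearF F y0 (fun a x => {for x, continuous (fun x => f a (io x))}).
1,3: apply: (nearF_imp FF) (nio _ h1) => a x hc; apply: continuous_comp => //; exact: ctn.
all: have k2 : nearF F y0 (fun a x => `|f a (io x)| <= C).
1,3: exact: nio _ h2.
  by split => //; exists C.
split => //; first by exists C.
move=> v; have [h4 h5] := h3 (io0 v); split.
  by apply: (nearF_imp FF) (nio _ h4) => a x; rewrite /derivable dio.
have -> : (fun a => 'D_v (fun y => f a (io y))) = (fun a y => 'D_(io0 v) (f a) (io y)).
  by apply/funext => a; apply/funext => y; rewrite /derive dio.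
exact: IH h5.
Qed.

(** Joint continuity at the single point [(a0, x0)] yields bounds that are uniform along [F] on a
    common ball. *)
Lemma Cloc_of_family {P0 : topologicalType} {W : normedModType R} n (D : set (P0 * V))
    (f : P0 -> V -> W) (phi : P -> P0) (a0 : P0) (x0 : V) :
  phi @ F --> a0 -> D (a0, x0) -> nearF F x0 (fun a x => D (phi a, x)) ->
  is_Cn_family n D f -> Cloc n F x0 (fun a => f (phi a)).
Proof.
move=> hphi Dx0 hD.
have c1 (g : P0 -> V -> W) : {within D, continuous (fun z : P0 * V => g z.1 z.2)} ->
    nearF F x0 (fun a x => {for x, continuous (g (phi a))}).
  move=> /subspace_continuousP hc; apply: (nearF_imp FF) (nearF_and FF (nearF_nbhd FF hD) hD).
  move=> a x [/near_norm hn Dax] U hU.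
  have [[U1 U2] [/= n1 n2] hU12] := hc _ Dax U hU.
  rewrite /continuous_at nbhs_simpl; apply: filterS2 n2 hn => y y2 Dy.
  by apply: (hU12 (phi a, y)) => //; split => //=; exact: nbhs_singleton.
have c2 (g : P0 -> V -> W) : {within D, continuous (fun z : P0 * V => g z.1 z.2)} ->
    exists C, nearF F x0 (fun a x => `|g (phi a) x| <= C).
  move=> /subspace_continuousP hc; exists (`|g a0 x0| + 1).
  have /cvgrPdist_le/(_ 1 ltr01) := hc _ Dx0.
  rewrite near_withinE => -[[U1 U2] [/= n1 /nbhs_normP[r r0 hr]] hU12].
  have n1' : F (phi @^-1` U1) := hphi _ n1.
  have [s s0 hs] := hD.
  exists (Num.min r s); first by rewrite lt_min r0.
  apply: filterS2 n1' hs => a ha hs x; rewrite lt_min => /andP[xr xs].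
  have := hU12 (phi a, x); rewrite /=.
  have -> : g (phi a) x = g a0 x0 - (g a0 x0 - g (phi a) x) by rewrite opprB subrKC.
  move=> h; apply: le_trans (ler_normB _ _) _; rewrite lerD2l; apply: h.
    by split => //=; apply: hr => /=; rewrite -normrN opprB.
  exact: hs.
elim: n f => [|n IH] f /= [hc hd]; first by split; [exact: c1|exact: c2|].
split; [exact: c1|exact: c2|] => v; have [h1 h2] := hd v; split; last exact: IH h2.
by apply: (nearF_imp FF) hD => a x /h1.
Qed.

End Loc.
End ClocConversions.

(** * Algebra of smooth functions *)

Section Smooth.
Context {R : realType} {V : normedModType R}.

Lemma is_Cn_pred {W : normedModType R} n (f : V -> W) : is_Cn n.+1 setT f -> is_Cn n setT f.
Proof.
elim: n f => [|n IH] f [h1 h2]; first by split.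
by split=> // v; have [h3 h4] := h2 v; split => //; exact: IH.
Qed.

Lemma is_Cn_derive {W : normedModType R} n (f : V -> W) v :
  is_Cn n.+1 setT f -> is_Cn n setT ('D_v f).
Proof. by case=> _ /(_ v)[]. Qed.

Lemma is_Cn_ext {W : normedModType R} n (f g : V -> W) : f =1 g ->
  is_Cn n setT f -> is_Cn n setT g.
Proof. by move=> /funext ->. Qed.

Lemma is_Cn_cont {W : normedModType R} n (f : V -> W) : is_Cn n setT f -> continuous f.
Proof. by case: n => [|n] [h _]; exact: (continuous_subspace_setT f).2 h. Qed.

Lemma is_CnD n (f g : V -> R) : is_Cn n setT f -> is_Cn n setT g ->
  is_Cn n setT (fun x => f x + g x).
Proof.
elim: n f g => [|n IH] f g hf hg.
all: have cf := is_Cn_cont hf; have cg := is_Cn_cont hg.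
all: have cc : {within setT, continuous (fun x => f x + g x)}.
1,3: by apply: continuous_subspaceT => x; exact: (continuousD (cf x) (cg x)).
  by split.
split => //.
move=> v; have [df cdf] := hf.2 v; have [dg cdg] := hg.2 v; split.
  by move=> x _; apply: derivableD; [exact: df|exact: dg].
apply: is_Cn_ext (IH _ _ cdf cdg) => x.
by rewrite -deriveD //; [exact: df|exact: dg].
Qed.

Lemma is_CnM n (f g : V -> R) : is_Cn n setT f -> is_Cn n setT g ->
  is_Cn n setT (fun x => f x * g x).
Proof.
elim: n f g => [|n IH] f g hf hg.
all: have cf := is_Cn_cont hf; have cg := is_Cn_cont hg.
all: have cc : {within setT, continuous (fun x => f x * g x)}.
1,3: by apply: continuous_subspaceT => x; exact: (continuousM (cf x) (cg x)).
  by split.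
split => //.
move=> v; have [df cdf] := hf.2 v; have [dg cdg] := hg.2 v; split.
  by move=> x _; apply: derivableM; [exact: df|exact: dg].
apply: is_Cn_ext (is_CnD (IH _ _ (is_Cn_pred hf) cdg) (IH _ _ (is_Cn_pred hg) cdf)) => x.
by have := deriveM (df x I) (dg x I); rewrite /GRing.scale /= => ->.
Qed.

Lemma is_Cn_cst n (c : R) : is_Cn n setT (fun _ : V => c).
Proof.
elim: n c => [|n IH] c; split => //=.
- by apply: continuous_subspaceT => x; exact: cvg_cst.
- by apply: continuous_subspaceT => x; exact: cvg_cst.
move=> v; split; first by move=> x _; exact: derivable_cst.
by apply: is_Cn_ext (IH 0) => x; rewrite derive_cst.
Qed.

Definition smooth (f : V -> R) := is_Cinf setT f.

Lemma smoothD f g : smooth f -> smooth g -> smooth (fun x => f x + g x).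
Proof. by move=> hf hg n; exact: is_CnD. Qed.

Lemma smoothM f g : smooth f -> smooth g -> smooth (fun x => f x * g x).
Proof. by move=> hf hg n; exact: is_CnM. Qed.

Lemma smooth_cst c : smooth (fun=> c).
Proof. by move=> n; exact: is_Cn_cst. Qed.

Lemma smoothN f : smooth f -> smooth (fun x => - f x).
Proof.
move=> hf n; apply: (is_Cn_ext (f := fun x => -1 * f x)).
  by move=> x; rewrite mulN1r.
by apply: is_CnM => //; exact: is_Cn_cst.
Qed.

Lemma smooth_sum (I : finType) (f : I -> V -> R) : (forall i, smooth (f i)) ->
  smooth (fun x => \sum_i f i x).
Proof.
move=> h; have -> : (fun x => \sum_i f i x) = (fun x => \sum_(i <- enum I) f i x).
  by apply/funext => x; rewrite big_enum.
elim: (enum I) => [|i s IH].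
  have := smooth_cst 0; congr (is_Cinf _ _).
  by apply/funext => x; rewrite big_nil.
have := smoothD (h i) IH; congr (is_Cinf _ _).
by apply/funext => x; rewrite big_cons.
Qed.

Lemma smooth_derive f v : smooth f -> smooth ('D_v f).
Proof. by move=> h n; apply: is_Cn_derive. Qed.

Lemma Cloc_smooth {P : Type} {W : normedModType R} (F : set_system P) (FF : Filter F)
    (x0 : V) n (f : V -> W) :
  is_Cinf setT f -> Cloc n F x0 (fun=> f).
Proof.
move=> /(_ n); elim: n f => [|n IH] f hf; have cf := is_Cn_cont hf.
all: have k1 : nearF F x0 (fun a x => {for x, continuous f}).
1,3: by exists 1 => //; apply: filterE => a x _; exact: cf.
all: have k2 : nearF F x0 (fun a x => `|f x| <= `|f x0| + 1).
1,3: have /cvgrPdist_le/(_ 1 ltr01)/nbhs_normP[r r0 hr] := cf x0; exists r => //;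
  apply: filterE => a x xr;
  have -> : f x = f x0 - (f x0 - f x) by rewrite opprB subrKC.
1,2: apply: le_trans (ler_normB _ _) _; rewrite lerD2l; apply: hr => /=;
  by rewrite -normrN opprB.
  by split => //; exists (`|f x0| + 1).
split => //; first by exists (`|f x0| + 1).
move=> v; have [df cdf] := hf.2 v; split; last exact: IH.
by exists 1 => //; apply: filterE => a x _; exact: df.
Qed.

Lemma smooth_crd {W : normedModType R} {I : finType} (B : coords W I) (f : V -> W) i :
  is_Cinf setT f -> smooth (fun x => crd B (f x) i).
Proof.
move=> h n; move: (h n); elim: n f {h} => [|n IH] f hf; have cf := is_Cn_cont hf.
all: have cc : continuous (fun x => crd B (f x) i).
1,3: move=> x; apply/cvgrPdist_le => e e0; have /cvgrPdist_le/(_ e e0) := cf x;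
  by apply: filterS => y; rewrite -crdB; apply: le_trans; exact: crd_le.
  by split => //; exact: continuous_subspaceT.
split; first by exact: continuous_subspaceT.
move=> v; have [df cdf] := hf.2 v; split.
  by move=> x _; have [] := is_derive_crd B i (df x Logic.I).
by apply: is_Cn_ext (IH _ cdf) => x; have [_ ->] := is_derive_crd B i (df x Logic.I).
Qed.

End Smooth.

(** * Functions with bounded first-order Taylor data on a ball *)

Section Tame.
Context {R : realType} {V : normedModType R} {I : finType} (B : coords V I).

Lemma smooth_pd (f : V -> R) l : smooth f -> smooth (pd B l f).
Proof. by rewrite pdE; exact: smooth_derive. Qed.

(** Exactly the three estimates through which a smooth function enters the order calculus, with one
    constant and an explicit ball. *)
Definition tame (f : V -> R) (x0 : V) (r : R) := exists2 C, 0 <= C &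
  forall x y, `|x - x0| < r -> `|y - x0| < r ->
    [/\ `|f x| <= C, `|f y - f x| <= C * `|y - x| &
      `|f y - f x - \sum_i crd B (y - x) i * pd B i f x| <= C * `|y - x| ^+ 2].

Lemma tame_le f x0 r r' : r' <= r -> tame f x0 r -> tame f x0 r'.
Proof.
move=> rr [C C0 h]; exists C => // x y xr yr.
by apply: h; [exact: lt_le_trans rr|exact: lt_le_trans rr].
Qed.

Lemma smooth_tame f x0 : smooth f -> exists2 r, 0 < r & tame f x0 r.
Proof.
move=> hf; pose F := globally [set: unit].
have FF : Filter F by exact: globally_filter.
have h0 := Cloc_smooth FF x0 2 hf.
have [C1 C10 [r1 r10 h1]] := Cloc_lipschitz FF B (Cloc_pred h0).
have [C2 C20 [r2 r20 h2]] := Cloc_taylor2 FF B h0.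
have [_ [C3 [r3 r30 h3]] _] := h0.
exists (Num.min r1 (Num.min r2 r3)); first by rewrite !lt_min r10 r20.
have C30 : 0 <= `|C3| by [].
exists (C1 + C2 + `|C3|); first by rewrite !addr_ge0.
move=> x y; rewrite !lt_min => /and3P[x1 x2 x3] /and3P[y1 y2 y3]; split.
- apply: le_trans (h3 tt Logic.I x x3) _; apply: le_trans (ler_norm _) _.
  by rewrite lerDr addr_ge0.
- apply: le_trans (h1 tt Logic.I x y x1 y1) _; apply: ler_wpM2r => //.
  by rewrite -addrA lerDl addr_ge0.
- apply: le_trans (h2 tt Logic.I x y x2 y2) _; apply: ler_wpM2r; first exact: sqr_ge0.
  by rewrite addrAC lerDr addr_ge0.
Qed.

Lemma smooth_tame_fin (J : finType) (f : J -> V -> R) x0 : (forall j, smooth (f j)) ->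
  exists2 r, 0 < r & forall j, tame (f j) x0 r.
Proof.
move=> hf; have : exists2 r, 0 < r & forall j, j \in enum J -> tame (f j) x0 r.
  elim: (enum J) => [|j s [r r0 h]]; first by exists 1.
  have [r' r'0 h'] := smooth_tame x0 (hf j).
  exists (Num.min r r'); first by rewrite lt_min r0.
  move=> k; rewrite inE => /predU1P[->|/h].
    by apply: tame_le h'; rewrite ge_min lexx orbT.
  by apply: tame_le; rewrite ge_min lexx.
by move=> [r r0 h]; exists r => // j; apply: h; rewrite mem_enum.
Qed.


Context {T : Type} (P : set T) (eta : T -> R) (sc : scale P eta).
Variables (x0 : V) (r : R) (x y : T -> V).
Hypothesis (hx : forall t, P t -> `|x t - x0| < r).
Hypothesis (hy : forall t, P t -> `|y t - x0| < r).
Local Notation O := (bO P eta).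

Lemma bO_norm k : (forall i, O k (fun t => crd B (y t - x t) i)) ->
  O k (fun t => `|y t - x t|).
Proof.
move=> h; apply: (bO_le (B := fun t => \sum_i `|crd B (y t - x t) i| * `|bas B i|)).
  move=> t _; rewrite normr_id [leRHS]ger0_norm; last first.
    by apply: sumr_ge0 => i _; rewrite mulr_ge0.
  exact: norm_crd_le.
apply: bO_sum => i; apply: (bOM sc (k := k) (l := 0)); first by rewrite addn0.
  by apply: bO_le (h i) => t _; rewrite normr_id.
exact: bO_cst.
Qed.

Lemma bO_tame f : tame f x0 r -> O 0 (fun t => f (x t)).
Proof.
move=> [C C0 h]; exists C => t Pt; rewrite expr0 mulr1.
by have [] := h _ _ (hx Pt) (hx Pt).
Qed.

Lemma bO_tame_lip k f : tame f x0 r -> O k (fun t => `|y t - x t|) ->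
  O k (fun t => f (y t) - f (x t)).
Proof.
move=> [C C0 h] hO; apply: (bO_le (B := fun t => C * `|y t - x t|)); last exact: bOMc.
move=> t Pt; have [_ h1 _] := h _ _ (hx Pt) (hy Pt).
by rewrite [leRHS]ger0_norm // mulr_ge0.
Qed.

Lemma bO_tame_tay f : tame f x0 r -> O 1 (fun t => `|y t - x t|) ->
  O 2 (fun t => f (y t) - f (x t) - \sum_i crd B (y t - x t) i * pd B i f (x t)).
Proof.
move=> [C C0 h] hO.
apply: (bO_le (B := fun t => C * (`|y t - x t| * `|y t - x t|))); last first.
  by apply: bOMc => //; exact: (bOM sc (k := 1) (l := 1)).
move=> t Pt; have [_ _ h1] := h _ _ (hx Pt) (hy Pt).
by rewrite [leRHS]ger0_norm ?mulr_ge0.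
Qed.

End Tame.

(** * Smooth functions of controlled families *)

Section Composition.
Context {R : realType} {K : nat}.
Variables (alpha t0 t1 : R) (Z : R -> 'rV[R]_K) (ZZ : R -> R -> 'M[R]_K).
Hypotheses (al3 : 3^-1 < alpha) (al2 : alpha <= 2^-1).
Hypothesis rp : geometric_rough_path alpha Z ZZ t0 t1.
Context {V : normedModType R} {I : finType} (B : coords V I).
Context {E : Type} (A : set E) (lo hi : E -> R).
Hypothesis lohi : forall e, A e -> t0 <= lo e /\ hi e <= t1.
Local Notation O := (bO (dom2 A lo hi) (eta2 alpha)).
Local Notation sc := (scale2 al3 lohi).

Lemma dom2_swap (t : E * R * R) : dom2 A lo hi t -> dom2 A lo hi (t.1, t.2).
Proof. by case: t. Qed.

Lemma fctrl_comp (X : E -> R -> V) (X' : E -> R -> 'I_K -> I -> R) (f : V -> R) x0 r :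
  (forall e s, A e -> lo e <= s -> s <= hi e -> `|X e s - x0| < r) ->
  (forall l, fctrl alpha Z A lo hi (fun e s => crd B (X e s) l) (fun e s i => X' e s i l)) ->
  tame B f x0 r -> (forall l, tame B (pd B l f) x0 r) ->
  fctrl alpha Z A lo hi (fun e s => f (X e s))
    (fun e s i => \sum_l X' e s i l * pd B l f (X e s)).
Proof.
move=> hX hc tf tdf.
have hu t : dom2 A lo hi t -> `|X t.1.1 t.1.2 - x0| < r.
  by case: t => [[e u] v] [] /= Ae lu uv vh; apply: hX => //; exact: le_trans vh.
have hv t : dom2 A lo hi t -> `|X t.1.1 t.2 - x0| < r.
  by case: t => [[e u] v] [] /= Ae lu uv vh; apply: hX => //; exact: le_trans uv.
have i1 l : O 1 (fun t => crd B (X t.1.1 t.2 - X t.1.1 t.1.2) l).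
  apply: bO_eq (fctrl_inc al3 rp lohi (hc l)) => t _; exact: crdB.
have n1 := bO_norm sc i1.
split.
- apply: (bO_eq (B := fun t => (f (X t.1.1 t.2) - f (X t.1.1 t.1.2)
     - \sum_l crd B (X t.1.1 t.2 - X t.1.1 t.1.2) l * pd B l f (X t.1.1 t.1.2))
   + \sum_l (crd B (X t.1.1 t.2) l - crd B (X t.1.1 t.1.2) l
       - \sum_i dZ Z t.1.2 t.2 i * X' t.1.1 t.1.2 i l) * pd B l f (X t.1.1 t.1.2))).
    move=> t _; rewrite -[RHS]addrA; congr (_ + _).
    have -> : \sum_i dZ Z t.1.2 t.2 i * (\sum_l X' t.1.1 t.1.2 i l * pd B l f (X t.1.1 t.1.2))
      = \sum_l (\sum_i dZ Z t.1.2 t.2 i * X' t.1.1 t.1.2 i l) * pd B l f (X t.1.1 t.1.2).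
      under eq_bigr do rewrite mulr_sumr.
      rewrite exchange_big; apply: eq_bigr => l _; rewrite mulr_suml.
      by apply: eq_bigr => i _; rewrite mulrA.
    under [X in _ = _ + X]eq_bigr do rewrite -crdB mulrBl.
    by rewrite sumrB addKr.
  apply: bOD; first exact: (bO_tame_tay sc hu hv tf n1).
  apply: bO_sum => l; apply: (bOM sc (k := 2) (l := 0)) => //.
    exact: fctrl_rem (hc l).
  exact: (bO_tame _ hu (tdf l)).
- move=> i; apply: (bO_eq (B := fun t => \sum_l
     ((X' t.1.1 t.2 i l - X' t.1.1 t.1.2 i l) * pd B l f (X t.1.1 t.2)
     + X' t.1.1 t.1.2 i l * (pd B l f (X t.1.1 t.2) - pd B l f (X t.1.1 t.1.2))))).
    by move=> t _; rewrite -sumrB; apply: eq_bigr => l _; ring.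
  apply: bO_sum => l; apply: bOD.
    apply: (bOM sc (k := 1) (l := 0)) => //; first exact: fctrl_der (hc l) i.
    exact: (bO_tame _ hv (tdf l)).
  apply: (bOM sc (k := 0) (l := 1)) => //; first exact: fctrl_bdd (hc l) i.
  exact: (bO_tame_lip sc hu hv (tdf l) n1).
- move=> i; apply: bO_sum => l.
  apply: (bOM sc (k := 0) (l := 0)) => //; first exact: fctrl_bdd (hc l) i.
  exact: (bO_tame _ hu (tdf l)).
Qed.

End Composition.

(** * Davie's estimate: a uniform bound for the second-order Euler remainder *)

Section Davie.
Context {R : realType} {K : nat}.
Variables (alpha t0 t1 : R) (Z : R -> 'rV[R]_K) (ZZ : R -> R -> 'M[R]_K).
Hypotheses (al3 : 3^-1 < alpha) (al2 : alpha <= 2^-1).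
Hypothesis rp : geometric_rough_path alpha Z ZZ t0 t1.
Context {E : Type} (A : set E) (lo hi : E -> R).
Hypothesis lohi : forall e, A e -> t0 <= lo e /\ hi e <= t1.
Local Notation O := (bO (dom2 A lo hi) (eta2 alpha)).
Local Notation O3 := (bO (dom3 A lo hi) (eta3 alpha)).
Local Notation sc := (scale2 al3 lohi).
Local Notation sc3 := (scale3 al3 lohi).

(** On intervals longer than [d] the scale is bounded below, so a mere bound already has every
    order. *)
Lemma bO_small k (F : E * R * R -> R) d : 0 < d -> O 0 F ->
  (exists C, forall t, dom2 A lo hi t -> t.2 - t.1.2 < d -> `|F t| <= C * eta2 alpha t ^+ k) ->
  O k F.
Proof.
move=> d0 /(bO_ge0 sc)[C0 C00 h0] [C h].
have da : 0 < d `^ alpha ^+ k by rewrite exprn_gt0 // powR_gt0.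
exists (C0 / d `^ alpha ^+ k + `|C|) => t Pt; rewrite mulrDl.
have e0 : 0 <= eta2 alpha t ^+ k by rewrite exprn_ge0 // powR_ge0.
have [td|dt] := ltP (t.2 - t.1.2) d.
  apply: le_trans (h t Pt td) _; apply: le_trans (ler_wpM2r e0 (ler_norm C)) _.
  by rewrite lerDr mulr_ge0 // divr_ge0 // ltW.
apply: (@le_trans _ _ (C0 / d `^ alpha ^+ k * eta2 alpha t ^+ k)); last first.
  by rewrite lerDl mulr_ge0.
apply: le_trans (h0 t Pt) _; rewrite expr0 mulr1 -mulrA ler_peMr //.
rewrite ler_pdivlMl // mulr1; apply: lerXn2r; rewrite ?nnegrE ?powR_ge0 //.
by apply: (le_powR_alpha al3) => //; exact: ltW.
Qed.

Context {V : normedModType R} {I : finType} (B : coords V I).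
Variables (V0 : I -> V -> R) (Vf : 'I_K -> I -> V -> R).

(** Component [k] of the derivative of the field V_j along V_i, the coefficient of [ZZ i j] in the
    expansion of a solution. *)
Definition cf (i j : 'I_K) (k : I) (x : V) : R := \sum_l Vf i l x * pd B l (Vf j k) x.

(* The defect of the second-order Euler (Davie) expansion of [X]. *)
Definition rem (X : R -> V) (k : I) (u v : R) : R :=
  crd B (X v - X u) k - V0 k (X u) * (v - u) - \sum_j Vf j k (X u) * dZ Z u v j
  - \sum_i \sum_j cf i j k (X u) * ZZ u v i j.

Record good (x0 : V) (r : R) : Prop := {
  good_V0 : forall k, tame B (V0 k) x0 r;
  good_Vf : forall j k, tame B (Vf j k) x0 r;
  good_dVf : forall l j k, tame B (pd B l (Vf j k)) x0 r;
  good_cf : forall i j k, tame B (cf i j k) x0 r }.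

Variables (x0 : V) (r : R) (X : E -> R -> V).
Hypothesis gd : good x0 r.
Hypothesis hX : forall e s, A e -> lo e <= s -> s <= hi e -> `|X e s - x0| < r.

Lemma ball_u t : dom2 A lo hi t -> `|X t.1.1 t.1.2 - x0| < r.
Proof.
by case: t => [[e u] v] [] /= Ae lu uv vh; apply: hX => //; exact: le_trans vh.
Qed.

Lemma ball_v t : dom2 A lo hi t -> `|X t.1.1 t.2 - x0| < r.
Proof.
by case: t => [[e u] v] [] /= Ae lu uv vh; apply: hX => //; exact: le_trans uv.
Qed.

Lemma bO_h k : (k <= 2)%N -> O k (fun t => t.2 - t.1.2).
Proof. by move=> h; apply: (bOW sc h); exact: (bO_h2 al2 lohi). Qed.

Lemma bO_fX f : tame B f x0 r -> O 0 (fun t => f (X t.1.1 t.1.2)).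
Proof. by move=> tf; exact: (bO_tame _ ball_u tf). Qed.

Lemma bO_drift k : O 2 (fun t => V0 k (X t.1.1 t.1.2) * (t.2 - t.1.2)).
Proof.
apply: (bOM sc (k := 0) (l := 2)) => //; last exact: bO_h.
exact: (bO_fX (good_V0 gd k)).
Qed.

Lemma bO_second k : O 2 (fun t => \sum_i \sum_j cf i j k (X t.1.1 t.1.2) * ZZ t.1.2 t.2 i j).
Proof.
apply: bO_sum => i; apply: bO_sum => j; apply: (bOM sc (k := 0) (l := 2)) => //.
  exact: (bO_fX (good_cf gd i j k)).
exact: (bO_ZZ rp lohi i j).
Qed.

Lemma bO_first k : O 1 (fun t => \sum_j Vf j k (X t.1.1 t.1.2) * dZ Z t.1.2 t.2 j).
Proof.
apply: bO_sum => j; apply: (bOM sc (k := 0) (l := 1)) => //.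
  exact: (bO_fX (good_Vf gd j k)).
exact: (bO_dZ rp lohi j).
Qed.

Lemma bO_rem0 k : O 0 (fun t => rem (X t.1.1) k t.1.2 t.2).
Proof.
apply: bOB; last exact: (bOW sc (l := 2) _ (bO_second k)).
apply: bOB; last exact: (bOW sc (l := 1) _ (bO_first k)).
apply: bOB; last exact: (bOW sc (l := 2) _ (bO_drift k)).
exists (r + r) => t Pt; rewrite expr0 mulr1; apply: le_trans (crd_le _ _ _) _.
rewrite -(subrKA x0); apply: le_trans (ler_normD _ _) (lerD _ _).
  exact: ltW (ball_v Pt).
by rewrite -normrN opprB; exact: ltW (ball_u Pt).
Qed.

Definition remW (t : E * R * R * R) : R :=
  \sum_l `|rem (X t.1.1.1) l t.1.1.2 t.1.2|.

Lemma remW_ge0 t : 0 <= remW t.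
Proof. exact: sumr_ge0. Qed.

Lemma bO_remW : O3 0 remW.
Proof.
apply: bO_sum => l; apply: (bO_le (B := fun t => rem (X t.1.1.1) l t.1.1.2 t.1.2)).
  by move=> t _; rewrite normr_id.
exact: (bO_um al3 (bO_rem0 l)).
Qed.

(* In this scale the unknown defect [remW] has order 2. *)
Definition zeta (t : E * R * R * R) : R := eta3 alpha t + Num.sqrt (remW t).

Lemma eta3_ge0 (t : E * R * R * R) : 0 <= eta3 alpha t.
Proof. exact: powR_ge0. Qed.

Lemma scz : scale (dom3 A lo hi) zeta.
Proof.
split=> [t _|]; first by rewrite addr_ge0 ?eta3_ge0.
have [_ [M hM]] := sc3; have [C C0 hC] := bO_ge0 sc3 bO_remW.
exists (M + Num.sqrt C) => t Pt; apply: lerD; first exact: hM.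
apply: ler_wsqrtr; have := hC t Pt; rewrite expr0 mulr1 ger0_norm //.
exact: remW_ge0.
Qed.

Local Notation Oz := (bO (dom3 A lo hi) zeta).

Lemma bO_zeta k F : O3 k F -> Oz k F.
Proof.
apply: (bO_pull (phi := id)) => t Pt; first exact: eta3_ge0.
by split => //; rewrite lerDl.
Qed.

Lemma bO_rem_zeta l : Oz 2 (fun t => rem (X t.1.1.1) l t.1.1.2 t.1.2).
Proof.
exists 1 => t Pt; rewrite mul1r.
apply: (@le_trans _ _ (remW t)).
  by rewrite /remW (bigD1 l) //= lerDl sumr_ge0.
rewrite -[leLHS](sqr_sqrtr (remW_ge0 t)); apply: lerXn2r; rewrite ?nnegrE ?addr_ge0 ?eta3_ge0 //.
by rewrite lerDr eta3_ge0.
Qed.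

Lemma dom3_ball_u t : dom3 A lo hi t -> `|X t.1.1.1 t.1.1.2 - x0| < r.
Proof.
case: t => [[[e u] m] v] [] /= Ae lu um mv vh; apply: hX => //.
by apply: le_trans um _; exact: le_trans mv _.
Qed.

Lemma dom3_ball_m t : dom3 A lo hi t -> `|X t.1.1.1 t.1.2 - x0| < r.
Proof.
case: t => [[[e u] m] v] [] /= Ae lu um mv vh; apply: hX => //.
  exact: le_trans um.
exact: le_trans vh.
Qed.

(** By definition of [rem] the increment is an explicit expansion plus the unknown remainder; in the
    scale [zeta] both corrections have order 2, without any prior uniform bound. *)
Lemma bO_incr1 l : Oz 2 (fun t => crd B (X t.1.1.1 t.1.2 - X t.1.1.1 t.1.1.2) l
   - \sum_j Vf j l (X t.1.1.1 t.1.1.2) * dZ Z t.1.1.2 t.1.2 j).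
Proof.
apply: (bO_eq (B := fun t => V0 l (X t.1.1.1 t.1.1.2) * (t.1.2 - t.1.1.2)
  + \sum_i \sum_j cf i j l (X t.1.1.1 t.1.1.2) * ZZ t.1.1.2 t.1.2 i j
  + rem (X t.1.1.1) l t.1.1.2 t.1.2)).
  by move=> t _; rewrite /rem; ring.
apply: bOD; last exact: bO_rem_zeta.
apply: bOD; apply: bO_zeta.
  exact: (bO_um al3 (bO_drift l)).
exact: (bO_um al3 (bO_second l)).
Qed.

Lemma bO_incr l : Oz 1 (fun t => crd B (X t.1.1.1 t.1.2 - X t.1.1.1 t.1.1.2) l).
Proof.
apply: (bO_eq (B := fun t => (crd B (X t.1.1.1 t.1.2 - X t.1.1.1 t.1.1.2) l
   - \sum_j Vf j l (X t.1.1.1 t.1.1.2) * dZ Z t.1.1.2 t.1.2 j)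
   + \sum_j Vf j l (X t.1.1.1 t.1.1.2) * dZ Z t.1.1.2 t.1.2 j)).
  by move=> t _; rewrite subrK.
apply: bOD; first exact: (bOW scz (l := 2) _ (bO_incr1 l)).
apply: bO_zeta; exact: (bO_um al3 (bO_first l)).
Qed.

Let n1 := bO_norm scz bO_incr.

Lemma bO_fX_lip f : tame B f x0 r ->
  Oz 1 (fun t => f (X t.1.1.1 t.1.2) - f (X t.1.1.1 t.1.1.2)).
Proof. by move=> tf; exact: (bO_tame_lip scz dom3_ball_u dom3_ball_m tf n1). Qed.

Lemma bO_Vf_second j k : Oz 2 (fun t =>
  Vf j k (X t.1.1.1 t.1.2) - Vf j k (X t.1.1.1 t.1.1.2)
  - \sum_i cf i j k (X t.1.1.1 t.1.1.2) * dZ Z t.1.1.2 t.1.2 i).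
Proof.
apply: (bO_eq (B := fun t => (Vf j k (X t.1.1.1 t.1.2) - Vf j k (X t.1.1.1 t.1.1.2)
  - \sum_l crd B (X t.1.1.1 t.1.2 - X t.1.1.1 t.1.1.2) l * pd B l (Vf j k) (X t.1.1.1 t.1.1.2))
  + \sum_l (crd B (X t.1.1.1 t.1.2 - X t.1.1.1 t.1.1.2) l
   - \sum_i Vf i l (X t.1.1.1 t.1.1.2) * dZ Z t.1.1.2 t.1.2 i)
     * pd B l (Vf j k) (X t.1.1.1 t.1.1.2))).
  move=> t _; rewrite -[RHS]addrA; congr (_ + _).
  under [X in _ = _ + X]eq_bigr do rewrite mulrBl.
  rewrite sumrB addKr; congr (- _); rewrite /cf.
  under eq_bigr do rewrite mulr_suml.
  under [RHS]eq_bigr do rewrite mulr_suml.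
  by rewrite exchange_big; apply: eq_bigr => l _; apply: eq_bigr => i _; ring.
apply: bOD.
  exact: (bO_tame_tay scz dom3_ball_u dom3_ball_m (good_Vf gd j k) n1).
apply: bO_sum => l; apply: (bOM scz (k := 2) (l := 0)) => //; first exact: bO_incr1.
exact: (bO_tame _ dom3_ball_u (good_dVf gd l j k)).
Qed.

(** The unknown remainder enters this weight linearly and with the small factor [eta3]; this is what
    makes it absorbable. *)
Let wt (t : E * R * R * R) : R := eta3 alpha t ^+ 3 + eta3 alpha t * remW t.

(** One factor of genuine order [eta3] is split off; the rest is at most zeta^2, which is bounded by
    2 (eta3^2 + remW). *)
Let wt_prod a b F G : (a + b = 3)%N -> (1 <= b)%N -> Oz a F -> O3 b G ->
  bO (dom3 A lo hi) wt 1 (fun t => F t * G t).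
Proof.
move=> ab b1 /(bO_ge0 scz)[C C0 hC] /(bO_ge0 sc3)[D D0 hD].
exists (C * D * 2) => t Pt; rewrite normrM expr1.
apply: le_trans (ler_pM _ _ (hC t Pt) (hD t Pt)) _ => //.
rewrite mulrACA -[leRHS]mulrA; apply: ler_wpM2l; first exact: mulr_ge0.
have e0 := eta3_ge0 t; have s0 := sqrtr_ge0 (remW t).
have ez : eta3 alpha t <= zeta t by rewrite lerDl.
have z0 : 0 <= zeta t := le_trans e0 ez.
apply: (@le_trans _ _ (zeta t ^+ 2 * eta3 alpha t)).
  move: ab b1; case: b {hD} => [//|b] ab _; rewrite exprSr mulrA; apply: ler_wpM2r => //.
  have -> : 2%N = (a + b)%N by move: ab; rewrite addnS => -[].
  by rewrite exprD; apply: ler_wpM2l; [exact: exprn_ge0|apply: lerXn2r; rewrite ?nnegrE].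
rewrite /wt /zeta; move: (sqr_sqrtr (remW_ge0 t)) s0.
move: (Num.sqrt (remW t)) => b1' <- b0; move: (eta3 alpha t) e0 => a1 a0.
have -> : (2 : R) * (a1 ^+ 3 + a1 * b1' ^+ 2) = (2 * (a1 ^+ 2 + b1' ^+ 2)) * a1 by ring.
apply: ler_wpM2r => //; rewrite -subr_ge0.
have -> : 2 * (a1 ^+ 2 + b1' ^+ 2) - (a1 + b1') ^+ 2 = (a1 - b1') ^+ 2 by ring.
exact: sqr_ge0.
Qed.

Lemma rem_defect k : bO (dom3 A lo hi) wt 1 (fun t =>
  rem (X t.1.1.1) k t.1.1.2 t.2 - rem (X t.1.1.1) k t.1.1.2 t.1.2
  - rem (X t.1.1.1) k t.1.2 t.2).
Proof.
apply: (bO_eq (B := fun t =>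
    (V0 k (X t.1.1.1 t.1.2) - V0 k (X t.1.1.1 t.1.1.2)) * (t.2 - t.1.2)
  + \sum_j (Vf j k (X t.1.1.1 t.1.2) - Vf j k (X t.1.1.1 t.1.1.2)
    - \sum_i cf i j k (X t.1.1.1 t.1.1.2) * dZ Z t.1.1.2 t.1.2 i) * dZ Z t.1.2 t.2 j
  + \sum_i \sum_j (cf i j k (X t.1.1.1 t.1.2) - cf i j k (X t.1.1.1 t.1.1.2))
      * ZZ t.1.2 t.2 i j)).
  move=> [[[e u] m] v] [] /= Ae lu um mv vh; have [l0 h1] := lohi Ae.
  rewrite /rem.
  have -> : \sum_i \sum_j cf i j k (X e u) * ZZ u v i j =
    \sum_i \sum_j cf i j k (X e u) * ZZ u m i j
    + \sum_i \sum_j cf i j k (X e u) * ZZ m v i j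
    + \sum_j (\sum_i cf i j k (X e u) * dZ Z u m i) * dZ Z m v j.
    under [X in _ + X]eq_bigr do rewrite mulr_suml.
    rewrite [X in _ + X]exchange_big -!big_split /=; apply: eq_bigr => i _.
    rewrite -!big_split /=; apply: eq_bigr => j _.
    rewrite (ZZ_chen rp _ _ _ um mv) ?(le_trans l0) ?(le_trans vh) //; ring.
  have -> : \sum_j Vf j k (X e u) * dZ Z u v j =
    \sum_j Vf j k (X e u) * dZ Z u m j + \sum_j Vf j k (X e u) * dZ Z m v j.
    rewrite -big_split /=; apply: eq_bigr => j _; rewrite /dZ !mxE; ring.
  have -> : \sum_j (Vf j k (X e m) - Vf j k (X e u)
     - \sum_i cf i j k (X e u) * dZ Z u m i) * dZ Z m v j =
    \sum_j Vf j k (X e m) * dZ Z m v j - \sum_j Vf j k (X e u) * dZ Z m v j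
    - \sum_j (\sum_i cf i j k (X e u) * dZ Z u m i) * dZ Z m v j.
    by rewrite -!sumrB; apply: eq_bigr => j _; ring.
  have -> : \sum_i \sum_j (cf i j k (X e m) - cf i j k (X e u)) * ZZ m v i j =
    \sum_i \sum_j cf i j k (X e m) * ZZ m v i j
    - \sum_i \sum_j cf i j k (X e u) * ZZ m v i j.
    rewrite -sumrB; apply: eq_bigr => i _; rewrite -sumrB.
    by apply: eq_bigr => j _; ring.
  rewrite !crdB; ring.
apply: bOD; first apply: bOD.
- apply: (wt_prod (a := 1) (b := 2)) => //; first exact: bO_fX_lip (good_V0 gd k).
  exact: (bO_mv al3 (bO_h (leqnn 2))).
- apply: bO_sum => j; apply: (wt_prod (a := 2) (b := 1)) => //; first exact: bO_Vf_second.
  exact: (bO_mv al3 (bO_dZ rp lohi j)).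
apply: bO_sum => i; apply: bO_sum => j; apply: (wt_prod (a := 1) (b := 2)) => //.
  exact: bO_fX_lip (good_cf gd i j k).
exact: (bO_mv al3 (bO_ZZ rp lohi i j)).
Qed.

(** Each path satisfies the bound with a constant depending on [e]. That makes the best constant
    finite, and halving short intervals bounds it by itself with a factor below one, whence a bound
    free of [e]. *)
Lemma davie : (forall e, A e -> exists C, forall k u v, lo e <= u -> u <= v -> v <= hi e ->
    `|rem (X e) k u v| <= C * ((v - u) `^ alpha) ^+ 3) ->
  forall k, O 3 (fun t => rem (X t.1.1) k t.1.2 t.2).
Proof.
move=> hfin k.
have /choice[Cd hCd] := rem_defect.
pose M := \sum_k `|Cd k|.
have M0 : 0 <= M by apply: sumr_ge0.
have hM l t : dom3 A lo hi t -> `|rem (X t.1.1.1) l t.1.1.2 t.2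
     - rem (X t.1.1.1) l t.1.1.2 t.1.2 - rem (X t.1.1.1) l t.1.2 t.2| <= M * wt t.
  move=> Pt; apply: le_trans (hCd l t Pt) _; rewrite expr1; apply: ler_wpM2r.
    by rewrite addr_ge0 ?exprn_ge0 ?mulr_ge0 ?eta3_ge0 ?remW_ge0.
  apply: le_trans (ler_norm _) _; rewrite /M (bigD1 l) //= lerDl.
  exact: sumr_ge0.
pose th : R := 3 * alpha.
pose lam : R := 2 * 2^-1 `^ th.
have lam1 : lam < 1 by exact: powR_double_lt1 (alpha3_gt1 al3).
have lam0 : 0 <= lam by rewrite mulr_ge0 // powR_ge0.
pose n : R := #|I|%:R.
have n0 : 0 <= n by exact: ler0n.
(* On intervals shorter than [d], where d^alpha = [q], the remainder fed back through [wt] costs at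
   most half of the gap [1 - lam] left by halving. *)
pose q : R := (1 - lam) / 2 / (M * n + 1).
have q0 : 0 < q.
  by rewrite !divr_gt0 ?subr_gt0 // ltr_wpDl // mulr_ge0.
pose d : R := q `^ alpha^-1.
have d0 : 0 < d by exact: powR_gt0.
have da : d `^ alpha = q.
  by rewrite -powRrM mulVf ?gt_eqF ?(alpha_gt0 al3) // powRr1 // ltW.
apply: (bO_small d0 (bO_rem0 k)).
exists (2 * M / (1 - lam)) => -[[e u] v] /= De vud.
have [] := De; rewrite /= => Ae lu uv vh.
have [C hC] := hfin e Ae.
rewrite /eta2 /=.
have [uv0|uv1] := eqVneq u v.
  apply: le_trans (hC k u v lu uv vh) _; rewrite uv0 subrr powR0 ?gt_eqF ?(alpha_gt0 al3) //.
  by rewrite expr0n /= !mulr0.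
have uvlt : u < v by rewrite lt_neqAle uv1.
(* The ratios whose supremum is the best constant for this [e] on short intervals; [hC] bounds
   them. *)
pose Sr := [set y | exists k u v, [/\ lo e <= u, u < v, v <= hi e, v - u < d &
   y = `|rem (X e) k u v| / (v - u) `^ th]].
have p3 (a b : R) : a <= b -> ((b - a) `^ alpha) ^+ 3 = (b - a) `^ th.
  by move=> ab; rewrite -powR_alpha // subr_ge0.
have supS : has_sup Sr.
  split; first by exists (`|rem (X e) k u v| / (v - u) `^ th), k, u, v.
  exists C => y [l [u' [v' [lu' uv' vh' _ ->]]]].
  rewrite ler_pdivrMr ?powR_gt0 ?subr_gt0 //.
  by rewrite -(p3 _ _ (ltW uv')); apply: hC => //; exact: ltW.
pose s := sup Sr.
have les l a b : lo e <= a -> a < b -> b <= hi e -> b - a < d ->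
    `|rem (X e) l a b| <= s * (b - a) `^ th.
  move=> la ab bh abd; rewrite -ler_pdivrMr ?powR_gt0 ?subr_gt0 //.
  by apply: ub_le_sup; [exact: supS.2|exists l, a, b].
have s0 : 0 <= s.
  have := les k u v lu uvlt vh vud => /(le_trans (normr_ge0 _)).
  have p0 : 0 < (v - u) `^ th by apply: powR_gt0; rewrite subr_gt0.
  by rewrite pmulr_lge0.
(* Splitting at the midpoint: the two halves give [lam * s], the defect gives [M], and the remainder
   inside the weight gives [M * q * n * s]. *)
have step : s <= M + (lam + M * q * n) * s.
  apply: ge_sup; first exact: supS.1.
  move=> y [l [a [b [la ab bh abd ->]]]].
  have p0 : 0 < (b - a) `^ th by apply: powR_gt0; rewrite subr_gt0.
  rewrite ler_pdivrMr //.
  pose m := (a + b) / 2.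
  have am : a < m by rewrite /m; lra.
  have mb : m < b by rewrite /m; lra.
  have dd : dom3 A lo hi (e, a, m, b) by split => //=; exact: ltW.
  have := hM l _ dd; rewrite /wt /eta3 /remW /=.
  have mh : m - a = (b - a) * 2^-1 by rewrite /m; field.
  have mh' : b - m = (b - a) * 2^-1 by rewrite /m; field.
  have half : ((b - a) * 2^-1) `^ th = (b - a) `^ th * 2^-1 `^ th.
    by rewrite powRM ?subr_ge0 ?invr_ge0 // ltW.
  have mlt : m - a < d by move: abd; rewrite /m; lra.
  have mlt' : b - m < d by move: abd; rewrite /m; lra.
  have e1 l' : `|rem (X e) l' a m| <= s * ((b - a) `^ th * 2^-1 `^ th).
    by rewrite -half -mh; apply: les => //; apply: le_trans bh; exact: ltW.
  have e2 : `|rem (X e) l m b| <= s * ((b - a) `^ th * 2^-1 `^ th).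
    by rewrite -half -mh'; apply: les => //; apply: le_trans la _; exact: ltW.
  have half1 : 2^-1 `^ th <= 1 :> R.
    have := lam1; rewrite /lam; have := powR_ge0 (2^-1 : R) th; lra.
  have e3 : \sum_l0 `|rem (X e) l0 a m| <= n * (s * (b - a) `^ th).
    apply: le_trans (ler_sum _ (fun l' _ => e1 l')) _.
    rewrite sumr_const -[leLHS]mulr_natl; apply: ler_wpM2l => //.
    by apply: ler_wpM2l => //; rewrite ler_piMr // ltW.
  have e4 : (b - a) `^ alpha <= q.
    by rewrite -da; apply: (le_powR_alpha al3); rewrite ?subr_ge0 ltW.
  have e5 : (b - a) `^ alpha * (\sum_l0 `|rem (X e) l0 a m|) <= q * (n * (s * (b - a) `^ th)).
    by apply: ler_pM => //; [exact: powR_ge0|exact: sumr_ge0].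
  rewrite (p3 _ _ (ltW ab)).
  have e6 : M * ((b - a) `^ th + (b - a) `^ alpha * (\sum_l0 `|rem (X e) l0 a m|))
      <= M * ((b - a) `^ th + q * (n * (s * (b - a) `^ th))).
    by apply: ler_wpM2l => //; rewrite lerD2l.
  move=> /le_trans/(_ e6).
  have -> : (M + (lam + M * q * n) * s) * (b - a) `^ th =
     M * ((b - a) `^ th + q * (n * (s * (b - a) `^ th)))
     + s * ((b - a) `^ th * 2^-1 `^ th) + s * ((b - a) `^ th * 2^-1 `^ th).
    by rewrite /lam; ring.
  have := e1 l; move: e2; rewrite !ler_norml; lra.
have sle : s <= 2 * M / (1 - lam).
  rewrite ler_pdivlMr ?subr_gt0 //.
  have qn : M * q * n <= (1 - lam) / 2.
    rewrite /q mulrAC mulrA ler_pdivrMr ?ltr_wpDl ?mulr_ge0 //.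
    rewrite mulrC; apply: ler_wpM2l; first by rewrite divr_ge0 // subr_ge0 ltW.
    by rewrite lerDl.
  have : M * q * n * s <= (1 - lam) / 2 * s by exact: ler_wpM2r.
  move: step; rewrite mulrDl; lra.
rewrite p3 //; apply: le_trans (les k u v lu uvlt vh vud) _.
by apply: ler_wpM2r => //; exact: powR_ge0.
Qed.

End Davie.

(** * Compactness of time segments and Lebesgue integrals on them *)

Section Segments.
Context {R : realType}.

(** A single real [C] is both the constant of the estimate and the inverse of the radius, so
    compactness only has to produce one large [C]. *)
Lemma seg_uniform (a b : R) (Q : R -> R -> R -> Prop) :
  (forall C C' u v, C <= C' -> Q C u v -> Q C' u v) ->
  (forall r0, a <= r0 <= b -> exists2 C, 0 < C & forall u v,
     `|u - r0| < C^-1 -> `|v - r0| < C^-1 -> Q C u v) ->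
  exists2 C, 0 < C & forall u v, a <= u <= b -> `|v - u| < C^-1 -> Q C u v.
Proof.
move=> mono hloc.
pose P (C x : R) := forall v, `|v - x| < C^-1 -> Q C x v.
have := (compact_near_coveringP (`[a, b] : set R)).1 (@segment_compact _ a b).
move=> /(_ R (+oo_ R) P _) [].
  move=> r0 /=; rewrite in_itv /= => /hloc[C C0 hC].
  have C20 : 0 < (2 * C)^-1 by rewrite invr_gt0 mulr_gt0.
  exists ([set x | `|x - r0| < (2 * C)^-1], [set C' | 2 * C <= C']) => /=.
    split; last by apply: nbhs_pinfty_ge; exact: num_real.
    apply/nbhs_normP; exists (2 * C)^-1 => //= y /=.
    by rewrite -normrN opprB.
  move=> [x C'] /= [xr CC'] v vx.
  have C'0 : 0 < C' by apply: lt_le_trans CC'; rewrite mulr_gt0.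
  have le1 : C'^-1 <= (2 * C)^-1 by rewrite lef_pV2 // posrE mulr_gt0.
  have half : (2 * C)^-1 + (2 * C)^-1 = C^-1 by field; rewrite gt_eqF.
  apply: (mono C); first by apply: le_trans CC'; rewrite ler_peMl ?ltW // ltr1n.
  apply: hC.
    by apply: lt_trans xr _; rewrite -half ltrDl.
  rewrite -(subrKA x); apply: le_lt_trans (ler_normD _ _) _.
  by rewrite -half; apply: ltrD => //; exact: lt_le_trans le1.
move=> M [_ hM]; pose C := Num.max (M + 1) 1.
have C0 : 0 < C by rewrite lt_max ltr01 orbT.
exists C => // u v uab vu; apply: (hM C) => //=.
  by rewrite lt_max ltrDl ltr01.
Qed.

Local Notation mu := (@lebesgue_measure R).

Lemma continuous_itv_integrable (f : R -> R) (a b : R) :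
  {within `[a, b], continuous f} -> mu.-integrable `[a, b] (EFin \o f).
Proof. by move=> hf; apply: continuous_compact_integrable => //; exact: segment_compact. Qed.

Lemma within_itv_sub (f : R -> R) (a b u v : R) : a <= u -> v <= b ->
  {within `[a, b], continuous f} -> {within `[u, v], continuous f}.
Proof.
move=> au vb; apply: continuous_subspaceW => x /=; rewrite !in_itv /= => /andP[h1 h2].
by rewrite (le_trans au h1) (le_trans h2 vb).
Qed.

Lemma Rint_cst (c u v : R) : u <= v -> \int[mu]_(r in `[u, v]) c = c * (v - u).
Proof.
move=> uv; rewrite Rintegral_cst //; congr (_ * _).
rewrite /= lebesgue_measure_itv /= lte_fin; case: ltP => // vu.
by apply/eqP; rewrite eq_sym subr_eq0 eq_le uv vu.
Qed.

Lemma Rint_near (f : R -> R) (u v M : R) : u <= v ->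
  {within `[u, v], continuous f} ->
  (forall r, u <= r <= v -> `|f r - f u| <= M) ->
  `|\int[mu]_(r in `[u, v]) f r - f u * (v - u)| <= M * (v - u).
Proof.
move=> uv cf hM.
have cc c : {within `[u, v], continuous (fun _ : R => c : R)}.
  by apply: continuous_subspaceT => x; exact: cvg_cst.
have ci c := continuous_itv_integrable (cc c).
have fi := continuous_itv_integrable cf.
have cd : {within `[u, v], continuous (fun r => f r - f u)}.
  by move=> x; apply: cvgB; [exact: cf|exact: cc].
rewrite -[f u * _]Rint_cst // -RintegralB //.
apply: le_trans (le_normr_Rintegral _ _) _ => //; first exact: continuous_itv_integrable.
rewrite -Rint_cst //; apply: le_Rintegral => //.
  apply: continuous_itv_integrable => x; apply: cvg_norm; exact: cd.
Qed.

Lemma Rint_add (f : R -> R) (a b c : R) : a <= b -> b <= c ->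
  {within `[a, c], continuous f} ->
  \int[mu]_(r in `[a, c]) f r =
  \int[mu]_(r in `[a, b]) f r + \int[mu]_(r in `[b, c]) f r.
Proof.
move=> ab bc cf; apply/eqP; rewrite addrC -subr_eq; apply/eqP.
rewrite Rintegral_itvB ?bnd_simp //; last exact: continuous_itv_integrable.
rewrite Rintegral_itv_obnd_cbnd //.
apply: integrableS (continuous_itv_integrable cf) => // x /=; rewrite !in_itv /=.
by move=> /andP[/ltW bx ->]; rewrite (le_trans ab bx).
Qed.

Lemma eq_Rint (f g : R -> R) (u v : R) : (forall r, u <= r <= v -> f r = g r) ->
  \int[mu]_(r in `[u, v]) f r = \int[mu]_(r in `[u, v]) g r.
Proof.
by move=> h; apply: eq_Rintegral => r; rewrite inE /= in_itv /= => /h.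
Qed.

Lemma small_powR (C al e : R) : 0 < al -> 0 < e ->
  exists2 d, 0 < d & forall s, 0 <= s -> s < d -> C * s `^ al < e.
Proof.
move=> al0 e0; pose q := e / (`|C| + 1).
have C0 : 0 < `|C| + 1 by rewrite ltr_wpDl.
have q0 : 0 < q by exact: divr_gt0.
exists (q `^ al^-1); first exact: powR_gt0.
move=> s s0 sd; have sq : s `^ al < q.
  have -> : q = (q `^ al^-1) `^ al.
    by rewrite -powRrM mulVf ?gt_eqF // powRr1 // ltW.
  by apply: gt0_ltr_powR; rewrite ?nnegrE // powR_ge0.
have -> : e = (`|C| + 1) * q by rewrite /q mulrC divfK // gt_eqF.
apply: (@le_lt_trans _ _ ((`|C| + 1) * s `^ al)); last by rewrite ltr_pM2l.
apply: ler_wpM2r; first exact: powR_ge0.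
by apply: le_trans (ler_norm C) _; rewrite lerDl.
Qed.

Lemma holder_within_continuous (f : R -> R) (a b C al : R) : 0 < al ->
  (forall u v, a <= u -> u <= v -> v <= b -> `|f v - f u| <= C * (v - u) `^ al) ->
  {within `[a, b], continuous f}.
Proof.
move=> al0 h; apply/subspace_continuousP => x /=; rewrite in_itv /= => /andP[ax xb].
apply/cvgrPdist_lt => e e0; rewrite near_withinE.
have [d d0 small] := small_powR C al0 e0.
apply/nbhs_normP; exists d => //= y /= xy; rewrite in_itv /= => /andP[ay yb].
have [xley|/ltW ylex] := leP x y.
  rewrite -normrN opprB; apply: le_lt_trans (h x y ax xley yb) _.
  apply: small; first by rewrite subr_ge0.
  by apply: le_lt_trans xy; rewrite -normrN opprB ler_norm.
apply: le_lt_trans (h y x ay ylex xb) _.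
apply: small; first by rewrite subr_ge0.
by apply: le_lt_trans xy; exact: ler_norm.
Qed.

End Segments.

(** * Rough integrals of families of controlled paths *)

Section RoughIntegrals.
Context {R : realType} {K : nat}.
Variables (alpha t0 t1 : R) (Z : R -> 'rV[R]_K) (ZZ : R -> R -> 'M[R]_K).
Hypotheses (al3 : 3^-1 < alpha) (al2 : alpha <= 2^-1).
Hypothesis rp : geometric_rough_path alpha Z ZZ t0 t1.

Lemma rough_germ_germ1 n (F : R -> 'rV[R]_n) F' (G : R -> 'rV[R]_n) G' u v :
  rough_germ ZZ F F' G G' u v = \sum_k germ1 ZZ (fun r => F r 0 k) (fun r => G r 0 k)
     (fun r i => F' r i 0 k) (fun r i => G' r i 0 k) u v.
Proof.
rewrite /rough_germ /germ1 big_split /=; congr (_ + _).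
  by rewrite /dotr; apply: eq_bigr => k _; rewrite !mxE.
rewrite [RHS]exchange_big /=; apply: eq_bigr => i _.
rewrite [RHS]exchange_big /=; apply: eq_bigr => j _.
by rewrite /dotr mulr_suml; apply: eq_bigr => k _.
Qed.

(** [rough_int] selects a limit by [xget], so any known limit is identified with it by
    uniqueness. *)
Lemma rough_int_eq n (F : R -> 'rV[R]_n) F' (G : R -> 'rV[R]_n) G' u v I : u <= v ->
  sum_lim (rough_germ ZZ F F' G G') u v I -> rough_int ZZ F F' G G' u v = I.
Proof.
move=> uv hI; have hx : is_rough_int ZZ F F' G G' u v (rough_int ZZ F F' G G' u v).
  by apply: (@xgetPex _ 0 [set I | is_rough_int ZZ F F' G G' u v I]); exists I.
exact: sum_lim_unique hx hI.
Qed.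

Lemma rough_int_ext n (F1 F2 : R -> 'rV[R]_n) F1' F2' (G1 G2 : R -> 'rV[R]_n) G1' G2' u v :
  (forall r, u <= r <= v -> [/\ F1 r = F2 r, F1' r = F2' r, G1 r = G2 r & G1' r = G2' r]) ->
  rough_int ZZ F1 F1' G1 G1' u v = rough_int ZZ F2 F2' G2 G2' u v.
Proof.
move=> h; rewrite /rough_int; congr (xget 0 _); apply/seteqP; split => I /= hI.
  apply: sum_lim_ext hI => a b ua ab bv; rewrite /rough_germ.
  have [|-> -> -> ->] := h a; first by rewrite ua (le_trans ab).
  by have [|_ _ -> _] := h b; first by rewrite bv (le_trans ua).
apply: sum_lim_ext hI => a b ua ab bv; rewrite /rough_germ.
have [|-> -> -> ->] := h a; first by rewrite ua (le_trans ab).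
by have [|_ _ -> _] := h b; first by rewrite bv (le_trans ua).
Qed.

Context {E : Type} (A : set E) (lo hi : E -> R).
Hypothesis lohi : forall e, A e -> t0 <= lo e /\ hi e <= t1.
Local Notation O := (bO (dom2 A lo hi) (eta2 alpha)).
Local Notation sc := (scale2 al3 lohi).
Local Notation fct := (fctrl alpha Z A lo hi).

Lemma rough_int_family n (F : E -> R -> 'rV[R]_n) (F' : E -> R -> 'I_K -> 'rV[R]_n)
    (G : E -> R -> 'rV[R]_n) (G' : E -> R -> 'I_K -> 'rV[R]_n) :
  (forall k, fct (fun e r => F e r 0 k) (fun e r i => F' e r i 0 k)) ->
  (forall k, fct (fun e r => G e r 0 k) (fun e r i => G' e r i 0 k)) ->
  (forall e u v, A e -> lo e <= u -> u <= v -> v <= hi e ->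
     sum_lim (rough_germ ZZ (F e) (F' e) (G e) (G' e)) u v
       (rough_int ZZ (F e) (F' e) (G e) (G' e) u v)) /\
  O 3 (fun t => rough_int ZZ (F t.1.1) (F' t.1.1) (G t.1.1) (G' t.1.1) t.1.2 t.2
     - rough_germ ZZ (F t.1.1) (F' t.1.1) (G t.1.1) (G' t.1.1) t.1.2 t.2).
Proof.
move=> hF hG.
have hd : bO (dom3 A lo hi) (eta3 alpha) 3 (fun t =>
   rough_germ ZZ (F t.1.1.1) (F' t.1.1.1) (G t.1.1.1) (G' t.1.1.1) t.1.1.2 t.2
   - rough_germ ZZ (F t.1.1.1) (F' t.1.1.1) (G t.1.1.1) (G' t.1.1.1) t.1.1.2 t.1.2
   - rough_germ ZZ (F t.1.1.1) (F' t.1.1.1) (G t.1.1.1) (G' t.1.1.1) t.1.2 t.2).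
  have := bO_sum (fun k => germ1_defect al3 rp lohi (hF k) (hG k)).
  by apply: bO_eq => t _; rewrite !rough_germ_germ1 -!sumrB.
have [I [hI hO]] := germ_sewing al3 lohi
  (G := fun e => rough_germ ZZ (F e) (F' e) (G e) (G' e)) hd.
have eI e u v : A e -> lo e <= u -> u <= v -> v <= hi e ->
    rough_int ZZ (F e) (F' e) (G e) (G' e) u v = I e u v.
  by move=> Ae lu uv vh; apply: rough_int_eq => //; exact: hI.
split; first by move=> e u v Ae lu uv vh; rewrite eI //; exact: hI.
by apply: bO_eq hO => -[[e u] v] [] /= Ae lu uv vh; rewrite eI.
Qed.

Lemma fctrl_Z k : fct (fun _ r => Z r 0 k)
  (fun _ _ i => (delta_mx 0 i : 'rV[R]_K) 0 k).
Proof.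
split.
- apply: (bO_eq (B := fun=> 0)); last exact: bO0.
  move=> t _; rewrite (bigD1 k) //= !mxE !eqxx /= mulr1 big1 ?addr0.
    by rewrite /dZ !mxE subrr.
  by move=> i ik; rewrite !mxE eqxx /= eq_sym (negbTE ik) mulr0.
- by move=> i; apply: (bO_eq (B := fun=> 0)) => [t _|]; [rewrite subrr|exact: bO0].
- by move=> i; exact: bO_cst.
Qed.

Lemma rough_germZ (F : R -> 'rV[R]_K) F' u v :
  rough_germ ZZ F F' Z (fun _ j => delta_mx 0 j) u v =
  \sum_j F u 0 j * dZ Z u v j + \sum_i \sum_j F' u i 0 j * ZZ u v i j.
Proof.
rewrite /rough_germ /dotr /dZ; congr (_ + _).
apply: eq_bigr => i _; apply: eq_bigr => j _; congr (_ * _).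
rewrite (bigD1 j) //= !mxE !eqxx mulr1 big1 ?addr0 // => k kj.
by rewrite !mxE (negbTE kj) mulr0.
Qed.

Lemma rough_intZ_family (F : E -> R -> 'rV[R]_K) (F' : E -> R -> 'I_K -> 'rV[R]_K) :
  (forall k, fct (fun e r => F e r 0 k) (fun e r i => F' e r i 0 k)) ->
  (forall e u v w, A e -> lo e <= u -> u <= v -> v <= w -> w <= hi e ->
    rough_intZ Z ZZ (F e) (F' e) u w =
      rough_intZ Z ZZ (F e) (F' e) u v + rough_intZ Z ZZ (F e) (F' e) v w) /\
  O 3 (fun t => rough_intZ Z ZZ (F t.1.1) (F' t.1.1) t.1.2 t.2
     - (\sum_j F t.1.1 t.1.2 0 j * dZ Z t.1.2 t.2 j
        + \sum_i \sum_j F' t.1.1 t.1.2 i 0 j * ZZ t.1.2 t.2 i j)).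
Proof.
move=> hF; have [h1 h2] := rough_int_family hF fctrl_Z.
split; last by apply: bO_eq h2 => t _; rewrite rough_germZ.
move=> e u v w Ae lu uv vw wh; have lv := le_trans lu uv; have vh := le_trans vw wh.
exact: (sum_lim_cat uv vw (h1 e u v Ae lu uv vh) (h1 e v w Ae lv vw wh)
  (h1 e u w Ae lu (le_trans uv vw) wh)).
Qed.

End RoughIntegrals.

(** * From local to global bounds along one path *)

Section SinglePath.
Context {R : realType} {K : nat}.
Variables (alpha t0 t1 : R) (Z : R -> 'rV[R]_K) (ZZ : R -> R -> 'M[R]_K).
Hypotheses (al3 : 3^-1 < alpha) (al2 : alpha <= 2^-1).
Hypothesis rp : geometric_rough_path alpha Z ZZ t0 t1.

Definition segdom (a b : R) : set (unit * R * R) := dom2 [set: unit] (fun=> a) (fun=> b).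

Lemma fctrl_sub {E E' : Type} (phi : E' -> E) (A : set E) (A' : set E') lo hi lo' hi' f f' :
  (forall e, A' e -> [/\ A (phi e), lo (phi e) <= lo' e & hi' e <= hi (phi e)]) ->
  fctrl alpha Z A lo hi f f' ->
  fctrl alpha Z A' lo' hi' (fun e => f (phi e)) (fun e => f' (phi e)).
Proof.
move=> h [f1 f2 f3].
have pull k F : bO (dom2 A lo hi) (eta2 alpha) k F ->
    bO (dom2 A' lo' hi') (eta2 alpha) k (fun t => F (phi t.1.1, t.1.2, t.2)).
  apply: (bO_pull (phi := fun t => (phi t.1.1, t.1.2, t.2))) => [t _|]; first exact: powR_ge0.
  move=> -[[e u] v] [] /= /h[Ae ll hh] lu uv vh; split => //.
  by split => //=; [exact: le_trans lu|exact: le_trans vh _].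
split; first exact: pull _ _ f1.
- by move=> i; exact: pull _ _ (f2 i).
- by move=> i; exact: pull _ _ (f3 i).
Qed.

(** Pairs of close times are covered by finitely many of the local bounds; pairs of distant times
    are handled by the bound of order 0. *)
Lemma bO_seg a b k (F : unit * R * R -> R) : t0 <= a -> b <= t1 ->
  (forall r0, a <= r0 <= b -> exists2 d, 0 < d &
    bO (segdom (Num.max a (r0 - d)) (Num.min b (r0 + d))) (eta2 alpha) k F) ->
  bO (segdom a b) (eta2 alpha) 0 F -> bO (segdom a b) (eta2 alpha) k F.
Proof.
move=> t0a bt1 hloc h0.
have lohi (e : unit) : [set: unit] e -> t0 <= a /\ b <= t1 by [].
pose Q C (u v : R) := a <= u -> u <= v -> v <= b ->
  `|F (tt, u, v)| <= C * eta2 alpha (tt, u, v) ^+ k.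
have [|r0 r0ab|C C0 hC] := @seg_uniform R a b Q.
- move=> C C' u v CC' h au uv vb; apply: le_trans (h au uv vb) _.
  by apply: ler_wpM2r CC'; rewrite exprn_ge0 // powR_ge0.
- have [d d0 [C hC]] := hloc r0 r0ab.
  have C1 : 0 < Num.max `|C| d^-1 by rewrite lt_max invr_gt0 d0 orbT.
  exists (Num.max `|C| d^-1) => //.
  have le1 : (Num.max `|C| d^-1)^-1 <= d.
    by rewrite -[leRHS]invrK lef_pV2 ?posrE ?invr_gt0 // le_max lexx orbT.
  move=> u v ur vr au uv vb; apply: le_trans (hC (tt, u, v) _) _.
    have {}ur := lt_le_trans ur le1; have {}vr := lt_le_trans vr le1.
    split => //=.
      by rewrite ge_max au; move: ur; rewrite ltr_norml; lra.
    by rewrite le_min vb; move: vr; rewrite ltr_norml; lra.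
  apply: ler_wpM2r; first by rewrite exprn_ge0 // powR_ge0.
  by rewrite le_max ler_norm.
apply: (bO_small al3 lohi (d := C^-1) _ h0); first by rewrite invr_gt0.
exists C => -[[[] u] v] [] /= _ au uv vb vu; apply: hC => //.
  by rewrite au (le_trans uv).
by rewrite ger0_norm // subr_ge0.
Qed.

Lemma bdd_seg a b (g : R -> R) : (forall r0, a <= r0 <= b -> exists2 d, 0 < d &
    exists C, forall r, a <= r <= b -> `|r - r0| < d -> `|g r| <= C) ->
  exists C, forall r, a <= r <= b -> `|g r| <= C.
Proof.
move=> hloc.
pose Q C (u v : R) := a <= u <= b -> `|g u| <= C.
have [||C C0 hC] := @seg_uniform R a b Q.
- by move=> C C' u v CC' h uab; exact: le_trans (h uab) CC'.
- move=> r0 /hloc[d d0 [C hC]].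
  have C1 : 0 < Num.max `|C| d^-1 by rewrite lt_max invr_gt0 d0 orbT.
  exists (Num.max `|C| d^-1) => // u v ur _ uab.
  apply: le_trans (hC u uab _) _; last by rewrite le_max ler_norm.
  apply: lt_le_trans ur _.
  by rewrite -[leRHS]invrK lef_pV2 ?posrE ?invr_gt0 // le_max lexx orbT.
by exists C => r rab; apply: (hC r r rab) => //; rewrite subrr normr0 invr_gt0.
Qed.

Context {V : normedModType R} {I : finType} (B : coords V I).

Lemma controlled_fctrl a b (X : R -> V) X' : a <= b -> t0 <= a -> b <= t1 ->
  controlled alpha Z a b X X' -> forall l,
  fctrl alpha Z [set: unit] (fun=> a) (fun=> b) (fun _ r => crd B (X r) l)
    (fun _ r i => crd B (X' r i) l).
Proof.
move=> ab ta bt [C hC] l.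
have lohi (e : unit) : [set: unit] e -> t0 <= a /\ b <= t1 by [].
have sc := scale2 al3 lohi.
have crd_sum (J : finType) (F : J -> V) k : crd B (\sum_j F j) k = \sum_j crd B (F j) k.
  by elim/big_rec2 : _ => [|j y z _ <-]; rewrite ?crd0 ?crdD.
have der i : bO (segdom a b) (eta2 alpha) 1
    (fun t => crd B (X' t.2 i) l - crd B (X' t.1.2 i) l).
  exists C => -[[e u] v] [] /= _ au uv vb; rewrite -crdB expr1.
  by apply: le_trans (crd_le _ _ _) _; exact: (hC u v au uv vb).2.
split => //.
  exists C => -[[e u] v] [] /= _ au uv vb; rewrite /eta2 /= -powR_alpha ?subr_ge0 //.
  have -> : crd B (X v) l - crd B (X u) l - \sum_i dZ Z u v i * crd B (X' u i) l =
      crd B (X v - X u - \sum_(i < K) (Z v - Z u) 0 i *: X' u i) l.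
    rewrite !crdB crd_sum; congr (_ - _).
    by apply: eq_bigr => i _; rewrite crdZ.
  by apply: le_trans (crd_le _ _ _) _; exact: (hC u v au uv vb).1.
move=> i.
apply: (bO_eq (B := fun t => (crd B (X' t.1.2 i) l - crd B (X' a i) l) + crd B (X' a i) l)).
  by move=> t _; rewrite subrK.
apply: bOD; last exact: bO_cst.
exists (`|C| * (b - a) `^ alpha) => -[[e u] v] [] /= _ au uv vb; rewrite -crdB expr0 mulr1.
apply: le_trans (crd_le _ _ _) _.
apply: le_trans ((hC a u (lexx a) au (le_trans uv vb)).2 i) _.
apply: (@le_trans _ _ (`|C| * (u - a) `^ alpha)).
  by apply: ler_wpM2r (ler_norm C); exact: powR_ge0.
by apply: ler_wpM2l => //; apply: (le_powR_alpha al3); lra.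
Qed.

Section Global.
Variables (a b : R) (X : R -> V) (X' : R -> 'I_K -> I -> R).
Hypotheses (t0a : t0 <= a) (bt1 : b <= t1).
Local Notation fct := (fctrl alpha Z [set: unit] (fun=> a) (fun=> b)).
Hypothesis hX : forall l, fct (fun _ r => crd B (X r) l) (fun _ r i => X' r i l).

Let lohi (e : unit) : [set: unit] e -> t0 <= a /\ b <= t1. Proof. by []. Qed.

Lemma path_holder : exists2 C, 0 <= C & forall u v, a <= u -> u <= v -> v <= b ->
  `|X v - X u| <= C * (v - u) `^ alpha.
Proof.
have i1 l : bO (segdom a b) (eta2 alpha) 1 (fun t => crd B (X t.2 - X t.1.2) l).
  by apply: bO_eq (fctrl_inc al3 rp lohi (hX l)) => t _; exact: crdB.
have [C C0 hC] := bO_ge0 (scale2 al3 lohi) (bO_norm (scale2 al3 lohi) i1).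
exists C => // u v au uv vb; have := hC (tt, u, v).
by rewrite normr_id expr1; apply.
Qed.

Lemma path_near r0 e : a <= r0 <= b -> 0 < e -> exists2 d, 0 < d &
  forall r, a <= r <= b -> `|r - r0| < d -> `|X r - X r0| < e.
Proof.
move=> /andP[ar0 r0b] e0; have [C C0 hC] := path_holder.
have [d d0 hd] := small_powR C (alpha_gt0 al3) e0.
exists d => // r /andP[ar rb] rd.
have [le|/ltW le] := leP r0 r.
  apply: le_lt_trans (hC r0 r ar0 le rb) _; apply: hd; first by rewrite subr_ge0.
  by apply: le_lt_trans rd; exact: ler_norm.
rewrite -normrN opprB; apply: le_lt_trans (hC r r0 ar le r0b) _.
apply: hd; first by rewrite subr_ge0.
by apply: le_lt_trans rd; rewrite -normrN opprB ler_norm.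
Qed.

Lemma smooth_path_bdd f : smooth f -> exists C, forall r, a <= r <= b -> `|f (X r)| <= C.
Proof.
move=> hf; apply: bdd_seg => r0 r0ab.
have [e e0 [C _ hC]] := smooth_tame B (X r0) hf.
have [d d0 hd] := path_near r0ab e0.
exists d => //; exists C => r rab /(hd r rab) rr.
by have [] := hC _ _ rr rr.
Qed.

(** [fctrl_comp] requires the path to stay in one small ball. By Hölder continuity this holds on
    short windows, and [bO_seg] glues the windows together. *)
Lemma fctrl_global f : smooth f -> fct (fun _ r => f (X r))
  (fun _ r i => \sum_l X' r i l * pd B l f (X r)).
Proof.
move=> hf.
have hdf l : smooth (pd B l f) by exact: smooth_pd.
have bO_bdd (g : V -> R) : smooth g ->
    bO (segdom a b) (eta2 alpha) 0 (fun t => g (X t.1.2)) /\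
    bO (segdom a b) (eta2 alpha) 0 (fun t => g (X t.2)).
  move=> /smooth_path_bdd[C hC]; split; exists C => -[[e u] v] [] /= _ au uv vb;
    rewrite expr0 mulr1; apply: hC.
    by rewrite au (le_trans uv).
  by rewrite vb (le_trans au).
have sc := scale2 al3 lohi.
have loc r0 : a <= r0 <= b -> exists2 d, 0 < d &
    fctrl alpha Z [set: unit] (fun=> Num.max a (r0 - d)) (fun=> Num.min b (r0 + d))
     (fun _ r => f (X r)) (fun _ r i => \sum_l X' r i l * pd B l f (X r)).
  move=> r0ab.
  have [e1 e10 h1] := smooth_tame B (X r0) hf.
  have [e2 e20 h2] := smooth_tame_fin B (X r0) hdf.
  have e0 : 0 < Num.min e1 e2 by rewrite lt_min e10.
  have [d d0 hd] := path_near r0ab e0.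
  exists (d / 2); first exact: divr_gt0.
  have lohi' (e : unit) : [set: unit] e ->
      t0 <= Num.max a (r0 - d / 2) /\ Num.min b (r0 + d / 2) <= t1.
    by move=> _; rewrite le_max t0a ge_min bt1.
  apply: (fctrl_comp al3 rp lohi' (X := fun _ => X) (X' := fun _ => X') (x0 := X r0)
    (r := Num.min e1 e2)).
  - move=> e s _; rewrite ge_max => /andP[as_ rs]; rewrite le_min => /andP[sb sr].
    by apply: hd; [rewrite as_|rewrite ltr_norml; lra].
  - move=> l; apply: (fctrl_sub (phi := id) _ (hX l)) => e _.
    by rewrite le_max lexx ge_min lexx.
  - by apply: tame_le h1; rewrite ge_min lexx.
  - by move=> l; apply: tame_le (h2 l); rewrite ge_min lexx orbT.
have bX' l i : bO (segdom a b) (eta2 alpha) 0 (fun t => X' t.1.2 i l).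
  exact: fctrl_bdd (hX l) i.
have bX'2 l i : bO (segdom a b) (eta2 alpha) 0 (fun t => X' t.2 i l).
  exact: (fctrl_bdd_r al3 lohi i (hX l)).
have bs i : bO (segdom a b) (eta2 alpha) 0 (fun t => \sum_l X' t.1.2 i l * pd B l f (X t.1.2)).
  apply: bO_sum => l; apply: (bOM sc (k := 0) (l := 0)) => //.
  exact: (bO_bdd _ (hdf l)).1.
have bs2 i : bO (segdom a b) (eta2 alpha) 0 (fun t => \sum_l X' t.2 i l * pd B l f (X t.2)).
  apply: bO_sum => l; apply: (bOM sc (k := 0) (l := 0)) => //.
  exact: (bO_bdd _ (hdf l)).2.
have [b1 b2] := bO_bdd _ hf.
split => //.
- apply: (bO_seg t0a bt1).
    by move=> r0 /loc[d d0 [h _ _]]; exists d.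
  apply: bOB; first exact: bOB.
  apply: bO_sum => i; apply: (bOM sc (k := 0) (l := 0)) => //.
  by apply: (bOW sc (l := 1)) => //; exact: (bO_dZ rp lohi i).
- move=> i; apply: (bO_seg t0a bt1).
    by move=> r0 /loc[d d0 [_ h _]]; exists d.
  exact: bOB.
Qed.

End Global.
End SinglePath.

(** * Derivative rules for functions of one real parameter *)

Section DeriveRules.
Context {R : realType}.
Implicit Types (f g : R -> R) (t df dg c : R).

Lemma ider_cst c t : is_derive t 1 (fun=> c) 0.
Proof. exact: is_derive_cst. Qed.

Lemma iderD f g t df dg : is_derive t 1 f df -> is_derive t 1 g dg ->
  is_derive t 1 (fun e => f e + g e) (df + dg).
Proof. exact: is_deriveD. Qed.

Lemma iderB f g t df dg : is_derive t 1 f df -> is_derive t 1 g dg ->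
  is_derive t 1 (fun e => f e - g e) (df - dg).
Proof. exact: is_deriveB. Qed.

Lemma iderM f g t df dg : is_derive t 1 f df -> is_derive t 1 g dg ->
  is_derive t 1 (fun e => f e * g e) (df * g t + f t * dg).
Proof.
move=> hf hg; have := is_deriveM (f := f) (g := g) (x := t) (v := 1) (df := df) (dg := dg).
by move=> h; apply: is_derive_eq; rewrite -![_ *: _]/(_ * _) addrC [g t * _]mulrC.
Qed.

Lemma iderMc f t df c : is_derive t 1 f df -> is_derive t 1 (fun e => f e * c) (df * c).
Proof. by move=> hf; have := iderM hf (ider_cst c t); rewrite mulr0 addr0. Qed.

Lemma ider_sum (I : finType) (f : I -> R -> R) t (df : I -> R) :
  (forall i, is_derive t 1 (f i) (df i)) -> is_derive t 1 (fun e => \sum_i f i e) (\sum_i df i).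
Proof.
move=> h; have -> : (fun e => \sum_i f i e) = (fun e => \sum_(i <- enum I) f i e).
  by apply/funext => e; rewrite big_enum.
rewrite -[X in is_derive _ _ _ X]big_enum /=.
elim: (enum I) => [|i s IH].
  have -> : (fun e => \sum_(i <- [::]) f i e) = fun=> 0.
    by apply/funext => e; rewrite big_nil.
  by rewrite big_nil; exact: ider_cst.
have -> : (fun e => \sum_(i0 <- i :: s) f i0 e) = fun e => f i e + \sum_(i0 <- s) f i0 e.
  by apply/funext => e; rewrite big_cons.
by rewrite big_cons; exact: iderD.
Qed.

Lemma mvt_bound f (df : R -> R) (C a : R) : 0 <= C ->
  (forall t, `|t| <= `|a| -> is_derive t 1 f (df t) /\ `|df t| <= C) ->
  `|f a - f 0| <= C * `|a|.
Proof.
move=> C0 h.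
have le_t t : 0 <= t <= 1 -> `|0 + t *: a| <= `|a|.
  move=> /andP[t0 t1]; rewrite add0r -[t *: a]/(t * a) normrM ger0_norm //.
  by rewrite ler_piMl.
have [|t t01] := @mvt_line R R f (fun x => a * df x) 0 a.
  move=> t t01; have [hd _] := h _ (le_t t t01).
  have := is_derive_scale a hd; rewrite -[a *: 1]/(a * 1) mulr1; exact.
rewrite add0r => ->; rewrite normrM mulrC; apply: ler_wpM2r => //.
exact: (h _ (le_t t t01)).2.
Qed.

End DeriveRules.

(** * Time integrals and rough integrals of smooth functions along families *)

Section Compositions.
Context {R : realType} {K : nat}.
Variables (alpha t0 t1 : R) (Z : R -> 'rV[R]_K) (ZZ : R -> R -> 'M[R]_K).
Hypotheses (al3 : 3^-1 < alpha) (al2 : alpha <= 2^-1).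
Hypothesis rp : geometric_rough_path alpha Z ZZ t0 t1.
Context {V : normedModType R} {I : finType} (B : coords V I).

Lemma pdN (l : I) (f : V -> R) x : smooth f -> pd B l (fun x => - f x) x = - pd B l f x.
Proof. by move=> hf; have [_ h] := hf 1%N; have [hd _] := h (bas B l); rewrite !pdE; exact: deriveN (hd x Logic.I). Qed.

Lemma smooth_is_derive (f : V -> R) x w : smooth f ->
  is_derive x w f (\sum_l crd B w l * pd B l f x).
Proof.
move=> hf; have FF : Filter (globally [set: unit]) by exact: globally_filter.
have [r r0 h] := Cloc_is_derive FF B (Cloc_smooth FF x 1 hf).
by have := h tt Logic.I x; rewrite subrr normr0; apply.
Qed.

Lemma derive_row (f : V -> 'rV[R]_K) x w j : (forall j, smooth (fun x => f x 0 j)) ->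
  ('D_w f x) 0 j = \sum_l crd B w l * pd B l (fun x => f x 0 j) x.
Proof.
move=> hf; have d k : derivable (fun x => f x 0 k) x w.
  by have [] := smooth_is_derive x w (hf k).
have dd : derivable f x w.
  apply: (derivable_mxP _ _ _).2 => i k. rewrite (ord1 i). exact: d.
rewrite derive_mx; last exact: dd.
by rewrite mxE; have [_ ->] := smooth_is_derive x w (hf j).
Qed.

Context {E : Type} (A : set E) (lo hi : E -> R).
Hypothesis lohi : forall e, A e -> t0 <= lo e /\ hi e <= t1.
Local Notation O := (bO (dom2 A lo hi) (eta2 alpha)).
Local Notation sc := (scale2 al3 lohi).
Local Notation fct := (fctrl alpha Z A lo hi).

Lemma Rint_family (f : E -> R -> R) :
  O 1 (fun t => f t.1.1 t.2 - f t.1.1 t.1.2) ->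
  (forall e, A e -> {within `[lo e, hi e], continuous (f e)}) /\
  O 3 (fun t => \int[lebesgue_measure]_(r in `[t.1.2, t.2]) f t.1.1 r
      - f t.1.1 t.1.2 * (t.2 - t.1.2)).
Proof.
move=> /(bO_ge0 sc)[C C0 hC].
have hold e u v : A e -> lo e <= u -> u <= v -> v <= hi e ->
    `|f e v - f e u| <= C * (v - u) `^ alpha.
  by move=> Ae lu uv vh; have := hC (e, u, v); rewrite expr1; apply.
have cont e : A e -> {within `[lo e, hi e], continuous (f e)}.
  move=> Ae; apply: (holder_within_continuous (alpha_gt0 al3) (C := C)) => u v.
  exact: hold.
split => //.
have [D D0 hD] := bO_ge0 sc (bO_h2 al2 lohi).
exists (C * D) => -[[e u] v] [] /= Ae lu uv vh.
apply: (@le_trans _ _ (C * (v - u) `^ alpha * (v - u))).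
  apply: Rint_near => //; first exact: within_itv_sub lu vh (cont e Ae).
  move=> r /andP[ur rv]; apply: le_trans (hold e u r Ae lu ur (le_trans rv vh)) _.
  by apply: ler_wpM2l => //; apply: (le_powR_alpha al3); lra.
have := hD (e, u, v); rewrite /eta2 /= ger0_norm ?subr_ge0 // => h.
rewrite exprS mulrACA -!mulrA; apply: ler_wpM2l => //.
by apply: ler_wpM2l; [exact: powR_ge0|exact: h].
Qed.

Lemma rough_comp_family (f : V -> 'rV[R]_K) (X : E -> R -> V) (X' : E -> R -> 'I_K -> V) :
  (forall j, smooth (fun x => f x 0 j)) ->
  (forall j, fct (fun e r => f (X e r) 0 j)
    (fun e r i => \sum_l crd B (X' e r i) l * pd B l (fun x => f x 0 j) (X e r))) ->
  (forall e u v w, A e -> lo e <= u -> u <= v -> v <= w -> w <= hi e ->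
    rough_int_comp Z ZZ f (X e) (X' e) u w =
      rough_int_comp Z ZZ f (X e) (X' e) u v + rough_int_comp Z ZZ f (X e) (X' e) v w) /\
  O 3 (fun t => rough_int_comp Z ZZ f (X t.1.1) (X' t.1.1) t.1.2 t.2
     - (\sum_j f (X t.1.1 t.1.2) 0 j * dZ Z t.1.2 t.2 j
        + \sum_i \sum_j (\sum_l crd B (X' t.1.1 t.1.2 i) l
             * pd B l (fun x => f x 0 j) (X t.1.1 t.1.2)) * ZZ t.1.2 t.2 i j)).
Proof.
move=> sf hf.
have hF k : fct (fun e r => (f \o X e) r 0 k) (fun e r i => chain_gub f (X e) (X' e) r i 0 k).
  have := hf k; congr (fctrl _ _ _ _ _ _ _).
  by apply/funext => e; apply/funext => r; apply/funext => i; rewrite /chain_gub derive_row.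
have [h1 h2] := rough_intZ_family al3 rp lohi (F := fun e => f \o X e) hF.
split; first exact: h1.
apply: bO_eq h2 => t _; congr (_ - (_ + _)).
by apply: eq_bigr => i _; apply: eq_bigr => j _; rewrite /chain_gub derive_row.
Qed.

End Compositions.

(** * Hamiltonian vector fields in coordinates *)

Section HamiltonianFields.
Context {R : realType} {N : nat}.
Local Notation TQ := ('rV[R]_N * 'rV[R]_N)%type.
Definition tqB : coords TQ ('I_N + 'I_N)%type := pair_coords N N.
Local Notation B := tqB.

Lemma derive_affine {V V' W : normedModType R} (io io0 : V' -> V) (f : V -> W) v y :
  (forall (h : R) v y, io (h *: v + y) = h *: io0 v + io y) ->
  'D_v (fun y => f (io y)) y = 'D_(io0 v) f (io y).
Proof.
move=> hio; have e : (fun h : R => h^-1 *: (((fun y => f (io y)) \o shift y) (h *: v) - f (io y)))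
   = (fun h : R => h^-1 *: ((f \o shift (io y)) (h *: io0 v) - f (io y))).
  by apply/funext => h /=; rewrite hio.
by rewrite /derive e.
Qed.

Lemma affine_inl (p : 'rV[R]_N) (h : R) (v y : 'rV[R]_N) :
  (h *: v + y, p) = h *: (v, 0 : 'rV[R]_N) + (y, p).
Proof. by rewrite -[RHS]/((_, _)) /= scaler0 add0r. Qed.

Lemma affine_inr (q : 'rV[R]_N) (h : R) (v y : 'rV[R]_N) :
  (q, h *: v + y) = h *: (0 : 'rV[R]_N, v) + (q, y).
Proof. by rewrite -[RHS]/((_, _)) /= scaler0 add0r. Qed.

Lemma dHdqE (h : TQ -> R) x k : dHdq h x 0 k = pd B (inl k) h x.
Proof.
case: x => q p; rewrite /dHdq /grad mxE pdE.
exact: (derive_affine (io := fun q => (q, p)) (io0 := fun v => (v, 0)) h _ _ (affine_inl p)).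
Qed.

Lemma dHdpE (h : TQ -> R) x k : dHdp h x 0 k = pd B (inr k) h x.
Proof.
case: x => q p; rewrite /dHdp /grad mxE pdE.
exact: (derive_affine (io := fun p => (q, p)) (io0 := fun v => (0, v)) h _ _ (affine_inr q)).
Qed.

(** The Hamiltonian vector field of [h]: momentum derivatives in the position slots, negated
    position derivatives in the momentum slots. *)
Definition hvf (h : TQ -> R) (l : 'I_N + 'I_N) (x : TQ) : R :=
  match l with inl k => pd B (inr k) h x | inr k => - pd B (inl k) h x end.

Lemma hvf_inl h k x : hvf h (inl k) x = pd B (inr k) h x. Proof. by []. Qed.

Lemma hvf_inr h k x : hvf h (inr k) x = - pd B (inl k) h x. Proof. by []. Qed.

Lemma smooth_schwarz h (x : TQ) l m : smooth h -> pd B l (pd B m h) x = pd B m (pd B l h) x.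
Proof.
move=> hs; have FF : Filter (globally [set: unit]) by exact: globally_filter.
have [r r0 hr] := Cloc_schwarz FF B (Cloc_smooth FF x 3 hs).
by have := hr tt Logic.I x; rewrite subrr normr0; apply.
Qed.

Lemma pdM (f g : TQ -> R) l x : smooth f -> smooth g ->
  pd B l (fun x => f x * g x) x = pd B l f x * g x + f x * pd B l g x.
Proof.
move=> hf hg; have [_ /(_ (bas B l))[df _]] := hf 1%N.
have [_ /(_ (bas B l))[dg _]] := hg 1%N.
rewrite !pdE; have := deriveM (df x Logic.I) (dg x Logic.I).
rewrite -![_ *: _]/(_ * _) => ->; ring.
Qed.

Lemma pd_sum (J : finType) (f : J -> TQ -> R) l x : (forall j, smooth (f j)) ->
  pd B l (fun x => \sum_j f j x) x = \sum_j pd B l (f j) x.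
Proof.
move=> hf; have h j : is_derive (0 : R) 1 (fun e : R => f j (x + e *: bas B l)) (pd B l (f j) x).
  apply: is_derive_line; rewrite scale0r addr0 pdE; apply: derivableP.
  by have [_ /(_ (bas B l))[df _]] := hf j 1%N; exact: df.
by rewrite pdE; have [_] := is_derive_of_line (f := fun x => \sum_j f j x) (ider_sum h).
Qed.

Lemma smooth_hvf h l : smooth h -> smooth (hvf h l).
Proof.
by move=> hs; case: l => k; [exact: smooth_pd|apply: smoothN; exact: smooth_pd].
Qed.

Context {K : nat} (cH : TQ -> 'rV[R]_K).

Lemma smooth_cHj j : is_Cinf setT cH -> smooth (cHj cH j).
Proof. exact: (smooth_crd (rV_coords K)). Qed.

Lemma ham_gubE (X : R -> TQ) r j l : crd B (ham_gub cH X r j) l = hvf (cHj cH j) l (X r).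
Proof. by case: l => k; rewrite /= ?dHdpE // mxE dHdqE. Qed.

End HamiltonianFields.

(** * Solutions of the rough Hamilton equations and their action *)

Section Solutions.
Context {R : realType} {N K : nat}.
Local Notation TQ := ('rV[R]_N * 'rV[R]_N)%type.
Variables (alpha t0 t1 : R) (Z : R -> 'rV[R]_K) (ZZ : R -> R -> 'M[R]_K).
Hypotheses (al3 : 3^-1 < alpha) (al2 : alpha <= 2^-1) (t01 : t0 <= t1).
Hypothesis rp : geometric_rough_path alpha Z ZZ t0 t1.
Variables (H : TQ -> R) (cH : TQ -> 'rV[R]_K).
Hypotheses (Hs : smooth H) (cHs : is_Cinf setT cH).
Local Notation B := (@tqB R N).
Local Notation hj := (cHj cH).
Local Notation sol := (rough_hamilton_solution alpha t0 t1 Z ZZ H cH).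

Definition V0 (l : 'I_N + 'I_N) : TQ -> R := hvf H l.
Definition Vf (j : 'I_K) (l : 'I_N + 'I_N) : TQ -> R := hvf (hj j) l.
Local Notation rem := (rem Z ZZ B V0 Vf).
Local Notation cf := (cf B Vf).

Let hs j : smooth (hj j). Proof. exact: smooth_cHj. Qed.

Lemma smooth_V0 l : smooth (V0 l). Proof. exact: smooth_hvf. Qed.
Lemma smooth_Vf j l : smooth (Vf j l). Proof. exact: smooth_hvf. Qed.

Lemma smooth_cf i j k : smooth (cf i j k).
Proof.
apply: smooth_sum => l; apply: smoothM; first exact: smooth_Vf.
exact: smooth_pd (smooth_Vf j k).
Qed.

Lemma good_exists x0 : exists2 r, 0 < r & good B V0 Vf x0 r.
Proof.
have [r1 r10 h1] := smooth_tame_fin B x0 smooth_V0.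
have [r2 r20 h2] : exists2 r, 0 < r &
    forall u : 'I_K * ('I_N + 'I_N), tame B (Vf u.1 u.2) x0 r.
  by apply: smooth_tame_fin => u; exact: smooth_Vf.
have [r3 r30 h3] : exists2 r, 0 < r &
    forall u : 'I_K * ('I_N + 'I_N) * ('I_N + 'I_N), tame B (pd B u.2 (Vf u.1.1 u.1.2)) x0 r.
  by apply: smooth_tame_fin => u; exact/smooth_pd/smooth_Vf.
have [r4 r40 h4] : exists2 r, 0 < r &
    forall u : 'I_K * 'I_K * ('I_N + 'I_N), tame B (cf u.1.1 u.1.2 u.2) x0 r.
  by apply: smooth_tame_fin => u; exact: smooth_cf.
exists (Num.min (Num.min r1 r2) (Num.min r3 r4)).
  by rewrite !lt_min r10 r20 r30.
split.
- by move=> k; apply: tame_le (h1 k); rewrite !ge_min lexx.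
- by move=> j k; apply: tame_le (h2 (j, k)); rewrite !ge_min lexx !orbT.
- by move=> l j k; apply: tame_le (h3 (j, k, l)); rewrite !ge_min lexx !orbT.
- by move=> i j k; apply: tame_le (h4 (i, j, k)); rewrite !ge_min lexx !orbT.
Qed.

Section Single.
Variable X : R -> TQ.
Hypothesis hX : sol X.
Local Notation fct := (fctrl alpha Z [set: unit] (fun=> t0) (fun=> t1)).

Lemma sol_fctrl l : fct (fun _ r => crd B (X r) l) (fun _ r i => Vf i l (X r)).
Proof.
have := controlled_fctrl al3 B t01 (lexx t0) (lexx t1) hX.1 l.
congr (fctrl _ _ _ _ _ _ _).
by apply/funext => e; apply/funext => r; apply/funext => i; exact: ham_gubE.
Qed.

Lemma sol_comp_fctrl f : smooth f -> fct (fun _ r => f (X r))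
   (fun _ r i => \sum_l Vf i l (X r) * pd B l f (X r)).
Proof. by move=> sf; exact: (fctrl_global al3 rp (lexx t0) (lexx t1) sol_fctrl sf). Qed.

Let lohi (e : unit) : [set: unit] e -> t0 <= t0 /\ t1 <= t1. Proof. by []. Qed.
Local Notation O := (bO (dom2 [set: unit] (fun=> t0) (fun=> t1)) (eta2 alpha)).

Lemma sol_drift f : smooth f -> {within `[t0, t1], continuous (f \o X)} /\
  O 3 (fun t => \int[lebesgue_measure]_(r in `[t.1.2, t.2]) f (X r)
      - f (X t.1.2) * (t.2 - t.1.2)).
Proof.
move=> sf; have [h1 h2] := Rint_family al3 al2 lohi (f := fun _ r => f (X r))
  (fctrl_inc al3 rp lohi (sol_comp_fctrl sf)).
by split; [exact: (h1 tt)|exact: h2].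
Qed.

Lemma sol_rough (f : TQ -> 'rV[R]_K) : (forall j, smooth (fun x => f x 0 j)) ->
  (forall u v w, t0 <= u -> u <= v -> v <= w -> w <= t1 ->
    rough_int_comp Z ZZ f X (ham_gub cH X) u w =
    rough_int_comp Z ZZ f X (ham_gub cH X) u v + rough_int_comp Z ZZ f X (ham_gub cH X) v w) /\
  O 3 (fun t => rough_int_comp Z ZZ f X (ham_gub cH X) t.1.2 t.2
     - (\sum_j f (X t.1.2) 0 j * dZ Z t.1.2 t.2 j
        + \sum_i \sum_j (\sum_l Vf i l (X t.1.2)
             * pd B l (fun x => f x 0 j) (X t.1.2)) * ZZ t.1.2 t.2 i j)).
Proof.
move=> sf; have [|h1 h2] := rough_comp_family (B := B) al3 rp lohi
  (X := fun _ => X) (X' := fun _ => ham_gub cH X) sf.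
  move=> j; have := sol_comp_fctrl (sf j); congr (fctrl _ _ _ _ _ _ _).
  apply/funext => e; apply/funext => r; apply/funext => i.
  by apply: eq_bigr => l _; rewrite ham_gubE.
split; first by move=> u v w; exact: (h1 tt).
apply: bO_eq h2 => t _; congr (_ - (_ + _)).
by do 2!apply: eq_bigr => ? _; congr (_ * _); apply: eq_bigr => l _; rewrite ham_gubE.
Qed.

(** Both integrals in the equation agree with their germs up to order 3, and the sum of the germs is
    the Euler expansion. The constant depends on [X]; [fam_rem] removes this dependence through
    [davie]. *)
Lemma sol_rem : exists C, forall l u v, t0 <= u -> u <= v -> v <= t1 ->
  `|rem X l u v| <= C * ((v - u) `^ alpha) ^+ 3.
Proof.
have key l : O 3 (fun t => rem X l t.1.2 t.2).
  case: l => k.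
    pose g (x : TQ) : 'rV[R]_K := \row_j dHdp (hj j) x 0 k.
    have gj j : (fun x => g x 0 j) = pd B (inr k) (hj j).
      by apply/funext => x; rewrite mxE dHdpE.
    have sg j : smooth (fun x => g x 0 j) by rewrite gj; exact: smooth_pd.
    have sV : smooth (pd B (inr k) H) by exact: smooth_pd.
    apply: bO_eq (bOD (sol_drift sV).2 (sol_rough sg).2) => -[[e u] v] [] /= _ tu uv vt.
    have [_ /(_ u v tu uv vt k)[+ _]] := hX; rewrite -/g.
    rewrite [X in _ = X + _](eq_Rint (g := fun r => pd B (inr k) H (X r))); last first.
      by move=> r _; rewrite dHdpE.
    move=> e1; rewrite /rem /cf /V0 /=.
    have -> : ((X v).1 - (X u).1) 0 k = ((X v).1 - (X u).1) 0 k by [].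
    rewrite e1.
    have -> : \sum_j g (X u) 0 j * dZ Z u v j = \sum_j Vf j (inl k) (X u) * dZ Z u v j.
      by apply: eq_bigr => j _; rewrite -[g _ 0 j]/((fun x => g x 0 j) (X u)) gj.
    have -> : \sum_i \sum_j (\sum_l Vf i l (X u) * pd B l (fun x => g x 0 j) (X u)) * ZZ u v i j
      = \sum_i \sum_j (\sum_l Vf i l (X u) * pd B l (Vf j (inl k)) (X u)) * ZZ u v i j.
      by do 2!apply: eq_bigr => ? _; rewrite gj.
    ring.
  pose g (x : TQ) : 'rV[R]_K := \row_j dHdq (hj j) x 0 k.
  have gj j : (fun x => g x 0 j) = pd B (inl k) (hj j).
    by apply/funext => x; rewrite mxE dHdqE.
  have sg j : smooth (fun x => g x 0 j) by rewrite gj; exact: smooth_pd.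
  have sV : smooth (pd B (inl k) H) by exact: smooth_pd.
  apply: bO_eq (bON (bOD (sol_drift sV).2 (sol_rough sg).2)) => -[[e u] v] [] /= _ tu uv vt.
  have [_ /(_ u v tu uv vt k)[_ +]] := hX; rewrite -/g.
  rewrite [X in _ = - X - _](eq_Rint (g := fun r => pd B (inl k) H (X r))); last first.
    by move=> r _; rewrite dHdqE.
  move=> e1; rewrite /rem /cf /V0 /=.
  rewrite e1.
  have -> : \sum_j g (X u) 0 j * dZ Z u v j = - \sum_j Vf j (inr k) (X u) * dZ Z u v j.
    rewrite -sumrN; apply: eq_bigr => j _; rewrite -[g _ 0 j]/((fun x => g x 0 j) (X u)) gj.
    by rewrite mulNr opprK.
  have -> : \sum_i \sum_j (\sum_l Vf i l (X u) * pd B l (fun x => g x 0 j) (X u)) * ZZ u v i j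
    = - \sum_i \sum_j (\sum_l Vf i l (X u) * pd B l (Vf j (inr k)) (X u)) * ZZ u v i j.
    rewrite -sumrN; apply: eq_bigr => i _; rewrite -sumrN; apply: eq_bigr => j _.
    rewrite -mulNr -sumrN gj; congr (_ * _); apply: eq_bigr => l _.
    by rewrite [pd B l (Vf j (inr k))](_ : _ = fun x => - pd B l (pd B (inl k) (hj j)) x)
      ?mulrN ?opprK //; apply/funext => x; apply: pdN; exact: smooth_pd.
  ring.
have /choice[C hC] := key.
exists (\sum_l `|C l|) => l u v tu uv vt.
apply: le_trans (hC l (tt, u, v) _) _ => //.
apply: ler_wpM2r; first by rewrite exprn_ge0 // powR_ge0.
apply: le_trans (ler_norm _) _; rewrite (bigD1 l) //= lerDl.
exact: sumr_ge0.
Qed.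

Definition rough_action (u v : R) : R :=
  rough_int ZZ (fun r => (X r).2) (fun r i => (ham_gub cH X r i).2)
    (fun r => (X r).1) (fun r i => (ham_gub cH X r i).1) u v
  - \int[lebesgue_measure]_(r in `[u, v]) H (X r)
  - rough_int_comp Z ZZ cH X (ham_gub cH X) u v.

Lemma rVcrd_fst (x : TQ) k : x.1 0 k = crd B x (inl k). Proof. by []. Qed.

Lemma act_add u v w : t0 <= u -> u <= v -> v <= w -> w <= t1 ->
  rough_action u w = rough_action u v + rough_action v w.
Proof.
move=> tu uv vw wt.
have [h1 _] := rough_int_family al3 rp lohi
  (F := fun _ r => (X r).2) (F' := fun _ r i => (ham_gub cH X r i).2)
  (G := fun _ r => (X r).1) (G' := fun _ r i => (ham_gub cH X r i).1)
  (fun k => controlled_fctrl al3 B t01 (lexx t0) (lexx t1) hX.1 (inr k))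
  (fun k => controlled_fctrl al3 B t01 (lexx t0) (lexx t1) hX.1 (inl k)).
have tv := le_trans tu uv; have vt := le_trans vw wt.
rewrite /rough_action (sum_lim_cat uv vw (h1 tt u v Logic.I tu uv vt) (h1 tt v w Logic.I tv vw wt)
  (h1 tt u w Logic.I tu (le_trans uv vw) wt)).
rewrite (Rint_add uv vw); last exact: within_itv_sub tu wt (sol_drift Hs).1.
have [h2 _] := sol_rough (f := cH) hs; rewrite (h2 u v w) //.
ring.
Qed.

End Single.

Section FamilyOfSolutions.
Context {E : Type} (A : set E) (lo hi : E -> R) (X : E -> R -> TQ) (x0 : TQ) (r : R).
Hypothesis lohi : forall e, A e -> t0 <= lo e /\ hi e <= t1.
Hypothesis gd : good B V0 Vf x0 r.
Hypothesis hball : forall e s, A e -> lo e <= s -> s <= hi e -> `|X e s - x0| < r.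
Hypothesis hsol : forall e, A e -> sol (X e).
Local Notation O := (bO (dom2 A lo hi) (eta2 alpha)).
Local Notation sc := (scale2 al3 lohi).
Local Notation fct := (fctrl alpha Z A lo hi).

Lemma fam_rem l : O 3 (fun t => rem (X t.1.1) l t.1.2 t.2).
Proof.
apply: (davie al3 al2 rp lohi gd hball) => e Ae.
have [C hC] := sol_rem (hsol Ae); have [tl ht] := lohi Ae.
exists C => k u v lu uv vh; apply: hC => //; first exact: le_trans lu.
exact: le_trans ht.
Qed.

Lemma fam_incr2 l : O 2 (fun t => crd B (X t.1.1 t.2 - X t.1.1 t.1.2) l
   - \sum_j Vf j l (X t.1.1 t.1.2) * dZ Z t.1.2 t.2 j).
Proof.
apply: (bO_eq (B := fun t => V0 l (X t.1.1 t.1.2) * (t.2 - t.1.2)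
  + \sum_i \sum_j cf i j l (X t.1.1 t.1.2) * ZZ t.1.2 t.2 i j
  + rem (X t.1.1) l t.1.2 t.2)).
  by move=> t _; rewrite /rem; ring.
apply: bOD; last exact: (bOW sc (l := 3) _ (fam_rem l)).
apply: bOD; first exact: (bO_drift al3 al2 lohi gd hball).
exact: (bO_second al3 rp lohi gd hball).
Qed.

Lemma fam_incr1 l : O 1 (fun t => crd B (X t.1.1 t.2 - X t.1.1 t.1.2) l).
Proof.
apply: (bO_eq (B := fun t => (crd B (X t.1.1 t.2 - X t.1.1 t.1.2) l
   - \sum_j Vf j l (X t.1.1 t.1.2) * dZ Z t.1.2 t.2 j)
   + \sum_j Vf j l (X t.1.1 t.1.2) * dZ Z t.1.2 t.2 j)).
  by move=> t _; rewrite subrK.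
apply: bOD; first exact: (bOW sc (l := 2) _ (fam_incr2 l)).
exact: (bO_first al3 rp lohi gd hball).
Qed.

Lemma fam_norm : O 1 (fun t => `|X t.1.1 t.2 - X t.1.1 t.1.2|).
Proof. exact: (bO_norm sc fam_incr1). Qed.

Lemma fam_fctrl l : fct (fun e s => crd B (X e s) l) (fun e s i => Vf i l (X e s)).
Proof.
split.
- apply: bO_eq (fam_incr2 l) => t _; rewrite crdB; congr (_ - _).
  by apply: eq_bigr => i _; rewrite mulrC.
- move=> i; exact: (bO_tame_lip sc (ball_u hball) (ball_v hball) (good_Vf gd i l) fam_norm).
- move=> i; exact: (bO_fX alpha hball (good_Vf gd i l)).
Qed.

Lemma fam_comp_fctrl f : tame B f x0 r -> (forall l, tame B (pd B l f) x0 r) ->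
  fct (fun e s => f (X e s)) (fun e s i => \sum_l Vf i l (X e s) * pd B l f (X e s)).
Proof. by move=> tf tdf; exact: (fctrl_comp al3 rp lohi hball fam_fctrl tf tdf). Qed.

(** Half of a Poisson bracket: [ab i j - ab j i] is the derivative of [hj j] along the Hamiltonian
    field of [hj i]. *)
Definition ab (i j : 'I_K) (x : TQ) : R :=
  \sum_k pd B (inl k) (hj j) x * pd B (inr k) (hj i) x.

Hypothesis tH : tame B H x0 r /\ forall l, tame B (pd B l H) x0 r.
Hypothesis th : forall j, tame B (hj j) x0 r /\ forall l, tame B (pd B l (hj j)) x0 r.

(** At second order the integral of [p dq] contributes minus [ab j i] and that of [cH] contributes
    [ab i j - ab j i]; in the difference only minus [ab i j] survives. *)
Lemma fam_act : O 3 (fun t => rough_action (X t.1.1) t.1.2 t.2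
  - (\sum_k crd B (X t.1.1 t.1.2) (inr k) * crd B (X t.1.1 t.2 - X t.1.1 t.1.2) (inl k)
     - H (X t.1.1 t.1.2) * (t.2 - t.1.2) - \sum_j hj j (X t.1.1 t.1.2) * dZ Z t.1.2 t.2 j
     - \sum_i \sum_j ab i j (X t.1.1 t.1.2) * ZZ t.1.2 t.2 i j)).
Proof.
have fc l : fct (fun e s => crd B (X e s) l) (fun e s i => crd B (ham_gub cH (X e) s i) l).
  have := fam_fctrl l; congr (fctrl _ _ _ _ _ _ _).
  by apply/funext => e; apply/funext => s; apply/funext => i; rewrite ham_gubE.
have [_ h1] := rough_int_family al3 rp lohi
  (F := fun e s => (X e s).2) (F' := fun e s i => (ham_gub cH (X e) s i).2)
  (G := fun e s => (X e s).1) (G' := fun e s i => (ham_gub cH (X e) s i).1)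
  (fun k => fc (inr k)) (fun k => fc (inl k)).
have [_ h2] := Rint_family al3 al2 lohi (f := fun e s => H (X e s))
  (fctrl_inc al3 rp lohi (fam_comp_fctrl tH.1 tH.2)).
have [|_ h3] := rough_comp_family (B := B) al3 rp lohi (f := cH) (X := X)
  (X' := fun e => ham_gub cH (X e)) hs.
  move=> j; have := fam_comp_fctrl (th j).1 (th j).2; congr (fctrl _ _ _ _ _ _ _).
  apply/funext => e; apply/funext => s; apply/funext => i.
  by apply: eq_bigr => l _; rewrite ham_gubE.
apply: bO_eq (bOB (bOB h1 h2) h3) => -[[e u] v] _ /=.
rewrite /rough_action /rough_germ.
set x := X e u.
have -> : dotr x.2 ((X e v).1 - x.1) =
  \sum_k crd B x (inr k) * crd B (X e v - x) (inl k) by [].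
have -> : \sum_i \sum_j (\sum_l crd B (ham_gub cH (X e) u i) l
      * pd B l (fun x => cH x 0 j) x) * ZZ u v i j
  = \sum_i \sum_j (ab i j x - ab j i x) * ZZ u v i j.
  apply: eq_bigr => i _; apply: eq_bigr => j _; congr (_ * _).
  rewrite big_sumType /= /ab -sumrB -big_split /=; apply: eq_bigr => k _.
  by rewrite !mxE -!/(dHdp _ _ 0 k) -/x; rewrite -(dHdqE (hj i)) -(dHdpE (hj i)) -/(hj j) !mxE; ring.
have -> : \sum_i \sum_j dotr (ham_gub cH (X e) u i).2 (ham_gub cH (X e) u j).1 * ZZ u v i j
  = - \sum_i \sum_j ab j i x * ZZ u v i j.
  rewrite -sumrN; apply: eq_bigr => i _; rewrite -sumrN; apply: eq_bigr => j _.
  rewrite -mulNr; congr (_ * _); rewrite /dotr /ab -sumrN; apply: eq_bigr => k _.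
  by rewrite /= mxE dHdqE dHdpE mulNr.
have -> : \sum_i \sum_j (ab i j x - ab j i x) * ZZ u v i j =
  \sum_i \sum_j ab i j x * ZZ u v i j - \sum_i \sum_j ab j i x * ZZ u v i j.
  rewrite -sumrB; apply: eq_bigr => i _; rewrite -sumrB; apply: eq_bigr => j _.
  by rewrite mulrBl.
rewrite /cHj; ring.
Qed.

End FamilyOfSolutions.
End Solutions.

(** * Second-order sums and symplectic identities *)

Section SecondOrderSums.
Context {R : realType} {J : finType} {K : nat}.

Lemma lin_expand (c A0 Rm : J -> R) (B0 : 'I_K -> J -> R) (C0 : 'I_K -> 'I_K -> J -> R)
    (h : R) (z : 'I_K -> R) (zz : 'I_K -> 'I_K -> R) :
  \sum_k c k * (A0 k * h + \sum_j B0 j k * z j + \sum_i \sum_j C0 i j k * zz i j + Rm k) =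
  (\sum_k c k * A0 k) * h + \sum_j (\sum_k c k * B0 j k) * z j
  + \sum_i \sum_j (\sum_k c k * C0 i j k) * zz i j + \sum_k c k * Rm k.
Proof.
have -> : \sum_j (\sum_k c k * B0 j k) * z j = \sum_k c k * \sum_j B0 j k * z j.
  under eq_bigr do rewrite mulr_suml.
  rewrite exchange_big; apply: eq_bigr => k _; rewrite mulr_sumr.
  by apply: eq_bigr => j _; rewrite mulrA.
have -> : \sum_i \sum_j (\sum_k c k * C0 i j k) * zz i j =
    \sum_k c k * \sum_i \sum_j C0 i j k * zz i j.
  under eq_bigr do under eq_bigr do rewrite mulr_suml.
  under eq_bigr do rewrite exchange_big.
  rewrite exchange_big; apply: eq_bigr => k _; rewrite mulr_sumr.
  apply: eq_bigr => i _; rewrite mulr_sumr.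
  by apply: eq_bigr => j _; rewrite mulrA.
rewrite mulr_suml -!big_split /=; apply: eq_bigr => k _; ring.
Qed.

(** Geometricity replaces a product of first-order increments by the symmetrized second-order
    ones. *)
Lemma quad_expand (a b : 'I_K -> J -> R) (z : 'I_K -> R) (zz : 'I_K -> 'I_K -> R) :
  (forall i j, zz i j + zz j i = z i * z j) ->
  \sum_k (\sum_i a i k * z i) * (\sum_j b j k * z j) =
  \sum_i \sum_j (\sum_k (a i k * b j k + a j k * b i k)) * zz i j.
Proof.
move=> hz.
have -> : \sum_k (\sum_i a i k * z i) * (\sum_j b j k * z j) =
    \sum_i \sum_j (\sum_k a i k * b j k) * (zz i j + zz j i).
  under eq_bigr do rewrite mulr_suml.
  rewrite exchange_big; apply: eq_bigr => i _.
  under eq_bigr do rewrite mulr_sumr.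
  rewrite exchange_big; apply: eq_bigr => j _; rewrite mulr_suml.
  by apply: eq_bigr => k _; rewrite hz; ring.
have -> : \sum_i \sum_j (\sum_k a i k * b j k) * (zz i j + zz j i) =
    \sum_i \sum_j (\sum_k a i k * b j k) * zz i j
    + \sum_i \sum_j (\sum_k a j k * b i k) * zz i j.
  rewrite [X in _ = _ + X]exchange_big -big_split /=; apply: eq_bigr => i _.
  by rewrite -big_split /=; apply: eq_bigr => j _; rewrite mulrDr.
rewrite -big_split /=; apply: eq_bigr => i _.
rewrite -big_split /=; apply: eq_bigr => j _.
by rewrite -mulrDl big_split.
Qed.

End SecondOrderSums.

Section SymplecticAlgebra.
Context {R : realType} {N : nat}.
Implicit Types (g gi gj xd : 'I_N + 'I_N -> R) (Di Dj : 'I_N + 'I_N -> 'I_N + 'I_N -> R).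

Definition sgrad g (l : 'I_N + 'I_N) : R :=
  match l with inl k => g (inr k) | inr k => - g (inl k) end.

Lemma sgrad_pairing g xd :
  \sum_k xd (inr k) * sgrad g (inl k) - \sum_k xd (inl k) * sgrad g (inr k)
  = \sum_l xd l * g l.
Proof.
rewrite big_sumType /= -sumrN -!big_split /=; apply: eq_bigr => k _.
by rewrite mulrN opprK addrC.
Qed.

(** Symmetry of the Hessian [Dj] turns the first two sums into the derivative of [gj]'s gradient
    along [xd], paired with the symplectic gradient of [gi]; subtracting the derivative of [ab]
    cancels the unsymmetric part. *)
Lemma second_order_algebra gi gj Di Dj xd : (forall l m, Dj l m = Dj m l) ->
  \sum_k xd (inr k) * (\sum_l sgrad gi l * Dj l (inr k))
  - \sum_k xd (inl k) * (\sum_l sgrad gi l * - Dj l (inl k))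
  - \sum_l xd l * (\sum_k (Dj l (inl k) * gi (inr k) + gj (inl k) * Di l (inr k)))
  = \sum_k (sgrad gi (inr k) * (\sum_l xd l * Dj l (inr k))
          + sgrad gj (inr k) * (\sum_l xd l * Di l (inr k))).
Proof.
move=> sym.
have E1 : \sum_k xd (inr k) * (\sum_l sgrad gi l * Dj l (inr k))
    - \sum_k xd (inl k) * (\sum_l sgrad gi l * - Dj l (inl k))
    = \sum_m sgrad gi m * \sum_l xd l * Dj l m.
  transitivity (\sum_l xd l * \sum_m sgrad gi m * Dj m l).
    rewrite [RHS]big_sumType /= addrC -sumrN; congr (_ + _); apply: eq_bigr => k _ //.
    by rewrite -mulrN -sumrN; congr (_ * _); apply: eq_bigr => m _; rewrite mulrN opprK.
  under eq_bigr do rewrite mulr_sumr.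
  rewrite exchange_big; apply: eq_bigr => m _; rewrite mulr_sumr.
  by apply: eq_bigr => l _; rewrite (sym m l) mulrCA.
have E3 : \sum_l xd l * (\sum_k (Dj l (inl k) * gi (inr k) + gj (inl k) * Di l (inr k))) =
  \sum_k gi (inr k) * (\sum_l xd l * Dj l (inl k))
  + \sum_k gj (inl k) * (\sum_l xd l * Di l (inr k)).
  under eq_bigr do rewrite mulr_sumr.
  rewrite exchange_big -big_split /=; apply: eq_bigr => k _.
  by rewrite !mulr_sumr -big_split /=; apply: eq_bigr => l _; ring.
rewrite E1 E3 big_sumType /= big_split /=.
have -> : \sum_k - gj (inl k) * (\sum_l xd l * Di l (inr k))
  = - \sum_k gj (inl k) * (\sum_l xd l * Di l (inr k)).
  by rewrite -sumrN; apply: eq_bigr => k _; rewrite -mulNr.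
ring.
Qed.

End SymplecticAlgebra.

Section SymplecticIdentities.
Context {R : realType} {N K : nat}.
Local Notation TQ := ('rV[R]_N * 'rV[R]_N)%type.
Local Notation B := (@tqB R N).

Lemma hvf_sgrad (h : TQ -> R) l x : hvf h l x = sgrad (fun l => pd B l h x) l.
Proof. by case: l. Qed.

Lemma ham_pairing (h : TQ -> R) xd (x : TQ) :
  \sum_k xd (inr k) * hvf h (inl k) x - \sum_k xd (inl k) * hvf h (inr k) x
  = \sum_l xd l * pd B l h x.
Proof. exact: sgrad_pairing (fun l => pd B l h x) xd. Qed.

Variables (cH : TQ -> 'rV[R]_K).
Hypothesis cHs : is_Cinf setT cH.
Local Notation hj := (cHj cH).
Local Notation Vf := (Vf cH).

(* Coefficient of the second-order terms in the variation of the action. *)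
Lemma second_order_identity (i j : 'I_K) xd (x : TQ) :
  \sum_k xd (inr k) * cf B Vf i j (inl k) x - \sum_k xd (inl k) * cf B Vf i j (inr k) x
  - \sum_l xd l * pd B l (ab cH i j) x
  = \sum_k (Vf i (inr k) x * (\sum_l xd l * pd B l (Vf j (inl k)) x)
          + Vf j (inr k) x * (\sum_l xd l * pd B l (Vf i (inl k)) x)).
Proof.
have hs i' : smooth (hj i') by exact: smooth_cHj.
have hp i' l : smooth (pd B l (hj i')) by exact: smooth_pd.
have := @second_order_algebra R N (fun l => pd B l (hj i) x) (fun l => pd B l (hj j) x)
  (fun l m => pd B l (pd B m (hj i)) x) (fun l m => pd B l (pd B m (hj j)) x) xd
  (fun l m => smooth_schwarz x l m (hs j)).
congr (_ - _ - _ = _).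
- apply: eq_bigr => k _; congr (_ * _); apply: eq_bigr => l _; rewrite -(hvf_sgrad (hj i) l x).
  by congr (_ * _); apply/esym; exact: pdN.
- apply: eq_bigr => l _; congr (_ * _); apply/esym; rewrite pd_sum.
    by apply: eq_bigr => k _; rewrite pdM.
  by move=> k; exact: smoothM.
Qed.

End SymplecticIdentities.

(** * First variation of the action *)

Section VariationAlgebra.
Context {R : realType} {N K : nat}.

(** The cancellation behind [kk_derive], stated for plain numbers. The three pairing hypotheses
    remove the terms in time, in the first-order increments and in the second-order increments. *)
Lemma kk_algebra (yu yv dx v0 rm : 'I_N + 'I_N -> R) (pu pv xv0 : 'I_N -> R)
  (vf : 'I_K -> 'I_N + 'I_N -> R) (cc : 'I_K -> 'I_K -> 'I_N + 'I_N -> R)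
  (gH : R) (gh : 'I_K -> R) (gab : 'I_K -> 'I_K -> R)
  (xvf : 'I_K -> 'I_N -> R) (xcf : 'I_K -> 'I_K -> 'I_N -> R)
  (h : R) (z : 'I_K -> R) (zz : 'I_K -> 'I_K -> R) :
  (forall i j, zz i j + zz j i = z i * z j) ->
  (forall k, dx (inr k) = pv k - pu k) ->
  (forall l, dx l = v0 l * h + \sum_j vf j l * z j + \sum_i \sum_j cc i j l * zz i j + rm l) ->
  \sum_k yu (inr k) * v0 (inl k) - \sum_k yu (inl k) * v0 (inr k) = gH ->
  (forall j, \sum_k yu (inr k) * vf j (inl k) - \sum_k yu (inl k) * vf j (inr k) = gh j) ->
  (forall i j, \sum_k yu (inr k) * cc i j (inl k) - \sum_k yu (inl k) * cc i j (inr k)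
     - gab i j = \sum_k (vf i (inr k) * xvf j k + vf j (inr k) * xvf i k)) ->
  \sum_k (yu (inr k) * dx (inl k) + pu k * (yv (inl k) - yu (inl k)))
  - gH * h - \sum_j gh j * z j - \sum_i \sum_j gab i j * zz i j
  - (\sum_k pv k * yv (inl k) - \sum_k pu k * yu (inl k))
  + \sum_k ((yv (inr k) - yu (inr k)) * rm (inl k)
     + dx (inr k) * (yv (inl k) - yu (inl k) - xv0 k * h - \sum_j xvf j k * z j
         - \sum_i \sum_j xcf i j k * zz i j))
  = \sum_k yu (inr k) * rm (inl k) - \sum_k yu (inl k) * rm (inr k)
  + \sum_k (yv (inr k) - yu (inr k)) * rm (inl k)
  - \sum_k dx (inr k) * (xv0 k * h + \sum_i \sum_j xcf i j k * zz i j)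
  - \sum_k (dx (inr k) - \sum_i vf i (inr k) * z i) * \sum_j xvf j k * z j.
Proof.
move=> zzs dxE ex idH idh id2.
have X1 := lin_expand (fun k => yu (inr k)) (fun k => v0 (inl k)) (fun k => rm (inl k))
  (fun j k => vf j (inl k)) (fun i j k => cc i j (inl k)) h z zz.
have X2 := lin_expand (fun k => yu (inl k)) (fun k => v0 (inr k)) (fun k => rm (inr k))
  (fun j k => vf j (inr k)) (fun i j k => cc i j (inr k)) h z zz.
have X3 := quad_expand (fun i k => vf i (inr k)) (fun j k => xvf j k) zzs.
have Y1 : \sum_k yu (inr k) * dx (inl k) = \sum_k yu (inr k) * (v0 (inl k) * h
    + \sum_j vf j (inl k) * z j + \sum_i \sum_j cc i j (inl k) * zz i j + rm (inl k)).
  by apply: eq_bigr => k _; rewrite ex.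
rewrite X1 in Y1.
have Y2 : \sum_k yu (inl k) * dx (inr k) = \sum_k yu (inl k) * (v0 (inr k) * h
    + \sum_j vf j (inr k) * z j + \sum_i \sum_j cc i j (inr k) * zz i j + rm (inr k)).
  by apply: eq_bigr => k _; rewrite ex.
rewrite X2 in Y2.
have Y4 : (\sum_k yu (inr k) * v0 (inl k)) * h - (\sum_k yu (inl k) * v0 (inr k)) * h = gH * h.
  by rewrite -mulrBl idH.
have Y5 : \sum_j (\sum_k yu (inr k) * vf j (inl k)) * z j
   - \sum_j (\sum_k yu (inl k) * vf j (inr k)) * z j = \sum_j gh j * z j.
  by rewrite -sumrB; apply: eq_bigr => j _; rewrite -mulrBl idh.
have Y6 : \sum_i \sum_j (\sum_k yu (inr k) * cc i j (inl k)) * zz i j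
   - \sum_i \sum_j (\sum_k yu (inl k) * cc i j (inr k)) * zz i j
   - \sum_i \sum_j gab i j * zz i j
   = \sum_k (\sum_i vf i (inr k) * z i) * (\sum_j xvf j k * z j).
  rewrite X3 -!sumrB; apply: eq_bigr => i _; rewrite -!sumrB; apply: eq_bigr => j _.
  by rewrite -!mulrBl id2.
have Z1 : \sum_k (yu (inr k) * dx (inl k) + pu k * (yv (inl k) - yu (inl k)))
  = \sum_k yu (inr k) * dx (inl k) + \sum_k pu k * (yv (inl k) - yu (inl k)).
  by rewrite big_split.
have Z2 : \sum_k pv k * yv (inl k) - \sum_k pu k * yu (inl k)
  = \sum_k pu k * (yv (inl k) - yu (inl k)) + \sum_k dx (inr k) * (yv (inl k) - yu (inl k))
  + \sum_k yu (inl k) * dx (inr k).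
  by rewrite -sumrB -!big_split /=; apply: eq_bigr => k _; rewrite dxE; ring.
have Z3 : \sum_k ((yv (inr k) - yu (inr k)) * rm (inl k)
     + dx (inr k) * (yv (inl k) - yu (inl k) - xv0 k * h - \sum_j xvf j k * z j
         - \sum_i \sum_j xcf i j k * zz i j))
  = \sum_k (yv (inr k) - yu (inr k)) * rm (inl k)
  + \sum_k dx (inr k) * (yv (inl k) - yu (inl k))
  - \sum_k dx (inr k) * (xv0 k * h + \sum_i \sum_j xcf i j k * zz i j)
  - \sum_k dx (inr k) * (\sum_j xvf j k * z j).
  by rewrite -!big_split /= -!sumrB; apply: eq_bigr => k _; ring.
have Z4 : \sum_k (dx (inr k) - \sum_i vf i (inr k) * z i) * (\sum_j xvf j k * z j)
  = \sum_k dx (inr k) * (\sum_j xvf j k * z j)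
  - \sum_k (\sum_i vf i (inr k) * z i) * (\sum_j xvf j k * z j).
  by rewrite -sumrB; apply: eq_bigr => k _; rewrite mulrBl.
rewrite Z1 Z2 Z3 Z4 -Y4 -Y5 -Y6 Y1 Y2.
ring.
Qed.

End VariationAlgebra.

Section Variation.
Context {R : realType} {N K : nat}.
Local Notation TQ := ('rV[R]_N * 'rV[R]_N)%type.
Variables (alpha t0 t1 : R) (Z : R -> 'rV[R]_K) (ZZ : R -> R -> 'M[R]_K).
Hypotheses (al3 : 3^-1 < alpha) (al2 : alpha <= 2^-1) (t01 : t0 <= t1).
Hypothesis rp : geometric_rough_path alpha Z ZZ t0 t1.
Variables (H : TQ -> R) (cH : TQ -> 'rV[R]_K).
Hypotheses (Hs : smooth H) (cHs : is_Cinf setT cH).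
Local Notation B := (@tqB R N).
Local Notation hj := (cHj cH).
Local Notation sol := (rough_hamilton_solution alpha t0 t1 Z ZZ H cH).
Local Notation V0 := (V0 H).
Local Notation Vf := (Vf cH).
Local Notation rem := (rem Z ZZ B V0 Vf).
Local Notation cf := (cf B Vf).
Local Notation ab := (ab cH).
Local Notation act := (rough_action Z ZZ H cH).

Record vgood (x0 : TQ) (r : R) : Prop := {
  vg_good : good B V0 Vf x0 r;
  vg_H : tame B H x0 r;
  vg_dH : forall l, tame B (pd B l H) x0 r;
  vg_h : forall j, tame B (hj j) x0 r;
  vg_dh : forall l j, tame B (pd B l (hj j)) x0 r;
  vg_dV0 : forall l k, tame B (pd B l (V0 k)) x0 r;
  vg_dcf : forall l i j k, tame B (pd B l (cf i j k)) x0 r }.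

Let hs j : smooth (hj j). Proof. exact: smooth_cHj. Qed.

Lemma vgood_exists x0 : exists2 r, 0 < r & vgood x0 r.
Proof.
have [r1 r10 h1] := good_exists Hs cHs x0.
have [r2 r20 h2] := smooth_tame B x0 Hs.
have [r3 r30 h3] : exists2 r, 0 < r & forall l, tame B (pd B l H) x0 r.
  by apply: smooth_tame_fin => l; exact: smooth_pd.
have [r4 r40 h4] := smooth_tame_fin B x0 hs.
have [r5 r50 h5] : exists2 r, 0 < r &
    forall u : ('I_N + 'I_N) * 'I_K, tame B (pd B u.1 (hj u.2)) x0 r.
  by apply: smooth_tame_fin => u; exact: smooth_pd.
have [r6 r60 h6] : exists2 r, 0 < r &
    forall u : ('I_N + 'I_N) * ('I_N + 'I_N), tame B (pd B u.1 (V0 u.2)) x0 r.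
  by apply: smooth_tame_fin => u; exact/smooth_pd/smooth_V0.
have [r7 r70 h7] : exists2 r, 0 < r &
    forall u : ('I_N + 'I_N) * 'I_K * 'I_K * ('I_N + 'I_N),
      tame B (pd B u.1.1.1 (cf u.1.1.2 u.1.2 u.2)) x0 r.
  by apply: smooth_tame_fin => u; exact/smooth_pd/smooth_cf.
pose r := Num.min r1 (Num.min r2 (Num.min r3 (Num.min r4 (Num.min r5 (Num.min r6 r7))))).
have [] : [/\ r <= r1, r <= r2, r <= r3 & [/\ r <= r4, r <= r5, r <= r6 & r <= r7]].
  by rewrite /r !ge_min !lexx !orbT.
move=> l1 l2 l3 [l4 l5 l6 l7].
exists r; first by rewrite !lt_min r10 r20 r30 r40 r50 r60.
split.
- case: h1 => g1 g2 g3 g4; split.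
  + by move=> k; exact: tame_le l1 (g1 k).
  + by move=> j k; exact: tame_le l1 (g2 j k).
  + by move=> l j k; exact: tame_le l1 (g3 l j k).
  + by move=> i j k; exact: tame_le l1 (g4 i j k).
- exact: tame_le l2 h2.
- by move=> l; exact: tame_le l3 (h3 l).
- by move=> j; exact: tame_le l4 (h4 j).
- by move=> l j; exact: tame_le l5 (h5 (l, j)).
- by move=> l k; exact: tame_le l6 (h6 (l, k)).
- by move=> l i j k; exact: tame_le l7 (h7 (l, i, j, k)).
Qed.

Variables (lo hi e1 r : R) (x0 : TQ) (Y : R -> R -> TQ) (yd : R -> R -> 'I_N + 'I_N -> R).
Variable Bp : R -> R -> R.
Hypotheses (t0lo : t0 <= lo) (hit1 : hi <= t1) (e10 : 0 < e1).
Let A : set R := [set e | `|e| < e1].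
Hypothesis vg : vgood x0 r.
Hypothesis hsol : forall e, A e -> sol (Y e).
Hypothesis hball : forall e s, A e -> lo <= s -> s <= hi -> `|Y e s - x0| < r.
Hypothesis hyd : forall e s l, A e -> lo <= s -> s <= hi ->
  is_derive e 1 (fun e => crd B (Y e s) l) (yd e s l).
Hypothesis ydb : exists C, forall e s l, A e -> lo <= s -> s <= hi -> `|yd e s l| <= C.
Hypothesis hBp : forall e s, A e -> lo <= s -> s <= hi ->
  is_derive e 1 (Bp s) (\sum_k crd B (Y e s) (inr k) * yd e s (inl k)).

Let lohi (e : R) : A e -> t0 <= lo /\ hi <= t1. Proof. by []. Qed.
Local Notation dom := (dom2 A (fun=> lo) (fun=> hi)).
Local Notation O := (bO dom (eta2 alpha)).
Local Notation sc := (scale2 al3 lohi).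
Let gd := vg_good vg.

Lemma comp_derive f e s : smooth f -> A e -> lo <= s -> s <= hi ->
  is_derive e 1 (fun e => f (Y e s)) (\sum_l yd e s l * pd B l f (Y e s)).
Proof.
move=> sf Ae ls sh.
have [r' r'0 [C C0 hC]] := smooth_tame B (Y e s) sf.
apply: (chain_curve (B := B) (x := fun e => Y e s) (d := fun l => pd B l f (Y e s)) r'0 C0).
  by move=> l; exact: hyd.
move=> y yr; by have [||_ _ h] := hC (Y e s) y; rewrite ?subrr ?normr0.
Qed.

Definition ell (u v e : R) : R :=
  \sum_k crd B (Y e u) (inr k) * crd B (Y e v - Y e u) (inl k)
  - H (Y e u) * (v - u) - \sum_j hj j (Y e u) * dZ Z u v j
  - \sum_i \sum_j ab i j (Y e u) * ZZ u v i j.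

(** Differentiating [ell] minus the boundary term leaves the product of the increment of [p] with
    the increment of the varied [q], and nothing is known about the latter as a function of time.
    The last sum is of order 3 itself, and its derivative contains the opposite product. *)
Definition kk (u v e : R) : R := ell u v e - (Bp v e - Bp u e)
  + \sum_k crd B (Y e v - Y e u) (inr k) * rem (Y e) (inl k) u v.

Definition xpd (e u : R) (f : TQ -> R) : R := \sum_l yd e u l * pd B l f (Y e u).

Definition dkk (u v e : R) : R :=
  \sum_k yd e u (inr k) * rem (Y e) (inl k) u v
  - \sum_k yd e u (inl k) * rem (Y e) (inr k) u v
  + \sum_k (yd e v (inr k) - yd e u (inr k)) * rem (Y e) (inl k) u v
  - \sum_k crd B (Y e v - Y e u) (inr k) * (xpd e u (V0 (inl k)) * (v - u)
      + \sum_i \sum_j xpd e u (cf i j (inl k)) * ZZ u v i j)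
  - \sum_k (crd B (Y e v - Y e u) (inr k) - \sum_i Vf i (inr k) (Y e u) * dZ Z u v i)
      * \sum_j xpd e u (Vf j (inl k)) * dZ Z u v j.

Lemma smooth_ab i j : smooth (ab i j).
Proof.
by apply: smooth_sum => k; apply: smoothM; exact: smooth_pd.
Qed.

Lemma kk_derive u v e : A e -> lo <= u -> u <= v -> v <= hi ->
  is_derive e 1 (kk u v) (dkk u v e).
Proof.
move=> Ae lu uv vh.
have lv := le_trans lu uv; have uh := le_trans uv vh.
have cd f : smooth f -> is_derive e 1 (fun e => f (Y e u)) (xpd e u f).
  by move=> sf; exact: comp_derive.
have dd l : is_derive e 1 (fun e => crd B (Y e v - Y e u) l) (yd e v l - yd e u l).
  have -> : (fun e => crd B (Y e v - Y e u) l) = fun e => crd B (Y e v) l - crd B (Y e u) l.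
    by apply/funext => e'; rewrite crdB.
  by apply: iderB; exact: hyd.
have dell := iderB (iderB (iderB
   (ider_sum (fun k => iderM (hyd (inr k) Ae lu uh) (dd (inl k))))
   (iderMc (v - u) (cd _ Hs)))
   (ider_sum (fun j => iderMc (dZ Z u v j) (cd _ (hs j)))))
   (ider_sum (fun i => ider_sum (fun j => iderMc (ZZ u v i j) (cd _ (smooth_ab i j))))).
have drem k := iderB (iderB (iderB (dd (inl k))
   (iderMc (v - u) (cd _ (smooth_V0 Hs (inl k)))))
   (ider_sum (fun j => iderMc (dZ Z u v j) (cd _ (smooth_Vf cHs j (inl k))))))
   (ider_sum (fun i => ider_sum (fun j => iderMc (ZZ u v i j) (cd _ (smooth_cf cHs i j (inl k)))))).
have dk := iderD (iderB dell (iderB (hBp Ae lv vh) (hBp Ae lu uh)))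
  (ider_sum (fun k => iderM (dd (inr k)) (drem k))).
apply: (is_derive_eq dk).
apply: (@kk_algebra R N K (yd e u) (yd e v) (fun l => crd B (Y e v - Y e u) l)
  (fun l => V0 l (Y e u)) (fun l => rem (Y e) l u v)
  (fun k => crd B (Y e u) (inr k)) (fun k => crd B (Y e v) (inr k))
  (fun k => xpd e u (V0 (inl k))) (fun j l => Vf j l (Y e u))
  (fun i j l => cf i j l (Y e u)) (xpd e u H) (fun j => xpd e u (hj j))
  (fun i j => xpd e u (ab i j)) (fun j k => xpd e u (Vf j (inl k)))
  (fun i j k => xpd e u (cf i j (inl k))) (v - u) (dZ Z u v) (fun i j => ZZ u v i j)).
- by move=> i j; apply: (ZZ_sym rp); [exact: le_trans lu|exact: uv|exact: le_trans vh _].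
- by move=> k; rewrite crdB.
- by move=> l; rewrite /rem; ring.
- exact: (ham_pairing H (yd e u) (Y e u)).
- by move=> j; exact: (ham_pairing (hj j) (yd e u) (Y e u)).
- by move=> i j; exact: (second_order_identity cHs i j (yd e u) (Y e u)).
Qed.

Let bX k f : tame B f x0 r -> (k = 0)%N -> O k (fun t => f (Y t.1.1 t.1.2)).
Proof. by move=> tf ->; exact: (bO_fX alpha hball tf). Qed.

Let byd l : O 0 (fun t => yd t.1.1 t.1.2 l) /\ O 0 (fun t => yd t.1.1 t.2 l).
Proof.
have [C hC] := ydb; split; exists C => -[[e u] v] [] /= Ae lu uv vh; rewrite expr0 mulr1.
  by apply: hC => //; exact: le_trans vh.
by apply: hC => //; exact: le_trans uv.
Qed.

Let bxpd f : (forall l, tame B (pd B l f) x0 r) -> O 0 (fun t => xpd t.1.1 t.1.2 f).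
Proof.
move=> tf; apply: bO_sum => l; apply: (bOM sc (k := 0) (l := 0)) => //; first exact: (byd l).1.
exact: bX.
Qed.

Let brem l := fam_rem al3 al2 t01 rp Hs cHs lohi gd hball hsol l.
Let bincr1 l := fam_incr1 al3 al2 t01 rp Hs cHs lohi gd hball hsol l.
Let bincr2 l := fam_incr2 al3 al2 t01 rp Hs cHs lohi gd hball hsol l.

(** Only bounded variations occur here: each sum pairs them with [rem], or with products of
    increments of orders 1 and 2. *)
Lemma bO_dkk : O 3 (fun t => dkk t.1.2 t.2 t.1.1).
Proof.
apply: bOB; [apply: bOB; [apply: bOD; [apply: bOB|]|]|]; apply: bO_sum => k.
- by apply: (bOM sc (k := 0) (l := 3)); [|exact: (byd _).1|exact: brem].
- by apply: (bOM sc (k := 0) (l := 3)); [|exact: (byd _).1|exact: brem].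
- apply: (bOM sc (k := 0) (l := 3)); [by []| |exact: brem].
  by apply: bOB; [exact: (byd _).2|exact: (byd _).1].
- apply: (bOM sc (k := 1) (l := 2)); [by []|exact: bincr1|].
  apply: bOD.
    apply: (bOM sc (k := 0) (l := 2)); [by []| |exact: (bO_h al3 al2 lohi)].
    by apply: bxpd => l; exact: (vg_dV0 vg).
  apply: bO_sum => i; apply: bO_sum => j.
  apply: (bOM sc (k := 0) (l := 2)); [by []| |exact: (bO_ZZ rp lohi i j)].
  by apply: bxpd => l; exact: (vg_dcf vg).
apply: (bOM sc (k := 2) (l := 1)); [by []|exact: bincr2|].
apply: bO_sum => j; apply: (bOM sc (k := 0) (l := 1)); [by []| |exact: (bO_dZ rp lohi j)].
by apply: bxpd => l; exact: (good_dVf gd).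
Qed.

(** The mean value inequality in [e] turns the bound on [dkk] into one on [kk] at [e] minus [kk] at
    0; [kk] differs from the action minus the boundary term by quantities of order 3. *)
Lemma variation : O 3 (fun t => act (Y t.1.1) t.1.2 t.2 - act (Y 0) t.1.2 t.2
   - (Bp t.2 t.1.1 - Bp t.1.2 t.1.1 - (Bp t.2 0 - Bp t.1.2 0))).
Proof.
have a0 : A 0 by rewrite /A /= normr0.
have hact : O 3 (fun t => act (Y t.1.1) t.1.2 t.2 - ell t.1.2 t.2 t.1.1) := fam_act al3 al2 t01 rp Hs cHs lohi gd hball hsol (conj (vg_H vg) (vg_dH vg))
  (fun j => conj (vg_h vg j) (fun l => vg_dh vg l j)).
have hpr : O 3 (fun t => \sum_k crd B (Y t.1.1 t.2 - Y t.1.1 t.1.2) (inr k)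
    * rem (Y t.1.1) (inl k) t.1.2 t.2).
  apply: bO_sum => k.
  by apply: (bOM sc (k := 1) (l := 3)); [|exact: bincr1|exact: brem].
have at0 F : O 3 F -> O 3 (fun t => F (0, t.1.2, t.2)).
  apply: (bO_pull (phi := fun t => (0, t.1.2, t.2))) => [t _|]; first exact: powR_ge0.
  by move=> -[[e u] v] [] /= Ae lu uv vh.
have hk : O 3 (fun t => kk t.1.2 t.2 t.1.1 - kk t.1.2 t.2 0).
  have [C C0 hC] := bO_ge0 sc bO_dkk.
  exists (C * e1) => -[[e u] v] [] /= Ae lu uv vh.
  have eta0 : 0 <= eta2 alpha (0 : R, u, v) ^+ 3 by rewrite exprn_ge0 // powR_ge0.
  apply: (@le_trans _ _ (C * eta2 alpha (0 : R, u, v) ^+ 3 * `|e|)).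
    apply: mvt_bound; first exact: mulr_ge0.
    move=> t te; have At : A t by exact: le_lt_trans te Ae.
    by split; [exact: kk_derive|exact: (hC (t, u, v))].
  rewrite mulrAC; apply: ler_wpM2r => //; apply: ler_wpM2l => //; exact: ltW.
apply: bO_eq (bOD (bOB hact (at0 _ hact)) (bOB hk (bOB hpr (at0 _ hpr)))).
move=> [[e u] v] _; cbn [fst snd]; rewrite /kk.
move: (act (Y e) u v) (act (Y 0) u v) (ell u v e) (ell u v 0) => a1 a2 l1 l2.
move: (\sum_k _) (\sum_k _) (Bp v e) (Bp u e) (Bp v 0) (Bp u 0) => s1 s2 b1 b2 b3 b4.
ring.
Qed.

End Variation.

(** * Continuity and primitives along a line of data *)

Section LineContinuity.
Context {R : realType}.

Lemma continuous_crd_line {V W : normedModType R} {I : finType} (B : coords W I)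
    (g : V -> W) (x0 w : V) (e : R) l : {for x0 + e *: w, continuous g} ->
  {for e, continuous (fun e : R => crd B (g (x0 + e *: w)) l)}.
Proof.
move=> cg.
have cl : {for e, continuous (fun e : R => x0 + e *: w)}.
  by apply: cvgD; [exact: cvg_cst|apply: cvgZr_tmp; exact: cvg_id].
have cgl : {for e, continuous (g \o (fun e : R => x0 + e *: w))} by exact: continuous_comp.
apply/cvgrPdist_le => d d0; have /cvgrPdist_le/(_ d d0) := cgl.
by apply: filterS => y; rewrite -crdB; apply: le_trans; exact: crd_le.
Qed.

Lemma continuous_sumr (I : finType) (f : I -> R -> R) (e : R) :
  (forall i, {for e, continuous (f i)}) -> {for e, continuous (fun e => \sum_i f i e)}.
Proof.
move=> h; rewrite (_ : (fun e => _) = \sum_i f i); last by apply/funext => x; rewrite fct_sumE.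
elim/big_ind : _ => [|u v hu hv|i _]; [exact: cvg_cst|exact: cvgD|exact: h].
Qed.

(** Yields the functions [Bp], primitives of the boundary pairing in the parameter; integrating from
    [- e0] makes 0 an interior point. *)
Lemma symmetric_primitive (f : R -> R) (e0 : R) :
  (forall e, `|e| <= e0 -> {for e, continuous f}) ->
  exists F : R -> R, forall e : R, `|e| < e0 -> is_derive e 1 F (f e).
Proof.
move=> hf; exists (fun x => \int[lebesgue_measure]_(r in `[- e0, x]) f r) => e.
rewrite ltr_norml => /andP[h1 h2].
have fi : lebesgue_measure.-integrable `[- e0, e0] (EFin \o f).
  apply: continuous_itv_integrable; apply: continuous_in_subspaceT => x.
  by rewrite inE /= in_itv /= -ler_norml => /hf.
have ce : {for e, continuous f} by apply: hf; rewrite ler_norml !ltW.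
have [d de] := continuous_FTC1_closed h2 fi h1 ce.
exact: (DeriveDef d (etrans (esym (derive1E _ _)) de)).
Qed.

End LineContinuity.

Lemma common_cst {R : realType} (C d e : R) : 0 < d -> 0 < e ->
  exists2 C', 0 < C' & [/\ C <= C', C'^-1 <= d & C'^-1 <= e].
Proof.
move=> d0 e0; have d0' : 0 < d^-1 by rewrite invr_gt0.
have e0' : 0 < e^-1 by rewrite invr_gt0.
have C0 : 0 < `|C| + d^-1 + e^-1 by rewrite ltr_wpDl // ltW // ltr_wpDl.
exists (`|C| + d^-1 + e^-1) => //; split.
- by rewrite -addrA (le_trans (ler_norm C)) // lerDl ltW // addr_gt0.
- rewrite -[leRHS]invrK lef_pV2 ?posrE // addrAC lerDr ltW // ltr_wpDl //; exact: normr_ge0.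
- by rewrite -[leRHS]invrK lef_pV2 ?posrE // lerDr ltW // ltr_wpDl.
Qed.

(** * Gradient of the generating function *)

Section Branch.
Context {R : realType} {N K : nat}.
Local Notation TQ := ('rV[R]_N * 'rV[R]_N)%type.
Variables (alpha t0 t1 : R) (Z : R -> 'rV[R]_K) (ZZ : R -> R -> 'M[R]_K).
Hypotheses (al3 : 3^-1 < alpha) (al2 : alpha <= 2^-1) (t01 : t0 <= t1).
Hypothesis rp : geometric_rough_path alpha Z ZZ t0 t1.
Variables (H : TQ -> R) (cH : TQ -> 'rV[R]_K).
Hypotheses (Hs : smooth H) (cHs : is_Cinf setT cH).
Variables (Om : R -> set TQ) (Phi : R -> R -> TQ -> TQ).
Variables (D : R -> R -> set TQ) (sol : R -> R -> TQ -> R -> TQ).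
Hypothesis br : nondegenerate_branch alpha t0 t1 Z ZZ H cH Om Phi D sol.
Local Notation B := (@tqB R N).
Local Notation act := (rough_action Z ZZ H cH).
Local Notation gen := (gen_fun Z ZZ H cH sol).

Lemma branch_near t s x : D t s x -> exists2 d, 0 < d & forall t' s' y,
  `|t' - t| < d -> `|s' - s| < d -> `|y - x| < d -> D t' s' !=set0 -> D t' s' y.
Proof.
move=> /(branch_open br)[[U1 U2] [/= [[U3 U4] [/= n3 n4] h34] n2] h].
move/nbhs_normP: n3 => [d3 d30 h3]; move/nbhs_normP: n4 => [d4 d40 h4].
move/nbhs_normP: n2 => [d2 d20 h2].
exists (Num.min d2 (Num.min d3 d4)); first by rewrite !lt_min d20 d30.
move=> t' s' y; rewrite !lt_min => /and3P[_ t3 _] /and3P[_ _ s4] /and3P[y2 _ _].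
apply: (h ((t', s'), y)); split => /=.
  apply: (h34 (t', s')); split => /=; [apply: h3|apply: h4] => /=;
    by rewrite -normrN opprB.
by apply: h2 => /=; rewrite -normrN opprB.
Qed.

Lemma sol_near t s x r e : D t s x -> t0 <= r <= t1 -> 0 < e ->
  exists2 d, 0 < d & forall t' s' y r', `|t' - t| < d -> `|s' - s| < d ->
    `|y - x| < d -> `|r' - r| < d -> D t' s' y -> t0 <= r' <= t1 ->
    `|sol t' s' y r' - sol t s x r| < e.
Proof.
move=> Dx rt e0.
have [/subspace_continuousP hc _] := branch_smooth br 0.
have := hc (((t, s), r), x) (conj Dx rt) => /cvgrPdist_lt/(_ e e0).
rewrite near_withinE => -[[U1 U2] [/= [[U3 U4] [/= [[U5 U6] [/= n5 n6] h56] n4] h34] n2] h].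
move/nbhs_normP: n5 => [d5 d50 h5]; move/nbhs_normP: n6 => [d6 d60 h6].
move/nbhs_normP: n4 => [d4 d40 h4]; move/nbhs_normP: n2 => [d2 d20 h2].
exists (Num.min (Num.min d5 d6) (Num.min d4 d2)); first by rewrite !lt_min d50 d60 d40.
move=> t' s' y r'; rewrite !lt_min => /andP[/andP[t5 _] _] /andP[/andP[_ s6] _].
move=> /andP[_ /andP[_ y2]] /andP[_ /andP[r4 _]] D' r't.
rewrite -normrN opprB; apply: (h (((t', s'), r'), y)) => //=; split => /=.
  apply: (h34 ((t', s'), r')); split => /=.
    apply: (h56 (t', s')); split => /=; [apply: h5|apply: h6] => /=;
      by rewrite -normrN opprB.
  by apply: h4 => /=; rewrite -normrN opprB.
by apply: h2 => /=; rewrite -normrN opprB.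
Qed.

Definition tseg : set R := [set r | t0 <= r <= t1].

Lemma sol_Cloc n t s x r : D t s x -> t0 <= r <= t1 ->
  Cloc n (within tseg (nbhs r)) x (fun r y => sol t s y r).
Proof.
move=> Dx rt; have FF : Filter (within tseg (nbhs r)) by exact: within_filter.
apply: (Cloc_of_family FF (phi := fun r => ((t, s), r)) (a0 := ((t, s), r)) _ _ _
  (branch_smooth br n)).
- move=> W [[U1 U2] [/= n1 n2] h]; rewrite /fmap /= /within /=.
  apply: filterS n2 => r' r'2 _; apply: h; split => //=; exact: nbhs_singleton.
- by split.
have [d d0 hd] := branch_near Dx.
exists d => //; rewrite /within /=; apply: nearW => r' r't y yx; split => //.
by apply: hd => //=; rewrite ?subrr ?normr0 //; exists x.
Qed.

Lemma tseg_within (Q : set R) r : t0 <= r <= t1 -> within tseg (nbhs r) Q -> Q r.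
Proof. by move=> rt /nbhs_singleton; apply. Qed.

Section Gradient.
Variables (t s : R) (x0 w : TQ).
Hypothesis Dx0 : D t s x0.

Let Y (e r : R) : TQ := sol t s (x0 + e *: w) r.
Let yd (e r : R) l : R := crd B ('D_w (fun x => sol t s x r) (x0 + e *: w)) l.
Let bb (r e : R) : R := \sum_k crd B (Y e r) (inr k) * yd e r (inl k).

Lemma dir_small d : 0 < d -> exists2 e, 0 < e & forall e', `|e'| < e -> `|(x0 + e' *: w) - x0| < d.
Proof.
move=> d0; have w0 : 0 < `|w| + 1 by rewrite ltr_wpDl.
exists (d / (`|w| + 1)); first exact: divr_gt0.
move=> e'; rewrite ltr_pdivlMr // => h; rewrite addrC addKr normrZ.
by apply: le_lt_trans h; apply: ler_wpM2l => //; rewrite lerDl.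
Qed.

Lemma dir_branch : exists2 e, 0 < e & forall e', `|e'| < e -> D t s (x0 + e' *: w).
Proof.
have [d d0 hd] := branch_near Dx0; have [e e00 he] := dir_small d0.
exists e => // e' /he h; apply: hd; rewrite ?subrr ?normr0 //.
by exists x0.
Qed.

Lemma dir_derive e r l : D t s (x0 + e *: w) -> t0 <= r <= t1 ->
  is_derive e 1 (fun e => crd B (Y e r) l) (yd e r l).
Proof.
move=> De rt; have [_ /(_ w)[hd _]] := branch_smooth br 1.
have := hd (((t, s), r), x0 + e *: w) (conj De rt) => /= dd.
have := is_derive_crd B l dd.
exact: (is_derive_line (f := fun x => crd B (sol t s x r) l)).
Qed.

Lemma sol_cont x r : D t s x -> t0 <= r <= t1 ->
  {for x, continuous (fun y => sol t s y r)} /\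
  {for x, continuous ('D_w (fun y => sol t s y r))}.
Proof.
move=> Dx rt; have xx : `|x - x| < 1 by rewrite subrr normr0.
have [[d1 d10 /(tseg_within rt) h1] _ /(_ w)[_ [[d2 d20 /(tseg_within rt) h2] _ _]]] :=
  sol_Cloc 1 Dx rt.
by split; [apply: h1|apply: h2]; rewrite subrr normr0.
Qed.

Lemma dir_continuous e r : D t s (x0 + e *: w) -> t0 <= r <= t1 ->
  {for e, continuous (bb r)}.
Proof.
move=> De rt; have [c1 c2] := sol_cont De rt.
apply: continuous_sumr => k; apply: continuousM.
  exact: (continuous_crd_line (g := fun y => sol t s y r)).
exact: (continuous_crd_line (g := 'D_w (fun y => sol t s y r))).
Qed.

Section Primitive.
Variables (Bp : R -> R -> R) (e1 : R).
Hypotheses (e10 : 0 < e1) (hD : forall e : R, `|e| < e1 -> D t s (x0 + e *: w)).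
Hypothesis hBp : forall r e : R, t0 <= r <= t1 -> `|e| < e1 -> is_derive e 1 (Bp r) (bb r e).

Let defect (u v e : R) : R := act (Y e) u v - act (Y 0) u v
  - (Bp v e - Bp u e - (Bp v 0 - Bp u 0)).

(** Near [r0] and for small [e] all solutions lie in one ball where [vgood] holds and their
    variations are bounded, so [variation] applies. *)
Lemma dir_local r0 : t0 <= r0 <= t1 -> exists2 C, 0 < C & forall u v e,
  `|u - r0| < C^-1 -> `|v - r0| < C^-1 -> t0 <= u -> u <= v -> v <= t1 ->
  `|e| < C^-1 -> `|defect u v e| <= C * ((v - u) `^ alpha) ^+ 3.
Proof.
move=> rt; have [r r_0 vg] := vgood_exists Hs cHs (sol t s x0 r0).
have [d d0 hd] := sol_near Dx0 rt r_0.
have [_ _ /(_ w)[_ [_ [M [d3 d30 /nbhs_normP[d4 /= d40 h4]]] _]]] := sol_Cloc 1 Dx0 rt.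
have [e2 e20 he2] := dir_small d0; have [e3 e30 he3] := dir_small d30.
pose e' := Num.min e1 (Num.min e2 e3).
have e'0 : 0 < e' by rewrite !lt_min e10 e20.
pose d' := Num.min d d4 / 2.
have d'0 : 0 < d' by rewrite divr_gt0 // lt_min d0.
have d'm : d' < Num.min d d4 by rewrite ltr_pdivrMr // ltr_pMr ?ltr1n // lt_min d0.
pose lo := Num.max t0 (r0 - d'); pose hi := Num.min t1 (r0 + d').
have t0lo : t0 <= lo by rewrite le_max lexx.
have hit1 : hi <= t1 by rewrite ge_min lexx.
have inn r' : lo <= r' -> r' <= hi -> [/\ t0 <= r' <= t1, `|r' - r0| < d & `|r' - r0| < d4].
  rewrite ge_max le_min => /andP[a1 a2] /andP[a3 a4].
  have : `|r' - r0| <= d' by rewrite ler_norml; apply/andP; split; lra.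
  by move=> /le_lt_trans/(_ d'm); rewrite lt_min a1 a3 => /andP[].
have Ae e : `|e| < e' -> [/\ `|e| < e1, `|x0 + e *: w - x0| < d & `|x0 + e *: w - x0| < d3].
  by rewrite !lt_min => /and3P[? /he2 ? /he3 ?].
have [] := @variation R N K alpha t0 t1 Z ZZ al3 al2 t01 rp H cH Hs cHs lo hi e' r
  (sol t s x0 r0) Y yd Bp t0lo hit1 e'0 vg.
- by move=> e /Ae[/hD/(branch_sol br)].
- move=> e r' /Ae[/hD De ed _] l1 l2; have [rt' rd _] := inn _ l1 l2.
  have dd (x : R) : `|x - x| < d by rewrite subrr normr0.
  exact: (hd t s (x0 + e *: w) r' (dd t) (dd s) ed rd De rt').
- move=> e r' l /Ae[/hD De _ _] l1 l2; have [rt' _ _] := inn _ l1 l2; exact: dir_derive.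
- exists M => e r' l /Ae[_ _ e3'] l1 l2; have [rt' _ r4] := inn _ l1 l2.
  apply: le_trans (crd_le _ _ _) _; apply: (h4 r') => //=.
  by rewrite -normrN opprB.
- move=> e r' /Ae[ee _ _] l1 l2; have [rt' _ _] := inn _ l1 l2; exact: hBp.
move=> C hC; have [C' C'0 [CC' Cd' Ce']] := common_cst C d'0 e'0.
exists C' => // u v e ur vr tu uv vt eC.
apply: (@le_trans _ _ (C * ((v - u) `^ alpha) ^+ 3)).
  apply: (hC (e, u, v)); split => /=; first exact: lt_le_trans eC Ce'.
  - rewrite ge_max tu /=; move: ur => /lt_le_trans/(_ Cd').
    by rewrite ltr_norml => /andP[? _]; lra.
  - by [].
  - rewrite le_min vt /=; move: vr => /lt_le_trans/(_ Cd').
    by rewrite ltr_norml => /andP[_ ?]; lra.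
by apply: ler_wpM2r => //; rewrite exprn_ge0 // powR_ge0.
Qed.

(** The defect is additive in time by [act_add], and of order 3 on short intervals, hence zero. *)
Lemma dir_global : exists2 C, 0 < C & forall e, `|e| < C^-1 -> defect s t e = 0.
Proof.
have [ts st tt] := branch_time br Dx0.
(* The separate [C0 <= C] makes [Q] monotone in [C], although the admissible range of [e] shrinks as
   the constant grows. *)
pose Q C u v := exists2 C0, 0 < C0 <= C & t0 <= u -> u <= v -> v <= t1 ->
  forall e, `|e| < C0^-1 -> `|defect u v e| <= C0 * ((v - u) `^ alpha) ^+ 3.
have [] := @seg_uniform R t0 t1 Q.
- move=> C C' u v CC' [C0 /andP[C00 C0C] h]; exists C0 => //.
  by rewrite C00 (le_trans C0C).
- move=> r0 /dir_local[C C0 h]; exists C => // u v ur vr.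
  by exists C => [|tu uv vt e eC]; [rewrite C0 lexx|exact: h].
move=> C C0 hC; have Ci : 0 < C^-1 by rewrite invr_gt0.
have [C2 C20 [_ C2e C2C]] := common_cst 0 e10 Ci.
exists C2 => // e e2; have ee := lt_le_trans e2 C2e; have eC := lt_le_trans e2 C2C.
pose phi r := act (Y e) t0 r - act (Y 0) t0 r - (Bp r e - Bp r 0).
have phiE u v : t0 <= u -> u <= v -> v <= t1 -> phi v - phi u = defect u v e.
  move=> tu uv vt; rewrite /phi /defect.
  rewrite (act_add al3 al2 t01 rp Hs cHs (branch_sol br (hD ee)) (lexx t0) tu uv vt).
  have e00 : `|0 : R| < e1 by rewrite normr0.
  rewrite (act_add al3 al2 t01 rp Hs cHs (branch_sol br (hD e00)) (lexx t0) tu uv vt).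
  move: (act (Y e) t0 u) (act (Y e) u v) (act (Y 0) t0 u) (act (Y 0) u v) => a1 a2 a3 a4.
  move: (Bp v e) (Bp u e) (Bp v 0) (Bp u 0) => b1 b2 b3 b4.
  by ring.
(* The sums of the zero germ converge to the increment of [phi], and also to 0. *)
have h1 : sum_lim (fun _ _ => 0) s t (phi t - phi s).
  apply: (@sum_lim_increment R _ phi s t C (3 * alpha) C^-1 (alpha3_gt1 al3) Ci).
  move=> u v su uv vt uvC; have vt1 : v <= t1 := le_trans vt tt.
  have tu := le_trans ts su.
  have [||C1 /andP[C10 C1C] /(_ tu uv vt1) h] := hC u v _ _.
  - by rewrite tu (le_trans uv).
  - by rewrite ger0_norm // subr_ge0.
  rewrite sub0r normrN phiE // powR_alpha ?subr_ge0 //.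
  apply: (@le_trans _ _ (C1 * ((v - u) `^ alpha) ^+ 3)).
    by apply: h; apply: lt_le_trans eC _; rewrite lef_pV2 ?posrE.
  by apply: ler_wpM2r => //; rewrite exprn_ge0 // powR_ge0.
have h2 : sum_lim (fun _ _ => 0) s t ((fun _ : R => 0 : R) t - (fun _ : R => 0) s).
  apply: (@sum_lim_increment R _ (fun=> 0) s t 0 (3 * alpha) 1 (alpha3_gt1 al3) ltr01).
  by move=> u v *; rewrite subrr subr0 normr0 mul0r.
have := sum_lim_unique st h1 h2; rewrite phiE //.
  by rewrite subrr.
Qed.

End Primitive.

Lemma dir_act : is_derive (0 : R) 1 (fun e : R => act (Y e) s t) (bb t 0 - bb s 0).
Proof.
have [ts st tt] := branch_time br Dx0.
have [e0 e00 hD] := dir_branch; pose e1 := e0 / 2.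
have e10 : 0 < e1 by rewrite divr_gt0.
have e1e : e1 < e0 by rewrite ltr_pdivrMr // ltr_pMr ?ltr1n.
have [Bp hBp] : exists Bp : R -> R -> R, forall r, t0 <= r <= t1 ->
    forall e : R, `|e| < e1 -> is_derive e 1 (Bp r) (bb r e).
  have /choice[Bp hBp] : forall r, exists F : R -> R, t0 <= r <= t1 ->
      forall e : R, `|e| < e1 -> is_derive e 1 F (bb r e).
    move=> r; have [rt|nrt] := boolP (t0 <= r <= t1); last by exists (fun=> 0).
    have [e ee|F hF] := @symmetric_primitive R (bb r) e1; last by exists F.
    by apply: dir_continuous => //; apply: hD; exact: le_lt_trans ee e1e.
  by exists Bp.
have hD1 (e : R) : `|e| < e1 -> D t s (x0 + e *: w) by move=> ee; apply: hD; exact: lt_trans e1e.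
have [C C0 hC] := @dir_global Bp e1 e10 hD1 (fun r e rt => hBp r rt e).
have z0 : `|0 : R| < e1 by rewrite normr0.
have tt0 : t0 <= t <= t1 by rewrite (le_trans ts st).
have ss0 : t0 <= s <= t1 by rewrite ts (le_trans st tt).
have := iderD (ider_cst (act (Y 0) s t - (Bp t 0 - Bp s 0)) 0)
  (iderB (hBp t tt0 0 z0) (hBp s ss0 0 z0)).
rewrite add0r; apply: near_eq_is_derive.
apply: near_norm; exists C^-1; first by rewrite invr_gt0.
move=> e; rewrite subr0 => /hC.
move: (act (Y e) s t) (act (Y 0) s t) => a1 a2.
move: (Bp t e) (Bp s e) (Bp t 0) (Bp s 0) => b1 b2 b3 b4 h.
by apply/eqP; rewrite eq_sym -subr_eq0; apply/eqP; rewrite -[RHS]h; ring.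
Qed.

Lemma gen_funE x : gen t s x = dotr x.2 (sol t s x t).1 - act (sol t s x) s t.
Proof.
rewrite /gen_fun /rough_action.
move: (dotr _ _) (rough_int _ _ _ _ _ _ _) (\int[_]_(_ in _) _) (rough_int_comp _ _ _ _ _ _ _).
by move=> a b c d; ring.
Qed.

(** The final momentum is the datum [p], so the variation of the final position cancels between the
    pairing and the action; the initial position is the datum [q], so its variation is [w.1]. *)
Theorem branch_gradient : is_derive x0 w (gen t s)
  (dotr w.2 (sol t s x0 t).1 + dotr (sol t s x0 s).2 w.1).
Proof.
have [ts st tt] := branch_time br Dx0.
have tt0 : t0 <= t <= t1 by rewrite (le_trans ts st).
have ss0 : t0 <= s <= t1 by rewrite ts (le_trans st tt).
have [bs bt] := branch_bdry br Dx0.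
have D0 : D t s (x0 + (0 : R) *: w) by rewrite scale0r addr0.
have Y0 : Y 0 = sol t s x0 by rewrite /Y scale0r addr0.
(* The position at time [s] equals its datum on the whole branch, so it is affine in [e] near 0. *)
have ysE k : yd 0 s (inl k) = w.1 0 k.
  have [e0 e00 hD] := dir_branch.
  have h1 := dir_derive (inl k) D0 ss0.
  have h2 : is_derive (0 : R) 1 (fun e : R => x0.1 0 k + e * w.1 0 k) (w.1 0 k).
    by have := iderD (ider_cst (x0.1 0 k) 0) (is_derive_mulrC (w.1 0 k) 0); rewrite add0r.
  have h3 : is_derive (0 : R) 1 (fun e : R => crd B (Y e s) (inl k)) (w.1 0 k).
    apply: near_eq_is_derive h2; apply: near_norm; exists e0 => // e.
    rewrite subr0 => /hD De; have [bs' _] := branch_bdry br De.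
    by rewrite -rVcrd_fst bs' !mxE.
  by rewrite -(@derive_val _ _ _ _ _ _ _ h1) (@derive_val _ _ _ _ _ _ _ h3).
apply: is_derive_of_line.
have hdot : is_derive (0 : R) 1 (fun e : R => dotr (x0 + e *: w).2 (Y e t).1)
    (\sum_k (w.2 0 k * crd B (Y 0 t) (inl k) + x0.2 0 k * yd 0 t (inl k))).
  apply: ider_sum => k.
  have hx : is_derive (0 : R) 1 (fun e : R => (x0 + e *: w).2 0 k) (w.2 0 k).
    have := iderD (ider_cst (x0.2 0 k) 0) (is_derive_mulrC (w.2 0 k) 0); rewrite add0r.
    by congr is_derive; apply/funext => e; rewrite !mxE.
  have := iderM hx (dir_derive (inl k) D0 tt0).
  by rewrite scale0r addr0.
have := iderB hdot dir_act.
suff -> : \sum_k (w.2 0 k * crd B (Y 0 t) (inl k) + x0.2 0 k * yd 0 t (inl k))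
   - (bb t 0 - bb s 0) = dotr w.2 (sol t s x0 t).1 + dotr (sol t s x0 s).2 w.1.
  by congr is_derive; apply/funext => e; rewrite gen_funE.
rewrite /bb -!sumrB /dotr -!big_split; apply: eq_bigr => k _.
cbv beta; rewrite ysE Y0 -!rVcrd_fst -[crd B (sol t s x0 t) (inr k)]/((sol t s x0 t).2 0 k) bt.
rewrite -[crd B (sol t s x0 s) (inr k)]/((sol t s x0 s).2 0 k).
move: (yd 0 t (inl k)) ((sol t s x0 t).1 0 k) ((sol t s x0 s).2 0 k) => y q p /=.
by ring.
Qed.

End Gradient.
End Branch.

(** * Derivatives of families near a point *)

Section FamilyLemmas.
Context {R : realType} {V : normedModType R}.

Lemma is_Cn_family_cst {P0 : topologicalType} {W : normedModType R} n (U : set V) (f : V -> W) :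
  is_Cn n U f -> is_Cn_family n [set z : P0 * V | U z.2] (fun=> f).
Proof.
elim: n f => [|n IH] f [/subspace_continuousP hc hd].
all: have k : {within [set z : P0 * V | U z.2], continuous (fun z => f z.2)}.
1,3: apply/subspace_continuousP => z Uz Q /(hc _ Uz) h;
  exists (setT, [set y | U y -> Q (f y)]) => //=;
  [by split => //; exact: filterT|by move=> z' [_ /= h'] /h'].
  by split.
by split => // v; have [h1 h2] := hd v; split; [move=> z /h1|exact: IH].
Qed.

Lemma Cloc_open {P : Type} {W : normedModType R} (F : set_system P) (FF : Filter F)
    n (U : set V) (x0 : V) (f : V -> W) :
  open U -> U x0 -> is_Cn n U f -> Cloc n F x0 (fun=> f).
Proof.
move=> oU Ux0 hf.
apply: (Cloc_of_family FF (phi := fun=> 0 : R) (a0 := 0 : R) _ _ _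
  (is_Cn_family_cst (P0 := R) hf)) => //=.
  exact: cvg_cst.
have /nbhs_normP[r r0 hr] : nbhs x0 U by exact: open_nbhs_nbhs.
exists r => //; apply: filterE => a x xr; apply: hr => /=.
by rewrite -normrN opprB.
Qed.

Context {P : Type} (F : set_system P) (FF : Filter F).

Lemma nearF_within {P0 : topologicalType} (D : set (P0 * V)) (Q : P0 * V -> Prop)
    (phi : P -> P0) (a0 : P0) (x0 : V) :
  phi @ F --> a0 -> nearF F x0 (fun a x => D (phi a, x)) ->
  (\forall z \near within D (nbhs (a0, x0)), Q z) -> nearF F x0 (fun a x => Q (phi a, x)).
Proof.
move=> hphi [s s0 hs].
rewrite near_withinE => -[[U1 U2] [/= n1 /nbhs_normP[r r0 hr]] hU12].
exists (Num.min r s); first by rewrite lt_min r0.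
have n1' : F (phi @^-1` U1) := hphi _ n1.
apply: filterS2 n1' hs => a ha hsa x; rewrite lt_min => /andP[xr xs].
apply: (hU12 (phi a, x)); last exact: hsa.
by split => //=; apply: hr => /=; rewrite -normrN opprB.
Qed.

(* Linearity of the directional derivatives of [f], together with the joint
   continuity of the partial ones. *)
Lemma family_pd_near {P0 : topologicalType} {W : normedModType R} {I J : finType}
    (B : coords V I) (C : coords W J) (D : set (P0 * V)) (f : P0 -> V -> W)
    (phi : P -> P0) (a0 : P0) (x0 : V) eta :
  phi @ F --> a0 -> D (a0, x0) -> nearF F x0 (fun a x => D (phi a, x)) ->
  is_Cn_family 1 D f -> 0 < eta ->
  nearF F x0 (fun a x => forall l, (forall w, is_derive x w (fun y => crd C (f (phi a) y) l)
      (\sum_i crd B w i * pd B i (fun y => crd C (f (phi a) y) l) x)) /\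
    forall i, `|pd B i (fun y => crd C (f (phi a) y) l) x
                - pd B i (fun y => crd C (f a0 y) l) x0| <= eta).
Proof.
move=> hphi D0 hD hf e0; apply: (nearF_fin FF) => l.
have h1 := Cloc_is_derive FF B (Cloc_crd FF C l (Cloc_of_family FF hphi D0 hD hf)).
have h2 : nearF F x0 (fun a x => forall i, `|pd B i (fun y => crd C (f (phi a) y) l) x
                - pd B i (fun y => crd C (f a0 y) l) x0| <= eta).
  apply: (nearF_fin FF) => i.
  have [_ /(_ (bas B i))[hd [/subspace_continuousP hc _]]] := hf.
  have := hc _ D0 => /cvgrPdist_le/(_ _ e0) /(nearF_within hphi hD) h.
  apply: (nearF_imp FF) (nearF_and FF hD h) => a x [Da] /=.
  rewrite !pdE.
  have [_ ->] := is_derive_crd C l (hd _ Da).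
  have [_ ->] := is_derive_crd C l (hd _ D0).
  move=> h'; rewrite -crdB -normrN -crdN opprB.
  exact: le_trans (crd_le _ _ _) h'.
by apply: (nearF_imp FF) (nearF_and FF h1 h2).
Qed.

End FamilyLemmas.

(** * Local uniqueness and continuation along the branch *)

Section Continuation.
Context {R : realType} {N K : nat}.
Local Notation TQ := ('rV[R]_N * 'rV[R]_N)%type.
Variables (alpha t0 t1 : R) (Z : R -> 'rV[R]_K) (ZZ : R -> R -> 'M[R]_K).
Variables (H : TQ -> R) (cH : TQ -> 'rV[R]_K).
Variables (Om : R -> set TQ) (Phi : R -> R -> TQ -> TQ).
Variables (D : R -> R -> set TQ) (sol : R -> R -> TQ -> R -> TQ).
Hypothesis br : nondegenerate_branch alpha t0 t1 Z ZZ H cH Om Phi D sol.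
Local Notation B := (@tqB R N).

Let fl := branch_flow br.

Lemma flow_pd_near s x t eta : Om s x -> t0 <= t <= t1 -> 0 < eta ->
  exists2 d, 0 < d & forall t' s' y, t0 <= t' <= t1 -> t0 <= s' <= t1 ->
    `|t' - t| < d -> `|s' - s| < d -> `|y - x| < d ->
    forall l, (forall w, is_derive y w (fun z => crd B (Phi t' s' z) l)
      (\sum_i crd B w i * pd B i (fun z => crd B (Phi t' s' z) l) y)) /\
    forall i, `|pd B i (fun z => crd B (Phi t' s' z) l) y
                - pd B i (fun z => crd B (Phi t s z) l) x| <= eta.
Proof.
move=> Ox tt e0; pose T2 : set (R * R) := [set a | t0 <= a.1 <= t1 /\ t0 <= a.2 <= t1].
have ss := flow_time fl Ox.
pose F := within T2 (nbhs (t, s)).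
have FF : Filter F by exact: within_filter.
have hphi : (@id (R * R)) @ F --> (t, s) by move=> U hU; apply: filterS hU => a Ua _.
have hD : nearF F x (fun a y => t0 <= a.1 <= t1 /\ Om a.2 y).
  have [[U1 U2] [/= n1 /nbhs_normP[r r0 hr]] h] := flow_open fl Ox.
  exists r => //; have n1' : nbhs (t, s) [set a : R * R | U1 a.2].
    exact: (cvg_snd n1).
  apply: filterS n1' => a Ua [a1 a2] y yr; split => //.
  apply: (h (a.2, y)) => //; split => //=; apply: hr => /=.
  by rewrite -normrN opprB.
have [r r0 /nbhs_normP[d /= d0 hd]] :=
  family_pd_near FF B B hphi (conj tt Ox) hD (flow_smooth fl 1%N) e0.
exists (Num.min r d); first by rewrite lt_min r0.
move=> t' s' y tt' ss'; rewrite !lt_min => /andP[_ td] /andP[_ sd] /andP[yr _].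
apply: (hd (t', s')) => //=; rewrite /ball_ /= -normrN opprB.
by rewrite [X in X < _]/Num.Def.normr /= gt_max td.
Qed.

Lemma norm_pair1 (x y : 'rV[R]_N) d : `|x| < d -> `|y| < d -> `|(x, y) : TQ| < d.
Proof. by move=> xd yd; rewrite [X in X < _]/Num.Def.normr /= gt_max xd. Qed.

Lemma crd_inr_le (y : 'rV[R]_N) i : `|crd B (0 : 'rV[R]_N, y) i| <= `|y|.
Proof.
case: i => k; last exact: rV_norm_ge.
by rewrite -rVcrd_fst /fst mxE normr0.
Qed.

(** The smooth inverse is locally Lipschitz. *)
Lemma diffeo_expands (f : 'rV[R]_N -> 'rV[R]_N) m : local_diffeo_at f m ->
  exists2 L, 0 <= L & exists2 d, 0 < d & forall m1 m2, `|m1 - m| < d -> `|m2 - m| < d ->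
    `|m1 - m2| <= L * `|f m1 - f m2|.
Proof.
move=> [A [B' [g [[oA Am] [oB AB] fA gB gf]]]].
have Bm : B' (f m) by rewrite -AB; exists m.
pose F : set_system unit := globally [set: unit].
have FF : Filter F by exact: globally_filter.
pose C := rV_coords (R := R) N.
have /choice[L hL] : forall k, exists L, 0 <= L /\ nearF2 F (f m) (fun _ x y =>
    `|crd C (g y) k - crd C (g x) k| <= L * `|y - x|).
  move=> k; have [L L0 hL] := Cloc_lipschitz FF C
    (Cloc_crd FF C k (Cloc_open FF oB Bm (gB 1%N))).
  by exists L.
have [r r0 hr] := nearF2_fin FF (fun k => (hL k).2).
have {}hr : forall x y, `|x - f m| < r -> `|y - f m| < r -> forall k,
  `|crd C (g y) k - crd C (g x) k| <= L k * `|y - x|.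
  by move=> x y xr yr k; exact: (hr tt Logic.I x y xr yr k).
exists (\sum_k L k * `|bas C k|).
  by apply: sumr_ge0 => k _; rewrite mulr_ge0 // (hL k).1.
have [d d0 hd] : exists2 d, 0 < d & forall m', `|m' - m| < d -> A m' /\ `|f m' - f m| < r.
  have [/subspace_continuousP /(_ _ Am) /cvgrPdist_lt/(_ _ r0)] := fA 0%N.
  rewrite near_withinE => h _.
  have hA : nbhs m A by exact: open_nbhs_nbhs.
  have /nbhs_normP[d d0 hd] : \forall m' \near m, A m' /\ (A m' -> `|f m - f m'| < r).
    exact: filterI.
  exists d => // m' m'd; have [|A' h'] := hd m'; first by rewrite /= -normrN opprB.
  by split => //; rewrite -normrN opprB; exact: h'.
exists d => // m1 m2 /hd[A1 f1] /hd[A2 f2].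
rewrite -{1}(gf _ A1) -{1}(gf _ A2).
apply: le_trans (norm_crd_le C _) _; rewrite mulr_suml; apply: ler_sum => k _.
rewrite mulrAC; apply: ler_wpM2r => //; rewrite crdB; exact: hr.
Qed.

(** The diffeomorphism at the base times expands distances by a definite factor. The momentum map at
    nearby times and positions differs from it by a map with small derivative, so it stays
    injective. *)
Lemma flow_locally_injective t s x : D t s x -> exists2 d, 0 < d & forall t' s' q m1 m2,
  t0 <= t' <= t1 -> t0 <= s' <= t1 -> `|t' - t| < d -> `|s' - s| < d ->
  `|q - x.1| < d -> `|m1 - (sol t s x s).2| < d -> `|m2 - (sol t s x s).2| < d ->
  (Phi t' s' (q, m1)).2 = (Phi t' s' (q, m2)).2 -> m1 = m2.
Proof.
move=> Dx; have [ts st tt] := branch_time br Dx.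
have tt0 : t0 <= t <= t1 by rewrite (le_trans ts st).
have ss0 : t0 <= s <= t1 by rewrite ts (le_trans st tt).
have [Oz _] := branch_follows_flow br Dx.
have zE : sol t s x s = (x.1, (sol t s x s).2).
  by rewrite -[in RHS](branch_bdry br Dx).1 -surjective_pairing.
set m := (sol t s x s).2 in zE *.
have [L L0 [dL dL0 hL]] := diffeo_expands (branch_nondeg br Dx).
pose C := rV_coords (R := R) N.
pose S : R := \sum_k `|bas C k|; have S0 : 0 <= S by apply: sumr_ge0.
pose c : R := \sum_(i : 'I_N + 'I_N) 2; have c0 : 0 <= c by apply: sumr_ge0.
(* Derivatives are kept within 1 / [M] of the central one, so the final comparison has the factor
   [(M - 1) / M], below one. *)
pose M := L * (S * c) + 1.
have M0 : 0 < M by rewrite ltr_wpDl // !mulr_ge0.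
have e0 : 0 < M^-1 by rewrite invr_gt0.
have [d d0 hd] := flow_pd_near Oz tt0 e0.
rewrite -/m in hL.
exists (Num.min dL d); first by rewrite lt_min dL0.
move=> t' s' q m1 m2 tt' ss'; rewrite !lt_min.
move=> /andP[_ td] /andP[_ sd] /andP[_ qd] /andP[m1L m1d] /andP[m2L m2d] e.
pose w : TQ := (0, m1 - m2).
have seg q' tau : `|q' - x.1| < d -> 0 <= tau <= 1 -> `|(q', m2) + tau *: w - sol t s x s| < d.
  move=> q'd tau01; rewrite zE.
  have := @ball_segment R _ (sol t s x s) (q', m2) (q', m1) d tau.
  rewrite zE; have -> : (q', m1) - (q', m2) = w by rewrite /w -[LHS]/((_, _)) /= subrr.
  by apply => //; apply: norm_pair1.
have endp q' : (q', m2) + w = (q', m1).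
  by rewrite -[LHS]/((_, _)) /= addr0 addrC subrK.
have mvt t2 s2 q' k : t0 <= t2 <= t1 -> t0 <= s2 <= t1 -> `|t2 - t| < d -> `|s2 - s| < d ->
    `|q' - x.1| < d -> exists2 y, `|y - sol t s x s| < d &
    (Phi t2 s2 (q', m1)).2 0 k - (Phi t2 s2 (q', m2)).2 0 k =
      \sum_i crd B w i * pd B i (fun z => crd B (Phi t2 s2 z) (inr k)) y.
  move=> h1 h2 h3 h4 h5.
  have [tau tau01] := @mvt_line R _ (fun z => crd B (Phi t2 s2 z) (inr k))
    (fun y => \sum_i crd B w i * pd B i (fun z => crd B (Phi t2 s2 z) (inr k)) y)
    (q', m2) w (fun tau tau01 => (hd t2 s2 _ h1 h2 h3 h4 (seg _ _ h5 tau01) (inr k)).1 w).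
  by rewrite endp => E; exists ((q', m2) + tau *: w); [exact: seg|exact: E].
have dd (z : R) : `|z - z| < d by rewrite subrr normr0.
have dq : `|x.1 - x.1| < d by rewrite subrr normr0.
(* The perturbed map takes equal values at [m1] and [m2], so its mean value expression is zero and
   may be subtracted; what remains are differences of nearby derivatives, at most 2 / [M] each. *)
have key k : `|((Phi t s (x.1, m1)).2 - (Phi t s (x.1, m2)).2) 0 k| <= c * M^-1 * `|m1 - m2|.
  have [y yd E1] := mvt t s x.1 k tt0 ss0 (dd t) (dd s) dq.
  have [y' y'd E2] := mvt t' s' q k tt' ss' td sd qd.
  rewrite e subrr in E2.
  have -> : ((Phi t s (x.1, m1)).2 - (Phi t s (x.1, m2)).2) 0 k
      = (Phi t s (x.1, m1)).2 0 k - (Phi t s (x.1, m2)).2 0 k by rewrite !mxE.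
  rewrite E1 -[X in `|X|]subr0.
  move: E2; set S2 := (X in _ = X) => E2; rewrite [X in `|X|](_ : _ = \sum_i crd B w i * pd B i (fun z => crd B (Phi t s z) (inr k)) y - S2); last by rewrite -E2.
  rewrite /S2 -sumrB.
  rewrite /c !mulr_suml.
  apply: le_trans (ler_norm_sum _ _ _) _; apply: ler_sum => i _.
  rewrite -mulrBr normrM mulrC; apply: ler_pM => //; last exact: crd_inr_le.
  have h1 := (hd t s y tt0 ss0 (dd t) (dd s) yd (inr k)).2 i.
  have h2 := (hd t' s' y' tt' ss' td sd y'd (inr k)).2 i.
  move: h1 h2; set a := pd B i _ y; set b := pd B i _ y'; set p := pd B i _ _ => h1 h2.
  rewrite -(subrKA p); apply: le_trans (ler_normD _ _) _.
  by rewrite mulr2n mulrDl mul1r lerD // -normrN opprB.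
have := hL m1 m2 m1L m2L.
have h3 : `|(Phi t s (x.1, m1)).2 - (Phi t s (x.1, m2)).2| <= S * (c * M^-1 * `|m1 - m2|).
  apply: le_trans (norm_crd_le C _) _; rewrite /S mulr_suml; apply: ler_sum => k _.
  by rewrite mulrC; apply: ler_wpM2l => //; exact: key.
move=> /le_trans/(_ (ler_wpM2l L0 h3)).
have -> : L * (S * (c * M^-1 * `|m1 - m2|)) = (M - 1) * M^-1 * `|m1 - m2|.
  by rewrite /M addrK; ring.
rewrite mulrBl divff ?gt_eqF // mulrBl !mul1r lerBrDr gerDl => h4.
have : `|m1 - m2| <= 0 by rewrite -(pmulr_rle0 _ e0).
by rewrite normr_le0 subr_eq0 => /eqP.
Qed.

Lemma norm_fst_le (x y : TQ) : `|x.1 - y.1| <= `|x - y|.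
Proof. by rewrite [leRHS]/Num.Def.normr /= le_max lexx. Qed.

Lemma norm_snd_le (x y : TQ) : `|x.2 - y.2| <= `|x - y|.
Proof. by rewrite [leRHS]/Num.Def.normr /= le_max lexx orbT. Qed.

(** Both solutions have the same position at [sb] and the same momentum at [tb], and their momenta
    at [sb] are close to that of the base solution. Injectivity identifies these momenta, and the
    flow then identifies the whole paths. *)
Lemma continuation t s x : D t s x -> exists2 d, 0 < d & forall ta sa xa tb sb xb,
  `|ta - t| < d -> `|sa - s| < d -> `|xa - x| < d ->
  `|tb - t| < d -> `|sb - s| < d -> `|xb - x| < d ->
  D ta sa xa -> D tb sb xb ->
  xb.1 = (sol ta sa xa sb).1 -> xb.2 = (sol ta sa xa tb).2 ->
  forall r, t0 <= r <= t1 -> sol tb sb xb r = sol ta sa xa r.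
Proof.
move=> Dx; have [d d0 hd] := flow_locally_injective Dx.
have [ts st tt] := branch_time br Dx.
have ss0 : t0 <= s <= t1 by rewrite ts (le_trans st tt).
have [e e0 he] := sol_near br Dx ss0 d0.
exists (Num.min d e); first by rewrite lt_min d0.
move=> ta sa xa tb sb xb; rewrite !lt_min.
move=> /andP[_ tae] /andP[_ sae] /andP[_ xae] /andP[tbd tbe] /andP[sbd sbe] /andP[xbd xbe].
move=> Da Db q1 p2; have [tsb stb ttb] := branch_time br Db.
have [tsa sta tta] := branch_time br Da.
have sb0 : t0 <= sb <= t1 by rewrite tsb (le_trans stb ttb).
have tb0 : t0 <= tb <= t1 by rewrite (le_trans tsb stb).
have [Oa fa] := branch_follows_flow br Da.
have [Ob fb] := branch_follows_flow br Db.
have [bq bp] := branch_bdry br Db.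
have fa' r : t0 <= r <= t1 -> sol ta sa xa r = Phi r sb (sol ta sa xa sb).
  by move=> rt; rewrite (fa r rt) (fa sb sb0) (flow_comp fl rt sb0 Oa).
have E1 : sol ta sa xa sb = (xb.1, (sol ta sa xa sb).2) by rewrite q1 -surjective_pairing.
have E2 : sol tb sb xb sb = (xb.1, (sol tb sb xb sb).2).
  by rewrite -[in RHS]bq -surjective_pairing.
have m1 := he _ _ _ sb tae sae xae sbe Da sb0.
have m2 := he _ _ _ sb tbe sbe xbe sbe Db sb0.
have em : (sol tb sb xb sb).2 = (sol ta sa xa sb).2.
  apply: (hd tb sb xb.1 _ _ tb0 sb0 tbd sbd) => //.
  - exact: le_lt_trans (norm_fst_le _ _) xbd.
  - exact: le_lt_trans (norm_snd_le _ _) m2.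
  - exact: le_lt_trans (norm_snd_le _ _) m1.
  by rewrite -E1 -E2 -fa' // -fb // bp.
by move=> r rt; rewrite fb // fa' // E1 E2 em.
Qed.

End Continuation.

(** * From characteristics to a fixed point: local expansions *)

Lemma taylor_value_algebra {R : realType} (a b c e s1 s2 s3 s4 s5 s6 : R) :
  a - c - e - s6 - (s5 + 2^-1 * s4) =
  a - b + s1 - 2^-1 * (s2 + s3 + s4) + (b - c - s1 - e - s6 - s5) + 2^-1 * s2 + 2^-1 * s3.
Proof. by ring. Qed.

(** Half of the quadratic form in the increments of [Z] becomes a plain [ZZ] sum: geometricity
    produces two transposed sums, which agree by symmetry of [p2]. *)
Lemma geometric_hessian {R : realType} {J : finType} {K : nat} (q : 'I_K -> J -> R)
    (p2 : J -> J -> R) (z : 'I_K -> R) (zz : 'I_K -> 'I_K -> R) :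
  (forall i j, zz i j + zz j i = z i * z j) -> (forall k l, p2 k l = p2 l k) ->
  2^-1 * \sum_k \sum_l (\sum_i q i k * z i) * (\sum_i q i l * z i) * p2 l k =
  \sum_i \sum_j (\sum_k q j k * \sum_l q i l * p2 l k) * zz i j.
Proof.
move=> hz sym.
have -> : \sum_k \sum_l (\sum_i q i k * z i) * (\sum_i q i l * z i) * p2 l k =
    \sum_k (\sum_i q i k * z i) * (\sum_j (\sum_l q j l * p2 l k) * z j).
  apply: eq_bigr => k _; rewrite (eq_bigr _ (fun l _ => esym (mulrA _ _ _))) -mulr_sumr.
  congr (_ * _); rewrite (eq_bigr _ (fun l _ => mulr_suml _ _ _ _)) exchange_big.
  by apply: eq_bigr => j _; rewrite mulr_suml; apply: eq_bigr => l _; rewrite mulrAC.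
rewrite (quad_expand _ (fun j k => \sum_l q j l * p2 l k) hz) mulr_sumr; apply: eq_bigr => i _.
rewrite mulr_sumr; apply: eq_bigr => j _; rewrite mulrA; congr (_ * _).
have c : \sum_k q i k * (\sum_l q j l * p2 l k) = \sum_k q j k * \sum_l q i l * p2 l k.
  rewrite (eq_bigr _ (fun l _ => mulr_sumr _ _ _ _)) exchange_big.
  apply: eq_bigr => k _; rewrite mulr_sumr; apply: eq_bigr => l _.
  by rewrite mulrCA (sym k l).
by rewrite big_split c /=; field.
Qed.

Lemma sum_defect {R : comPzRingType} {J : finType} (a b c z : J -> R) (p q : R) :
  (forall j, a j = b j + c j) ->
  p - q - \sum_j a j * z j + \sum_j c j * z j = p - q - \sum_j b j * z j.
Proof.
move=> e; rewrite -addrA; congr (_ + _); rewrite addrC -sumrB -sumrN.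
by apply: eq_bigr => j _; rewrite e; ring.
Qed.

Section HJCore.
Context {R : realType} {N K : nat}.
Local Notation TQ := ('rV[R]_N * 'rV[R]_N)%type.
Variables (alpha t0 t1 : R) (Z : R -> 'rV[R]_K) (ZZ : R -> R -> 'M[R]_K).
Hypotheses (al3 : 3^-1 < alpha) (al2 : alpha <= 2^-1).
Hypothesis rp : geometric_rough_path alpha Z ZZ t0 t1.
Local Notation B := (@tqB R N).
Local Notation C := (rV_coords (R := R) N).

(** Regularity in space only, uniform in time over a window; nothing is said about regularity in
    time. *)
Record taylor_bounds (sg : R -> 'rV[R]_N -> R) (lo hi rho M : R) (y0 : 'rV[R]_N) : Prop := {
  tb_ge0 : 0 <= M;
  tb_taylor3 : forall r y y', lo <= r <= hi -> `|y - y0| < rho -> `|y' - y0| < rho ->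
    `|sg r y' - sg r y - \sum_i crd C (y' - y) i * pd C i (sg r) y
      - 2^-1 * \sum_i \sum_k crd C (y' - y) i * crd C (y' - y) k * pd C k (pd C i (sg r)) y|
     <= M * `|y' - y| ^+ 3;
  tb_taylor2 : forall r y y' k, lo <= r <= hi -> `|y - y0| < rho -> `|y' - y0| < rho ->
    `|pd C k (sg r) y' - pd C k (sg r) y
       - \sum_i crd C (y' - y) i * pd C i (pd C k (sg r)) y| <= M * `|y' - y| ^+ 2;
  tb_lip1 : forall r y y' k, lo <= r <= hi -> `|y - y0| < rho -> `|y' - y0| < rho ->
    `|pd C k (sg r) y' - pd C k (sg r) y| <= M * `|y' - y|;
  tb_lip2 : forall r y y' i k, lo <= r <= hi -> `|y - y0| < rho -> `|y' - y0| < rho ->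
    `|pd C i (pd C k (sg r)) y' - pd C i (pd C k (sg r)) y| <= M * `|y' - y|;
  tb_bdd2 : forall r y i k, lo <= r <= hi -> `|y - y0| < rho ->
    `|pd C i (pd C k (sg r)) y| <= M;
  tb_sym : forall r y i k, lo <= r <= hi -> `|y - y0| < rho ->
    pd C i (pd C k (sg r)) y = pd C k (pd C i (sg r)) y }.

Variables (sg : R -> 'rV[R]_N -> R) (lo hi rho M d : R) (y0 : 'rV[R]_N).
Hypotheses (t0lo : t0 <= lo) (hit1 : hi <= t1) (d0 : 0 < d) (drho : d <= rho).
Hypothesis tb : taylor_bounds sg lo hi rho M y0.
Variables (hh : TQ -> R) (h : 'I_K -> TQ -> R) (xc : TQ) (rc : R).

(** The point above [y] of the Lagrangian graph of the gradient at time [r]. *)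
Definition gradpt (r : R) (y : 'rV[R]_N) : TQ := (\row_k pd C k (sg r) y, y).
Local Notation x := gradpt.
Local Notation P k r y := (pd C k (sg r) y).
Local Notation P2 i k r y := (pd C i (pd C k (sg r)) y).

Hypothesis hx : forall r y, lo <= r <= hi -> `|y - y0| < d -> `|x r y - xc| < rc.
Hypothesis hdh : forall l j, tame B (pd B l (h j)) xc rc.
Hypothesis hsmall : forall i, (hi - lo) `^ alpha * `|bas C i| < d.

Let A : set 'rV[R]_N := [set y | `|y - y0| < d].
Let lohi (y : 'rV[R]_N) : A y -> t0 <= lo /\ hi <= t1. Proof. by []. Qed.
Local Notation dom := (dom2 A (fun=> lo) (fun=> hi)).
Local Notation O := (bO dom (eta2 alpha)).
Local Notation sc := (scale2 al3 lohi).
Let lohi0 (e : unit) : [set: unit] e -> t0 <= lo /\ hi <= t1. Proof. by []. Qed.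
Local Notation dom0 := (dom2 [set: unit] (fun=> lo) (fun=> hi)).
Local Notation O0 := (bO dom0 (eta2 alpha)).
Local Notation sc0 := (scale2 al3 lohi0).

(** A characteristic starts at time u on the graph above y, and [Y'] is the point above which it
    sits at time v. The next hypotheses expand, along it, the displacement and the gradient up to
    order 2 and the value up to order 3. *)
Variable Y' : 'rV[R]_N * R * R -> 'rV[R]_N.
Hypothesis hY : forall t, dom t -> `|Y' t - y0| < rho.
Hypothesis hinc : forall k, O 2 (fun t => crd C (Y' t - t.1.1) k
  + \sum_j pd B (inl k) (h j) (x t.1.2 t.1.1) * dZ Z t.1.2 t.2 j).
Hypothesis hgrad : forall k, O 2 (fun t => P k t.2 (Y' t) - P k t.1.2 t.1.1
  - \sum_j pd B (inr k) (h j) (x t.1.2 t.1.1) * dZ Z t.1.2 t.2 j).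
Hypothesis hval : O 3 (fun t => sg t.2 (Y' t) - sg t.1.2 t.1.1
  - \sum_k crd C (Y' t - t.1.1) k * P k t.2 (Y' t)
  - hh (x t.1.2 t.1.1) * (t.2 - t.1.2) - \sum_j h j (x t.1.2 t.1.1) * dZ Z t.1.2 t.2 j
  - \sum_i \sum_j (\sum_k pd B (inl k) (h j) (x t.1.2 t.1.1)
      * pd B (inr k) (h i) (x t.1.2 t.1.1)) * ZZ t.1.2 t.2 i j).

Let domE t : dom t -> [/\ `|t.1.1 - y0| < d, lo <= t.1.2 <= hi & lo <= t.2 <= hi].
Proof.
case: t => -[y u] v [] /= Ay lu uv vh; split => //; first by rewrite lu (le_trans uv).
by rewrite (le_trans lu).
Qed.

Let dom0E t : dom0 t -> lo <= t.1.2 <= hi /\ lo <= t.2 <= hi.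
Proof.
case: t => -[y u] v [] /= _ lu uv vh; split; first by rewrite lu (le_trans uv).
by rewrite (le_trans lu).
Qed.

Let dh l j : O 0 (fun t => pd B l (h j) (x t.1.2 t.1.1)).
Proof.
have hx' t : dom t -> `|x t.1.2 t.1.1 - xc| < rc by move=> /domE[yd ul _]; exact: hx.
exact: (bO_tame _ hx' (hdh l j)).
Qed.

Let bdZ j : O 1 (fun t => dZ Z t.1.2 t.2 j).
Proof. exact: (bO_dZ rp lohi). Qed.

Let bP2 i k : O 0 (fun t => P2 i k t.2 t.1.1).
Proof.
exists M => t /domE[yd _ ul]; rewrite expr0 mulr1.
exact: (tb_bdd2 tb _ _ ul (lt_le_trans yd drho)).
Qed.

Let inc1 k : O 1 (fun t => crd C (Y' t - t.1.1) k).
Proof.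
apply: (bO_eq (B := fun t => (crd C (Y' t - t.1.1) k
  + \sum_j pd B (inl k) (h j) (x t.1.2 t.1.1) * dZ Z t.1.2 t.2 j)
  - \sum_j pd B (inl k) (h j) (x t.1.2 t.1.1) * dZ Z t.1.2 t.2 j)) => [t _|].
  by rewrite addrK.
apply: bOB; first exact: (bOW sc (l := 2)).
by apply: bO_sum => j; exact: (bO_mulr sc).
Qed.

Let incn : O 1 (fun t => `|Y' t - t.1.1|).
Proof. exact: (bO_norm sc inc1). Qed.

Let incnN : O 1 (fun t => `|t.1.1 - Y' t|).
Proof. by apply: bO_le incn => t _; rewrite !normr_id distrC. Qed.

(** The derivative of [h j] along the graph in direction [k], with the gradient at time [u] but the
    Hessian at time [v]: the characteristic leaves at [u], the Taylor expansion is made at [v]. *)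
Definition rate (j : 'I_K) (k : 'I_N) (u v : R) (y : 'rV[R]_N) : R :=
  pd B (inr k) (h j) (x u y) + \sum_i pd B (inl i) (h j) (x u y) * P2 i k v y.

(** The gradient at [Y'] is known from the characteristic; a first-order Taylor expansion at time v
    moves it back to y, and the displacement is replaced by its leading rough part. *)
Lemma grad_step k : O 2 (fun t => P k t.2 t.1.1 - P k t.1.2 t.1.1
  - \sum_j rate j k t.1.2 t.2 t.1.1 * dZ Z t.1.2 t.2 j).
Proof.
have h1 : O 2 (fun t => P k t.2 (Y' t) - P k t.2 t.1.1
    - \sum_i crd C (Y' t - t.1.1) i * P2 i k t.2 t.1.1).
  apply: (bO_le (B := fun t => M * (`|Y' t - t.1.1| * `|Y' t - t.1.1|))).
    move=> t Dt; have [yd _ ul] := domE Dt; rewrite [leRHS]ger0_norm; last first.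
      by rewrite mulr_ge0 ?(tb_ge0 tb) // mulr_ge0.
    exact: (tb_taylor2 tb k ul (lt_le_trans yd drho) (hY Dt)).
  by apply: (bOMc sc); exact: (bOM sc (m := 2) _ incn incn).
have h2 : O 2 (fun t => \sum_i (crd C (Y' t - t.1.1) i
    + \sum_j pd B (inl i) (h j) (x t.1.2 t.1.1) * dZ Z t.1.2 t.2 j) * P2 i k t.2 t.1.1).
  by apply: bO_sum => i; exact: (bOM sc (m := 2) _ (hinc i) (bP2 i k)).
apply: bO_eq (bOB (bOB (hgrad k) h1) h2) => t _.
have -> : \sum_j rate j k t.1.2 t.2 t.1.1 * dZ Z t.1.2 t.2 j =
    \sum_j pd B (inr k) (h j) (x t.1.2 t.1.1) * dZ Z t.1.2 t.2 j
    + \sum_i (\sum_j pd B (inl i) (h j) (x t.1.2 t.1.1) * dZ Z t.1.2 t.2 j) * P2 i k t.2 t.1.1.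
  rewrite (eq_bigr _ (fun j _ => mulrDl _ _ _)) big_split; congr (_ + _).
  rewrite (eq_bigr _ (fun j _ => mulr_suml _ _ _ _)) exchange_big.
  apply: eq_bigr => i _; rewrite mulr_suml; apply: eq_bigr => j _; exact: mulrAC.
rewrite (eq_bigr _ (fun i _ => mulrDl _ _ _)) big_split.
set s1 := (\sum_j _ * _); set s2 := (\sum_i _ * _); set s3 := (\sum_i _ * _).
move: s1 s2 s3 (P k t.2 (Y' t)) (P k t.1.2 t.1.1) (P k t.2 t.1.1) => a b c e f g /=.
by ring.
Qed.

Let pull (y : unit * R * R -> 'rV[R]_N) k F : (forall t, dom0 t -> `|y t - y0| < d) ->
  O k F -> O0 k (fun t => F (y t, t.1.2, t.2)).
Proof.
move=> hy; apply: (bO_pull (phi := fun t => (y t, t.1.2, t.2))) => [t _|t Dt].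
  exact: powR_ge0.
by split => //; move: Dt (hy _ Dt); case: t => -[e u] v [] /= _ lu uv vh yd.
Qed.

Let y0d (t : unit * R * R) : dom0 t -> `|y0 - y0| < d.
Proof. by rewrite subrr normr0. Qed.

Section Shift.
Variable i0 : 'I_N.
(** A probe at distance of the order of |v - u|^alpha from [y0]; [hsmall] keeps it in the ball. *)
Let y1 (t : unit * R * R) : 'rV[R]_N := y0 + eta2 alpha t *: bas C i0.

Let y1E t : y1 t - y0 = eta2 alpha t *: bas C i0.
Proof. by rewrite /y1 addrC addKr. Qed.

Let eta_ge0 (t : unit * R * R) : 0 <= eta2 alpha t. Proof. exact: powR_ge0. Qed.

Let y1d t : dom0 t -> `|y1 t - y0| < d.
Proof.
move=> Dt; rewrite y1E normrZ ger0_norm //; apply: le_lt_trans (hsmall i0).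
apply: ler_wpM2r => //; move: Dt; case: t => -[e u] v [] /= _ lu uv vh.
apply: (le_powR_alpha al3) => //=; first by rewrite subr_ge0.
by rewrite lerB.
Qed.

Let y1n : O0 1 (fun t => `|y1 t - y0|).
Proof.
exists `|bas C i0| => t Dt; rewrite normr_id y1E normrZ ger0_norm // mulrC expr1.
exact: lexx.
Qed.

Let y1le (F : unit * R * R -> R) :
  (forall t, dom0 t -> `|F t| <= M * `|y1 t - y0|) -> O0 1 F.
Proof.
move=> hF; apply: (bO_le (B := fun t => M * `|y1 t - y0|)); last exact: (bOMc sc0).
by move=> t /hF; rewrite [X in _ -> _ <= X]ger0_norm // mulr_ge0 // (tb_ge0 tb).
Qed.

Let rho0 (t : unit * R * R) : `|y0 - y0| < rho.
Proof. by rewrite subrr normr0 (lt_le_trans d0). Qed.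

Let dh_lip l j : O0 1 (fun t => pd B l (h j) (x t.1.2 (y1 t)) - pd B l (h j) (x t.1.2 y0)).
Proof.
have h0 t : dom0 t -> `|x t.1.2 y0 - xc| < rc.
  by move=> Dt; have [ul _] := dom0E Dt; apply: hx => //; exact: (y0d Dt).
have h1 t : dom0 t -> `|x t.1.2 (y1 t) - xc| < rc.
  by move=> Dt; have [ul _] := dom0E Dt; apply: hx => //; exact: (y1d Dt).
apply: (bO_tame_lip sc0 h0 h1 (hdh l j)).
apply: (bO_norm sc0 (B := B)) => -[k|k].
  apply: y1le => t Dt; have [ul _] := dom0E Dt.
  rewrite crdB -!rVcrd_fst /gradpt /fst !mxE.
  exact: (tb_lip1 tb k ul (rho0 t) (lt_le_trans (y1d Dt) drho)).
apply: bO_le y1n => t Dt; rewrite normr_id; exact: rV_norm_ge.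
Qed.

Let rate_lip j k : O0 1 (fun t => rate j k t.1.2 t.2 (y1 t) - rate j k t.1.2 t.2 y0).
Proof.
apply: (bO_eq (B := fun t => (pd B (inr k) (h j) (x t.1.2 (y1 t)) - pd B (inr k) (h j) (x t.1.2 y0))
  + \sum_i ((pd B (inl i) (h j) (x t.1.2 (y1 t)) - pd B (inl i) (h j) (x t.1.2 y0)) * P2 i k t.2 (y1 t)
     + pd B (inl i) (h j) (x t.1.2 y0) * (P2 i k t.2 (y1 t) - P2 i k t.2 y0)))).
  move=> t _; rewrite /rate opprD addrACA; congr (_ + _).
  rewrite -sumrB; apply: eq_bigr => i _.
  move: (pd B _ _ _) (pd B _ _ _) (P2 i k t.2 (y1 t)) (P2 i k t.2 y0) => a b c e.
  by ring.
apply: bOD => //; apply: bO_sum => i; apply: bOD.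
  exact: (bOM sc0 (m := 1) _ (dh_lip (inl i) j) (pull y1d (bP2 i k))).
apply: (bO_mulr sc0 (pull y0d (dh (inl i) j))).
apply: y1le => t Dt; have [_ vl] := dom0E Dt.
exact: (tb_lip2 tb i k vl (rho0 t) (lt_le_trans (y1d Dt) drho)).
Qed.

(** [grad_step] at the probe minus [grad_step] at [y0]: the two gradient increments differ, up to
    order 2, by [eta2] times the Hessian increment, while the rates differ by order 1 and multiply
    increments of [Z]. Division by [eta2] gives Hölder continuity in time. *)
Lemma hess_incr k : O0 1 (fun t => P2 i0 k t.2 y0 - P2 i0 k t.1.2 y0).
Proof.
have tay r t : dom0 t -> lo <= r <= hi ->
    `|P k r (y1 t) - P k r y0 - eta2 alpha t * P2 i0 k r y0| <= M * `|y1 t - y0| ^+ 2.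
  move=> Dt rl; have := tb_taylor2 tb k rl (rho0 t) (lt_le_trans (y1d Dt) drho).
  have -> : \sum_i crd C (y1 t - y0) i * P2 i k r y0 = eta2 alpha t * P2 i0 k r y0.
    rewrite y1E (bigD1 i0) // crdZ crd_bas eqxx mulr1 big1; first exact: addr0.
    by move=> i ii0; rewrite crdZ crd_bas eq_sym (negbTE ii0) mulr0 mul0r.
  by [].
have bt (r : unit * R * R -> R) : (forall t, dom0 t -> lo <= r t <= hi) ->
    O0 2 (fun t => P k (r t) (y1 t) - P k (r t) y0 - eta2 alpha t * P2 i0 k (r t) y0).
  move=> hr; apply: (bO_le (B := fun t => M * (`|y1 t - y0| * `|y1 t - y0|))).
    move=> t Dt; rewrite [leRHS]ger0_norm ?mulr_ge0 ?(tb_ge0 tb) //.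
    exact: tay (hr t Dt).
  by apply: (bOMc sc0); exact: (bOM sc0 (m := 2) _ y1n y1n).
have bv := bt (fun t => t.2) (fun t Dt => (dom0E Dt).2).
have bu := bt (fun t => t.1.2) (fun t Dt => (dom0E Dt).1).
have br : O0 2 (fun t => \sum_j (rate j k t.1.2 t.2 (y1 t) - rate j k t.1.2 t.2 y0)
    * dZ Z t.1.2 t.2 j).
  apply: bO_sum => j; exact: (bOM sc0 (m := 2) _ (rate_lip j k) (bO_dZ rp lohi0 j)).
have bs : O0 2 (fun t => eta2 alpha t * (P2 i0 k t.2 y0 - P2 i0 k t.1.2 y0)).
  apply: bO_eq (bOD (bOB bu bv) (bOD (bOB (pull y1d (grad_step k)) (pull y0d (grad_step k))) br)).
  move=> t _; cbn [fst snd].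
  rewrite (eq_bigr _ (fun j _ => mulrBl _ _ _)) sumrB.
  move: (\sum_j _) (\sum_j _) (P k t.2 (y1 t)) (P k t.2 y0) (P k t.1.2 (y1 t)) (P k t.1.2 y0)
    (P2 i0 k t.2 y0) (P2 i0 k t.1.2 y0) (eta2 alpha t) => a b c1 c2 c3 c4 c5 c6 c7.
  by ring.
(* Division by [eta2] lowers the order by one; when [eta2] is 0 the two times coincide and the
   increment is zero. *)
have [c hc] := bs; exists c => t Dt; rewrite expr1.
have [e0|e0] := eqVneq (eta2 alpha t) 0.
  have : t.2 - t.1.2 = 0.
    by move/eqP: e0; rewrite powR_eq0 => /andP[/eqP].
  by move=> /subr0_eq ->; rewrite subrr normr0 e0 mulr0.
have ep : 0 < eta2 alpha t by rewrite lt_neqAle eq_sym e0 eta_ge0.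
rewrite -(ler_pM2l ep); have := hc t Dt.
rewrite normrM (ger0_norm (eta_ge0 t)) => /le_trans; apply.
by rewrite expr2 mulrCA.
Qed.

End Shift.

(** By [hess_incr] the Hessian inside [rate] may be taken at the earlier time, at a cost of order 1
    times an increment of [Z]. *)
Lemma gradpt_step k : O0 2 (fun t => P k t.2 y0 - P k t.1.2 y0
  - \sum_j rate j k t.1.2 t.1.2 y0 * dZ Z t.1.2 t.2 j).
Proof.
have h1 : O0 2 (fun t => \sum_j (\sum_i pd B (inl i) (h j) (x t.1.2 y0)
    * (P2 i k t.2 y0 - P2 i k t.1.2 y0)) * dZ Z t.1.2 t.2 j).
  apply: bO_sum => j.
  have hj : O0 1 (fun t => \sum_i pd B (inl i) (h j) (x t.1.2 y0)
      * (P2 i k t.2 y0 - P2 i k t.1.2 y0)).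
    apply: bO_sum => i; exact: (bO_mulr sc0 (pull y0d (dh (inl i) j)) (hess_incr i k)).
  exact: (bOM sc0 (m := 2) _ hj (bO_dZ rp lohi0 j)).
apply: bO_eq (bOD (pull y0d (grad_step k)) h1) => t _; cbn [fst snd].
have rateE j : rate j k t.1.2 t.2 y0 = rate j k t.1.2 t.1.2 y0
    + \sum_i pd B (inl i) (h j) (x t.1.2 y0) * (P2 i k t.2 y0 - P2 i k t.1.2 y0).
  rewrite /rate (eq_bigr _ (fun i _ => mulrBr _ _ _)) sumrB.
  by rewrite -addrA subrKC.
exact: (esym (sum_defect _ _ _ rateE)).
Qed.

Let rho0 : `|y0 - y0| < rho.
Proof. by rewrite subrr normr0 (lt_le_trans d0). Qed.

Let bP20 i k : O0 0 (fun t => P2 i k t.1.2 y0).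
Proof.
by exists M => t /dom0E[ul _]; rewrite expr0 mulr1; exact: (tb_bdd2 tb).
Qed.

Let bP20v i k : O0 0 (fun t => P2 i k t.2 y0).
Proof.
by exists M => t /dom0E[_ ul]; rewrite expr0 mulr1; exact: (tb_bdd2 tb).
Qed.

Let dh0 l j : O0 0 (fun t => pd B l (h j) (x t.1.2 y0)).
Proof. exact: (pull y0d (dh l j)). Qed.

Lemma rate_bdd j k : O0 0 (fun t => rate j k t.1.2 t.1.2 y0).
Proof. by apply: bOD => //; apply: bO_sum => i; exact: (bOM sc0 (m := 0) _ (dh0 _ _)). Qed.

Lemma gradpt_incr k : O0 1 (fun t => P k t.2 y0 - P k t.1.2 y0).
Proof.
apply: (bO_eq (B := fun t => (P k t.2 y0 - P k t.1.2 y0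
  - \sum_j rate j k t.1.2 t.1.2 y0 * dZ Z t.1.2 t.2 j)
  + \sum_j rate j k t.1.2 t.1.2 y0 * dZ Z t.1.2 t.2 j)) => [t _|]; first by rewrite subrK.
apply: bOD; first exact: (bOW sc0 (l := 2) _ (gradpt_step k)).
by apply: bO_sum => j; exact: (bO_mulr sc0 (rate_bdd j k) (bO_dZ rp lohi0 j)).
Qed.

Lemma rate_incr j k : O0 1 (fun t => rate j k t.2 t.2 y0 - rate j k t.1.2 t.1.2 y0).
Proof.
have hinc0 l : O0 1 (fun t => pd B l (h j) (x t.2 y0) - pd B l (h j) (x t.1.2 y0)).
  have h0 t : dom0 t -> `|x t.1.2 y0 - xc| < rc.
    by move=> Dt; have [ul _] := dom0E Dt; apply: hx => //; exact: (y0d Dt).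
  have h1 t : dom0 t -> `|x t.2 y0 - xc| < rc.
    by move=> Dt; have [_ ul] := dom0E Dt; apply: hx => //; exact: (y0d Dt).
  apply: (bO_tame_lip sc0 h0 h1 (hdh l j)).
  apply: (bO_norm sc0 (B := B)) => -[m|m].
    apply: bO_eq (gradpt_incr m) => t _.
    by rewrite crdB -!rVcrd_fst /gradpt /fst !mxE.
  apply: bO_eq (bO0 _ _ _) => t _.
  by rewrite crdB subrr.
apply: (bO_eq (B := fun t => (pd B (inr k) (h j) (x t.2 y0) - pd B (inr k) (h j) (x t.1.2 y0))
  + \sum_i ((pd B (inl i) (h j) (x t.2 y0) - pd B (inl i) (h j) (x t.1.2 y0)) * P2 i k t.2 y0
     + pd B (inl i) (h j) (x t.1.2 y0) * (P2 i k t.2 y0 - P2 i k t.1.2 y0)))).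
  move=> t _; rewrite /rate opprD addrACA; congr (_ + _).
  rewrite -sumrB; apply: eq_bigr => i _.
  move: (pd B _ _ _) (pd B _ _ _) (P2 i k t.2 y0) (P2 i k t.1.2 y0) => a b c e.
  by ring.
apply: bOD => //; apply: bO_sum => i; apply: bOD.
  exact: (bOM sc0 (m := 1) _ (hinc0 _) (bP20v i k)).
exact: (bO_mulr sc0 (dh0 _ _) (hess_incr i k)).
Qed.

Let Y0 (t : unit * R * R) : 'rV[R]_N := Y' (y0, t.1.2, t.2).
Let D (k : 'I_N) (t : unit * R * R) : R :=
  - \sum_j pd B (inl k) (h j) (x t.1.2 y0) * dZ Z t.1.2 t.2 j.
Let del k t : R := crd C (Y0 t - y0) k.

Let Dd k : O0 2 (fun t => del k t - D k t).
Proof.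
apply: bO_eq (pull y0d (hinc k)) => t _; cbn [fst snd].
by rewrite /del /D opprK.
Qed.

Let D1 k : O0 1 (D k).
Proof.
apply: bON; apply: bO_sum => j; exact: (bO_mulr sc0 (dh0 _ _) (bO_dZ rp lohi0 j)).
Qed.

Let del1 k : O0 1 (del k). Proof. exact: (pull y0d (inc1 k)). Qed.

(** The value at [Y'] is moved back to [y0] by a second-order Taylor expansion at the later time.
    Its quadratic term supplies exactly the Hessian part of [rate] in the second-order
    coefficient. *)
Lemma value_step : O0 3 (fun t => sg t.2 y0 - sg t.1.2 y0
  - hh (x t.1.2 y0) * (t.2 - t.1.2) - \sum_j h j (x t.1.2 y0) * dZ Z t.1.2 t.2 j
  - \sum_i \sum_j (\sum_k pd B (inl k) (h j) (x t.1.2 y0) * rate i k t.1.2 t.1.2 y0)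
     * ZZ t.1.2 t.2 i j).
Proof.
have dom0d t : dom0 t -> dom (y0, t.1.2, t.2).
  by move=> Dt; move: (y0d Dt); case: t Dt => -[e u] v [] /= _ lu uv vh yd.
have nY : O0 1 (fun t => `|Y0 t - y0|) := pull y0d incn.
have T3 : O0 3 (fun t => sg t.2 y0 - sg t.2 (Y0 t) + \sum_i del i t * P i t.2 (Y0 t)
    - 2^-1 * \sum_i \sum_k del i t * del k t * P2 k i t.2 (Y0 t)).
  apply: (bO_le (B := fun t => M * (`|Y0 t - y0| * (`|Y0 t - y0| * `|Y0 t - y0|)))).
    move=> t Dt; have [_ vl] := dom0E Dt.
    rewrite [leRHS]ger0_norm ?mulr_ge0 ?(tb_ge0 tb) //.
    have := tb_taylor3 tb vl (hY (dom0d t Dt)) rho0.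
    rewrite -/(Y0 t) (distrC y0) exprS expr2.
    have dE k : crd C (y0 - Y0 t) k = - del k t by rewrite -opprB crdN.
    rewrite (eq_bigr _ (fun k _ => congr1 (fun w => w * _) (dE k))).
    rewrite (eq_bigr _ (fun k _ => mulNr _ _)) sumrN opprK.
    have -> : \sum_i \sum_k crd C (y0 - Y0 t) i * crd C (y0 - Y0 t) k * P2 k i t.2 (Y0 t)
        = \sum_i \sum_k del i t * del k t * P2 k i t.2 (Y0 t).
      by apply: eq_bigr => i _; apply: eq_bigr => k _; rewrite !dE mulrNN.
    by [].
  by apply: (bOMc sc0); exact: (bOM sc0 (m := 3) _ nY (bOM sc0 (m := 2) _ nY nY)).
have dP i k : O0 1 (fun t => P2 k i t.2 (Y0 t) - P2 k i t.1.2 y0).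
  apply: (bO_eq (B := fun t => (P2 k i t.2 (Y0 t) - P2 k i t.2 y0)
    + (P2 k i t.2 y0 - P2 k i t.1.2 y0))) => [t _|]; first by rewrite addrA subrK.
  apply: bOD (hess_incr k i).
  apply: (bO_le (B := fun t => M * `|Y0 t - y0|)); last exact: (bOMc sc0).
  move=> t Dt; have [_ vl] := dom0E Dt; rewrite [leRHS]ger0_norm ?mulr_ge0 ?(tb_ge0 tb) //.
  exact: (tb_lip2 tb k i vl rho0 (hY (dom0d t Dt))).
(* The Hessian at the later time and at the displaced point is replaced by the one at [y0] and the
   earlier time. *)
have E1 : O0 3 (fun t => 2^-1 * \sum_i \sum_k del i t * del k t
    * (P2 k i t.2 (Y0 t) - P2 k i t.1.2 y0)).
  apply: (bOMc sc0); apply: bO_sum => i; apply: bO_sum => k.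
  exact: (bOM sc0 (m := 3) _ (bOM sc0 (m := 2) _ (del1 i) (del1 k)) (dP i k)).
(* The displacement is replaced by its leading part [D], to which [geometric_hessian] applies. *)
have E2 : O0 3 (fun t => 2^-1 * \sum_i \sum_k
    ((del i t - D i t) * del k t + D i t * (del k t - D k t)) * P2 k i t.1.2 y0).
  apply: (bOMc sc0); apply: bO_sum => i; apply: bO_sum => k.
  have h1 : O0 3 (fun t => (del i t - D i t) * del k t).
    exact: (bOM sc0 (m := 3) _ (Dd i) (del1 k)).
  have h2 : O0 3 (fun t => D i t * (del k t - D k t)).
    exact: (bOM sc0 (m := 3) _ (D1 i) (Dd k)).
  exact: (bOM sc0 (m := 3) _ (bOD h1 h2) (bP20 k i)).
apply: bO_eq (bOD (bOD (bOD T3 (pull y0d hval)) E1) E2) => t Dt; cbn [fst snd].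
have [ul _] := dom0E Dt.
have hz i j : ZZ t.1.2 t.2 i j + ZZ t.1.2 t.2 j i = dZ Z t.1.2 t.2 i * dZ Z t.1.2 t.2 j.
  move: Dt; case: (t) => -[e u] v [] /= _ lu uv vh.
  apply: (ZZ_sym rp) => //; [exact: le_trans lu|exact: le_trans hit1].
have sym i k : P2 i k t.1.2 y0 = P2 k i t.1.2 y0 := tb_sym tb i k ul rho0.
have G := geometric_hessian (fun i k => pd B (inl k) (h i) (x t.1.2 y0)) hz sym.
have Q1 : \sum_i \sum_k del i t * del k t * P2 k i t.2 (Y0 t) =
    \sum_i \sum_k del i t * del k t * (P2 k i t.2 (Y0 t) - P2 k i t.1.2 y0)
    + \sum_i \sum_k ((del i t - D i t) * del k t + D i t * (del k t - D k t)) * P2 k i t.1.2 y0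
    + \sum_i \sum_k D i t * D k t * P2 k i t.1.2 y0.
  rewrite -!big_split; apply: eq_bigr => i _; rewrite -!big_split; apply: eq_bigr => k _ /=.
  move: (del i t) (del k t) (D i t) (D k t) (P2 k i _ _) (P2 k i _ _) => a b c e f g.
  by ring.
have Q2 : \sum_i \sum_k D i t * D k t * P2 k i t.1.2 y0 =
    \sum_i \sum_k (\sum_j pd B (inl i) (h j) (x t.1.2 y0) * dZ Z t.1.2 t.2 j)
      * (\sum_j pd B (inl k) (h j) (x t.1.2 y0) * dZ Z t.1.2 t.2 j) * P2 k i t.1.2 y0.
  by apply: eq_bigr => i _; apply: eq_bigr => k _; rewrite /D mulrNN.
have Q3 : \sum_i \sum_j (\sum_k pd B (inl k) (h j) (x t.1.2 y0) * rate i k t.1.2 t.1.2 y0)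
     * ZZ t.1.2 t.2 i j =
    \sum_i \sum_j (\sum_k pd B (inl k) (h j) (x t.1.2 y0) * pd B (inr k) (h i) (x t.1.2 y0))
      * ZZ t.1.2 t.2 i j
    + \sum_i \sum_j (\sum_k pd B (inl k) (h j) (x t.1.2 y0)
        * \sum_l pd B (inl l) (h i) (x t.1.2 y0) * P2 l k t.1.2 y0) * ZZ t.1.2 t.2 i j.
  rewrite -big_split; apply: eq_bigr => i _; rewrite -big_split; apply: eq_bigr => j _ /=.
  rewrite -mulrDl -big_split; congr (_ * _); apply: eq_bigr => k _.
  by rewrite /rate mulrDr.
rewrite Q3 -G -Q2 Q1.
have -> : \sum_k crd C (Y' (y0, t.1.2, t.2) - y0) k * P k t.2 (Y' (y0, t.1.2, t.2))
  = \sum_i del i t * P i t.2 (Y0 t) by [].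
rewrite -/(Y0 t).
exact: taylor_value_algebra.
Qed.

End HJCore.

(** * Existence of uniform Taylor bounds *)

Section TaylorBounds.
Context {R : realType} {N : nat}.
Local Notation C := (rV_coords (R := R) N).

Lemma nearF2_of_nearF {P : Type} {V : normedModType R} (F : set_system P) (FF : Filter F)
    (x0 : V) (Q : P -> V -> Prop) :
  nearF F x0 Q -> nearF2 F x0 (fun a x _ => Q a x).
Proof. by move=> [r r0 h]; exists r => //; apply: filterS h => a h x y /h. Qed.

Lemma le_sum_cst (I : finType) (c : I -> R) k : (forall i, 0 <= c i) -> c k <= \sum_i c i.
Proof. by move=> c0; rewrite (bigD1 k) //= lerDl sumr_ge0. Qed.

Lemma taylor_bounds_exist (sg : R -> 'rV[R]_N -> R) (T : set R) r0 y0 :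
  Cloc 3 (within T (nbhs r0)) y0 sg ->
  exists rho d M, [/\ 0 < rho, 0 < d & forall lo hi,
    (forall r, lo <= r <= hi -> T r /\ `|r - r0| < d) -> taylor_bounds sg lo hi rho M y0].
Proof.
set F := within T (nbhs r0) => hf.
have FF : Filter F by exact: within_filter.
have [M3 M30 n3] := Cloc_taylor3 FF C hf.
have /choice[M2 n2] : forall k, exists M2, 0 <= M2 /\ nearF2 F y0 (fun r y y' =>
    `|pd C k (sg r) y' - pd C k (sg r) y
       - \sum_i crd C (y' - y) i * pd C i (pd C k (sg r)) y| <= M2 * `|y' - y| ^+ 2).
  by move=> k; have [c c0 hc] := Cloc_taylor2 FF C (Cloc_pd C k hf); exists c.
have /choice[L1 nl1] : forall k, exists L, 0 <= L /\ nearF2 F y0 (fun r y y' =>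
    `|pd C k (sg r) y' - pd C k (sg r) y| <= L * `|y' - y|).
  move=> k; have [c c0 hc] := Cloc_lipschitz FF C (Cloc_pred (Cloc_pd C k hf)).
  by exists c.
have /choice[L2 nl2] : forall p : 'I_N * 'I_N, exists L, 0 <= L /\ nearF2 F y0 (fun r y y' =>
    `|pd C p.1 (pd C p.2 (sg r)) y' - pd C p.1 (pd C p.2 (sg r)) y| <= L * `|y' - y|).
  move=> p; have [c c0 hc] := Cloc_lipschitz FF C (Cloc_pd C p.1 (Cloc_pd C p.2 hf)).
  by exists c.
have /choice[b2 nb2] : forall p : 'I_N * 'I_N, exists c, nearF F y0 (fun r y =>
    `|pd C p.1 (pd C p.2 (sg r)) y| <= c).
  by move=> p; case: (Cloc_pd C p.1 (Cloc_pd C p.2 hf)).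
have ns := Cloc_schwarz FF C hf.
pose M := M3 + \sum_k M2 k + \sum_k L1 k + \sum_p L2 p + \sum_p `|b2 p|.
have M2s : 0 <= \sum_k M2 k by apply: sumr_ge0 => k _; exact: (n2 k).1.
have L1s : 0 <= \sum_k L1 k by apply: sumr_ge0 => k _; exact: (nl1 k).1.
have L2s : 0 <= \sum_p L2 p by apply: sumr_ge0 => k _; exact: (nl2 k).1.
have b2s : 0 <= \sum_p `|b2 p| by apply: sumr_ge0.
have M2M k : M2 k <= M by have := le_sum_cst k (fun k => (n2 k).1); rewrite /M; lra.
have L1M k : L1 k <= M by have := le_sum_cst k (fun k => (nl1 k).1); rewrite /M; lra.
have L2M k : L2 k <= M by have := le_sum_cst k (fun k => (nl2 k).1); rewrite /M; lra.
have b2M k : b2 k <= M.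
  have := le_sum_cst k (fun k => normr_ge0 (b2 k)); have := ler_norm (b2 k).
  by rewrite /M; lra.
have M0 : 0 <= M by rewrite /M; lra.
have M3M : M3 <= M by rewrite /M; lra.
have n5 := nearF2_of_nearF FF (nearF_and FF ns (nearF_fin FF nb2)).
have [rho rho0 /nbhs_normP[d /= d0 hd]] := nearF2_and FF n5 (nearF2_and FF n3 (nearF2_and FF (nearF2_fin FF (fun k => (n2 k).2))
  (nearF2_and FF (nearF2_fin FF (fun k => (nl1 k).2)) (nearF2_fin FF (fun k => (nl2 k).2))))).
exists rho, d, M; split; [exact: rho0|exact: d0|move=> lo hi hT].
have rd r : lo <= r <= hi -> `|r0 - r| < d.
  by move=> rl; rewrite -normrN opprB; exact: (hT r rl).2.
have use r y y' (rl : lo <= r <= hi) (yr : `|y - y0| < rho) (y'r : `|y' - y0| < rho) :=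
  hd r (rd r rl) (hT r rl).1 y y' yr y'r.
have mono (c e : R) k : c <= M -> 0 <= e -> c * e ^+ k <= M * e ^+ k.
  by move=> cM e0; apply: ler_wpM2r => //; exact: exprn_ge0.
split.
- exact: M0.
- move=> r y y' rl yr y'r; have [_ [h _]] := use r y y' rl yr y'r.
  exact: le_trans h (mono _ _ 3%N M3M (normr_ge0 _)).
- move=> r y y' k rl yr y'r; have [_ [_ [/(_ k) h _]]] := use r y y' rl yr y'r.
  exact: le_trans h (mono _ _ 2%N (M2M k) (normr_ge0 _)).
- move=> r y y' k rl yr y'r; have [_ [_ [_ [/(_ k) h _]]]] := use r y y' rl yr y'r.
  exact: le_trans h (ler_wpM2r (normr_ge0 _) (L1M k)).
- move=> r y y' i k rl yr y'r; have [_ [_ [_ [_ /(_ (i, k)) h]]]] := use r y y' rl yr y'r.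
  exact: le_trans h (ler_wpM2r (normr_ge0 _) (L2M (i, k))).
- move=> r y i k rl yr; have [[_ /(_ (i, k)) h] _] := use r y y rl yr yr.
  exact: le_trans h (b2M (i, k)).
- by move=> r y i k rl yr; have [[h _] _] := use r y y rl yr yr.
Qed.

End TaylorBounds.

(** * Expansions of the gradient and of the value on the whole interval *)

Section HJGlobal.
Context {R : realType} {N K : nat}.
Local Notation TQ := ('rV[R]_N * 'rV[R]_N)%type.
Variables (alpha t0 t1 : R) (Z : R -> 'rV[R]_K) (ZZ : R -> R -> 'M[R]_K).
Hypotheses (al3 : 3^-1 < alpha) (al2 : alpha <= 2^-1).
Hypothesis rp : geometric_rough_path alpha Z ZZ t0 t1.
Local Notation B := (@tqB R N).
Local Notation C := (rV_coords (R := R) N).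

Lemma bO_dom2_sub {E : Type} (A A' : set E) (lo lo' hi hi' : E -> R) k F :
  (forall e, A' e -> [/\ A e, lo e <= lo' e & hi' e <= hi e]) ->
  bO (dom2 A lo hi) (eta2 alpha) k F -> bO (dom2 A' lo' hi') (eta2 alpha) k F.
Proof.
move=> h; apply: (bO_pull (phi := id)) => [t _|]; first exact: powR_ge0.
move=> -[[e u] v] [] /= Ae lu uv vh; have [Ae' l1 h1] := h _ Ae.
by split => //; split => //=; [exact: le_trans lu|exact: le_trans h1].
Qed.

(* [Y' (y, u, v)] is the momentum at time [v] of the characteristic that sits at
   the point [gradpt sg u y] of the graph of the gradient at time [u]. *)
Record characteristics (sg : R -> 'rV[R]_N -> R) (hh : TQ -> R) (h : 'I_K -> TQ -> R)
    (lo hi d rho : R) (y0 : 'rV[R]_N) (Y' : 'rV[R]_N * R * R -> 'rV[R]_N) : Prop := {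
  ch_near : forall t, dom2 [set y | `|y - y0| < d] (fun=> lo) (fun=> hi) t ->
    `|Y' t - y0| < rho;
  ch_incr : forall k, bO (dom2 [set y | `|y - y0| < d] (fun=> lo) (fun=> hi)) (eta2 alpha) 2
    (fun t => crd C (Y' t - t.1.1) k
      + \sum_j pd B (inl k) (h j) (gradpt sg t.1.2 t.1.1) * dZ Z t.1.2 t.2 j);
  ch_grad : forall k, bO (dom2 [set y | `|y - y0| < d] (fun=> lo) (fun=> hi)) (eta2 alpha) 2
    (fun t => pd C k (sg t.2) (Y' t) - pd C k (sg t.1.2) t.1.1
      - \sum_j pd B (inr k) (h j) (gradpt sg t.1.2 t.1.1) * dZ Z t.1.2 t.2 j);
  ch_val : bO (dom2 [set y | `|y - y0| < d] (fun=> lo) (fun=> hi)) (eta2 alpha) 3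
    (fun t => sg t.2 (Y' t) - sg t.1.2 t.1.1
      - \sum_k crd C (Y' t - t.1.1) k * pd C k (sg t.2) (Y' t)
      - hh (gradpt sg t.1.2 t.1.1) * (t.2 - t.1.2)
      - \sum_j h j (gradpt sg t.1.2 t.1.1) * dZ Z t.1.2 t.2 j
      - \sum_i \sum_j (\sum_k pd B (inl k) (h j) (gradpt sg t.1.2 t.1.1)
          * pd B (inr k) (h i) (gradpt sg t.1.2 t.1.1)) * ZZ t.1.2 t.2 i j) }.

Variables (sg : R -> 'rV[R]_N -> R) (hh : TQ -> R) (h : 'I_K -> TQ -> R).
Variables (U V : R) (y0 : 'rV[R]_N).
Hypotheses (t0U : t0 <= U) (Vt1 : V <= t1) (hs : smooth hh) (hjs : forall j, smooth (h j)).
Let T : set R := [set r | U <= r <= V].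
Local Notation x r := (gradpt sg r y0).
Local Notation P k r := (pd C k (sg r) y0).
Local Notation P2 i k r := (pd C i (pd C k (sg r)) y0).
Local Notation rt j k r := (rate sg h j k r r y0).

Hypothesis hC : forall r0, T r0 -> Cloc 3 (within T (nbhs r0)) y0 sg.
Hypothesis hcont : forall r0 e, T r0 -> 0 < e -> exists2 d, 0 < d & forall r y,
  T r -> `|r - r0| < d -> `|y - y0| < d -> `|gradpt sg r y - gradpt sg r0 y0| < e.
Hypothesis hchar : forall r0 rho, T r0 -> 0 < rho -> exists2 d, 0 < d &
  exists Y', characteristics sg hh h (Num.max U (r0 - d)) (Num.min V (r0 + d)) d rho y0 Y'.

Let step1 k (t : unit * R * R) : R :=
  P k t.2 - P k t.1.2 - \sum_j rt j k t.1.2 * dZ Z t.1.2 t.2 j.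
Let step2 j k (t : unit * R * R) : R := rt j k t.2 - rt j k t.1.2.
Let step3 (t : unit * R * R) : R := sg t.2 y0 - sg t.1.2 y0
  - hh (x t.1.2) * (t.2 - t.1.2) - \sum_j h j (x t.1.2) * dZ Z t.1.2 t.2 j
  - \sum_i \sum_j (\sum_k pd B (inl k) (h j) (x t.1.2) * rt i k t.1.2) * ZZ t.1.2 t.2 i j.

(** Near a given time all the requirements of the local expansions hold on a common window; the
    order 0 bounds below and [bO_seg] then extend them to [U, V]. *)
Let local r0 : T r0 -> exists2 d, 0 < d &
  let O n := bO (segdom (Num.max U (r0 - d)) (Num.min V (r0 + d))) (eta2 alpha) n in
  [/\ forall k, O 2 (step1 k), forall j k, O 1 (step2 j k) & O 3 step3].
Proof.
move=> Tr; have [rho [d1 [M [rho0 d10 htb]]]] := taylor_bounds_exist (hC Tr).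
have [d2 d20 [Y' ch]] := hchar Tr rho0.
have [rc rc0 hdh] : exists2 rc, 0 < rc &
    forall u : ('I_N + 'I_N) * 'I_K, tame B (pd B u.1 (h u.2)) (x r0) rc.
  by apply: smooth_tame_fin => u; exact: smooth_pd.
have [d3 d30 hd3] := hcont Tr rc0.
pose d := Num.min rho (Num.min d2 d3).
have d0 : 0 < d by rewrite !lt_min rho0 d20.
pose b := \sum_i `|bas C i|.
have [d4 d40 hd4] := small_powR b (alpha_gt0 al3) d0.
(* The quarter leaves room: the window is at most [2 * tau] long, strictly below [d4], as [hsmall]
   requires. *)
pose tau := Num.min (Num.min d1 d2) (Num.min d3 d4) / 4.
have m0 : 0 < Num.min (Num.min d1 d2) (Num.min d3 d4) by rewrite !lt_min d10 d20 d30.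
have tau0 : 0 < tau by rewrite divr_gt0.
have taum : 4 * tau = Num.min (Num.min d1 d2) (Num.min d3 d4) by rewrite /tau; field.
have [td1 td2 td3 td4] : [/\ 4 * tau <= d1, 4 * tau <= d2, 4 * tau <= d3 & 4 * tau <= d4].
  by rewrite taum !ge_min !lexx !orbT.
exists tau => //; set lo := Num.max U (r0 - tau); set hi := Num.min V (r0 + tau).
have inn r : lo <= r <= hi -> T r /\ `|r - r0| <= tau.
  rewrite ge_max le_min => /andP[/andP[a1 a2] /andP[a3 a4]]; split; first exact/andP.
  by rewrite ler_norml; apply/andP; split; lra.
have tb : taylor_bounds sg lo hi rho M y0.
  by apply: htb => r /inn[Tr' rr]; split => //; apply: le_lt_trans rr _; lra.
have sub k F : bO (dom2 [set y | `|y - y0| < d2] (fun=> Num.max U (r0 - d2))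
      (fun=> Num.min V (r0 + d2))) (eta2 alpha) k F ->
    bO (dom2 [set y | `|y - y0| < d] (fun=> lo) (fun=> hi)) (eta2 alpha) k F.
  apply: bO_dom2_sub => y /= yd; split.
  - by apply: lt_le_trans yd _; rewrite !ge_min lexx orbT.
  - by rewrite ge_max !le_max lexx /=; apply/orP; right; lra.
  - by rewrite le_min !ge_min lexx /=; apply/orP; right; lra.
have t0lo : t0 <= lo by rewrite le_max t0U.
have hit1 : hi <= t1 by rewrite ge_min Vt1.
have drho : d <= rho by rewrite ge_min lexx.
have hx r y : lo <= r <= hi -> `|y - y0| < d -> `|gradpt sg r y - x r0| < rc.
  move=> /inn[Tr' rr] yd; apply: hd3 => //; first by apply: le_lt_trans rr _; lra.
  by apply: lt_le_trans yd _; rewrite !ge_min lexx !orbT.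
have hsm i : (hi - lo) `^ alpha * `|bas C i| < d.
  have /andP[Ur rV] := Tr.
  have lor : lo <= r0 by rewrite ge_max Ur lerBlDr lerDl ltW.
  have rhi : r0 <= hi by rewrite le_min rV lerDl ltW.
  have l1 : r0 - tau <= lo by rewrite le_max lexx orbT.
  have h1 : hi <= r0 + tau by rewrite ge_min lexx orbT.
  apply: le_lt_trans (hd4 (hi - lo) _ _); [|by rewrite subr_ge0 (le_trans lor)|lra].
  rewrite mulrC; apply: ler_wpM2r; first exact: powR_ge0.
  exact: (le_sum_cst i (fun i => normr_ge0 (bas C i))).
have hY t : dom2 [set y | `|y - y0| < d] (fun=> lo) (fun=> hi) t -> `|Y' t - y0| < rho.
  case: t => -[y u] v [] /= yd lu uv vh; apply: (ch_near ch); split => //=.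
  - by apply: lt_le_trans yd _; rewrite !ge_min lexx orbT.
  - by apply: le_trans lu; rewrite ge_max !le_max lexx /=; apply/orP; right; lra.
  - by apply: le_trans vh _; rewrite le_min !ge_min lexx /=; apply/orP; right; lra.
have hinc k := sub _ _ (ch_incr ch k).
have hgrad k := sub _ _ (ch_grad ch k).
have hval := sub _ _ (ch_val ch).
have hdh' l j : tame B (pd B l (h j)) (x r0) rc := hdh (l, j).
have g1 := gradpt_step al3 rp t0lo hit1 d0 drho tb hx hdh' hsm hY hinc hgrad.
have g2 := rate_incr al3 rp t0lo hit1 d0 drho tb hx hdh' hsm hY hinc hgrad.
have g3 := value_step al3 rp t0lo hit1 d0 drho tb hx hdh' hsm hY hinc hgrad hval.
by split; [exact: g1|exact: g2|exact: g3].
Qed.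

Let bdd f : smooth f -> exists c, forall r, U <= r <= V -> `|f (x r)| <= c.
Proof.
move=> sf; apply: bdd_seg => r0 Tr; have [rc rc0 [c c0 hc]] := smooth_tame B (x r0) sf.
have [d d0 hd] := hcont Tr rc0; exists d => //; exists c => r Tr' rd.
have xr : `|x r - x r0| < rc by apply: hd => //; rewrite subrr normr0.
by have [] := hc _ _ xr xr.
Qed.

Let bdd_P k : exists c, forall r, U <= r <= V -> `|P k r| <= c.
Proof.
apply: bdd_seg => r0 Tr; have [d d0 hd] := hcont Tr ltr01.
exists d => //; exists (`|x r0| + 1) => r Tr' rd.
apply: (@le_trans _ _ `|x r|).
  by have := crd_le B (x r) (inl k); rewrite -rVcrd_fst mxE.
rewrite -{1}(subrK (x r0) (x r)); apply: le_trans (ler_normD _ _) _.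
by rewrite addrC lerD2l ltW //; apply: hd => //; rewrite subrr normr0.
Qed.

Let near_bdd (f : R -> 'rV[R]_N -> R) : (forall r0, T r0 -> exists c,
    nearF (within T (nbhs r0)) y0 (fun r y => `|f r y| <= c)) ->
  exists c, forall r, U <= r <= V -> `|f r y0| <= c.
Proof.
move=> hf; apply: bdd_seg => r0 /hf[c [r r_0 /nbhs_normP[d d0 hd]]].
exists d => //; exists c => s Ts sr; apply: (hd s) => //=; first by rewrite -normrN opprB.
by rewrite subrr normr0.
Qed.

Let bdd_P2 i k : exists c, forall r, U <= r <= V -> `|P2 i k r| <= c.
Proof.
apply: (near_bdd (f := fun r y => pd C i (pd C k (sg r)) y)) => r0 Tr.
by case: (Cloc_pd C i (Cloc_pd C k (hC Tr))).
Qed.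

Let bdd_sg : exists c, forall r, U <= r <= V -> `|sg r y0| <= c.
Proof. by apply: near_bdd => r0 Tr; case: (hC Tr). Qed.

Local Notation O := (bO (segdom U V) (eta2 alpha)).
Let lohi (e : unit) : [set: unit] e -> t0 <= U /\ V <= t1. Proof. by []. Qed.
Local Notation sc := (scale2 al3 lohi).

Let O0u f : (exists c, forall r, U <= r <= V -> `|f r| <= c) ->
  O 0 (fun t => f t.1.2) /\ O 0 (fun t => f t.2).
Proof.
move=> [c hc]; split; exists c => -[[e u] v] [] /= _ lu uv vh; rewrite expr0 mulr1; apply: hc.
  by rewrite lu (le_trans uv).
by rewrite vh (le_trans lu).
Qed.

Let bdd_rt j k : O 0 (fun t => rt j k t.1.2) /\ O 0 (fun t => rt j k t.2).
Proof.
have [a1 a2] := O0u (bdd (smooth_pd B (inr k) (hjs j))).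
have b i := O0u (bdd (smooth_pd B (inl i) (hjs j))).
have c i := O0u (bdd_P2 i k).
split; apply: bOD => //; apply: bO_sum => i.
  exact: (bO_mulr sc (b i).1 (c i).1).
exact: (bO_mulr sc (b i).2 (c i).2).
Qed.

Let dZ0 j : O 0 (fun t => dZ Z t.1.2 t.2 j).
Proof. exact: (bOW sc (l := 1) _ (bO_dZ rp lohi j)). Qed.

Lemma grad_increment k : O 2 (fun t => P k t.2 - P k t.1.2
  - \sum_j rt j k t.1.2 * dZ Z t.1.2 t.2 j).
Proof.
apply: (bO_seg al3 t0U Vt1) => [r0 /local[d d0 [h1 _ _]]|]; first by exists d => //; exact: h1.
have [h1 h2] := O0u (bdd_P k).
apply: bOB; first exact: bOB.
by apply: bO_sum => j; exact: (bO_mulr sc (bdd_rt j k).1 (dZ0 j)).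
Qed.

Lemma grad_rate_increment j k : O 1 (fun t => rt j k t.2 - rt j k t.1.2).
Proof.
apply: (bO_seg al3 t0U Vt1) => [r0 /local[d d0 [_ h1 _]]|]; first by exists d => //; exact: h1.
by have [h1 h2] := bdd_rt j k; exact: bOB.
Qed.

Lemma grad_rate_bdd j k : O 0 (fun t => rt j k t.1.2).
Proof. exact: (bdd_rt j k).1. Qed.

Lemma value_increment : O 3 (fun t => sg t.2 y0 - sg t.1.2 y0
  - hh (x t.1.2) * (t.2 - t.1.2) - \sum_j h j (x t.1.2) * dZ Z t.1.2 t.2 j
  - \sum_i \sum_j (\sum_k pd B (inl k) (h j) (x t.1.2) * rt i k t.1.2) * ZZ t.1.2 t.2 i j).
Proof.
apply: (bO_seg al3 t0U Vt1) => [r0 /local[d d0 [_ _ h1]]|]; first by exists d => //; exact: h1.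
have [s1 s2] := O0u bdd_sg.
apply: bOB; [apply: bOB; [apply: bOB; [exact: bOB|]|]|].
- have h2 : O 0 (fun t => t.2 - t.1.2).
    exact: (bOW sc (l := 2) _ (bO_h2 al2 lohi)).
  exact: (bO_mulr sc (O0u (bdd hs)).1 h2).
- by apply: bO_sum => j; exact: (bO_mulr sc (O0u (bdd (hjs j))).1 (dZ0 j)).
apply: bO_sum => i; apply: bO_sum => j.
have zz : O 0 (fun t => ZZ t.1.2 t.2 i j).
  exact: (bOW sc (l := 2) _ (bO_ZZ rp lohi i j)).
apply: (bO_mulr sc _ zz); apply: bO_sum => k.
exact: (bO_mulr sc (O0u (bdd (smooth_pd B (inl k) (hjs j)))).1 (bdd_rt i k).1).
Qed.

End HJGlobal.

(** * The rate as a spatial gradient *)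

Section RateChain.
Context {R : realType} {N K : nat}.
Local Notation TQ := ('rV[R]_N * 'rV[R]_N)%type.
Local Notation B := (@tqB R N).
Local Notation C := (rV_coords (R := R) N).

(** Chain rule along the graph of the gradient; symmetry of the Hessian matches the indices. This
    identifies the Gubinelli derivative appearing in the equation. *)
Lemma rate_chain (sg : R -> 'rV[R]_N -> R) (T : set R) (r : R) (y0 : 'rV[R]_N)
    (h : 'I_K -> TQ -> R) j k : T r -> Cloc 3 (within T (nbhs r)) y0 sg -> smooth (h j) ->
  is_derive y0 (bas C k) (fun y => h j (gradpt sg r y)) (rate sg h j k r r y0).
Proof.
move=> Tr hf sh; set F := within T (nbhs r) in hf.
have FF : Filter F by exact: within_filter.
have here Q : nearF F y0 Q -> Q r y0.
  by move=> [d d0 /nbhs_singleton hd]; apply: hd; rewrite ?subrr ?normr0.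
have hP l : is_derive y0 (bas C k) (pd C l (sg r)) (pd C k (pd C l (sg r)) y0).
  have := here _ (Cloc_is_derive FF C (Cloc_pred (Cloc_pd C l hf))) => /(_ (bas C k)).
  congr is_derive; rewrite (bigD1 k) // crd_bas eqxx mul1r big1; first exact: addr0.
  by move=> i ik; rewrite crd_bas eq_sym (negbTE ik) mul0r.
have sym i : pd C i (pd C k (sg r)) y0 = pd C k (pd C i (sg r)) y0.
  by have := here _ (Cloc_schwarz FF C hf) => /(_ i k).
apply: is_derive_of_line.
have y00 : y0 + (0 : R) *: bas C k = y0 by rewrite scale0r addr0.
have [rc rc0 [c c0 hc]] := smooth_tame B (gradpt sg r y0) sh.
pose dx (l : 'I_N + 'I_N) : R :=
  match l with inl l => pd C k (pd C l (sg r)) y0 | inr l => (k == l)%:R end.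
have hdx l : is_derive (0 : R) 1 (fun e : R => crd B (gradpt sg r (y0 + e *: bas C k)) l) (dx l).
  case: l => l; rewrite /dx.
    have := @is_derive_line R _ (pd C l (sg r)) y0 (bas C k) 0 (pd C k (pd C l (sg r)) y0).
    rewrite y00 => /(_ (hP l)); congr is_derive; apply/funext => e.
    by rewrite -rVcrd_fst mxE.
  have := iderD (ider_cst (crd C y0 l) 0) (is_derive_mulrC ((k == l)%:R : R) 0).
  rewrite add0r; congr is_derive; apply/funext => e.
  by rewrite [RHS](_ : _ = crd C (y0 + e *: bas C k) l) // crdD crdZ crd_bas.
have := @chain_curve R _ _ B (h j) (fun e : R => gradpt sg r (y0 + e *: bas C k)) 0 dx
  (fun l => pd B l (h j) (gradpt sg r y0)) c rc rc0 c0 hdx.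
rewrite y00 => hch; have {}hch := hch _.
have E : \sum_l dx l * pd B l (h j) (gradpt sg r y0) = rate sg h j k r r y0.
  rewrite big_sumType /= addrC /rate; congr (_ + _).
    rewrite (bigD1 k) // eqxx mul1r big1; first exact: addr0.
    by move=> i ik; rewrite eq_sym (negbTE ik) mul0r.
  by apply: eq_bigr => i _; rewrite mulrC sym.
rewrite -E; apply: hch => y yr.
by have [||_ _ h2] := hc (gradpt sg r y0) y; rewrite ?subrr ?normr0.
Qed.

End RateChain.

(** * From a local expansion to the integral equation *)

Section ControlledPath.
Context {R : realType} {K : nat}.
Variables (alpha t0 t1 : R) (Z : R -> 'rV[R]_K) (ZZ : R -> R -> 'M[R]_K).
Hypotheses (al3 : 3^-1 < alpha) (al2 : alpha <= 2^-1).
Hypothesis rp : geometric_rough_path alpha Z ZZ t0 t1.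
Variables (a b : R).
Hypotheses (t0a : t0 <= a) (ab : a <= b) (bt1 : b <= t1).
Local Notation fct := (fctrl alpha Z [set: unit] (fun=> a) (fun=> b)).
Local Notation O := (bO (segdom a b) (eta2 alpha)).
Let lohi (e : unit) : [set: unit] e -> t0 <= a /\ b <= t1. Proof. by []. Qed.
Local Notation sc := (scale2 al3 lohi).

Lemma fctrl_controlled {V : normedModType R} {I : finType} (B : coords V I)
    (F : R -> V) (F' : R -> 'I_K -> V) :
  (forall l, fct (fun _ r => crd B (F r) l) (fun _ r i => crd B (F' r i) l)) ->
  controlled alpha Z a b F F'.
Proof.
move=> h; have /choice[c2 h2] : forall l, exists c, 0 <= c /\ forall t, segdom a b t ->
    `|crd B (F t.2) l - crd B (F t.1.2) l - \sum_i dZ Z t.1.2 t.2 i * crd B (F' t.1.2 i) l|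
      <= c * eta2 alpha t ^+ 2.
  by move=> l; have [c c0 hc] := bO_ge0 sc (fctrl_rem (h l)); exists c.
have /choice[c1 h1] : forall p : I * 'I_K, exists c, 0 <= c /\ forall t, segdom a b t ->
    `|crd B (F' t.2 p.2) p.1 - crd B (F' t.1.2 p.2) p.1| <= c * eta2 alpha t ^+ 1.
  by move=> p; have [c c0 hc] := bO_ge0 sc (fctrl_der (h p.1) p.2); exists c.
pose c := \sum_l c2 l * `|bas B l| + \sum_i \sum_l c1 (l, i) * `|bas B l|.
have s1 i : \sum_l c1 (l, i) * `|bas B l| <= c.
  apply: le_trans (le_sum_cst (c := fun i => \sum_l c1 (l, i) * `|bas B l|) i _) _.
    by move=> k; apply: sumr_ge0 => l _; rewrite mulr_ge0 // (h1 (l, k)).1.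
  by rewrite lerDr; apply: sumr_ge0 => l _; rewrite mulr_ge0 //; case: (h2 l).
have s2 : \sum_l c2 l * `|bas B l| <= c.
  by rewrite lerDl; apply: sumr_ge0 => i _; apply: sumr_ge0 => l _; rewrite mulr_ge0 // (h1 (l, i)).1.
exists c => u v au uv vb; have d : segdom a b (tt, u, v) by [].
have vu : 0 <= v - u by rewrite subr_ge0.
split.
  rewrite (powR_alpha alpha 2 vu).
  apply: (@le_trans _ _ ((\sum_l c2 l * `|bas B l|) * ((v - u) `^ alpha) ^+ 2)); last first.
    by apply: ler_wpM2r => //; rewrite exprn_ge0 // powR_ge0.
  apply: le_trans (norm_crd_le B _) _; rewrite mulr_suml; apply: ler_sum => l _.
  rewrite mulrAC; apply: ler_wpM2r => //; have [_ /(_ _ d) /=] := h2 l.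
  suff -> : crd B (F v - F u - \sum_i (Z v - Z u) 0 i *: F' u i) l =
      crd B (F v) l - crd B (F u) l - \sum_i dZ Z u v i * crd B (F' u i) l by [].
  rewrite !crdB; congr (_ - _ - _).
  elim/big_rec2 : _ => [|i y1 y2 _ IH]; first exact: crd0.
  by rewrite crdD crdZ IH.
move=> i; apply: (@le_trans _ _ ((\sum_l c1 (l, i) * `|bas B l|) * (v - u) `^ alpha)); last first.
  by apply: ler_wpM2r => //; exact: powR_ge0.
apply: le_trans (norm_crd_le B _) _; rewrite mulr_suml; apply: ler_sum => l _.
rewrite mulrAC; apply: ler_wpM2r => //; have [_ /(_ _ d) /=] := h1 (l, i).
by rewrite crdB expr1.
Qed.

Lemma bO3_constant (psi : R -> R) : O 3 (fun t => psi t.2 - psi t.1.2) -> psi b = psi a.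
Proof.
move=> [c hc]; apply/eqP; rewrite -subr_eq0; apply/eqP.
have h1 : sum_lim (fun _ _ => 0) a b (psi b - psi a).
  apply: (@sum_lim_increment R _ psi a b c (3 * alpha) 1 (alpha3_gt1 al3) ltr01) => u v au uv vb _.
  rewrite sub0r normrN (powR_alpha alpha 3) ?subr_ge0 //.
  exact: (hc (tt, u, v)).
have h2 : sum_lim (fun _ _ => 0) a b ((fun _ : R => 0 : R) b - (fun _ : R => 0) a).
  apply: (@sum_lim_increment R _ (fun=> 0) a b 0 (3 * alpha) 1 (alpha3_gt1 al3) ltr01).
  by move=> u v *; rewrite subrr subr0 normr0 mul0r.
by rewrite (sum_lim_unique ab h1 h2) subrr.
Qed.

Context {V : normedModType R} {I : finType} (B : coords V I).
Variables (X : R -> V) (X' : R -> 'I_K -> V) (H : V -> R) (cH : V -> 'rV[R]_K).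
Hypotheses (Hs : smooth H) (cHs : forall j, smooth (fun x => cH x 0 j)).
Hypothesis hX : forall l, fct (fun _ r => crd B (X r) l) (fun _ r i => crd B (X' r i) l).

Let hcH j : fct (fun _ r => cH (X r) 0 j)
  (fun _ r i => \sum_l crd B (X' r i) l * pd B l (fun x => cH x 0 j) (X r)).
Proof. exact: (fctrl_global al3 rp t0a bt1 hX (cHs j)). Qed.

Lemma controlled_comp : controlled alpha Z a b (cH \o X) (chain_gub cH X X').
Proof.
apply: (fctrl_controlled (B := rV_coords K)) => j.
have := hcH j; congr (fctrl _ _ _ _ _ _ _).
apply/funext => e; apply/funext => r; apply/funext => i.
by rewrite -[RHS]/((chain_gub cH X X' r i) 0 j) /chain_gub (derive_row B).
Qed.

(** The time integral and the rough integral have together the same expansion as [phi]. The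
    difference is an increment of order 3, hence zero by [bO3_constant]. *)
Lemma integral_equation (phi : R -> R) :
  O 3 (fun t => phi t.2 - phi t.1.2 - H (X t.1.2) * (t.2 - t.1.2)
    - \sum_j cH (X t.1.2) 0 j * dZ Z t.1.2 t.2 j
    - \sum_i \sum_j (\sum_l crd B (X' t.1.2 i) l * pd B l (fun x => cH x 0 j) (X t.1.2))
      * ZZ t.1.2 t.2 i j) ->
  phi b - phi a = \int[lebesgue_measure]_(r in `[a, b]) H (X r) + rough_int_comp Z ZZ cH X X' a b.
Proof.
move=> hphi.
have [/(_ tt Logic.I) i1 i2] := Rint_family al3 al2 lohi (f := fun _ r => H (X r))
  (fctrl_inc al3 rp lohi (fctrl_global al3 rp t0a bt1 hX Hs)).
have [r1 r2] := rough_comp_family (B := B) al3 rp lohi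
  (X := fun _ => X) (X' := fun _ => X') cHs hcH.
pose It u v : R := \int[lebesgue_measure]_(r in `[u, v]) H (X r).
pose Rt u v : R := rough_int_comp Z ZZ cH X X' u v.
(* Additivity on the degenerate interval reads [Rt a a = Rt a a + Rt a a]. *)
have Rt0 : Rt a a = 0.
  have := r1 tt a a a Logic.I (lexx a) (lexx a) (lexx a) ab; rewrite -/(Rt a a).
  by move: (Rt a a) => x h; lra.
have It0 : It a a = 0.
  have := Rint_add (lexx a) (lexx a) (within_itv_sub (lexx a) ab i1); rewrite -/(It a a).
  by move: (It a a) => x h; lra.
have key : O 3 (fun t => (phi t.2 - It a t.2 - Rt a t.2) - (phi t.1.2 - It a t.1.2 - Rt a t.1.2)).
  apply: bO_eq (bOB (bOB hphi i2) r2) => -[[e u] v] [] /= _ au uv vb.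
  have -> : It a v = It a u + It u v.
    by apply: Rint_add => //; exact: within_itv_sub (lexx a) vb i1.
  have -> : Rt a v = Rt a u + Rt u v by exact: (r1 tt a u v Logic.I).
  rewrite -/(It u v) -/(Rt u v).
  move: (It a u) (It u v) (Rt a u) (Rt u v) (phi v) (phi u) (H (X u) * _) => c1 c2 c3 c4 c5 c6 c7.
  move: (\sum_j _) (\sum_i _) => s1 s2.
  by ring.
have := @bO3_constant (fun r => phi r - It a r - Rt a r) key; cbv beta; rewrite It0 Rt0 -/(It a b) -/(Rt a b).
by move: (It a b) (Rt a b) (phi a) (phi b) => c1 c2 c3 c4 h; lra.
Qed.

End ControlledPath.

Lemma nonexpansive_continuous {R : realType} {V W : normedModType R} (f : V -> W) :
  (forall y z, `|f y - f z| <= `|y - z|) -> continuous f.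
Proof.
move=> hf y; apply/cvgrPdist_lt => e e0; apply/nbhs_normP; exists e => //= z /=.
exact: le_lt_trans.
Qed.

Lemma ClocN {R : realType} {P : Type} {V : normedModType R} (F : set_system P) (FF : Filter F)
    n x0 (f : P -> V -> R) : Cloc n F x0 f -> Cloc n F x0 (fun a x => - f a x).
Proof.
elim: n f => [|n IH] f [h1 [c h2] h3].
all: have k1 : nearF F x0 (fun a x => {for x, continuous (fun x => - f a x)}).
1,3: by apply: (nearF_imp FF) h1 => a x hc; exact: continuousN.
all: have k2 : nearF F x0 (fun a x => `|- f a x| <= c).
1,3: by apply: (nearF_imp FF) h2 => a x; rewrite normrN.
  by split => //; exists c.
split => //; first by exists c.
move=> v; have [h4 h5] := h3 v; split.
  by apply: (nearF_imp FF) h4 => a x hd; exact: derivableN.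
apply: (Cloc_ext FF) (IH _ h5); apply: (nearF_imp FF) h4 => a x hd.
by rewrite -(deriveN hd).
Qed.

(** * Symplectic rotation of phase space *)

Section Swap.
Context {R : realType} {N : nat}.
Local Notation TQ := ('rV[R]_N * 'rV[R]_N)%type.
Local Notation B := (@tqB R N).

(** For the negated generating function as a function of q, [gradpt] is the pair (-p, q), which
    [swap] sends to (q, p). The backward equation thereby takes the forward form. *)
Definition swap (x : TQ) : TQ := (x.2, - x.1).

Lemma swap_affine (h : R) (v y : TQ) : swap (h *: v + y) = h *: swap v + swap y.
Proof. by rewrite -[RHS]/((_, _)) /swap /= opprD scalerN. Qed.

Lemma swap_continuous : continuous swap.
Proof.
apply: nonexpansive_continuous => y z.
rewrite [leLHS]/Num.Def.normr /= ge_max; apply/andP; split; first exact: norm_snd_le.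
apply: le_trans (norm_fst_le y z); rewrite -[X in _ <= X]normrN opprD; exact: lexx.
Qed.

Lemma smooth_swap (h : TQ -> R) : smooth h -> smooth (fun x => h (swap x)).
Proof.
move=> hs n; move: (hs n); elim: n h {hs} => [|n IH] h hn.
all: have ch := is_Cn_cont hn.
all: have cc : {within setT, continuous (fun x => h (swap x))}.
1,3: apply: continuous_subspaceT => x; apply: continuous_comp; [exact: swap_continuous|exact: ch].
  by split.
split => // v; have [dh cdh] := hn.2 (swap v); split.
  move=> x _; have := dh (swap x) Logic.I; rewrite /derivable.
  have -> : (fun h0 : R => h0^-1 *: (((fun x => h (swap x)) \o shift x) (h0 *: v) - h (swap x)))
     = (fun h0 : R => h0^-1 *: ((h \o shift (swap x)) (h0 *: swap v) - h (swap x))).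
    by apply/funext => h0 /=; rewrite swap_affine.
  by [].
apply: is_Cn_ext (IH _ cdh) => x.
exact: (esym (derive_affine h v x swap_affine)).
Qed.

Lemma pd_swap_inl (h : TQ -> R) k x : smooth h ->
  pd B (inl k) (fun x => h (swap x)) x = - pd B (inr k) h (swap x).
Proof.
move=> hs; rewrite pdE (derive_affine h _ x swap_affine).
have [_ ->] := smooth_is_derive B (swap x) (swap (bas B (inl k))) hs.
have crdE l : crd B (swap (bas B (inl k))) l = - (inr k == l)%:R.
  case: l => m; rewrite /= !mxE ?oppr0 //=.
  by rewrite (inj_eq inr_inj) eq_sym.
rewrite (bigD1 (inr k)) // crdE eqxx mulN1r big1; first exact: addr0.
by move=> i ik; rewrite crdE eq_sym (negbTE ik) oppr0 mul0r.
Qed.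

Lemma pd_swap_inr (h : TQ -> R) k x : smooth h ->
  pd B (inr k) (fun x => h (swap x)) x = pd B (inl k) h (swap x).
Proof.
move=> hs; rewrite pdE (derive_affine h _ x swap_affine).
have [_ ->] := smooth_is_derive B (swap x) (swap (bas B (inr k))) hs.
have crdE l : crd B (swap (bas B (inr k))) l = (inl k == l)%:R.
  case: l => m; rewrite /= !mxE ?oppr0 //=.
  by rewrite (inj_eq inl_inj) eq_sym.
rewrite (bigD1 (inl k)) // crdE eqxx mul1r big1; first exact: addr0.
by move=> i ik; rewrite crdE eq_sym (negbTE ik) mul0r.
Qed.

End Swap.

(** * Partial gradients of the generating function *)

Section BranchGradient.
Context {R : realType} {N K : nat}.
Local Notation TQ := ('rV[R]_N * 'rV[R]_N)%type.
Variables (alpha t0 t1 : R) (Z : R -> 'rV[R]_K) (ZZ : R -> R -> 'M[R]_K).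
Hypotheses (al3 : 3^-1 < alpha) (al2 : alpha <= 2^-1) (t01 : t0 <= t1).
Hypothesis rp : geometric_rough_path alpha Z ZZ t0 t1.
Variables (H : TQ -> R) (cH : TQ -> 'rV[R]_K).
Hypotheses (Hs : smooth H) (cHs : is_Cinf setT cH).
Variables (Om : R -> set TQ) (Phi : R -> R -> TQ -> TQ).
Variables (D : R -> R -> set TQ) (sol : R -> R -> TQ -> R -> TQ).
Hypothesis br : nondegenerate_branch alpha t0 t1 Z ZZ H cH Om Phi D sol.
Local Notation B := (@tqB R N).
Local Notation C := (rV_coords (R := R) N).
Local Notation act := (rough_action Z ZZ H cH).
Local Notation gen := (gen_fun Z ZZ H cH sol).

(** [continuation] identifies solutions only on [t0, t1], so the action must be seen to depend on
    the path over [u, v] alone. *)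
Lemma act_ext (X X1 : R -> TQ) u v : (forall r, u <= r <= v -> X r = X1 r) ->
  act X u v = act X1 u v.
Proof.
move=> e; rewrite /rough_action.
have -> : rough_int ZZ (fun r => (X r).2) (fun r i => (ham_gub cH X r i).2)
    (fun r => (X r).1) (fun r i => (ham_gub cH X r i).1) u v =
  rough_int ZZ (fun r => (X1 r).2) (fun r i => (ham_gub cH X1 r i).2)
    (fun r => (X1 r).1) (fun r i => (ham_gub cH X1 r i).1) u v.
  by apply: rough_int_ext => r ruv; rewrite /ham_gub e.
have -> : \int[lebesgue_measure]_(r in `[u, v]) H (X r) =
    \int[lebesgue_measure]_(r in `[u, v]) H (X1 r).
  by apply: eq_Rint => r ruv; rewrite e.
suff -> : rough_int_comp Z ZZ cH X (ham_gub cH X) u v =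
    rough_int_comp Z ZZ cH X1 (ham_gub cH X1) u v by [].
by apply: rough_int_ext => r ruv; rewrite /chain_gub /ham_gub /comp e.
Qed.

Lemma gen_pd_inl t s q p k : D t s (q, p) ->
  pd C k (fun q => gen t s (q, p)) q = (sol t s (q, p) s).2 0 k.
Proof.
move=> Dx; rewrite pdE.
rewrite (derive_affine (io := fun q => (q, p)) (io0 := fun v => (v, 0)) _ _ _ (affine_inl p)).
have [_ ->] := branch_gradient al3 al2 t01 rp Hs cHs br (bas C k, 0) Dx.
rewrite /dotr /= big1 ?add0r => [|i _]; last by rewrite mxE mul0r.
rewrite (bigD1 k) //= big1 ?addr0 => [|i ik].
  by rewrite mxE !eqxx mulr1.
by rewrite mxE eqxx (negbTE ik) mulr0.
Qed.

Lemma gen_pd_inr t s q p k : D t s (q, p) ->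
  pd C k (fun p => gen t s (q, p)) p = (sol t s (q, p) t).1 0 k.
Proof.
move=> Dx; rewrite pdE.
rewrite (derive_affine (io := fun p => (q, p)) (io0 := fun v => (0, v)) _ _ _ (affine_inr q)).
have [_ ->] := branch_gradient al3 al2 t01 rp Hs cHs br (0, bas C k) Dx.
rewrite /dotr /= addrC big1 ?add0r => [|i _]; last by rewrite mxE mulr0.
rewrite (bigD1 k) //= big1 ?addr0 => [|i ik].
  by rewrite mxE !eqxx mul1r.
by rewrite mxE eqxx (negbTE ik) mul0r.
Qed.

End BranchGradient.

(** * Families of characteristics started at varying points and times *)

Section CharacteristicFamily.
Context {R : realType} {N K : nat}.
Local Notation TQ := ('rV[R]_N * 'rV[R]_N)%type.
Variables (alpha t0 t1 : R) (Z : R -> 'rV[R]_K) (ZZ : R -> R -> 'M[R]_K).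
Hypotheses (al3 : 3^-1 < alpha) (al2 : alpha <= 2^-1) (t01 : t0 <= t1).
Hypothesis rp : geometric_rough_path alpha Z ZZ t0 t1.
Variables (H : TQ -> R) (cH : TQ -> 'rV[R]_K).
Hypotheses (Hs : smooth H) (cHs : is_Cinf setT cH).
Local Notation B := (@tqB R N).
Local Notation hj := (cHj cH).

Variables (X : 'rV[R]_N * R -> R -> TQ) (lo hi d r : R) (y0 : 'rV[R]_N) (xc : TQ).
Hypotheses (t0lo : t0 <= lo) (hit1 : hi <= t1) (vg : vgood H cH xc r).
Let A : set ('rV[R]_N * R) := [set e | `|e.1 - y0| < d /\ lo <= e.2 <= hi].
Hypothesis hsol : forall e, A e -> rough_hamilton_solution alpha t0 t1 Z ZZ H cH (X e).
Hypothesis hball : forall e s, A e -> lo <= s -> s <= hi -> `|X e s - xc| < r.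
Let lohi (e : 'rV[R]_N * R) : A e -> t0 <= lo /\ hi <= t1. Proof. by []. Qed.
Local Notation O := (bO (dom2 [set y | `|y - y0| < d] (fun=> lo) (fun=> hi)) (eta2 alpha)).
Let Xt (t : 'rV[R]_N * R * R) : R -> TQ := X (t.1.1, t.1.2).

Let pull k F : bO (dom2 A (fun=> lo) (fun=> hi)) (eta2 alpha) k F ->
  O k (fun t => F ((t.1.1, t.1.2), t.1.2, t.2)).
Proof.
apply: (bO_pull (phi := fun t => ((t.1.1, t.1.2), t.1.2, t.2))) => [t _|]; first exact: powR_ge0.
move=> -[[y u] v] [] /= Ay lu uv vh; split => //; split => //=; split => //=.
by rewrite lu (le_trans uv).
Qed.

Lemma char_incr1 l : O 1 (fun t => crd B (Xt t t.2 - Xt t t.1.2) l).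
Proof. exact: (pull (fam_incr1 al3 al2 t01 rp Hs cHs lohi (vg_good vg) hball hsol l)). Qed.

Lemma char_incr2 l : O 2 (fun t => crd B (Xt t t.2 - Xt t t.1.2) l
  - \sum_j hvf (hj j) l (Xt t t.1.2) * dZ Z t.1.2 t.2 j).
Proof. exact: (pull (fam_incr2 al3 al2 t01 rp Hs cHs lohi (vg_good vg) hball hsol l)). Qed.

Lemma char_bdd f : tame B f xc r -> O 0 (fun t => f (Xt t t.1.2)).
Proof.
move=> tf; have hx (t : ('rV[R]_N * R) * R * R) : dom2 A (fun=> lo) (fun=> hi) t ->
    `|X t.1.1 t.1.2 - xc| < r.
  by case: t => -[e u] v [] /= Ae lu uv vh; apply: hball => //; exact: le_trans vh.
exact: (pull (bO_tame _ hx tf)).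
Qed.

Lemma char_act : O 3 (fun t => rough_action Z ZZ H cH (Xt t) t.1.2 t.2
  - (\sum_k crd B (Xt t t.1.2) (inr k) * crd B (Xt t t.2 - Xt t t.1.2) (inl k)
     - H (Xt t t.1.2) * (t.2 - t.1.2) - \sum_j hj j (Xt t t.1.2) * dZ Z t.1.2 t.2 j
     - \sum_i \sum_j ab cH i j (Xt t t.1.2) * ZZ t.1.2 t.2 i j)).
Proof.
exact: (pull (fam_act al3 al2 t01 rp Hs cHs lohi (vg_good vg) hball hsol
  (conj (vg_H vg) (vg_dH vg)) (fun j => conj (vg_h vg j) (fun l => vg_dh vg l j)))).
Qed.

Let scY := scale2 al3 (A := [set y | `|y - y0| < d]) (lo := fun=> lo) (hi := fun=> hi)
  (fun _ _ => conj t0lo hit1).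

(** To order 3, the paired increments of position and momentum equal the paired first-order parts,
    which [quad_expand] converts into [ZZ] sums. *)
Lemma char_pairing : O 3 (fun t =>
  \sum_k crd B (Xt t t.2 - Xt t t.1.2) (inl k) * crd B (Xt t t.2 - Xt t t.1.2) (inr k)
  + (\sum_i \sum_j ab cH i j (Xt t t.1.2) * ZZ t.1.2 t.2 i j
     + \sum_i \sum_j ab cH j i (Xt t t.1.2) * ZZ t.1.2 t.2 i j)).
Proof.
pose L l t : R := \sum_j hvf (hj j) l (Xt t t.1.2) * dZ Z t.1.2 t.2 j.
have L1 l : O 1 (L l).
  apply: bO_sum => j; apply: (bO_mulr scY (char_bdd (good_Vf (vg_good vg) j l))).
  exact: (bO_dZ rp (A := [set y | `|y - y0| < d]) (fun _ _ => conj t0lo hit1)).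
apply: (bO_eq (B := fun t =>
  \sum_k ((crd B (Xt t t.2 - Xt t t.1.2) (inl k) - L (inl k) t) * crd B (Xt t t.2 - Xt t t.1.2) (inr k)
    + L (inl k) t * (crd B (Xt t t.2 - Xt t t.1.2) (inr k) - L (inr k) t)))); last first.
  apply: bO_sum => k; apply: bOD.
    exact: (bOM scY (m := 3) _ (char_incr2 (inl k)) (char_incr1 (inr k))).
  exact: (bOM scY (m := 3) _ (L1 (inl k)) (char_incr2 (inr k))).
move=> t Dt.
have hz i j : ZZ t.1.2 t.2 i j + ZZ t.1.2 t.2 j i = dZ Z t.1.2 t.2 i * dZ Z t.1.2 t.2 j.
  move: Dt; case: (t) => -[e u] v [] /= _ lu uv vh.
  by apply: (ZZ_sym rp) => //; [exact: le_trans lu|exact: le_trans hit1].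
have Q := quad_expand (fun i k => hvf (hj i) (inl k) (Xt t t.1.2))
  (fun j k => hvf (hj j) (inr k) (Xt t t.1.2)) hz.
have Q2 : \sum_k L (inl k) t * L (inr k) t =
   - (\sum_i \sum_j ab cH i j (Xt t t.1.2) * ZZ t.1.2 t.2 i j
     + \sum_i \sum_j ab cH j i (Xt t t.1.2) * ZZ t.1.2 t.2 i j).
  rewrite /L Q -big_split -sumrN; apply: eq_bigr => i _ /=; rewrite -big_split -sumrN.
  apply: eq_bigr => j _ /=; rewrite -mulrDl -mulNr; congr (_ * _).
  rewrite /ab -big_split -sumrN; apply: eq_bigr => k _ /=.
  move: (pd _ _ _ _) (pd _ _ _ _) (pd _ _ _ _) (pd _ _ _ _) => a b c e.
  by ring.
rewrite -[X in _ + X]opprK -Q2 -sumrB; apply: eq_bigr => k _.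
move: (L (inl k) t) (L (inr k) t) (crd B _ (inl k)) (crd B _ (inr k)) => a b c e.
by ring.
Qed.

End CharacteristicFamily.

(** * Forward equation: moving the final time *)

Section PartOne.
Context {R : realType} {N K : nat}.
Local Notation TQ := ('rV[R]_N * 'rV[R]_N)%type.
Variables (alpha t0 t1 : R) (Z : R -> 'rV[R]_K) (ZZ : R -> R -> 'M[R]_K).
Hypotheses (al3 : 3^-1 < alpha) (al2 : alpha <= 2^-1) (t01 : t0 <= t1).
Hypothesis rp : geometric_rough_path alpha Z ZZ t0 t1.
Variables (H : TQ -> R) (cH : TQ -> 'rV[R]_K).
Hypotheses (Hs : smooth H) (cHs : is_Cinf setT cH).
Variables (Om : R -> set TQ) (Phi : R -> R -> TQ -> TQ).
Variables (D : R -> R -> set TQ) (sol : R -> R -> TQ -> R -> TQ).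
Hypothesis br : nondegenerate_branch alpha t0 t1 Z ZZ H cH Om Phi D sol.
Local Notation B := (@tqB R N).
Local Notation C := (rV_coords (R := R) N).
Local Notation act := (rough_action Z ZZ H cH).
Local Notation gen := (gen_fun Z ZZ H cH sol).
Local Notation hj := (cHj cH).

Lemma norm_pair_le (x y : 'rV[R]_N) d : `|x| <= d -> `|y| <= d -> `|(x, y) : TQ| <= d.
Proof. by move=> xd yd; rewrite [X in X <= _]/Num.Def.normr /= ge_max xd. Qed.

Lemma pairr_lt (q y p : 'rV[R]_N) d : 0 < d -> `|y - p| < d -> `|(q, y) - (q, p) : TQ| < d.
Proof. by move=> d0 yp; apply: (@norm_pair1 R N (q - q) (y - p)) => //; rewrite subrr normr0. Qed.

Lemma pairl_lt (q y p : 'rV[R]_N) d : 0 < d -> `|y - q| < d -> `|(y, p) - (q, p) : TQ| < d.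
Proof. by move=> d0 yp; apply: (@norm_pair1 R N (y - q) (p - p)) => //; rewrite subrr normr0. Qed.

Variables (s U V : R) (q p : 'rV[R]_N).
Hypothesis hD : forall r, U <= r <= V -> D r s (q, p).
Let T : set R := [set r | U <= r <= V].
Let sg r y := gen r s (q, y).

Lemma forward_near r0 : T r0 -> exists2 d, 0 < d & forall r y, T r -> `|r - r0| < d ->
  `|y - p| < d -> D r s (q, y).
Proof.
move=> Tr; have [d d0 h] := branch_near br (hD Tr); exists d => // r y Tr' rr yp.
apply: h => //; first by rewrite subrr normr0.
  exact: pairr_lt.
by exists (q, p); exact: hD.
Qed.

Lemma forward_gradpt r y : D r s (q, y) -> gradpt sg r y = sol r s (q, y) r.
Proof.
move=> Dr; rewrite [RHS]surjective_pairing (branch_bdry br Dr).2; congr (_, _).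
by apply/rowP => k; rewrite mxE; exact: (gen_pd_inr al3 al2 t01 rp Hs cHs br k Dr).
Qed.

Lemma forward_Cloc r0 : T r0 -> Cloc 3 (within T (nbhs r0)) p sg.
Proof.
move=> Tr; have FF : Filter (within T (nbhs r0)) by exact: within_filter.
have nio (y z : 'rV[R]_N) : `|(q, y) - (q, z) : TQ| <= `|y - z|.
  by apply: (@norm_pair_le (q - q) (y - z)) => //; rewrite subrr normr0.
apply: (Cloc_affine FF (io := fun y => (q, y)) (io0 := fun v => (0, v)) (affine_inr q) nio
  (f := fun r => gen r s)).
apply: (Cloc_of_family FF (phi := fun r : R => (r, s)) (a0 := (r0, s)) _ _ _
  (branch_gen_smooth br 3)).
- move=> W [[U1 U2] [/= n1 n2] h]; rewrite /fmap /= /within /=.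
  by apply: filterS n1 => r r1 _; apply: h; split => //=; exact: nbhs_singleton.
- exact: hD.
have [d d0 hd] := branch_near br (hD Tr); exists d => //.
apply/nbhs_normP; exists d => // r /= rr Tr' y yr; apply: hd => //.
- by rewrite -normrN opprB.
- by rewrite subrr normr0.
by exists (q, p); exact: hD.
Qed.

Lemma forward_cont r0 e : T r0 -> 0 < e -> exists2 d, 0 < d & forall r y,
  T r -> `|r - r0| < d -> `|y - p| < d -> `|gradpt sg r y - gradpt sg r0 p| < e.
Proof.
move=> Tr e0; have D0 := hD Tr; have [ts st tt] := branch_time br D0.
have rt : t0 <= r0 <= t1 by rewrite (le_trans ts st).
have [d d0 hd] := sol_near br D0 rt e0; have [d1 d10 hd1] := forward_near Tr.
exists (Num.min d d1); first by rewrite lt_min d0.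
move=> r y Tr'; rewrite !lt_min => /andP[rd rd1] /andP[yd yd1].
have Dr := hd1 r y Tr' rd1 yd1; have [ts' st' tt'] := branch_time br Dr.
rewrite !forward_gradpt //; apply: hd => //.
- by rewrite subrr normr0.
- exact: pairr_lt.
by rewrite (le_trans ts' st').
Qed.

End PartOne.

Lemma forward_value_algebra {R : realType} (c1 c2 a1 a2 s w1 w2 w3 : R) :
  c1 - (a1 + a2) - (c2 - a1) - s - w1 - w2 - w3 = - (a2 - (c1 - c2 - s - w1 - w2 - w3)).
Proof. by ring. Qed.

Lemma clamp_near {R : realType} (a b r0 d r : R) :
  Num.max a (r0 - d) <= r -> r <= Num.min b (r0 + d) -> a <= r <= b /\ `|r - r0| <= d.
Proof.
rewrite ge_max le_min => /andP[-> a2] /andP[-> a4]; split => //.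
by rewrite ler_norml; apply/andP; split; lra.
Qed.

Section ForwardCharacteristics.
Context {R : realType} {N K : nat}.
Local Notation TQ := ('rV[R]_N * 'rV[R]_N)%type.
Variables (alpha t0 t1 : R) (Z : R -> 'rV[R]_K) (ZZ : R -> R -> 'M[R]_K).
Hypotheses (al3 : 3^-1 < alpha) (al2 : alpha <= 2^-1) (t01 : t0 <= t1).
Hypothesis rp : geometric_rough_path alpha Z ZZ t0 t1.
Variables (H : TQ -> R) (cH : TQ -> 'rV[R]_K).
Hypotheses (Hs : smooth H) (cHs : is_Cinf setT cH).
Variables (Om : R -> set TQ) (Phi : R -> R -> TQ -> TQ).
Variables (D : R -> R -> set TQ) (sol : R -> R -> TQ -> R -> TQ).
Hypothesis br : nondegenerate_branch alpha t0 t1 Z ZZ H cH Om Phi D sol.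
Local Notation B := (@tqB R N).
Local Notation C := (rV_coords (R := R) N).
Local Notation act := (rough_action Z ZZ H cH).
Local Notation gen := (gen_fun Z ZZ H cH sol).
Local Notation hj := (cHj cH).

Variables (s U V : R) (q p : 'rV[R]_N).
Hypothesis hD : forall r, U <= r <= V -> D r s (q, p).
Let T : set R := [set r | U <= r <= V].
Let sg r y := gen r s (q, y).


(** The characteristic from time u is itself the branch solution for its momentum at time v, so
    values and gradients at both times are read off one path, and the two actions differ by the
    action over [u, v]. *)
Lemma forward_char r0 rho : T r0 -> 0 < rho -> exists2 d, 0 < d &
  exists Y', characteristics alpha Z ZZ sg H hj (Num.max U (r0 - d)) (Num.min V (r0 + d)) d rho p Y'.
Proof.
move=> Tr rho0; have D0 := hD Tr; have [ts st tt] := branch_time br D0.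
have rt : t0 <= r0 <= t1 by rewrite (le_trans ts st).
have [d1 d10 hd1] := forward_near br hD Tr.
have [dc dc0 hdc] := continuation br D0.
have [r r_0 vg] := vgood_exists Hs cHs (sol r0 s (q, p) r0).
(* One radius for four purposes: the ball of [vgood], the required nearness [rho], membership of the
   restarted data in the branch, and applicability of [continuation]. *)
pose m := Num.min (Num.min r rho) (Num.min d1 dc).
have m0 : 0 < m by rewrite !lt_min r_0 rho0 d10.
have [dn dn0 hdn] := sol_near br D0 rt m0.
pose d := Num.min (Num.min d1 dc) dn / 2.
have d0 : 0 < d by rewrite divr_gt0 // !lt_min d10 dc0.
have dm : d < Num.min (Num.min d1 dc) dn.
  by rewrite ltr_pdivrMr // ltr_pMr ?ltr1n // !lt_min d10 dc0.
have [dd1 ddc ddn] : [/\ d < d1, d < dc & d < dn].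
  by move: dm; rewrite !lt_min => /andP[/andP[]].
exists d => //; exists (fun t => (sol t.1.2 s (q, t.1.1) t.2).2).
set lo := Num.max U (r0 - d); set hi := Num.min V (r0 + d).
have inn r' : lo <= r' -> r' <= hi -> [/\ T r', `|r' - r0| < d1, `|r' - r0| < dc & `|r' - r0| < dn].
  move=> a1 a2; have [Tr' rd] := clamp_near a1 a2.
  by split => //; [exact: le_lt_trans rd dd1|exact: le_lt_trans rd ddc|exact: le_lt_trans rd ddn].
have tT r' : T r' -> t0 <= r' <= t1.
  by move=> /hD /(branch_time br)[h1 h2 h3]; rewrite (le_trans h1 h2).
have UV : U <= V by move: Tr => /andP[/le_trans]; apply.
have TU : T U by rewrite /T /= lexx.
have TV : T V by rewrite /T /= UV lexx.
have t0lo : t0 <= lo by rewrite le_max; have /andP[-> _] := tT U TU.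
have hit1 : hi <= t1 by rewrite ge_min; have /andP[_ ->] := tT V TV.
have Dd u y : lo <= u <= hi -> `|y - p| < d -> D u s (q, y).
  move=> /andP[lu uh] yd; have [Tu ud1 _ _] := inn _ lu uh.
  by apply: hd1 => //; exact: lt_trans dd1.
have near u y v : lo <= u <= hi -> lo <= v <= hi -> `|y - p| < d ->
    `|sol u s (q, y) v - sol r0 s (q, p) r0| < m.
  move=> ul /andP[lv vh] yd; have Du := Dd u y ul yd.
  have /andP[lu uh] := ul; have [Tu _ _ ur] := inn _ lu uh.
  have [Tv _ _ vr] := inn _ lv vh; apply: hdn => //.
  - by rewrite subrr normr0.
  - by apply: pairr_lt => //; exact: lt_trans ddn.
  exact: tT.
pose A : set ('rV[R]_N * R) := [set e | `|e.1 - p| < d /\ lo <= e.2 <= hi].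
pose X (e : 'rV[R]_N * R) : R -> TQ := sol e.2 s (q, e.1).
have hsol e : A e -> rough_hamilton_solution alpha t0 t1 Z ZZ H cH (X e).
  by move=> [yd ul]; exact: (branch_sol br (Dd _ _ ul yd)).
have hball e r' : A e -> lo <= r' -> r' <= hi -> `|X e r' - sol r0 s (q, p) r0| < r.
  move=> [yd ul] lr rh; have := near e.2 e.1 r' ul _ yd.
  by rewrite lr rh => /(_ isT); rewrite !lt_min => /andP[/andP[]].
pose dom := dom2 [set y | `|y - p| < d] (fun=> lo) (fun=> hi).
have domE t : dom t -> [/\ `|t.1.1 - p| < d, lo <= t.1.2 <= hi & lo <= t.2 <= hi].
  case: t => -[y u] v [] /= Ay lu uv vh; split => //; first by rewrite lu (le_trans uv).
  by rewrite vh (le_trans lu).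
pose Xt (t : 'rV[R]_N * R * R) : R -> TQ := X (t.1.1, t.1.2).
have pE : (sol r0 s (q, p) r0).2 = p := (branch_bdry br D0).2.
have Yd t : dom t -> `|(Xt t t.2).2 - p| < m.
  move=> /domE[yd ul vl]; apply: le_lt_trans (near _ _ _ ul vl yd).
  by have := norm_snd_le (Xt t t.2) (sol r0 s (q, p) r0); rewrite pE.
have DY t : dom t -> D t.2 s (q, (Xt t t.2).2).
  move=> Dt; have [yd ul /andP[lv vh]] := domE t Dt; have [Tv v1 _ _] := inn _ lv vh.
  by apply: hd1 => //; have := Yd t Dt; rewrite !lt_min => /andP[_ /andP[]].
(* The branch solution ending at the later time with the momentum found there coincides with the
   characteristic. *)
have same t r' : dom t -> t0 <= r' <= t1 -> sol t.2 s (q, (Xt t t.2).2) r' = Xt t r'.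
  move=> Dt; have [yd ul vl] := domE t Dt.
  have /andP[lu uh] := ul; have [Tu _ uc _] := inn _ lu uh.
  have /andP[lv vh] := vl; have [Tv _ vc _] := inn _ lv vh.
  have Du := Dd _ _ ul yd; have s0 : `|s - s| < dc by rewrite subrr normr0.
  apply: (hdc t.1.2 s (q, t.1.1) t.2 s (q, (Xt t t.2).2) uc s0 _ vc s0 _ Du (DY t Dt)) => //.
  - by apply: pairr_lt => //; exact: lt_trans ddc.
  - by apply: pairr_lt => //; have := Yd t Dt; rewrite !lt_min => /andP[_ /andP[]].
  by rewrite /= (branch_bdry br Du).1.
have gpu t : dom t -> gradpt sg t.1.2 t.1.1 = Xt t t.1.2.
  by move=> /domE[yd ul _]; exact: (forward_gradpt al3 al2 t01 rp Hs cHs br (Dd _ _ ul yd)).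
have Pu t k : dom t -> pd C k (sg t.1.2) t.1.1 = (Xt t t.1.2).1 0 k.
  move=> /domE[yd ul _]; exact: (gen_pd_inr al3 al2 t01 rp Hs cHs br k (Dd _ _ ul yd)).
have Pv t k : dom t -> pd C k (sg t.2) (Xt t t.2).2 = (Xt t t.2).1 0 k.
  move=> Dt; rewrite (gen_pd_inr al3 al2 t01 rp Hs cHs br k (DY t Dt)) (same t) //.
  by have [_ _ /andP[lv vh]] := domE t Dt; apply: tT; have [] := inn _ lv vh.
have yE t : dom t -> (Xt t t.1.2).2 = t.1.1.
  by move=> /domE[yd ul _]; exact: (branch_bdry br (Dd _ _ ul yd)).2.
split.
- by move=> t Dt; have := Yd t Dt; rewrite !lt_min => /andP[/andP[]].
- move=> k; apply: bO_eq (char_incr2 al3 al2 t01 rp Hs cHs t0lo hit1 vg hsol hball (inr k)) => t Dt.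
  rewrite (gpu t Dt) -/(Xt t).
  have -> : \sum_j hvf (hj j) (inr k) (Xt t t.1.2) * dZ Z t.1.2 t.2 j =
      - \sum_j pd B (inl k) (hj j) (Xt t t.1.2) * dZ Z t.1.2 t.2 j.
    by rewrite -sumrN; apply: eq_bigr => j _; rewrite hvf_inr mulNr.
  suff -> : crd B (Xt t t.2 - Xt t t.1.2) (inr k) = crd C ((Xt t t.2).2 - t.1.1) k by rewrite opprK.
  by rewrite !crdB -(yE t Dt).
- move=> k; apply: bO_eq (char_incr2 al3 al2 t01 rp Hs cHs t0lo hit1 vg hsol hball (inl k)) => t Dt.
  rewrite -/(Xt t) (gpu t Dt) (Pu t k Dt) (Pv t k Dt) crdB -!rVcrd_fst.
  by congr (_ - _); apply: eq_bigr => j _; rewrite hvf_inl.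
apply: bO_eq (bON (char_act al3 al2 t01 rp Hs cHs t0lo hit1 vg hsol hball)) => t Dt.
rewrite -/(Xt t) (gpu t Dt); have [yd ul vl] := domE t Dt.
have /andP[lu uh] := ul; have /andP[lv vh] := vl.
have [Tu _ _ _] := inn _ lu uh; have [Tv _ _ _] := inn _ lv vh.
have Du := Dd _ _ ul yd; have [_ su _] := branch_time br Du.
have uv : t.1.2 <= t.2 by case: Dt.
have /andP[_ vt1] := tT _ Tv.
have aE : act (sol t.2 s (q, (Xt t t.2).2)) s t.2 = act (Xt t) s t.2.
  apply: act_ext => r' /andP[r1 r2]; apply: same => //.
  by rewrite (le_trans ts r1) (le_trans r2).
have -> : sg t.2 (Xt t t.2).2 = dotr (Xt t t.2).2 (Xt t t.2).1 - act (Xt t) s t.2.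
  by rewrite /sg gen_funE aE (same t _ Dt (tT _ Tv)).
have -> : sg t.1.2 t.1.1 = dotr t.1.1 (Xt t t.1.2).1 - act (Xt t) s t.1.2.
  by rewrite /sg gen_funE.
rewrite (act_add al3 al2 t01 rp Hs cHs (hsol _ (conj yd ul)) ts su uv vt1).
(* The boundary pairings and the Taylor term combine into the pairing of the earlier momentum with
   the position increment, the leading term of the action. *)
have E : dotr (Xt t t.2).2 (Xt t t.2).1 - dotr t.1.1 (Xt t t.1.2).1
    - \sum_k crd C ((Xt t t.2).2 - t.1.1) k * pd C k (sg t.2) (Xt t t.2).2
  = \sum_k crd B (Xt t t.1.2) (inr k) * crd B (Xt t t.2 - Xt t t.1.2) (inl k).
  rewrite /dotr -!sumrB; apply: eq_bigr => k _; rewrite (Pv t k Dt) !crdB -!rVcrd_fst.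
  rewrite -[crd B (Xt t t.1.2) (inr k)]/((Xt t t.1.2).2 0 k) (yE t Dt).
  rewrite -[crd C (Xt t t.2).2 k]/((Xt t t.2).2 0 k) -[crd C t.1.1 k]/(t.1.1 0 k).
  move: ((Xt t t.2).2 0 k) ((Xt t t.2).1 0 k) ((Xt t t.1.2).1 0 k) (t.1.1 0 k) => a b c e.
  by ring.
rewrite -E.
exact: forward_value_algebra.
Qed.

End ForwardCharacteristics.

(** * Backward equation: moving the initial time *)

Lemma is_derive_affine {R : realType} {V V' : normedModType R} (io io0 : V' -> V) (f : V -> R)
    (v y : V') (df : R) : (forall (h : R) v y, io (h *: v + y) = h *: io0 v + io y) ->
  is_derive (io y) (io0 v) f df -> is_derive y v (fun y => f (io y)) df.
Proof.
move=> hio /is_derive_epsP h; apply/is_derive_epsP => e /h[d d0 hd].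
by exists d => // k /hd; rewrite hio.
Qed.

Lemma mul_increment {R : comPzRingType} (a b c : R) : a * b = c * a + a * (b - c).
Proof. by rewrite mulrBr [c * a]mulrC subrKC. Qed.

Lemma backward_value_algebra {R : realType} (c a1 a2 s1 s2 s3 w1 w2 w3 w4 w5 : R) :
  s3 = s1 + s2 -> w4 = - w5 ->
  - (c - a2) - - (c - (a1 + a2)) - - s3 - w1 - w2 - w4 =
  - (a1 - (s1 - w1 - w2 - w3)) + (s2 + (w3 + w5)).
Proof. by move=> -> ->; ring. Qed.

Section BackwardCharacteristics.
Context {R : realType} {N K : nat}.
Local Notation TQ := ('rV[R]_N * 'rV[R]_N)%type.
Variables (alpha t0 t1 : R) (Z : R -> 'rV[R]_K) (ZZ : R -> R -> 'M[R]_K).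
Hypotheses (al3 : 3^-1 < alpha) (al2 : alpha <= 2^-1) (t01 : t0 <= t1).
Hypothesis rp : geometric_rough_path alpha Z ZZ t0 t1.
Variables (H : TQ -> R) (cH : TQ -> 'rV[R]_K).
Hypotheses (Hs : smooth H) (cHs : is_Cinf setT cH).
Variables (Om : R -> set TQ) (Phi : R -> R -> TQ -> TQ).
Variables (D : R -> R -> set TQ) (sol : R -> R -> TQ -> R -> TQ).
Hypothesis br : nondegenerate_branch alpha t0 t1 Z ZZ H cH Om Phi D sol.
Local Notation B := (@tqB R N).
Local Notation C := (rV_coords (R := R) N).
Local Notation act := (rough_action Z ZZ H cH).
Local Notation gen := (gen_fun Z ZZ H cH sol).
Local Notation hj := (cHj cH).

Variables (t U V : R) (q p : 'rV[R]_N).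
Hypothesis hD : forall r, U <= r <= V -> D t r (q, p).
Let T : set R := [set r | U <= r <= V].
Let sg r y := - gen t r (y, p).
Let hh x := H (swap x).
Let h j x := hj j (swap x).

Lemma backward_near r0 : T r0 -> exists2 d, 0 < d & forall r y, T r -> `|r - r0| < d ->
  `|y - q| < d -> D t r (y, p).
Proof.
move=> Tr; have [d d0 hd] := branch_near br (hD Tr); exists d => // r y Tr' rr yq.
apply: hd => //; first by rewrite subrr normr0.
  exact: pairl_lt.
by exists (q, p); exact: hD.
Qed.

Lemma backward_pd r y k : D t r (y, p) -> pd C k (sg r) y = - (sol t r (y, p) r).2 0 k.
Proof.
move=> Dr; rewrite -(gen_pd_inl al3 al2 t01 rp Hs cHs br k Dr) !pdE.
apply: deriveN; have := branch_gradient al3 al2 t01 rp Hs cHs br (bas C k, 0) Dr.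
by move=> /(is_derive_affine (io := fun y => (y, p)) (io0 := fun v => (v, 0)) (affine_inl p))[].
Qed.

Lemma backward_gradpt r y : D t r (y, p) ->
  gradpt sg r y = (- (sol t r (y, p) r).2, (sol t r (y, p) r).1).
Proof.
move=> Dr; rewrite (branch_bdry br Dr).1; congr (_, _).
by apply/rowP => k; rewrite mxE [RHS]mxE; exact: backward_pd.
Qed.

Lemma backward_swap r y : D t r (y, p) -> swap (gradpt sg r y) = sol t r (y, p) r.
Proof. by move=> Dr; rewrite backward_gradpt // /swap opprK -surjective_pairing. Qed.

Lemma backward_Cloc r0 : T r0 -> Cloc 3 (within T (nbhs r0)) q sg.
Proof.
move=> Tr; have FF : Filter (within T (nbhs r0)) by exact: within_filter.
have nio (y z : 'rV[R]_N) : `|(y, p) - (z, p) : TQ| <= `|y - z|.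
  by apply: (@norm_pair_le R N (y - z) (p - p)) => //; rewrite subrr normr0.
apply: (ClocN FF); apply: (Cloc_affine FF (io := fun y => (y, p)) (io0 := fun v => (v, 0))
  (affine_inl p) nio (f := fun r => gen t r)).
apply: (Cloc_of_family FF (phi := fun r : R => (t, r)) (a0 := (t, r0)) _ _ _
  (branch_gen_smooth br 3)).
- move=> W [[U1 U2] [/= n1 n2] hW]; rewrite /fmap /= /within /=.
  by apply: filterS n2 => r r1 _; apply: hW; split => //=; exact: nbhs_singleton.
- exact: hD.
have [d d0 hd] := branch_near br (hD Tr); exists d => //.
apply/nbhs_normP; exists d => // r /= rr Tr' y yr; apply: hd => //.
- by rewrite subrr normr0.
- by rewrite -normrN opprB.
by exists (q, p); exact: hD.
Qed.

Let tT r : T r -> t0 <= r <= t1.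
Proof. by move=> /hD /(branch_time br)[h1 h2 h3]; rewrite h1 (le_trans h2). Qed.

Lemma backward_cont r0 e : T r0 -> 0 < e -> exists2 d, 0 < d & forall r y,
  T r -> `|r - r0| < d -> `|y - q| < d -> `|gradpt sg r y - gradpt sg r0 q| < e.
Proof.
move=> Tr e0; have D0 := hD Tr.
have [d d0 hd] := sol_near br D0 (tT Tr) e0; have [d1 d10 hd1] := backward_near Tr.
exists (Num.min d d1); first by rewrite lt_min d0.
move=> r y Tr'; rewrite !lt_min => /andP[rd rd1] /andP[yd yd1].
have Dr := hd1 r y Tr' rd1 yd1.
have hs : `|sol t r (y, p) r - sol t r0 (q, p) r0| < e.
  apply: hd => //; [by rewrite subrr normr0|exact: pairl_lt|exact: tT].
rewrite !backward_gradpt //; apply: le_lt_trans hs.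
apply: (@norm_pair_le R N (- (sol t r (y, p) r).2 - - (sol t r0 (q, p) r0).2)).
  by rewrite -opprD normrN; exact: norm_snd_le.
exact: norm_fst_le.
Qed.

Let hjs j : smooth (hj j). Proof. exact: smooth_cHj. Qed.

(** As in the forward case, with the final data kept and the initial position read off at the later
    time. The action over [u, v] is now lost from the interval, and [swap] converts the derivatives
    of the Hamiltonians. *)
Lemma backward_char r0 rho : T r0 -> 0 < rho -> exists2 d, 0 < d &
  exists Y', characteristics alpha Z ZZ sg hh h (Num.max U (r0 - d)) (Num.min V (r0 + d)) d rho q Y'.
Proof.
move=> Tr rho0; have D0 := hD Tr; have [ts st tt] := branch_time br D0.
have [d1 d10 hd1] := backward_near Tr.
have [dc dc0 hdc] := continuation br D0.
have [r r_0 vg] := vgood_exists Hs cHs (sol t r0 (q, p) r0).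
pose m := Num.min (Num.min r rho) (Num.min d1 dc).
have m0 : 0 < m by rewrite !lt_min r_0 rho0 d10.
have [dn dn0 hdn] := sol_near br D0 (tT Tr) m0.
pose d := Num.min (Num.min d1 dc) dn / 2.
have d0 : 0 < d by rewrite divr_gt0 // !lt_min d10 dc0.
have dm : d < Num.min (Num.min d1 dc) dn.
  by rewrite ltr_pdivrMr // ltr_pMr ?ltr1n // !lt_min d10 dc0.
have [dd1 ddc ddn] : [/\ d < d1, d < dc & d < dn].
  by move: dm; rewrite !lt_min => /andP[/andP[]].
exists d => //; exists (fun w => (sol t w.1.2 (w.1.1, p) w.2).1).
set lo := Num.max U (r0 - d); set hi := Num.min V (r0 + d).
have inn r' : lo <= r' -> r' <= hi -> [/\ T r', `|r' - r0| < d1, `|r' - r0| < dc & `|r' - r0| < dn].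
  move=> a1 a2; have [Tr' rd] := clamp_near a1 a2.
  by split => //; [exact: le_lt_trans rd dd1|exact: le_lt_trans rd ddc|exact: le_lt_trans rd ddn].
have UV : U <= V by move: Tr => /andP[/le_trans]; apply.
have TU : T U by rewrite /T /= lexx.
have TV : T V by rewrite /T /= UV lexx.
have t0lo : t0 <= lo by rewrite le_max; have /andP[-> _] := tT TU.
have hit1 : hi <= t1 by rewrite ge_min; have /andP[_ ->] := tT TV.
have Dd u y : lo <= u <= hi -> `|y - q| < d -> D t u (y, p).
  move=> /andP[lu uh] yd; have [Tu ud1 _ _] := inn _ lu uh.
  by apply: hd1 => //; exact: lt_trans dd1.
have near u y v : lo <= u <= hi -> lo <= v <= hi -> `|y - q| < d ->
    `|sol t u (y, p) v - sol t r0 (q, p) r0| < m.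
  move=> ul /andP[lv vh] yd; have Du := Dd u y ul yd.
  have /andP[lu uh] := ul; have [Tu _ _ ur] := inn _ lu uh.
  have [Tv _ _ vr] := inn _ lv vh; apply: hdn => //.
  - by rewrite subrr normr0.
  - by apply: pairl_lt => //; exact: lt_trans ddn.
  exact: tT.
pose A : set ('rV[R]_N * R) := [set e | `|e.1 - q| < d /\ lo <= e.2 <= hi].
pose X (e : 'rV[R]_N * R) : R -> TQ := sol t e.2 (e.1, p).
have hsol e : A e -> rough_hamilton_solution alpha t0 t1 Z ZZ H cH (X e).
  by move=> [yd ul]; exact: (branch_sol br (Dd _ _ ul yd)).
have hball e r' : A e -> lo <= r' -> r' <= hi -> `|X e r' - sol t r0 (q, p) r0| < r.
  move=> [yd ul] lr rh; have := near e.2 e.1 r' ul _ yd.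
  by rewrite lr rh => /(_ isT); rewrite !lt_min => /andP[/andP[]].
pose dom := dom2 [set y | `|y - q| < d] (fun=> lo) (fun=> hi).
have domE w : dom w -> [/\ `|w.1.1 - q| < d, lo <= w.1.2 <= hi & lo <= w.2 <= hi].
  case: w => -[y u] v [] /= Ay lu uv vh; split => //; first by rewrite lu (le_trans uv).
  by rewrite vh (le_trans lu).
pose Xt (w : 'rV[R]_N * R * R) : R -> TQ := X (w.1.1, w.1.2).
have qE : (sol t r0 (q, p) r0).1 = q := (branch_bdry br D0).1.
have Yd w : dom w -> `|(Xt w w.2).1 - q| < m.
  move=> /domE[yd ul vl]; apply: le_lt_trans (near _ _ _ ul vl yd).
  by have := norm_fst_le (Xt w w.2) (sol t r0 (q, p) r0); rewrite qE.
have DY w : dom w -> D t w.2 ((Xt w w.2).1, p).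
  move=> Dw; have [yd ul /andP[lv vh]] := domE w Dw; have [Tv v1 _ _] := inn _ lv vh.
  by apply: hd1 => //; have := Yd w Dw; rewrite !lt_min => /andP[_ /andP[]].
have same w r' : dom w -> t0 <= r' <= t1 -> sol t w.2 ((Xt w w.2).1, p) r' = Xt w r'.
  move=> Dw; have [yd ul vl] := domE w Dw.
  have /andP[lu uh] := ul; have [Tu _ uc _] := inn _ lu uh.
  have /andP[lv vh] := vl; have [Tv _ vc _] := inn _ lv vh.
  have Du := Dd _ _ ul yd; have s0 : `|t - t| < dc by rewrite subrr normr0.
  apply: (hdc t w.1.2 (w.1.1, p) t w.2 ((Xt w w.2).1, p) s0 uc _ s0 vc _ Du (DY w Dw)) => //.
  - by apply: pairl_lt => //; exact: lt_trans ddc.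
  - by apply: pairl_lt => //; have := Yd w Dw; rewrite !lt_min => /andP[_ /andP[]].
  by rewrite /= (branch_bdry br Du).2.
have gpu w : dom w -> swap (gradpt sg w.1.2 w.1.1) = Xt w w.1.2.
  by move=> /domE[yd ul _]; exact: (backward_swap (Dd _ _ ul yd)).
have Pu w k : dom w -> pd C k (sg w.1.2) w.1.1 = - (Xt w w.1.2).2 0 k.
  by move=> /domE[yd ul _]; exact: (backward_pd k (Dd _ _ ul yd)).
have Pv w k : dom w -> pd C k (sg w.2) (Xt w w.2).1 = - (Xt w w.2).2 0 k.
  move=> Dw; rewrite (backward_pd k (DY w Dw)) (same w) //.
  by have [_ _ /andP[lv vh]] := domE w Dw; apply: tT; have [] := inn _ lv vh.
have yE w : dom w -> (Xt w w.1.2).1 = w.1.1.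
  by move=> /domE[yd ul _]; exact: (branch_bdry br (Dd _ _ ul yd)).1.
have hl w j k : dom w -> pd B (inl k) (h j) (gradpt sg w.1.2 w.1.1)
    = - pd B (inr k) (hj j) (Xt w w.1.2).
  by move=> Dw; rewrite /h (pd_swap_inl k _ (hjs j)) (gpu w Dw).
have hr w j k : dom w -> pd B (inr k) (h j) (gradpt sg w.1.2 w.1.1)
    = pd B (inl k) (hj j) (Xt w w.1.2).
  by move=> Dw; rewrite /h (pd_swap_inr k _ (hjs j)) (gpu w Dw).
split.
- by move=> w Dw; have := Yd w Dw; rewrite !lt_min => /andP[/andP[]].
- move=> k; apply: bO_eq (char_incr2 al3 al2 t01 rp Hs cHs t0lo hit1 vg hsol hball (inl k)) => w Dw.
  rewrite -/(Xt w).
  have -> : \sum_j pd B (inl k) (h j) (gradpt sg w.1.2 w.1.1) * dZ Z w.1.2 w.2 j =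
      - \sum_j hvf (hj j) (inl k) (Xt w w.1.2) * dZ Z w.1.2 w.2 j.
    by rewrite -sumrN; apply: eq_bigr => j _; rewrite (hl w j k Dw) mulNr hvf_inl.
  suff -> : crd B (Xt w w.2 - Xt w w.1.2) (inl k) = crd C ((Xt w w.2).1 - w.1.1) k by [].
  by rewrite !crdB -(yE w Dw).
- move=> k; apply: bO_eq (bON (char_incr2 al3 al2 t01 rp Hs cHs t0lo hit1 vg hsol hball (inr k))) => w Dw.
  rewrite -/(Xt w) (Pu w k Dw) (Pv w k Dw).
  have -> : \sum_j pd B (inr k) (h j) (gradpt sg w.1.2 w.1.1) * dZ Z w.1.2 w.2 j =
      - \sum_j hvf (hj j) (inr k) (Xt w w.1.2) * dZ Z w.1.2 w.2 j.
    by rewrite -sumrN; apply: eq_bigr => j _; rewrite (hr w j k Dw) hvf_inr mulNr opprK.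
  by rewrite crdB; move: (\sum_j _) => S; rewrite !opprK opprB opprD opprK [LHS]addrC.
apply: bO_eq (bOD (bON (char_act al3 al2 t01 rp Hs cHs t0lo hit1 vg hsol hball))
  (char_pairing al3 al2 t01 rp Hs cHs t0lo hit1 vg hsol hball)) => w Dw.
rewrite -/(Xt w); have [yd ul vl] := domE w Dw.
have /andP[lu uh] := ul; have /andP[lv vh] := vl.
have [Tu _ _ _] := inn _ lu uh; have [Tv _ _ _] := inn _ lv vh.
have Du := Dd _ _ ul yd; have Dv := DY w Dw; have [tv vt _] := branch_time br Dv.
have uv : w.1.2 <= w.2 by case: Dw.
have /andP[tu _] := tT Tu; have t1t := tt.
have tt0 : t0 <= t <= t1 by rewrite (le_trans tv vt).
have aE : act (sol t w.2 ((Xt w w.2).1, p)) w.2 t = act (Xt w) w.2 t.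
  apply: act_ext => r' /andP[r1 r2]; apply: same => //.
  by rewrite (le_trans tv r1) (le_trans r2).
have -> : sg w.2 (Xt w w.2).1 = - (dotr p (Xt w t).1 - act (Xt w) w.2 t).
  by rewrite /sg gen_funE aE (same w _ Dw tt0).
have -> : sg w.1.2 w.1.1 = - (dotr p (Xt w t).1 - act (Xt w) w.1.2 t).
  by rewrite /sg gen_funE.
rewrite (act_add al3 al2 t01 rp Hs cHs (hsol _ (conj yd ul)) tu uv vt t1t).
have E1 : \sum_k crd C ((Xt w w.2).1 - w.1.1) k * pd C k (sg w.2) (Xt w w.2).1
  = - \sum_k crd B (Xt w w.2 - Xt w w.1.2) (inl k) * crd B (Xt w w.2) (inr k).
  by rewrite -sumrN; apply: eq_bigr => k _; rewrite (Pv w k Dw) !crdB -(yE w Dw) mulrN.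
(* The gradient at the later time is minus the later momentum, whereas the action expands with the
   earlier one; the excess is the product of increments evaluated by [char_pairing]. *)
have E2 : \sum_k crd B (Xt w w.2 - Xt w w.1.2) (inl k) * crd B (Xt w w.2) (inr k)
  = \sum_k crd B (Xt w w.1.2) (inr k) * crd B (Xt w w.2 - Xt w w.1.2) (inl k)
   + \sum_k crd B (Xt w w.2 - Xt w w.1.2) (inl k) * crd B (Xt w w.2 - Xt w w.1.2) (inr k).
  rewrite -big_split; apply: eq_bigr => k _ ; rewrite (crdB _ _ _ (inr k)).
  exact: mul_increment.
have E3 : \sum_i \sum_j (\sum_k pd B (inl k) (h j) (gradpt sg w.1.2 w.1.1)
      * pd B (inr k) (h i) (gradpt sg w.1.2 w.1.1)) * ZZ w.1.2 w.2 i j =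
  - \sum_i \sum_j ab cH j i (Xt w w.1.2) * ZZ w.1.2 w.2 i j.
  rewrite -sumrN; apply: eq_bigr => i _; rewrite -sumrN; apply: eq_bigr => j _.
  rewrite -mulNr; congr (_ * _); rewrite /ab -sumrN; apply: eq_bigr => k _.
  by rewrite (hl w j k Dw) (hr w i k Dw) mulNr mulrC.
have E4 : \sum_j h j (gradpt sg w.1.2 w.1.1) * dZ Z w.1.2 w.2 j =
    \sum_j hj j (Xt w w.1.2) * dZ Z w.1.2 w.2 j.
  by apply: eq_bigr => j _; rewrite /h (gpu w Dw).
have E5 : hh (gradpt sg w.1.2 w.1.1) = H (Xt w w.1.2) by rewrite /hh (gpu w Dw).
rewrite E1 E4 E5.
exact: (backward_value_algebra _ _ _ _ _ _ E2 E3).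
Qed.

End BackwardCharacteristics.

(** * Both rough Hamilton-Jacobi equations *)

Lemma neg_increment {R : comPzRingType} {J : finType} (a b : R) (z f g : J -> R) :
  (forall j, z j * g j = - f j * z j) ->
  - a - - b - \sum_j z j * g j = - (a - b - \sum_j f j * z j).
Proof.
move=> h; rewrite (eq_bigr _ (fun j _ => h j)) (eq_bigr _ (fun j _ => mulNr _ _)) sumrN.
by rewrite !opprD !opprK.
Qed.

Lemma gradptE {R : realType} {N : nat} (sg : R -> 'rV[R]_N -> R) r y :
  gradpt sg r y = (grad (sg r) y, y).
Proof. by congr (_, _); apply/rowP => k; rewrite !mxE pdE. Qed.

Section HamiltonJacobi.
Context {R : realType} {N K : nat}.
Local Notation TQ := ('rV[R]_N * 'rV[R]_N)%type.
Variables (alpha t0 t1 : R) (Z : R -> 'rV[R]_K) (ZZ : R -> R -> 'M[R]_K).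
Hypotheses (al3 : 3^-1 < alpha) (al2 : alpha <= 2^-1) (t01 : t0 <= t1).
Hypothesis rp : geometric_rough_path alpha Z ZZ t0 t1.
Variables (H : TQ -> R) (cH : TQ -> 'rV[R]_K).
Hypotheses (Hs : smooth H) (cHs : is_Cinf setT cH).
Variables (Om : R -> set TQ) (Phi : R -> R -> TQ -> TQ).
Variables (D : R -> R -> set TQ) (sol : R -> R -> TQ -> R -> TQ).
Hypothesis br : nondegenerate_branch alpha t0 t1 Z ZZ H cH Om Phi D sol.
Local Notation B := (@tqB R N).
Local Notation C := (rV_coords (R := R) N).
Local Notation act := (rough_action Z ZZ H cH).
Local Notation gen := (gen_fun Z ZZ H cH sol).
Local Notation hj := (cHj cH).


(** The action over a degenerate interval is zero by additivity, and the boundary conditions give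
    the pairing. *)
Lemma gen_diag s x : D s s x -> gen s s x = dotr x.2 x.1.
Proof.
move=> Dx; have [ts _ st] := branch_time br Dx.
have := act_add al3 al2 t01 rp Hs cHs (branch_sol br Dx) ts (lexx s) (lexx s) st.
rewrite gen_funE (branch_bdry br Dx).1; move: (act _ _ _) (dotr _ _) => a b h; lra.
Qed.

(** The first component of [X] is controlled by [grad_increment] and [grad_rate_increment], the
    second is constant; [value_increment] is then the hypothesis of [integral_equation]. *)
Lemma forward_equation s q p u v : u <= v -> (forall r, u <= r <= v -> D r s (q, p)) ->
  let S := fun (t : R) (p : 'rV[R]_N) => gen t s (q, p) in
  let X := fun r => (grad (S r) p, p) in
  let X' := fun r i => (grad (fun p' => cHj cH i (grad (S r) p', p')) p, 0) in
  controlled alpha Z u v X X' /\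
  controlled alpha Z u v (cH \o X) (chain_gub cH X X') /\
  S v p - S u p =
    (\int[lebesgue_measure]_(r in `[u, v]) H (X r)) + rough_int_comp Z ZZ cH X X' u v.
Proof.
move=> uv hD S X X'.
have [_ _ vt1] := branch_time br (hD v (ltac:(by rewrite uv lexx))).
have [t0s su _] := branch_time br (hD u (ltac:(by rewrite uv lexx))).
have t0u := le_trans t0s su.
have hjs j : smooth (hj j) by exact: smooth_cHj.
have hC := forward_Cloc br hD; have hcont := forward_cont al3 al2 t01 rp Hs cHs br hD.
have hch := forward_char al3 al2 t01 rp Hs cHs br hD.
pose T : set R := [set r | u <= r <= v].
have XE r : X r = gradpt (fun (r : R) (y : 'rV[R]_N) => gen r s (q, y)) r p by rewrite gradptE.
(* The Gubinelli derivative, written as a gradient in the statement, is the [rate] of the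
   expansions. *)
have X'l r i k : T r -> crd B (X' r i) (inl k) =
      rate (fun (r : R) (y : 'rV[R]_N) => gen r s (q, y)) hj i k r r p.
  move=> Tr; rewrite -rVcrd_fst /X' /= mxE.
  have [_ <-] := rate_chain k Tr (hC r Tr) (hjs i).
  by congr ('D__ _ _); apply/funext => y; rewrite gradptE.
have X'r r i k : crd B (X' r i) (inr k) = 0 by rewrite /X' /= mxE.
have dT w : segdom u v w -> T w.1.2 /\ T w.2.
  case: w => -[e a] b [] /= _ lu ab bh; split; rewrite /T /=; first by rewrite lu (le_trans ab).
  by rewrite bh (le_trans lu).
have Xr r k : crd B (X r) (inr k) = p 0 k by [].
clearbody X X'.
have hX l : fctrl alpha Z [set: unit] (fun=> u) (fun=> v) (fun _ r => crd B (X r) l)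
    (fun _ r i => crd B (X' r i) l).
  case: l => k; split.
  - apply: bO_eq (grad_increment al3 rp t0u vt1 hjs hC hcont hch k) => w Dw.
    have [Tu _] := dT w Dw; rewrite !XE -!rVcrd_fst !mxE; congr (_ - _).
    by apply: eq_bigr => j _; rewrite X'l // mulrC.
  - move=> i; apply: bO_eq (grad_rate_increment al3 rp t0u vt1 hjs hC hcont hch i k) => w Dw.
    have [Tu Tv] := dT w Dw; rewrite (X'l _ i k Tu) (X'l _ i k Tv); exact: erefl.
  - move=> i; apply: bO_eq (grad_rate_bdd al3 t0u vt1 hjs hC hcont i k) => w Dw.
    have [Tu _] := dT w Dw; rewrite (X'l _ i k Tu); exact: erefl.
  - apply: bO_eq (bO0 _ _ _) => w _.
    by rewrite !Xr subrr sub0r big1 ?oppr0 // => i _; rewrite X'r mulr0.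
  - by move=> i; apply: bO_eq (bO0 _ _ _) => w _; rewrite !X'r subrr.
  - by move=> i; apply: bO_eq (bO0 _ _ _) => w _; rewrite !X'r.
split; first exact: (fctrl_controlled al3 t0u vt1 hX).
split; first exact: (controlled_comp al3 rp t0u vt1 hjs hX).
apply: (@integral_equation R K alpha t0 t1 Z ZZ al3 al2 rp u v t0u uv vt1 _ _ B X X' H cH Hs hjs hX
  (fun r => S r p)).
apply: bO_eq (value_increment al3 al2 rp t0u vt1 Hs hjs hC hcont hch) => w Dw.
have [Tu _] := dT w Dw; rewrite XE; congr (_ - _).
apply: eq_bigr => i _; apply: eq_bigr => j _; congr (_ * _).
rewrite big_sumType; apply: etrans (congr2 +%R (_ : _ = _) (_ : _ = 0)) (addr0 _).
  by apply: eq_bigr => k _; rewrite (X'l _ i k Tu) mulrC; exact: erefl.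
by apply: big1 => k _; rewrite X'r mul0r.
Qed.

Lemma backward_equation t q p u v : u <= v -> (forall r, u <= r <= v -> D t r (q, p)) ->
  let S := fun (s : R) (q : 'rV[R]_N) => gen t s (q, p) in
  let X := fun r => (q, grad (S r) q) in
  let X' := fun r i => (0, - grad (fun q' => cHj cH i (q', grad (S r) q')) q) in
  controlled alpha Z u v X X' /\
  controlled alpha Z u v (cH \o X) (chain_gub cH X X') /\
  S v q - S u q =
    - (\int[lebesgue_measure]_(r in `[u, v]) H (X r)) - rough_int_comp Z ZZ cH X X' u v.
Proof.
move=> uv hD S X X'.
have [t0v vt tt1] := branch_time br (hD v (ltac:(by rewrite uv lexx))).
have [t0u _ _] := branch_time br (hD u (ltac:(by rewrite uv lexx))).
have vt1 := le_trans vt tt1.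
have hjs j : smooth (hj j) by exact: smooth_cHj.
have hs' : smooth (fun x => H (swap x)) by exact: smooth_swap.
have hjs' j : smooth (fun x => hj j (swap x)) by exact: smooth_swap.
have hC := backward_Cloc br hD; have hcont := backward_cont al3 al2 t01 rp Hs cHs br hD.
have hch := backward_char al3 al2 t01 rp Hs cHs br hD.
pose T : set R := [set r | u <= r <= v].
have SE r y : D t r (y, p) -> (y, grad (S r) y)
    = swap (gradpt (fun (r : R) (y : 'rV[R]_N) => - gen t r (y, p)) r y).
  move=> Dr; rewrite (backward_swap al3 al2 t01 rp Hs cHs br Dr).
  rewrite [RHS]surjective_pairing (branch_bdry br Dr).1; congr (_, _).
  by apply/rowP => k; rewrite mxE -(gen_pd_inl al3 al2 t01 rp Hs cHs br k Dr) pdE.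
have XE r : T r -> X r = swap (gradpt (fun (r : R) (y : 'rV[R]_N) => - gen t r (y, p)) r q).
  by move=> Tr; exact: SE (hD r Tr).
have X'r r i k : T r -> crd B (X' r i) (inr k) =
    - rate (fun (r : R) (y : 'rV[R]_N) => - gen t r (y, p)) (fun j x => hj j (swap x)) i k r r q.
  move=> Tr; have hr := @rate_chain R N K _ T r q (fun j x => hj j (swap x)) i k Tr (hC r Tr) (hjs' i).
  have [_ hd] : is_derive q (bas C k) (fun q' => hj i (q', grad (S r) q'))
    (rate (fun (r : R) (y : 'rV[R]_N) => - gen t r (y, p)) (fun j x => hj j (swap x)) i k r r q).
    (* The two functions agree only where the data lie in the branch, that is near [q], which
       suffices for the derivative. *)
    apply: near_eq_is_derive hr; apply: near_norm.
    have [d d0 hd] := backward_near br hD Tr; exists d => // y yq.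
    by rewrite (SE r y) //; apply: hd => //; rewrite subrr normr0.
  rewrite -[LHS]/((X' r i).2 0 k) /X' /snd mxE -hd; congr (- _).
  by rewrite mxE.
have X'l r i k : crd B (X' r i) (inl k) = 0 by rewrite -rVcrd_fst /X' /fst mxE.
have Xr r k : T r -> crd B (X r) (inr k) =
    - pd C k ((fun (r : R) (y : 'rV[R]_N) => - gen t r (y, p)) r) q.
  move=> Tr; rewrite XE // -[LHS]/((- (gradpt _ r q).1) 0 k) mxE; congr (- _).
  by rewrite mxE.
have Xl r k : crd B (X r) (inl k) = q 0 k by [].
have dT w : segdom u v w -> T w.1.2 /\ T w.2.
  case: w => -[e a] b [] /= _ lu ab bh; split; rewrite /T /=; first by rewrite lu (le_trans ab).
  by rewrite bh (le_trans lu).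
clearbody X X'.
have hX l : fctrl alpha Z [set: unit] (fun=> u) (fun=> v) (fun _ r => crd B (X r) l)
    (fun _ r i => crd B (X' r i) l).
  case: l => k; split.
  - apply: bO_eq (bO0 _ _ _) => w _.
    by rewrite !Xl subrr sub0r big1 ?oppr0 // => i _; rewrite X'l mulr0.
  - by move=> i; apply: bO_eq (bO0 _ _ _) => w _; rewrite !X'l subrr.
  - by move=> i; apply: bO_eq (bO0 _ _ _) => w _; rewrite !X'l.
  - apply: bO_eq (bON (grad_increment al3 rp t0u vt1 hjs' hC hcont hch k)) => w Dw.
    have [Tu Tv] := dT w Dw; rewrite (Xr _ k Tu) (Xr _ k Tv).
    apply: neg_increment => j; rewrite (X'r _ j k Tu); exact: mulrC.
  - move=> i; apply: bO_eq (bON (grad_rate_increment al3 rp t0u vt1 hjs' hC hcont hch i k)) => w Dw.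
    have [Tu Tv] := dT w Dw; rewrite (X'r _ i k Tu) (X'r _ i k Tv); exact: (esym (opprD _ _)).
  - move=> i; apply: bO_eq (bON (grad_rate_bdd al3 t0u vt1 hjs' hC hcont i k)) => w Dw.
    have [Tu _] := dT w Dw; rewrite (X'r _ i k Tu); exact: erefl.
split; first exact: (fctrl_controlled al3 t0u vt1 hX).
split; first exact: (controlled_comp al3 rp t0u vt1 hjs hX).
(* Applied to the negated generating function, whose equation has positive signs. *)
have := @integral_equation R K alpha t0 t1 Z ZZ al3 al2 rp u v t0u uv vt1 _ _ B X X' H cH Hs hjs hX
  (fun r => - S r q).
move=> h; rewrite -opprD -h; first by rewrite opprB opprK addrC.
apply: bO_eq (value_increment al3 al2 rp t0u vt1 hs' hjs' hC hcont hch) => w Dw.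
have [Tu _] := dT w Dw; rewrite XE //; congr (_ - _).
apply: eq_bigr => i _; apply: eq_bigr => j _; congr (_ * _).
rewrite big_sumType; apply: etrans (congr2 +%R (_ : _ = 0) (_ : _ = _)) (add0r _).
  by apply: big1 => k _; rewrite X'l mul0r.
apply: eq_bigr => k _; rewrite (X'r _ i k Tu) (pd_swap_inl k _ (hjs j)) mulNr mulrC -mulNr.
exact: erefl.
Qed.

End HamiltonJacobi.

Theorem proposition2p3 (R : realType) (N K : nat) (alpha t0 t1 : R)
  (Z : R -> 'rV[R]_K) (ZZ : R -> R -> 'M[R]_K)
  (H : 'rV[R]_N * 'rV[R]_N -> R) (cH : 'rV[R]_N * 'rV[R]_N -> 'rV[R]_K)
  (Om : R -> set ('rV[R]_N * 'rV[R]_N))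
  (Phi : R -> R -> 'rV[R]_N * 'rV[R]_N -> 'rV[R]_N * 'rV[R]_N)
  (D : R -> R -> set ('rV[R]_N * 'rV[R]_N))
  (sol : R -> R -> 'rV[R]_N * 'rV[R]_N -> R -> 'rV[R]_N * 'rV[R]_N) :
  3^-1 < alpha -> alpha <= 2^-1 -> t0 < t1 ->
  geometric_rough_path alpha Z ZZ t0 t1 ->
  is_Cinf setT H -> is_Cinf setT cH ->
  nondegenerate_branch alpha t0 t1 Z ZZ H cH Om Phi D sol ->
  (forall (s : R) (q : 'rV[R]_N),
     let S := fun (t : R) (p : 'rV[R]_N) => gen_fun Z ZZ H cH sol t s (q, p) in
     (forall p, D s s (q, p) -> S s p = dotr p q) /\
     forall (p : 'rV[R]_N) (u v : R), u <= v ->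
       (forall r, u <= r <= v -> D r s (q, p)) ->
       let X := fun r => (grad (S r) p, p) in
       (* Gubinelli derivative of [X]: the rate of dS/dp along Z^i is the
          p-gradient of the rate of S *)
       let X' := fun r i => (grad (fun p' => cHj cH i (grad (S r) p', p')) p, 0) in
       controlled alpha Z u v X X' /\
       controlled alpha Z u v (cH \o X) (chain_gub cH X X') /\
       S v p - S u p =
         (\int[lebesgue_measure]_(r in `[u, v]) H (X r)) +
         rough_int_comp Z ZZ cH X X' u v) /\
  (forall (t : R) (p : 'rV[R]_N),
     let S := fun (s : R) (q : 'rV[R]_N) => gen_fun Z ZZ H cH sol t s (q, p) in
     (forall q, D t t (q, p) -> S t q = dotr p q) /\
     forall (q : 'rV[R]_N) (u v : R), u <= v ->
       (forall r, u <= r <= v -> D t r (q, p)) ->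
       let X := fun r => (q, grad (S r) q) in
       let X' := fun r i => (0, - grad (fun q' => cHj cH i (q', grad (S r) q')) q) in
       controlled alpha Z u v X X' /\
       controlled alpha Z u v (cH \o X) (chain_gub cH X X') /\
       S v q - S u q =
         - (\int[lebesgue_measure]_(r in `[u, v]) H (X r)) -
         rough_int_comp Z ZZ cH X X' u v).
Proof.
move=> al3 al2 t01 rp Hs cHs br; have t01' := ltW t01.
split=> [s q|t p] S; split.
- by move=> p Dp; exact: (gen_diag al3 al2 t01' rp Hs cHs br Dp).
- by move=> p u v uv hD; exact: (forward_equation al3 al2 t01' rp Hs cHs br uv hD).
- by move=> q Dq; exact: (gen_diag al3 al2 t01' rp Hs cHs br Dq).
- by move=> q u v uv hD; exact: (backward_equation al3 al2 t01' rp Hs cHs br uv hD).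
Qed.
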